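(* Let $q$ be the Hastings–McLeod solution of the Painlevé II equation and let $R(x)=\int_x^\infty q(s)^2\,ds$, $F(x)=\exp\left(-\frac12\int_x^\infty R(s)\,ds\right)$, $E(x)=\exp\left(-\frac12\int_x^\infty q(s)\,ds\right)$. As $x\to-\infty$, $$F(x) = 2^{1/48}e^{\frac12\zeta'(-1)}\,\frac{e^{-\frac1{24}|x|^3}}{|x|^{1/16}} \left(1+ \frac{3}{2^7|x|^3} + O(|x|^{-6})\right)$$ and $$E(x) = \frac{1}{2^{1/4}}\, e^{-\frac1{3\sqrt{2}}|x|^{3/2}}\left( 1 -\frac1{24\sqrt{2}\,|x|^{3/2}}+ O(|x|^{-3})\right),$$ where $\zeta$ is the Riemann zeta function. Hence the constants $\tau_1,\tau_2,\tau_4$ in the asymptotic expansions as $x\to-\infty$ $$F_1(x) = \tau_1\frac{e^{-\frac1{24}|x|^3-\frac1{3\sqrt{2}}|x|^{3/2}}}{|x|^{1/16}}\left( 1 -\frac1{24\sqrt{2}|x|^{3/2}}+ O(|x|^{-3})\right),$$ $$F_2(x) = \tau_2\frac{e^{-\frac1{12}|x|^3}}{|x|^{1/8}} \left(1+ \frac{3}{2^6|x|^3} + O(|x|^{-6}) \right),$$ $$F_4(x) = \tau_4\frac{e^{-\frac1{24}|x|^3+\frac1{3\sqrt{2}}|x|^{3/2}}}{|x|^{1/16}}\left( 1 +\frac1{24\sqrt{2}|x|^{3/2}}+ O(|x|^{-3})\right)$$ of the GOE, GUE and GSE Tracy–Widom distribution functions $F_1,F_2,F_4$ are $$\tau_1=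 2^{-11/48}e^{\frac12 \zeta'(-1)},\qquad \tau_2= 2^{1/24}e^{\zeta'(-1)},\qquad \tau_4= 2^{-35/48} e^{\frac12 \zeta'(-1)}.$$
   Context: The Hastings–McLeod solution $q:\mathbb{R}\to\mathbb{R}$ is the unique global real solution of the Painlevé II equation $q''=2q^3+xq$ satisfying $q(x)\sim \mathrm{Ai}(x)$ as $x\to+\infty$, where $\mathrm{Ai}$ is the Airy function. The Tracy–Widom distribution functions are defined (in this normalization) by $$F_1(x)= F(x)E(x), \qquad F_2(x)= F(x)^2, \qquad F_4(x)=\frac12\left\{ E(x)+ \frac1{E(x)} \right\}F(x).$$ *)

(* Defs.v *)
From Stdlib Require Export Reals.
From Coquelicot Require Export Coquelicot.
Open Scope R_scope.

(* Conditionally convergent: [RInt_gen] is the limit of the proper integrals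
   over [0, T] as T tends to +oo. *)
Definition Ai (x : R) : R :=
  / PI * RInt_gen (fun t => cos (t ^ 3 / 3 + x * t))
                  (at_point 0) (Rbar_locally p_infty).

(* [ex_derive q x] is required because [Derive] is total, so that
   differentiability of [Derive q] alone says nothing about [q]. *)
Definition is_Hastings_McLeod (q : R -> R) : Prop :=
  (forall x, ex_derive q x /\
             is_derive (Derive q) x (2 * q x ^ 3 + x * q x)) /\
  is_equiv (Rbar_locally p_infty) q Ai.

Definition int_to_infty (f : R -> R) (x : R) : R :=
  RInt_gen f (at_point x) (Rbar_locally p_infty).

Definition TW_R (q : R -> R) (x : R) : R := int_to_infty (fun s => q s ^ 2) x.

Definition TW_F (q : R -> R) (x : R) : R :=
  exp (- (1 / 2) * int_to_infty (TW_R q) x).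

Definition TW_E (q : R -> R) (x : R) : R :=
  exp (- (1 / 2) * int_to_infty q x).

Definition F1 (q : R -> R) (x : R) : R := TW_F q x * TW_E q x.

Definition F2 (q : R -> R) (x : R) : R := TW_F q x ^ 2.

Definition F4 (q : R -> R) (x : R) : R :=
  1 / 2 * (TW_E q x + 1 / TW_E q x) * TW_F q x.

(* (n+1)^(-s) = exp (- s ln (n+1)), in real and imaginary parts. *)
Definition dirichlet_term (s : C) (n : nat) : C :=
  (Rpower (INR (S n)) (- Re s) * cos (Im s * ln (INR (S n))),
   - (Rpower (INR (S n)) (- Re s) * sin (Im s * ln (INR (S n))))).

(* The analytic continuation of the Dirichlet series to C minus {1}; the
   value at the pole s = 1 is left arbitrary. *)
Definition is_Riemann_zeta (zeta : C -> C) : Prop :=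
  (forall s : C, 1 < Re s -> is_series (dirichlet_term s) (zeta s)) /\
  (forall s : C, s <> RtoC 1 -> ex_derive (K := C_AbsRing) zeta s).

(* zeta'(-1), a complex derivative whose value is real. *)
Definition dzeta_m1 (zeta : C -> C) : R := Re (C_derive zeta (RtoC (-1))).

Definition bigO_minfty (f g : R -> R) : Prop :=
  exists M : R, Rbar_locally m_infty (fun x => Rabs (f x) <= M * Rabs (g x)).

(* f(x) = a(x) (m(x) + O(g(x))) as x -> -oo. *)
Definition expansion_minfty (f a m g : R -> R) : Prop :=
  exists r : R -> R,
    bigO_minfty r g /\
    Rbar_locally m_infty (fun x => f x = a x * (m x + r x)).

(* Main.v *)
(* The Toeplitz determinants D_N(t) with symbol exp (2 t cos theta), whose Verblunsky coefficients
   R_N(t) solve the discrete Painleve II equation started from R_0 = 1, interpolate between two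
   explicitly known regimes.  For fixed N and t -> 0 everything is trivial; for fixed N and t -> oo,
   log D_N is asymptotic to 2 N t - (N^2/2) log (2 t) plus a constant which is a Barnes-type product.
   In the scaling 2 t = N exp (- b x), b = (2 N^2)^(-1/3), the differential equation in t becomes a
   perturbation of Painleve II; comparison with Bessel functions at x -> +oo, damping and a Gronwall
   argument show that the scaled R_N converges to q, and hence that exp (- t^2) D_N converges to F^2
   and a companion sum of logarithms of (1 + R_j)/(1 - R_j) to - 4 log E.  Barrier functions that are
   uniform in N control the solution from x = - X0 down to x = - oo, so the constants known at t = oo
   are transported to fixed x: Stirling's formula and the asymptotics of the sum of j log j (that is,
   of the Barnes function) then give the constants in F and E, first with Glaisher's constant in
   place of zeta'(-1).  Barriers for Painleve II on the left give q to the required order, and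
   integrating twice gives the full expansions.  Finally zeta'(-1) is computed from Euler-Maclaurin
   approximations; that they converge to the given zeta near s = -1 is an instance of the identity
   theorem, proved by Cauchy's formula on a thin strip leading from -1 to Re s > 1 with the weight
   exp (N exp (2 pi w)), which is large at the strip's inner end and of modulus 1 on its long sides. *)

From Stdlib Require Import Lra Lia Psatz ClassicalEpsilon Factorial.
Require Import Defs.

(* The constants are global data: they tie the normalisation of the integrals at +oo to the
   behaviour at -oo, and no local analysis of Painleve II at one end can produce them. At finite N
   both ends are explicit, so that only errors uniform in N have to be controlled. With sin phi for
   the Verblunsky coefficient, the second-order equation reads phi'' = [Fx b x phi] without first
   derivative, and [Fx b x p]/p increases strictly in p. Hence sub- and supersolutions are compared
   through their ratio ([ratio_max]), without linearisation. The obstacle on the right is that q is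
   given only through q ~ Ai, a statement about values: nothing is known beforehand about q', about
   the signs of q and Ai, or about uniqueness. Derivatives are therefore recovered by the mean value
   theorem between X and X+1, and positivity of Ai and of q is inherited from the approximants. Two
   constants are never evaluated: the normalisation [k] of I_0 at infinity and Stirling's constant
   [kap]. They enter through N (k + kap), which must vanish because a limit exists. *)
Tactic Notation "have" ident(H) ":" lconstr(T) "by" tactic3(t) := assert (H : T) by t.
Tactic Notation "have" ident(H) ":" lconstr(T) := assert (H : T).
Tactic Notation "have" ":" lconstr(T) "by" tactic3(t) := assert T by t.
Tactic Notation "have" ":" lconstr(T) := assert T.
Tactic Notation "have" ident(H) ":=" lconstr(T) := pose proof T as H.
Tactic Notation "have" ":=" lconstr(T) := pose proof T.
Ltac trans x := apply Rle_trans with x.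
Tactic Notation "le_trans" uconstr(t) := eapply Rle_trans; [apply t|].
Ltac abs_in H := apply Rabs_le_between in H.
Ltac fld := field; lra.
Notation ok := ltac:(lra) (only parsing).
Notation RN := R_CompleteNormedModule (only parsing).
Notation Rmult_neq_0 := Rmult_integral_contrapositive_currified (only parsing).
Notation okn := ltac:(lia) (only parsing).

(** * Differentiation rules and tactics for inequalities *)

Lemma isd_eq (f : R -> R) (x l l' : R) : is_derive f x l -> l = l' -> is_derive f x l'.
Proof. now intros H <-. Qed.
Lemma isd_plus (f g : R -> R) (x a b : R) : is_derive f x a -> is_derive g x b ->
 is_derive (fun x => f x+g x) x (a+b).
Proof. intros; now apply (is_derive_plus (K:=R_AbsRing) (V:=R_NormedModule) f g). Qed.
Lemma isd_minus (f g : R -> R) (x a b : R) : is_derive f x a -> is_derive g x b ->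
 is_derive (fun x => f x-g x) x (a-b).
Proof. intros; now apply (is_derive_minus (K:=R_AbsRing) (V:=R_NormedModule) f g). Qed.
Lemma isd_opp (f : R -> R) (x a : R) : is_derive f x a -> is_derive (fun x => - f x) x (- a).
Proof. intros; now apply (is_derive_opp (K:=R_AbsRing) (V:=R_NormedModule) f). Qed.
Lemma isd_mult (f g : R -> R) (x a b : R) : is_derive f x a -> is_derive g x b ->
 is_derive (fun x => f x*g x) x (a*g x+f x*b).
Proof. intros; apply (is_derive_mult (K:=R_AbsRing) f g); auto. intros; apply Rmult_comm. Qed.
Lemma isd_inv (f : R -> R) (x a : R) : is_derive f x a -> f x <> 0 ->
 is_derive (fun x => / f x) x (- a/(f x)^2).
Proof. intros; now apply (is_derive_inv f). Qed.
Lemma isd_div (f g : R -> R) (x a b : R) : is_derive f x a -> is_derive g x b -> g x <> 0 ->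
 is_derive (fun x => f x/g x) x ((a*g x-f x*b)/(g x)^2).
Proof. intros; now apply (is_derive_div f g). Qed.
Lemma isd_pow (f : R -> R) (x a : R) n : is_derive f x a ->
 is_derive (fun x => f x^n) x (INR n*a*f x^pred n).
Proof. intros; now apply (is_derive_pow f). Qed.
Lemma isd_comp (f g : R -> R) (x a b : R) : is_derive f (g x) a -> is_derive g x b ->
 is_derive (fun x => f (g x)) x (a*b).
Proof. intros. rewrite Rmult_comm. now apply (is_derive_comp (K:=R_AbsRing) (V:=R_NormedModule) f g x a b). Qed.
Lemma isd_exp (f : R -> R) (x a : R) : is_derive f x a ->
 is_derive (fun x => exp (f x)) x (exp (f x)*a).
Proof. intros. apply (isd_comp exp); [apply is_derive_exp|assumption]. Qed.
Lemma isd_ln (f : R -> R) (x a : R) : is_derive f x a -> 0 < f x ->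
 is_derive (fun x => ln (f x)) x (a/f x).
Proof. intros. apply isd_eq with (/ f x*a); [|unfold Rdiv; ring]. apply (isd_comp ln); [now apply is_derive_ln|assumption]. Qed.
Lemma isd_sin (f : R -> R) (x a : R) : is_derive f x a ->
 is_derive (fun x => sin (f x)) x (cos (f x)*a).
Proof. intros. apply (isd_comp sin); [apply is_derive_sin|assumption]. Qed.
Lemma isd_cos (f : R -> R) (x a : R) : is_derive f x a ->
 is_derive (fun x => cos (f x)) x (- sin (f x)*a).
Proof. intros. apply (isd_comp cos); [apply is_derive_cos|assumption]. Qed.
Lemma isd_sqrt (f : R -> R) (x a : R) : is_derive f x a -> 0 < f x ->
 is_derive (fun x => sqrt (f x)) x (a/(2*sqrt (f x))).
Proof. intros. apply isd_eq with (/ (2*sqrt (f x))*a); [|unfold Rdiv; ring].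
 apply (isd_comp sqrt); [|assumption]. apply is_derive_Reals. now apply derivable_pt_lim_sqrt. Qed.

Lemma isd_const (c x : R) : is_derive (fun _ : R => c) x 0.
Proof. apply (is_derive_const (K:=R_AbsRing) (V:=R_NormedModule)). Qed.
Lemma isd_id (x : R) : is_derive (fun x : R => x) x 1.
Proof. apply (is_derive_id (K:=R_AbsRing)). Qed.

(** The derivative is computed from the syntax of the function into an existential, which [isd] then
    compares with the claimed value through [isd_eq]. Nonvanishing denominators and positive
    arguments are left as side goals, in the order in which they are met. *)
Ltac isd_ := cbv beta;
 lazymatch goal with
 | |- is_derive (fun _ => ?c) _ _ => apply isd_const
 | |- is_derive (fun x => x) _ _ => apply isd_id
 | |- is_derive (Rmult ?c) _ _ => apply (isd_mult (fun _ => c) (fun x => x)); isd_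
 | |- is_derive (Rplus ?c) _ _ => apply (isd_plus (fun _ => c) (fun x => x)); isd_
 | |- is_derive (Rminus ?c) _ _ => apply (isd_minus (fun _ => c) (fun x => x)); isd_
 | |- is_derive Ropp _ _ => apply (isd_opp (fun x => x)); isd_
 | |- is_derive exp _ _ => apply (isd_exp (fun x => x)); isd_
 | |- is_derive (fun x => @?f x + @?g x) _ _ => apply (isd_plus f g); cbv beta; isd_
 | |- is_derive (fun x => @?f x - @?g x) _ _ => apply (isd_minus f g); cbv beta; isd_
 | |- is_derive (fun x => @?f x * @?g x) _ _ => apply (isd_mult f g); cbv beta; isd_
 | |- is_derive (fun x => @?f x / @?g x) _ _ => apply (isd_div f g); cbv beta; [isd_|isd_|cbv beta]
 | |- is_derive (fun x => - @?f x) _ _ => apply (isd_opp f); cbv beta; isd_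
 | |- is_derive (fun x => / @?f x) _ _ => apply (isd_inv f); cbv beta; [isd_|cbv beta]
 | |- is_derive (fun x => @?f x ^ ?n) _ _ => apply (isd_pow f); cbv beta; isd_
 | |- is_derive (fun x => exp (@?f x)) _ _ => apply (isd_exp f); cbv beta; isd_
 | |- is_derive (fun x => ln (@?f x)) _ _ => apply (isd_ln f); cbv beta; [isd_|cbv beta]
 | |- is_derive (fun x => sin (@?f x)) _ _ => apply (isd_sin f); cbv beta; isd_
 | |- is_derive (fun x => cos (@?f x)) _ _ => apply (isd_cos f); cbv beta; isd_
 | |- is_derive (fun x => sqrt (@?f x)) _ _ => apply (isd_sqrt f); cbv beta; [isd_|cbv beta]
 | |- is_derive (fun x => ?f x) _ _ =>
   first [ eassumption | match goal with H : context [is_derive _ _ _] |- _ => eapply H end ]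
 | _ => first [ eassumption | match goal with H : context [is_derive _ _ _] |- _ => eapply H end ]
 end.
Ltac isd := eapply isd_eq; [isd_|cbv beta].

Ltac pos := first [lra | lazymatch goal with
 | |- 0 < _*_ => apply Rmult_lt_0_compat; pos
 | |- 0 <= _*_ => apply Rmult_le_pos; pos
 | |- 0 < _/_ => apply Rdiv_lt_0_compat; pos
 | |- 0 <= _/_ => apply Rdiv_le_0_compat; pos
 | |- 0 < / _ => apply Rinv_0_lt_compat; pos
 | |- 0 < _^_ => apply pow_lt; pos
 | |- 0 <= _^2 => apply pow2_ge_0
 | |- 0 <= _^_ => apply pow_le; pos
 | |- 0 < exp _ => apply exp_pos
 | |- 0 < sqrt _ => apply sqrt_lt_R0; pos
 | |- 0 <= Rabs _ => apply Rabs_pos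
 | |- 0 <= Cmod _ => apply Cmod_ge_0
 | |- 0 < Rmin _ _ => apply Rmin_glb_lt; pos
 | |- 0 <= _ => apply Rlt_le; pos
 | |- _ >= 0 => apply Rle_ge; pos
 | |- _ <> 0 => apply Rgt_not_eq; pos
 end].
Ltac minmax := repeat (match goal with
 | H : context [Rmax ?a ?b] |- _ => lazymatch goal with _ : a <= Rmax a b |- _ => fail | _ => pose proof (Rmax_l a b); pose proof (Rmax_r a b) end
 | H : context [Rmin ?a ?b] |- _ => lazymatch goal with _ : Rmin a b <= a |- _ => fail | _ => pose proof (Rmin_l a b); pose proof (Rmin_r a b) end
 | |- context [Rmax ?a ?b] => lazymatch goal with _ : a <= Rmax a b |- _ => fail | _ => pose proof (Rmax_l a b); pose proof (Rmax_r a b) end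
 | |- context [Rmin ?a ?b] => lazymatch goal with _ : Rmin a b <= a |- _ => fail | _ => pose proof (Rmin_l a b); pose proof (Rmin_r a b) end
 end).
Ltac alra := repeat match goal with
 | H : Rabs _ <= _ |- _ => apply Rabs_le_between in H
 | H : Rabs _ < _ |- _ => apply Rabs_lt_between in H
 | |- Rabs _ <= _ => apply Rabs_le
 | |- Rabs _ < _ => apply Rabs_def1
 end; lra.

Lemma exp_le_mono (x y : R) : x <= y -> exp x <= exp y.
Proof. intros [H| ->]; [left; now apply exp_increasing|lra]. Qed.

Ltac mono := first [lra | assumption | lazymatch goal with
 | |- ?a*_ <= ?a*_ => apply Rmult_le_compat_l; [pos|mono]
 | |- _ * ?a <= _ * ?a => apply Rmult_le_compat_r; [pos|mono]
 | |- _*_ <= _*_ => apply Rmult_le_compat; [pos|pos|mono|mono]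
 | |- _ / ?a <= _ / ?a => apply Rmult_le_compat_r; [pos|mono]
 | |- / _ <= / _ => apply Rinv_le_contravar; [pos|mono]
 | |- / _ <= 1 => rewrite <- Rinv_1; apply Rinv_le_contravar; [pos|mono]
 | |- _^_ <= _^_ => apply pow_incr; split; [pos|mono]
 | |- exp _ <= exp _ => apply exp_le_mono; mono
 | |- exp _ <= 1 => rewrite <- exp_0; apply exp_le_mono; mono
 | |- 1 <= exp _ => rewrite <- exp_0; apply exp_le_mono; mono
 | |- 1 <= sqrt _ => rewrite <- sqrt_1; apply sqrt_le_1_alt; mono
 | |- sqrt _ <= sqrt _ => apply sqrt_le_1_alt; mono
 | |- _+_ <= _+_ => apply Rplus_le_compat; mono
 end | nra].

(** * Monotonicity and comparison on an interval *)

Lemma derive_nonneg_le (f f' : R -> R) (a b : R) :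
 a <= b -> (forall x, a <= x <= b -> is_derive f x (f' x)) ->
 (forall x, a <= x <= b -> 0 <= f' x) -> f a <= f b.
Proof.
 intros Hab Hd Hp.
 destruct (MVT_gen f a b f') as [c [Hc He]];
  rewrite ?Rmin_left, ?Rmax_right in *; try lra.
 - intros x Hx; apply Hd; lra.
 - intros x Hx. apply continuity_pt_filterlim.
  apply (ex_derive_continuous f). exists (f' x). now apply Hd.
 - have: 0<=f' c by (apply Hp; lra). nra.
Qed.

Lemma derive_pos_lt (f f' : R -> R) (a b : R) :
 a < b -> (forall x, a <= x <= b -> is_derive f x (f' x)) ->
 (forall x, a < x < b -> 0 < f' x) -> f a < f b.
Proof.
 intros Hab Hd Hp.
 destruct (MVT_cor2 f f' a b Hab) as [c [Hc1 Hc2]].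
 - intros c Hc. apply is_derive_Reals. now apply Hd.
 - specialize (Hp c Hc2). nra.
Qed.

Lemma derive_bound (f f' : R -> R) (a b M : R) :
 a <= b -> (forall x, a <= x <= b -> is_derive f x (f' x)) ->
 (forall x, a <= x <= b -> Rabs (f' x) <= M) -> Rabs (f b-f a) <= M*(b-a).
Proof.
 intros Hab Hd Hp. apply Rabs_le; split.
 - assert (f a+M*a<=f b+M*b); [|lra].
  apply (derive_nonneg_le (fun x => f x+M*x) (fun x => f' x+M)); auto.
  + intros x Hx. isd; [lra|ring].
  + intros x Hx. specialize (Hp x Hx). abs_in Hp. lra.
 - assert (M*a-f a<=M*b-f b); [|lra].
  apply (derive_nonneg_le (fun x => M*x-f x) (fun x => M-f' x)); auto.
  + intros x Hx. isd; [lra|ring].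
  + intros x Hx. specialize (Hp x Hx). abs_in Hp. lra.
Qed.

Lemma derive_cont_eps (f : R -> R) (x l eps : R) :
 is_derive f x l -> 0 < eps ->
 exists d, 0 < d /\ forall y, Rabs (y-x) < d -> Rabs (f y-f x) < eps.
Proof.
 intros Hd He.
 have C: continuity_pt f x.
 { apply continuity_pt_filterlim, (ex_derive_continuous f). now exists l. }
 destruct (C eps He) as [d [Hd1 Hd2]]. exists d; split; [exact Hd1|].
 intros y Hy. destruct (Req_dec y x) as [->|Hn].
 - now rewrite Rminus_diag, Rabs_R0.
 - apply (Hd2 y). split; [split; [exact I|now apply not_eq_sym]|exact Hy].
Qed.

Lemma derive_pos_right (f : R -> R) (x l : R) :
 is_derive f x l -> 0 < l ->
 exists d, 0 < d /\ forall y, 0 < y-x < d -> f x < f y.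
Proof.
 intros Hd Hl. apply is_derive_Reals in Hd.
 destruct (Hd (l/2)) as [d Hd']; [lra|]. exists d; split; [apply cond_pos|].
 intros y Hy. specialize (Hd' (y-x)). replace (x+(y-x)) with y in Hd' by ring.
 have A: Rabs ((f y-f x)/(y-x)-l)<l/2.
 { apply Hd'. lra. rewrite Rabs_right; lra. }
 apply Rabs_lt_between in A.
 have E: f y-f x=(f y-f x)/(y-x)*(y-x) by fld. nra.
Qed.

Lemma derive_neg_left (f : R -> R) (x l : R) :
 is_derive f x l -> l < 0 ->
 exists d, 0 < d /\ forall y, 0 < x-y < d -> f x < f y.
Proof.
 intros Hd Hl. apply is_derive_Reals in Hd.
 destruct (Hd (-l/2)) as [d Hd']; [lra|]. exists d; split; [apply cond_pos|].
 intros y Hy. specialize (Hd' (y-x)). replace (x+(y-x)) with y in Hd' by ring.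
 have A: Rabs ((f y-f x)/(y-x)-l) < - l/2.
 { apply Hd'. lra. rewrite Rabs_left; lra. }
 apply Rabs_lt_between in A.
 have E: f y-f x=(f y-f x)/(y-x)*(y-x) by fld. nra.
Qed.

(** Let z be the supremum of the points up to which y stays negative. Values y z < 0 or y z > 0
    contradict continuity, and y z = 0 with y' z < 0 would make y positive just before z. Only the
    sign of y' at contact points matters, which is all that a barrier for a nonlinear equation
    provides. *)
Lemma no_crossing (y y' : R -> R) (a b : R) :
 (forall x, a <= x <= b -> is_derive y x (y' x)) -> y a < 0 ->
 (forall x, a < x <= b -> y x = 0 -> y' x < 0) ->
 forall x, a <= x <= b -> y x < 0.
Proof.
 intros Hd Ha Hz x1 Hx1. destruct (Rlt_le_dec (y x1) 0) as [|Hge]; [assumption|exfalso].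
 set (E := fun x => a<=x<=x1 /\ forall s, a<=s<=x -> y s<0).
 destruct (completeness E) as [z [Hz1 Hz2]].
 { exists x1. intros x [Hx _]; lra. }
 { exists a. split; [lra|]. intros s Hs. now replace s with a by lra. }
 have Haz: a<=z. { apply Hz1. split; [lra|]. intros s Hs. now replace s with a by lra. }
 have Hzx: z<=x1. { apply Hz2. intros x [Hx _]; lra. }
 have Hl: forall s, a<=s<z -> y s<0.
 { intros s Hs. destruct (Rlt_le_dec (y s) 0) as [|H]; [assumption|exfalso].
  assert (z<=s); [|lra]. apply Hz2. intros e [He1 He2].
  destruct (Rle_lt_dec e s); [assumption|]. specialize (He2 s ok). lra. }
 destruct (Rtotal_order (y z) 0) as [Hn|[Hn|Hn]].
 - have: z <> x1 by (intros ->; lra).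
  destruct (derive_cont_eps y z (y' z) (- y z)) as [d [Hd1 Hd2]]; [apply Hd; lra|lra|].
  set (w := Rmin (z+d/2) x1).
  have: z<w by (apply Rmin_glb_lt; lra).
  have: w<=x1 by apply Rmin_r. have: w<=z+d/2 by apply Rmin_l.
  assert (w<=z); [|lra]. apply Hz1. split; [lra|]. intros s Hs.
  destruct (Rlt_le_dec s z); [apply Hl; lra|].
  specialize (Hd2 s). rewrite Rabs_right in Hd2 by lra.
  specialize (Hd2 ok). apply Rabs_lt_between in Hd2. lra.
 - have: a<z by (destruct (Req_dec a z); [subst; lra|lra]).
  destruct (derive_neg_left y z (y' z)) as [d [Hd1 Hd2]]; [apply Hd; lra|apply Hz; lra|].
  set (w := Rmax a (z-d/2)).
  have: a<=w by apply Rmax_l. have: z-d/2<=w by apply Rmax_r.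
  have: w<z by (apply Rmax_lub_lt; lra).
  specialize (Hd2 w ok). specialize (Hl w ok). lra.
 - have: a<z by (destruct (Req_dec a z); [subst; lra|lra]).
  destruct (derive_cont_eps y z (y' z) (y z)) as [d [Hd1 Hd2]]; [apply Hd; lra|lra|].
  set (w := Rmax a (z-d/2)).
  have: a<=w by apply Rmax_l. have: z-d/2<=w by apply Rmax_r.
  have: w<z by (apply Rmax_lub_lt; lra).
  specialize (Hd2 w). rewrite Rabs_left in Hd2 by lra. specialize (Hd2 ok).
  apply Rabs_lt_between in Hd2. specialize (Hl w ok). lra.
Qed.

(* At an interior maximum of a/b above 1 the Wronskian a' b - a b' vanishes while increasing,
  so a/b grows to its right. *)
Lemma ratio_max (a a1 a2 b b1 b2 : R -> R) (l r k : R) :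
 (forall x, l <= x <= r -> is_derive a x (a1 x)) ->
 (forall x, l <= x <= r -> is_derive a1 x (a2 x)) ->
 (forall x, l <= x <= r -> is_derive b x (b1 x)) ->
 (forall x, l <= x <= r -> is_derive b1 x (b2 x)) ->
 (forall x, l <= x <= r -> 0 < b x) ->
 (forall x, l < x < r -> b x < a x -> 0 < a2 x*b x-a x*b2 x) ->
 1 <= k -> a l <= k*b l -> a r <= k*b r ->
 forall x, l <= x <= r -> a x <= k*b x.
Proof.
 intros Da Da1 Db Db1 Pb HW Hk Hl Hr x Hx.
 have Dq: forall s, l<=s<=r ->
  is_derive (fun s => a s/b s) s ((a1 s*b s-a s*b1 s)/(b s*b s)).
 { intros s Hs. specialize (Pb s Hs). eapply isd_eq; [apply isd_div; [now apply Da|now apply Db|lra]|simpl; field; lra]. }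
 destruct (continuity_ab_maj (fun s => a s/b s) l r) as [z [Hz1 Hz2]]; [lra| |].
 { intros s Hs. apply continuity_pt_filterlim.
  apply (ex_derive_continuous (fun s => a s/b s)). eexists; now apply Dq. }
 have Hq: forall s, l<=s<=r -> (a s<=k*b s <-> a s/b s<=k).
 { intros s Hs. specialize (Pb s Hs). split; intros H.
  - apply Rmult_le_reg_r with (b s); [lra|]. replace (a s/b s*b s) with (a s) by fld. lra.
  - apply Rmult_le_compat_r with (r := b s) in H; [|lra].
   replace (a s/b s*b s) with (a s) in H by fld. lra. }
 apply Hq; [lra|]. destruct (Rle_lt_dec (a x/b x) k) as [|Hgt]; [assumption|exfalso].
 have Hzk: k<a z/b z by (specialize (Hz1 x Hx); lra).
 have Hzl: z <> l. { intros ->. apply Hq in Hl; [lra|lra]. }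
 have Hzr: z <> r. { intros ->. apply Hq in Hr; [lra|lra]. }
 set (q1 := fun s => (a1 s*b s-a s*b1 s)/(b s*b s)).
 have q10: q1 z=0.
 { destruct (Rtotal_order (q1 z) 0) as [Hn|[Hn|Hn]]; [exfalso|assumption|exfalso].
  - destruct (derive_neg_left _ z _ (Dq z ok) Hn) as [d [Hd1 Hd2]].
   set (w := Rmax l (z-d/2)).
   have: l<=w by apply Rmax_l. have: z-d/2<=w by apply Rmax_r.
   have: w<z by (apply Rmax_lub_lt; lra).
   specialize (Hd2 w ok). specialize (Hz1 w ok). lra.
  - destruct (derive_pos_right _ z _ (Dq z ok) Hn) as [d [Hd1 Hd2]].
   set (w := Rmin r (z+d/2)).
   have: w<=r by apply Rmin_l. have: w<=z+d/2 by apply Rmin_r.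
   have: z<w by (apply Rmin_glb_lt; lra).
   specialize (Hd2 w ok). specialize (Hz1 w ok). lra. }
 set (W := fun s => a1 s*b s-a s*b1 s).
 have DW: forall s, l<=s<=r -> is_derive W s (a2 s*b s-a s*b2 s).
 { intros s Hs. unfold W. eapply isd_eq.
  - apply isd_minus; apply isd_mult; [now apply Da1|now apply Db|now apply Da|now apply Db1].
  - simpl; ring. }
 have W0: W z=0.
 { specialize (Pb z ok). unfold q1 in q10.
  have E: W z=(a1 z*b z-a z*b1 z)/(b z*b z)*(b z*b z) by (unfold W; field; lra).
  rewrite E, q10; ring. }
 have Hab: b z<a z.
 { specialize (Pb z ok). have E: a z=a z/b z*b z by fld. nra. }
 destruct (derive_cont_eps _ z _ ((a z/b z-1)) (Dq z ok) ok) as [d0 [Hd01 Hd02]].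
 destruct (derive_pos_right W z _ (DW z ok) (HW z ok Hab)) as [d [Hd1 Hd2]].
 set (w := Rmin r (z+Rmin d0 d/2)).
 have: 0<Rmin d0 d by now apply Rmin_glb_lt.
 have: Rmin d0 d<=d by apply Rmin_r.
 have: w<=r by apply Rmin_l. have: w<=z+Rmin d0 d/2 by apply Rmin_r.
 have: z<w by (apply Rmin_glb_lt; lra).
 have: a z/b z<a w/b w.
 { apply (derive_pos_lt (fun s => a s/b s) q1 z w); [lra|intros; apply Dq; lra|].
  intros s Hs. specialize (Hd2 s ok). specialize (Pb s ok).
  unfold q1. apply Rdiv_lt_0_compat; [unfold W in *; lra|nra]. }
 specialize (Hz1 w ok). lra.
Qed.

(** * Parameter integrals and Bessel functions of both kinds *)

Lemma isd_continuous (f : R -> R) (x l : R) : is_derive f x l -> continuous f x.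
Proof. intros H. apply (ex_derive_continuous f). now exists l. Qed.

Lemma RInt_extR (f g : R -> R) (a b : R) :
 (forall x, Rmin a b < x < Rmax a b -> f x = g x :> R) -> RInt f a b = RInt g a b :> R.
Proof. intros; now apply RInt_ext. Qed.

Lemma RInt_param_derive (f f1 : R -> R -> R) (a b x : R) :
 a <= b ->
 (forall u v, is_derive (fun u => f u v) u (f1 u v)) ->
 (forall u v, continuity_2d_pt f1 u v) ->
 (forall u v, continuous (f u) v) ->
 is_derive (fun u => RInt (f u) a b) x (RInt (f1 x) a b).
Proof.
 intros Hab Hd Hc Hf.
 have E: forall u v, Derive (fun u => f u v) u=f1 u v.
 { intros. apply is_derive_unique, Hd. }
 eapply isd_eq.
 - apply (is_derive_RInt_param f).
  + apply filter_forall. intros y t Ht. eexists; apply Hd.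
  + intros t Ht. eapply continuity_2d_pt_ext; [|apply Hc]. intros; symmetry; apply E.
  + apply filter_forall. intros y. apply (ex_RInt_continuous (V := RN)).
   intros; apply Hf.
 - apply RInt_extR. intros; apply E.
Qed.

Lemma RInt_derive_value (f f1 : R -> R) (a b : R) :
 (forall x, Rmin a b <= x <= Rmax a b -> is_derive f x (f1 x)) ->
 (forall x, Rmin a b <= x <= Rmax a b -> continuous f1 x) ->
 RInt f1 a b = f b-f a :> R.
Proof.
 intros Hd Hc. apply (is_RInt_unique (V := RN)).
 apply (is_RInt_derive (V := RN)); assumption.
Qed.

Lemma cont_ex_RInt (f : R -> R) (a b : R) : (forall x, continuous f x) -> ex_RInt f a b.
Proof. intros H. apply (ex_RInt_continuous (V := RN)). intros; apply H. Qed.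

Lemma RInt_lin (f g : R -> R) (a b k l : R) :
 (forall x, continuous f x) -> (forall x, continuous g x) ->
 RInt (fun x => k*f x+l*g x) a b = k*RInt f a b+l*RInt g a b :> R.
Proof.
 intros Hf Hg.
 rewrite (RInt_plus (V := RN) (fun x => k*f x) (fun x => l*g x)).
 - rewrite (RInt_scal (V := RN) f), (RInt_scal (V := RN) g);
   try now apply cont_ex_RInt. reflexivity.
 - apply (ex_RInt_scal (V := R_NormedModule) f). now apply cont_ex_RInt.
 - apply (ex_RInt_scal (V := R_NormedModule) g). now apply cont_ex_RInt.
Qed.

(* [bes nu t] is Bessel's J_nu(2 t) for integer [nu]. *)
Definition bes (nu t : R) : R := / PI*RInt (fun th => cos (nu*th-2*t*sin th)) 0 PI.

Lemma c2_sin_proj2 (u v : R) : continuity_2d_pt (fun _ v => sin v) u v.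
Proof. apply (continuity_1d_2d_pt_comp sin (fun _ v => v)); [apply continuity_sin|apply continuity_2d_pt_id2]. Qed.
Lemma c2_cos_proj2 (u v : R) : continuity_2d_pt (fun _ v => cos v) u v.
Proof. apply (continuity_1d_2d_pt_comp cos (fun _ v => v)); [apply continuity_cos|apply continuity_2d_pt_id2]. Qed.

Lemma bes_phase_c2 (nu u v : R) : continuity_2d_pt (fun u v => nu*v-2*u*sin v) u v.
Proof.
 apply continuity_2d_pt_minus.
 - apply continuity_2d_pt_mult; [apply continuity_2d_pt_const|apply continuity_2d_pt_id2].
 - apply continuity_2d_pt_mult; [|apply c2_sin_proj2].
  apply continuity_2d_pt_mult; [apply continuity_2d_pt_const|apply continuity_2d_pt_id1].
Qed.

Lemma bes_cont (nu t v : R) : continuous (fun th => cos (nu*th-2*t*sin th)) v.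
Proof. eapply isd_continuous. isd. reflexivity. Qed.

Lemma bes_derive (nu t : R) : is_derive (bes nu) t (bes (nu-1) t-bes (nu+1) t).
Proof.
 have := PI_RGT_0. unfold bes.
 have D: is_derive (fun u => RInt (fun th => cos (nu*th-2*u*sin th)) 0 PI) t
  (RInt (fun th => 2*sin th*sin (nu*th-2*t*sin th)) 0 PI).
 { apply (RInt_param_derive (fun u th => cos (nu*th-2*u*sin th))
       (fun u th => 2*sin th*sin (nu*th-2*u*sin th))); [lra| | |].
  - intros u v. isd. ring.
  - intros u v. apply continuity_2d_pt_mult.
   + apply continuity_2d_pt_mult; [apply continuity_2d_pt_const|apply c2_sin_proj2].
   + apply (continuity_1d_2d_pt_comp sin (fun u v => nu*v-2*u*sin v));
     [apply continuity_sin|apply bes_phase_c2].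
  - intros; apply bes_cont. }
 isd. rewrite Rmult_0_l, Rplus_0_l.
 rewrite <- Rmult_minus_distr_l. f_equal.
 replace (RInt (fun th => cos ((nu-1)*th-2*t*sin th)) 0 PI -
      RInt (fun th => cos ((nu+1)*th-2*t*sin th)) 0 PI)
  with (1*RInt (fun th => cos ((nu-1)*th-2*t*sin th)) 0 PI +
      (-1)*RInt (fun th => cos ((nu+1)*th-2*t*sin th)) 0 PI) by ring.
 rewrite <- RInt_lin by (intros; apply bes_cont). apply RInt_extR. intros x _.
 replace ((nu-1)*x-2*t*sin x) with ((nu*x-2*t*sin x)-x) by ring.
 replace ((nu+1)*x-2*t*sin x) with ((nu*x-2*t*sin x)+x) by ring.
 generalize (nu*x-2*t*sin x); intros w. rewrite cos_plus, cos_minus. ring.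
Qed.

(** The recurrence is the integral of the total derivative of sin(nu th - 2t sin th) over [0, PI];
    the boundary term at PI is sin(nu PI). *)
Lemma bes_rec (nu t : R) : sin (nu*PI) = 0 -> nu*bes nu t = t*(bes (nu-1) t+bes (nu+1) t).
Proof.
 intros Hs. unfold bes.
 enough (E : nu*RInt (fun th => cos (nu*th-2*t*sin th)) 0 PI =
  t*(1*RInt (fun th => cos ((nu-1)*th-2*t*sin th)) 0 PI +
     1*RInt (fun th => cos ((nu+1)*th-2*t*sin th)) 0 PI)).
 { transitivity (/ PI*(nu*RInt (fun th => cos (nu*th-2*t*sin th)) 0 PI)); [ring|].
  rewrite E. ring. }
 rewrite <- RInt_lin by (intros; apply bes_cont).
 have Hc: forall x, continuous (fun x => 1*cos ((nu-1)*x-2*t*sin x)+1*cos ((nu+1)*x-2*t*sin x)) x.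
 { intros. eapply isd_continuous. isd. reflexivity. }
 have L := RInt_lin (fun th => cos (nu*th-2*t*sin th)) _ 0 PI nu (-t)
  (fun v => bes_cont nu t v) Hc.
 have Z: RInt (fun x => nu*cos (nu*x-2*t*sin x) +
    - t*(1*cos ((nu-1)*x-2*t*sin x)+1*cos ((nu+1)*x-2*t*sin x))) 0 PI=0 :> R.
 { rewrite (RInt_derive_value (fun th => sin (nu*th-2*t*sin th))).
  - rewrite sin_PI, sin_0. replace (nu*PI-2*t*0) with (nu*PI) by ring.
   rewrite Hs. replace (nu*0-2*t*0) with 0 by ring. rewrite sin_0. ring.
  - intros x _. isd.
   replace ((nu-1)*x-2*t*sin x) with ((nu*x-2*t*sin x)-x) by ring.
   replace ((nu+1)*x-2*t*sin x) with ((nu*x-2*t*sin x)+x) by ring.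
   generalize (nu*x-2*t*sin x); intros w. rewrite cos_plus, cos_minus. ring.
  - intros x _. eapply isd_continuous. isd. reflexivity. }
 simpl in *. lra.
Qed.

Lemma sin_INR_PI (n : nat) : sin (INR n*PI) = 0.
Proof.
 induction n; [now rewrite Rmult_0_l, sin_0|].
 rewrite S_INR, Rmult_plus_distr_r, Rmult_1_l, neg_sin, IHn. ring.
Qed.

Lemma abs_sin_le (x : R) : Rabs (sin x) <= Rabs x.
Proof.
 have P: forall y, 0<=y -> sin y<=y.
 { intros y Hy. destruct (Req_dec y 0) as [->|]; [rewrite sin_0; lra|]. left. apply sin_lt_x. lra. }
 have Q: forall y, 0<=y -> Rabs (sin y)<=y.
 { intros y Hy. apply Rabs_le; split; [|now apply P].
  destruct (Rle_lt_dec y 1).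
  - have: 0<=sin y by (apply sin_ge_0; have := PI2_1; lra). lra.
  - have := SIN_bound y. lra. }
 destruct (Rle_lt_dec 0 x).
 - rewrite (Rabs_right x) by lra. now apply Q.
 - rewrite (Rabs_left x) by lra. rewrite <- (Ropp_involutive x) at 1. rewrite sin_neg, Rabs_Ropp. apply Q. lra.
Qed.

Lemma cos_ge_lin (x : R) : 1-Rabs x <= cos x.
Proof.
 replace x with (2*(x/2)) at 2 by field. rewrite cos_2a_sin.
 have H := abs_sin_le (x/2). rewrite Rabs_div in H by lra. rewrite (Rabs_right 2) in H by lra.
 have := Rabs_pos (sin (x/2)). have := SIN_bound (x/2).
 have: Rabs (sin (x/2))<=1 by (apply Rabs_le; lra).
 have: sin (x/2)*sin (x/2)=Rabs (sin (x/2))*Rabs (sin (x/2)) by (rewrite <- Rabs_mult; rewrite Rabs_right; nra).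
 nra.
Qed.

Lemma RInt_bounds (f : R -> R) (a b m M : R) : a <= b -> (forall x, continuous f x) ->
 (forall x, a < x < b -> m <= f x <= M) -> m*(b-a) <= RInt f a b <= M*(b-a).
Proof.
 intros Hab Hc Hb.
 have E: forall k, RInt (fun _ => k) a b=k*(b-a).
 { intros. rewrite RInt_const. unfold scal; simpl; unfold mult; simpl. ring. }
 rewrite <- !E. split; apply RInt_le; auto; try (apply cont_ex_RInt; intros; try apply Hc; apply continuous_const);
 intros x Hx; apply Hb; lra.
Qed.

Lemma bes_bound (nu t : R) : Rabs (bes nu t) <= 1.
Proof.
 have := PI_RGT_0. unfold bes.
 pose proof (RInt_bounds (fun th => cos (nu*th-2*t*sin th)) 0 PI (-1) 1 ok
  (fun v => bes_cont nu t v) (fun x _ => COS_bound _)) as [H1 H2]. rewrite Rminus_0_r in *.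
 apply Rabs_le. split.
 - apply Rmult_le_reg_l with PI; [lra|]. rewrite <- Rmult_assoc, Rinv_r, Rmult_1_l by lra. lra.
 - apply Rmult_le_reg_l with PI; [lra|]. rewrite <- Rmult_assoc, Rinv_r, Rmult_1_l by lra. lra.
Qed.

Lemma bes0_near (t : R) : 0 <= t -> 1-2*t <= bes 0 t <= 1.
Proof.
 intros Ht. split; [|have B := bes_bound 0 t; abs_in B; lra].
 have := PI_RGT_0. unfold bes.
 destruct (RInt_bounds (fun th => cos (0*th-2*t*sin th)) 0 PI (1-2*t) 1 ok
  (fun v => bes_cont 0 t v)) as [H1 H2].
 - intros x _. split; [|apply COS_bound]. eapply Rle_trans; [|apply cos_ge_lin].
  replace (0*x-2*t*sin x) with (- (2*t*sin x)) by ring. rewrite Rabs_Ropp, Rabs_mult.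
  rewrite (Rabs_right (2*t)) by lra. have := SIN_bound x.
  have: Rabs (sin x)<=1 by (apply Rabs_le; lra). nra.
 - rewrite Rminus_0_r in *. apply Rmult_le_reg_l with PI; [lra|]. rewrite <- Rmult_assoc, Rinv_r, Rmult_1_l by lra. lra.
Qed.

(* [mbes k t] is I_k(2 t) for k = 0, 1. *)
Definition mbes0 (t : R) : R := / PI*RInt (fun th => exp (2*t*cos th)) 0 PI.
Definition mbes1 (t : R) : R := / PI*RInt (fun th => cos th*exp (2*t*cos th)) 0 PI.

Lemma mbes_c2 (u v : R) : continuity_2d_pt (fun u v => exp (2*u*cos v)) u v.
Proof.
 apply (continuity_1d_2d_pt_comp exp (fun u v => 2*u*cos v)).
 - apply derivable_continuous_pt, derivable_pt_exp.
 - apply continuity_2d_pt_mult; [|apply c2_cos_proj2].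
  apply continuity_2d_pt_mult; [apply continuity_2d_pt_const|apply continuity_2d_pt_id1].
Qed.

Lemma mbes0_derive (t : R) : is_derive mbes0 t (2*mbes1 t).
Proof.
 have := PI_RGT_0. unfold mbes0, mbes1.
 have D: is_derive (fun u => RInt (fun th => exp (2*u*cos th)) 0 PI) t
  (RInt (fun th => 2*(cos th*exp (2*t*cos th))+0*cos th) 0 PI).
 { apply (RInt_param_derive (fun u th => exp (2*u*cos th))
       (fun u th => 2*(cos th*exp (2*u*cos th))+0*cos th)); [lra| | |].
  - intros u v. isd. ring.
  - intros u v. apply continuity_2d_pt_plus; [|apply continuity_2d_pt_mult; [apply continuity_2d_pt_const|apply c2_cos_proj2]].
   apply continuity_2d_pt_mult; [apply continuity_2d_pt_const|].
   apply continuity_2d_pt_mult; [apply c2_cos_proj2|apply mbes_c2].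
  - intros. eapply isd_continuous. isd. reflexivity. }
 rewrite (RInt_lin (fun th => cos th*exp (2*t*cos th)) cos) in D;
  [|intros x; eapply isd_continuous; isd; reflexivity|intros x; eapply isd_continuous, is_derive_cos].
 isd. simpl; ring.
Qed.

(** The integral form is kept because it covers t = 0, where the recurrence below would divide by
    zero; continuity of I_1/I_0 up to 0 relies on it. *)
Lemma mbes1_derive (t : R) : is_derive mbes1 t (/ PI*RInt (fun th => 2*(cos th*cos th*exp (2*t*cos th))+0*cos th) 0 PI).
Proof.
 have := PI_RGT_0. unfold mbes1.
 have D: is_derive (fun u => RInt (fun th => cos th*exp (2*u*cos th)) 0 PI) t
  (RInt (fun th => 2*(cos th*cos th*exp (2*t*cos th))+0*cos th) 0 PI).
 { apply (RInt_param_derive (fun u th => cos th*exp (2*u*cos th))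
       (fun u th => 2*(cos th*cos th*exp (2*u*cos th))+0*cos th)); [lra| | |].
  - intros u v. isd. ring.
  - intros u v. apply continuity_2d_pt_plus; [|apply continuity_2d_pt_mult; [apply continuity_2d_pt_const|apply c2_cos_proj2]].
   apply continuity_2d_pt_mult; [apply continuity_2d_pt_const|].
   apply continuity_2d_pt_mult; [|apply mbes_c2].
   apply continuity_2d_pt_mult; apply c2_cos_proj2.
  - intros. eapply isd_continuous. isd. reflexivity. }
 isd. ring.
Qed.

(** Integration by parts: the derivative of sin th exp(2t cos th) has integral 0 over [0, PI], which
    removes the factor cos^2 th. *)
Lemma mbes1_derive_val (t : R) : t <> 0 -> is_derive mbes1 t (2*mbes0 t-mbes1 t/t).
Proof.
 intros Ht. eapply isd_eq; [apply mbes1_derive|]. have := PI_RGT_0. unfold mbes0, mbes1.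
 rewrite (RInt_lin (fun th => cos th*cos th*exp (2*t*cos th)) cos);
  [|intros x; eapply isd_continuous; isd; reflexivity|intros x; eapply isd_continuous, is_derive_cos].
 have Z: RInt (fun th => 1*(cos th*exp (2*t*cos th)) +
   1*((-2*t)*exp (2*t*cos th)+(2*t)*(cos th*cos th*exp (2*t*cos th)))) 0 PI=0 :> R.
 { rewrite (RInt_derive_value (fun th => sin th*exp (2*t*cos th))).
  - rewrite sin_PI, sin_0. ring.
  - intros x _. isd. have: sin x*sin x=1-cos x*cos x by (have := sin2_cos2 x; unfold Rsqr in *; lra).
   transitivity (cos x*exp (2*t*cos x)-2*t*(sin x*sin x)*exp (2*t*cos x)); [ring|].
   rewrite H0; ring.
  - intros x _. eapply isd_continuous. isd. reflexivity. }
 rewrite (RInt_lin (fun th => cos th*exp (2*t*cos th))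
  (fun th => (-2*t)*exp (2*t*cos th)+(2*t)*(cos th*cos th*exp (2*t*cos th)))) in Z;
  [|intros x; eapply isd_continuous; isd; reflexivity..].
 rewrite (RInt_lin (fun th => exp (2*t*cos th)) (fun th => cos th*cos th*exp (2*t*cos th))) in Z;
  [|intros x; eapply isd_continuous; isd; reflexivity..].
 apply Rmult_eq_reg_l with (t*PI); [|apply Rmult_integral_contrapositive; lra].
 field_simplify; try lra.
Qed.

Lemma mbes0_pos (t : R) : 0 < mbes0 t.
Proof.
 have := PI_RGT_0. unfold mbes0. apply Rmult_lt_0_compat; [pos|].
 apply RInt_gt_0; [lra|intros; apply exp_pos|]. intros; eapply isd_continuous; isd; reflexivity.
Qed.

Lemma mbes0_0 : mbes0 0 = 1.
Proof.
 have := PI_RGT_0. unfold mbes0.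
 rewrite (RInt_extR _ (fun _ => 1)); [|intros; rewrite Rmult_0_r, Rmult_0_l; apply exp_0].
 rewrite RInt_const. unfold scal; simpl; unfold mult; simpl. field; lra.
Qed.

Lemma mbes1_0 : mbes1 0 = 0.
Proof.
 unfold mbes1.
 rewrite (RInt_extR _ (fun x => cos x)); [|intros; rewrite Rmult_0_r, Rmult_0_l, exp_0; ring].
 rewrite (RInt_derive_value sin); [rewrite sin_PI, sin_0; ring| |].
 - intros; apply is_derive_sin.
 - intros; eapply isd_continuous, is_derive_cos.
Qed.

(** * The discrete Painleve II solution: bounds and behaviour at both ends of t *)

(** The pair (R_n, R_(n+1)) makes the two-step recursion structural. Division being total, nothing
    here prevents 1 - R_(n+1)^2 from vanishing; [dp2_flow] shows that it does not for t > 0. *)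
Fixpoint dp2_pair (n : nat) (t : R) : R*R :=
 match n with
 | O => (1, mbes1 t/mbes0 t)
 | S m => let p := dp2_pair m t in
      (snd p, INR (S m)/t*(snd p/(1-snd p^2))-fst p)
 end.
(* The solution of the discrete Painleve II equation with R_0 = 1; up to sign these are the Verblunsky
  coefficients of the weight exp (2 t cos th) on the circle. *)
Definition dp2 (n : nat) (t : R) : R := fst (dp2_pair n t).

Lemma dp2_0 t : dp2 0 t = 1. Proof. reflexivity. Qed.
Lemma dp2_1 t : dp2 1 t = mbes1 t/mbes0 t. Proof. reflexivity. Qed.
Lemma dp2_SS n t : dp2 (S (S n)) t = INR (S n)/t*(dp2 (S n) t/(1-dp2 (S n) t^2))-dp2 n t.
Proof. reflexivity. Qed.

(** Replaces an initial condition at the singular point t = 0. If h t were negative, monotonicity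
    would keep h below h t all the way down to 0, against h s >= -K s for small s. *)
Lemma zero_start (h h' : R -> R) (d K : R) :
 0 < d -> (forall s, 0 < s <= d -> is_derive h s (h' s)) -> (forall s, 0 < s <= d -> 0 <= h' s) ->
 (forall s, 0 < s <= d -> - K*s <= h s) -> forall t, 0 < t <= d -> 0 <= h t.
Proof.
 intros Hd Dh Ph HK t Ht. destruct (Rle_lt_dec 0 (h t)) as [|Hn]; [assumption|exfalso].
 set (s := Rmin t (- h t/(2*(Rabs K+1)))).
 have := Rabs_pos K. have := Rle_abs K.
 have: 0 < - h t/(2*(Rabs K+1)) by pos.
 have: s<=t by apply Rmin_l. have Hs: s <= - h t/(2*(Rabs K+1)) by apply Rmin_r.
 have: 0<s by (apply Rmin_glb_lt; lra).
 have: h s<=h t by (apply (derive_nonneg_le h h'); [lra|intros; apply Dh; lra|intros; apply Ph; lra]).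
 specialize (HK s ok).
 have: (Rabs K+1)*s <= - h t/2.
 { apply Rmult_le_compat_l with (r := Rabs K+1) in Hs; [|lra].
  replace ((Rabs K+1)*(- h t/(2*(Rabs K+1)))) with (- h t/2) in Hs by fld. lra. }
 nra.
Qed.

Lemma pow_le_base (s : R) (n : nat) : 0 <= s <= 1 -> (1 <= n)%nat -> s^n <= s.
Proof.
 intros Hs Hn. destruct n; [lia|]. simpl. have: s^n<=1.
 { clear Hn. induction n; simpl; [lra|]. nra. }
 nra.
Qed.

(* The Riccati equation c' = 2 (1 - c^2) b - (m/t) c confines to (0,1) every solution that stays bounded at 0. *)
Lemma riccati_start (m : nat) (b c : R -> R) (d M : R) :
 (1 <= m)%nat -> 0 < d <= 1 ->
 (forall t, 0 < t -> is_derive c t (2*(1-c t^2)*b t-INR m/t*c t)) ->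
 (forall t, 0 < t -> 0 < b t <= 1) ->
 (forall t, 0 < t <= d -> Rabs (c t) <= M) ->
 (forall t, 0 < t <= d -> - (2*M^2)*t <= c t <= 2*t).
Proof.
 intros Hm Hd Dc Hb HM t Ht.
 have HM0: 0<=M by (specialize (HM d ok); have := Rabs_pos (c d); lra).
 have Hpw: forall s, 0<s -> s^m=s*s^pred m.
 { intros. replace m with (S (pred m)) at 1 by lia. reflexivity. }
 have Hpp: forall s, 0<s -> 0<s^m by (intros; now apply pow_lt).
 have IM: 1<=INR m by (now apply (le_INR 1)).
 have Dp: forall s, 0<s -> is_derive (fun s => s^m*c s) s (2*s^m*(1-c s^2)*b s).
 { intros s Hs. eapply isd_eq; [apply isd_mult; [isd_|now apply Dc]|].
  simpl. rewrite (Hpw s Hs). field. lra. }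
 have Dq: forall s, 0<s -> is_derive (fun s => s^(S m)) s (INR (S m)*s^m).
 { intros s Hs. isd. cbv beta; simpl pred; ring. }
 have Hsm: forall s, 0<s<=d -> Rabs (s^m*c s)<=M*s.
 { intros s Hs. rewrite Rabs_mult, Rabs_right by (apply Rle_ge, Rlt_le, Hpp; lra).
  have := pow_le_base s m ok Hm. specialize (HM s Hs). specialize (Hpp s ok).
  nra. }
 split.
 - have Hz: 0<=t^m*c t+2*M^2*t^S m.
  { apply (zero_start (fun s => s^m*c s+2*M^2*s^S m)
    (fun s => 2*s^m*(1-c s^2)*b s+2*M^2*(INR (S m)*s^m)) d M); try lra.
   - intros s Hs. eapply isd_eq; [apply isd_plus; [apply Dp; lra|apply isd_mult; [isd_|apply Dq; lra]]|].
    cbv beta; ring.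
   - intros s Hs. specialize (Hpp s ok). specialize (Hb s ok). specialize (HM s Hs).
    rewrite S_INR. abs_in HM.
    have: 0<=(1-c s^2)*b s+M^2 by nra.
    have: 0<=M^2*INR m by pos.
    replace (2*s^m*(1-c s^2)*b s+2*M^2*((INR m+1)*s^m))
     with (2*s^m*((1-c s^2)*b s+M^2+M^2*INR m)) by ring.
    apply Rmult_le_pos; lra.
   - intros s Hs. specialize (Hsm s Hs). abs_in Hsm.
    have: 0<s^S m by pos. nra. }
  specialize (Hpp t ok). simpl in Hz. nra.
 - have Hz: 0<=2*t^S m-t^m*c t.
  { apply (zero_start (fun s => 2*s^S m-s^m*c s)
    (fun s => 2*(INR (S m)*s^m)-2*s^m*(1-c s^2)*b s) d M); try lra.
   - intros s Hs. eapply isd_eq; [apply isd_minus; [apply isd_mult; [isd_|apply Dq; lra]|apply Dp; lra]|].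
    cbv beta; ring.
   - intros s Hs. specialize (Hpp s ok). specialize (Hb s ok). rewrite S_INR.
    have: (1-c s^2)*b s<=1 by nra.
    replace (2*((INR m+1)*s^m)-2*s^m*(1-c s^2)*b s)
     with (2*s^m*(INR m+1-(1-c s^2)*b s)) by ring.
    apply Rmult_le_pos; lra.
   - intros s Hs. specialize (Hsm s Hs). abs_in Hsm.
    have: 0<s^S m by pos. lra. }
  specialize (Hpp t ok). simpl in Hz. nra.
Qed.

(** Near 0 the solution is small by [riccati_start], so that t^m c increases there and c is positive
    at some e. From e on, 0 cannot be crossed, because c' = 2b > 0 at c = 0, nor 1, because c' =
    -m/t < 0 at c = 1. *)
Lemma riccati_trap (m : nat) (b c : R -> R) (d M : R) :
 (1 <= m)%nat -> 0 < d <= 1 ->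
 (forall t, 0 < t -> is_derive c t (2*(1-c t^2)*b t-INR m/t*c t)) ->
 (forall t, 0 < t -> 0 < b t <= 1) ->
 (forall t, 0 < t <= d -> Rabs (c t) <= M) ->
 forall t, 0 < t -> 0 < c t < 1.
Proof.
 intros Hm Hd Dc Hb HM t Ht.
 have Hst := riccati_start m b c d M Hm Hd Dc Hb HM.
 have IM: 1<=INR m by (now apply (le_INR 1)).
 (* The bound 1/(4(M^2+1)) keeps both 2e and 2 M^2 e below 1/2, hence |c| <= 1/2 on (0, e]. *)
 set (e := Rmin t (Rmin d (/ (4*(M^2+1))))).
 have: 0<=M^2 by nra.
 have: 0 < / (4*(M^2+1)) by pos.
 have He1: e<=t by apply Rmin_l.
 have He2: e<=d by (eapply Rle_trans; [apply Rmin_r|apply Rmin_l]).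
 have He3: e <= / (4*(M^2+1)) by (eapply Rle_trans; [apply Rmin_r|apply Rmin_r]).
 have He0: 0<e by (apply Rmin_glb_lt; [lra|apply Rmin_glb_lt; lra]).
 have He4: e*(4*(M^2+1))<=1.
 { apply Rmult_le_compat_r with (r := 4*(M^2+1)) in He3; [|lra]. rewrite Rinv_l in He3; lra. }
 have Hsmall: forall s, 0<s<=e -> -1/2<=c s<=1/2.
 { intros s Hs. specialize (Hst s ok). nra. }
 have Dp: forall s, 0<s -> is_derive (fun s => s^m*c s) s (2*s^m*(1-c s^2)*b s).
 { intros s Hs. eapply isd_eq; [apply isd_mult; [isd_|now apply Dc]|].
  simpl. have Hpw: s^m=s*s^pred m by (replace m with (S (pred m)) at 1 by lia; reflexivity). rewrite Hpw. field. lra. }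
 have Hpos: forall s, 0<s<=e -> 0<=s^m*c s.
 { apply (zero_start (fun s => s^m*c s) (fun s => 2*s^m*(1-c s^2)*b s) e 1); [lra| | |].
  - intros s Hs; apply Dp; lra.
  - intros s Hs. specialize (Hsmall s Hs). specialize (Hb s ok).
   have: 0<s^m by pos. have: 0<=1-c s^2 by nra.
   apply Rmult_le_pos; [|lra]. apply Rmult_le_pos; lra.
  - intros s Hs. specialize (Hsmall s Hs).
   have := pow_le_base s m ok Hm. have: 0<s^m by pos. nra. }
 have Hce: 0<c e.
 { have: 0<e^m*c e.
  { apply Rle_lt_trans with ((e/2)^m*c (e/2)); [apply Hpos; lra|].
   apply (derive_pos_lt (fun s => s^m*c s) (fun s => 2*s^m*(1-c s^2)*b s)); [lra|intros; apply Dp; lra|].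
   intros s Hs. specialize (Hsmall s ok). specialize (Hb s ok).
   have: 0<s^m by pos. have: 0<1-c s^2 by nra.
   apply Rmult_lt_0_compat; [|lra]. apply Rmult_lt_0_compat; lra. }
  have: 0<e^m by pos. nra. }
 specialize (Hsmall e ok). split.
 - assert (- c t<0); [|lra].
  apply (no_crossing (fun s => - c s) (fun s => - (2*(1-c s^2)*b s-INR m/s*c s)) e t); try lra.
  + intros s Hs. apply isd_opp, Dc. lra.
  + intros s Hs Hz0. assert (c s=0) as -> by lra. specialize (Hb s ok).
   rewrite Rmult_0_r. lra.
 - assert (c t-1<0); [|lra].
  apply (no_crossing (fun s => c s-1) (fun s => (2*(1-c s^2)*b s-INR m/s*c s)-0) e t); try lra.
  + intros s Hs. apply isd_minus; [apply Dc; lra|isd_].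
  + intros s Hs Hz0. assert (c s=1) as -> by lra.
   have: 0<INR m/s by pos. lra.
Qed.

(** The five statements support each other. The recursion combines the two flow equations into one
    for R_(n+2), a Riccati equation whose coefficient R_(n+1) lies in (0, 1), so [riccati_trap]
    gives the next bounds. The linear bound on R_(n+1) near 0 compensates the factor (n+1)/t of the
    recursion and supplies the boundedness at 0 which that lemma requires. *)
Lemma dp2_flow (n : nat) :
 (forall t, 0 < t -> is_derive (dp2 (S n)) t
   (2*(1-dp2 (S n) t^2)*dp2 n t-INR (S n)/t*dp2 (S n) t)) /\
 (forall t, 0 < t -> is_derive (dp2 n) t
   (INR n/t*dp2 n t-2*(1-dp2 n t^2)*dp2 (S n) t)) /\
 (forall t, 0 < t -> 0 < dp2 (S n) t < 1) /\
 (forall t, 0 < t -> 0 < dp2 n t <= 1) /\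
 (forall t, 0 < t <= 1/4 -> dp2 (S n) t <= 2*t).
Proof.
 induction n as [|n [IA [IB [IC [ID IE]]]]].
 - have A: forall t, 0<t -> is_derive (dp2 1) t
   (2*(1-dp2 1 t^2)*dp2 0 t-INR 1/t*dp2 1 t).
  { intros t Ht. have := mbes0_pos t.
   eapply isd_eq; [apply (isd_div mbes1 mbes0); [apply mbes1_derive_val; lra|apply mbes0_derive|lra]|].
   rewrite dp2_0, dp2_1. simpl. field. lra. }
  have BB: forall t, 0<t -> 0<dp2 0 t<=1 by (intros; rewrite dp2_0; lra).
  have BM: exists M, forall t, 0<t<=1/4 -> Rabs (dp2 1 t)<=M.
  { destruct (continuity_ab_maj (fun t => Rabs (mbes1 t/mbes0 t)) 0 (1/4)) as [z [Hz _]]; [lra| |].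
   - intros t Ht. apply continuity_pt_filterlim.
    apply (continuous_comp (fun t => mbes1 t/mbes0 t) Rabs); [|apply continuous_Rabs].
    eapply isd_continuous. apply isd_div; [apply mbes1_derive|apply mbes0_derive|apply Rgt_not_eq, mbes0_pos].
   - exists (Rabs (mbes1 z/mbes0 z)). intros t Ht. apply Hz. lra. }
  destruct BM as [M HM].
  repeat apply conj; auto.
  + intros t Ht. eapply isd_eq; [apply (isd_const 1 t)|]. rewrite dp2_0. simpl. field. lra.
  + apply (riccati_trap 1 (dp2 0) (dp2 1) (1/4) M); auto; lra.
  + apply (riccati_start 1 (dp2 0) (dp2 1) (1/4) M); auto; lra.
 - have A: forall t, 0<t -> is_derive (dp2 (S (S n))) t
   (2*(1-dp2 (S (S n)) t^2)*dp2 (S n) t-INR (S (S n))/t*dp2 (S (S n)) t).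
  { intros t Ht. specialize (IA t Ht). specialize (IB t Ht). specialize (IC t Ht).
   eapply isd_eq.
   - apply (is_derive_ext (fun t => INR (S n)/t*(dp2 (S n) t/(1-dp2 (S n) t^2))-dp2 n t));
     [intros; symmetry; apply dp2_SS|].
    apply isd_minus; [|exact IB]. apply isd_mult; [apply (isd_div (fun _ => INR (S n)) (fun t => t)); [isd_|isd_|lra]|].
    apply isd_div; [exact IA|apply isd_minus; [isd_|apply isd_pow, IA]|nra].
   - rewrite dp2_SS, !S_INR. simpl INR. simpl pred. field. nra. }
  have B: forall t, 0<t -> is_derive (dp2 (S n)) t
   (INR (S n)/t*dp2 (S n) t-2*(1-dp2 (S n) t^2)*dp2 (S (S n)) t).
  { intros t Ht. eapply isd_eq; [apply IA, Ht|]. rewrite dp2_SS. specialize (IC t Ht). field. nra. }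
  have BB: forall t, 0<t -> 0<dp2 (S n) t<=1 by (intros t Ht; specialize (IC t Ht); lra).
  have HM: forall t, 0<t<=1/4 -> Rabs (dp2 (S (S n)) t)<=4*INR (S n)+1.
  { intros t Ht. rewrite dp2_SS. specialize (ID t ok). specialize (IC t ok).
   specialize (IE t Ht). set (b := dp2 (S n) t) in *. set (a := dp2 n t) in *.
   have: b^2<=1/4 by nra.
   have: 0<=b/(1-b^2)<=4*t.
   { split; [pos|].
    apply Rmult_le_reg_r with (1-b^2); [lra|]. unfold Rdiv. rewrite Rmult_assoc, Rinv_l by lra. nra. }
   have: 0<INR (S n) by (apply lt_0_INR; lia).
   have: INR (S n)/t*(b/(1-b^2))<=4*INR (S n).
   { apply Rmult_le_reg_l with t; [lra|]. replace (t*(INR (S n)/t*(b/(1-b^2)))) with (INR (S n)*(b/(1-b^2))) by fld. nra. }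
   have: 0<=INR (S n)/t*(b/(1-b^2)).
   { apply Rmult_le_pos; [|lra]. apply Rlt_le, Rdiv_lt_0_compat; lra. }
   alra. }
  repeat apply conj; auto.
  + apply (riccati_trap (S (S n)) (dp2 (S n)) (dp2 (S (S n))) (1/4) (4*INR (S n)+1)); auto; try lra; lia.
  + apply (riccati_start (S (S n)) (dp2 (S n)) (dp2 (S (S n))) (1/4) (4*INR (S n)+1)); auto; try lra; lia.
Qed.

Lemma dp2_derive (n : nat) t : 0 < t -> is_derive (dp2 (S n)) t
   (2*(1-dp2 (S n) t^2)*dp2 n t-INR (S n)/t*dp2 (S n) t).
Proof. apply dp2_flow. Qed.
Lemma dp2_derive' (n : nat) t : 0 < t -> is_derive (dp2 n) t
   (INR n/t*dp2 n t-2*(1-dp2 n t^2)*dp2 (S n) t).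
Proof. apply dp2_flow. Qed.
Lemma dp2_range (n : nat) t : 0 < t -> 0 < dp2 (S n) t < 1.
Proof. apply dp2_flow. Qed.
Lemma dp2_le_lin (n : nat) t : 0 < t <= 1/4 -> dp2 (S n) t <= 2*t.
Proof. apply dp2_flow. Qed.

(** c = t^n/n! (1 + O(t)) with one-sided error. The window K d <= 1 keeps the lower bound
    nonnegative, which the inductive step uses. *)
Definition starts_like (n : nat) (K : R) (c : R -> R) : Prop :=
 exists d, 0 < d <= 1/4 /\ K*d <= 1 /\
  forall t, 0 < t <= d -> t^n/INR (fact n)*(1-K*t) <= c t <= t^n/INR (fact n).

(** t^(n+1) c has derivative 2 t^(n+1) (1 - e) b and is compared with U = t^(2n+2)/(n+1)! by
    [zero_start]; the factor 1 - e >= 1 - 4t costs 4 in the constant K. One lemma serves the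
    nonlinear case e = c^2 and the Bessel case e = 0. *)
Lemma starts_like_step (n : nat) (K M : R) (b c e : R -> R) :
 0 <= K -> starts_like n K b ->
 (forall t, 0 < t -> is_derive c t (2*(1-e t)*b t-INR (S n)/t*c t)) ->
 (forall t, 0 < t <= 1/4 -> 0 <= e t <= 4*t) ->
 (forall t, 0 < t <= 1/4 -> Rabs (c t) <= M) ->
 starts_like (S n) (K+4) c.
Proof.
 intros HK [d [Hd [HKd Hb]]] Dc He HM.
 set (F := INR (fact (S n))). have HF: 0<F by apply INR_fact_lt_0.
 have HF0: 0<INR (fact n) by apply INR_fact_lt_0.
 have EF: F=INR (S n)*INR (fact n).
 { unfold F. rewrite <- mult_INR. f_equal. }
 have HF1: 1<=F by (unfold F; apply (le_INR 1), lt_O_fact).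
 have IN: 0<INR (S n) by (apply lt_0_INR; lia).
 set (U := fun t => t^S n*t^S n/F).
 set (U1 := fun t => 2*t^S n*(t^n/INR (fact n))).
 have DU: forall t, 0<t -> is_derive U t (U1 t).
 { intros t Ht. unfold U, U1. rewrite S_INR in IN. isd; [lra|]. rewrite EF, !S_INR. simpl pred. field. lra. }
 have Dg: forall s, 0<s -> is_derive (fun s => s^S n*c s) s (2*s^S n*(1-e s)*b s).
 { intros s Hs. eapply isd_eq; [apply isd_mult; [isd_|now apply Dc]|].
  cbv beta. simpl pow. field. lra. }
 set (d' := Rmin d (/ (K+4))).
 have: 0 < / (K+4) by pos.
 have: d'<=d by apply Rmin_l. have Hd2: d' <= / (K+4) by apply Rmin_r.
 have: 0<d' by (apply Rmin_glb_lt; lra).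
 have HKd': (K+4)*d'<=1.
 { apply Rmult_le_compat_l with (r := K+4) in Hd2; [|lra]. rewrite Rinv_r in Hd2; lra. }
 have Hg: forall s, 0<s<=d' -> Rabs (s^S n*c s)<=M*s.
 { intros s Hs. rewrite Rabs_mult, Rabs_right by pos.
  have := pow_le_base s (S n) ok okn. specialize (HM s ok).
  have := Rabs_pos (c s). nra. }
 have HU: forall s, 0<s<=d' -> 0<=U s<=s.
 { intros s Hs. unfold U. have := pow_le_base s (S n) ok okn.
  have: 0<=s^S n by pos. split.
  - apply Rmult_le_pos; [nra|]. now apply Rlt_le, Rinv_0_lt_compat.
  - apply Rmult_le_reg_r with F; [lra|]. unfold Rdiv. rewrite Rmult_assoc, Rinv_l by lra. nra. }
 have Up: forall t, 0<t<=d' -> 0<=U t-t^S n*c t.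
 { apply (zero_start (fun t => U t-t^S n*c t) (fun s => U1 s-2*s^S n*(1-e s)*b s) d' (M+1)); [lra| | |].
  - intros s Hs. apply isd_minus; [apply DU; lra|apply Dg; lra].
  - intros s Hs. specialize (Hb s ok). specialize (He s ok).
   have: 0<s^S n by pos.
   have: 0<s^n/INR (fact n) by pos.
   unfold U1.
   replace (2*s^S n*(s^n/INR (fact n))-2*s^S n*(1-e s)*b s)
    with (2*s^S n*(s^n/INR (fact n)-b s+e s*b s)) by ring.
   apply Rmult_le_pos; nra.
  - intros s Hs. specialize (Hg s Hs). abs_in Hg. specialize (HU s Hs). lra. }
 have Lo: forall t, 0<t<=d' -> 0<=t^S n*c t-U t*(1-(K+4)*t).
 { apply (zero_start (fun t => t^S n*c t-U t*(1-(K+4)*t))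
   (fun s => 2*s^S n*(1-e s)*b s-(U1 s*(1-(K+4)*s)-U s*(K+4))) d' (M+1)); [lra| | |].
  - intros s Hs. eapply isd_eq; [apply isd_minus; [apply Dg; lra|]|].
   + apply isd_mult; [apply DU; lra|]. isd_.
   + cbv beta. ring.
  - intros s Hs. specialize (Hb s ok). specialize (He s ok).
   have: 0<s^S n by pos.
   have Q: 0<s^n/INR (fact n) by pos.
   have: 0<=1-K*s by nra. unfold U1. specialize (HU s Hs).
   set (q := s^n/INR (fact n)) in *. set (p := s^S n) in *.
   have: q*(1-(K+4)*s)<=(1-e s)*b s.
   { have: 0<=q*(K*(s*s)) by pos.
    have: 0<=q*(1-K*s) by pos.
    have: 0<=(4*s-e s)*(q*(1-K*s)) by pos.
    have: 0<=(1-e s)*(b s-q*(1-K*s)) by pos. lra. }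
   have: 0<=U s*(K+4) by nra.
   have: 0<=p*((1-e s)*b s-q*(1-(K+4)*s)) by pos. lra.
  - intros s Hs. specialize (Hg s Hs). abs_in Hg. specialize (HU s Hs).
   have: 0<=(K+4)*s by nra. have: U s*(1-(K+4)*s)<=U s by nra. lra. }
 exists d'. split; [lra|split; [exact HKd'|]]. intros t Ht.
 specialize (Up t Ht). specialize (Lo t Ht). have P: 0<t^S n by pos.
 have EU: U t=t^S n*(t^S n/F) by (unfold U; field; lra). rewrite EU in *. fold F.
 split; nra.
Qed.

Lemma dp2_starts (n : nat) : starts_like n (4*INR n) (dp2 n).
Proof.
 induction n.
 - exists (1/4). split; [lra|split; [simpl; lra|]]. intros t Ht. rewrite dp2_0. simpl. lra.
 - rewrite S_INR. replace (4*(INR n+1)) with (4*INR n+4) by ring.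
  apply (starts_like_step n (4*INR n) 1 (dp2 n) (dp2 (S n)) (fun t => dp2 (S n) t^2)); auto.
  + have := pos_INR n; lra.
  + intros; now apply dp2_derive.
  + intros t Ht. have := dp2_range n t ok. have := dp2_le_lin n t Ht. nra.
  + intros t Ht. have := dp2_range n t ok. apply Rabs_le; lra.
Qed.

Lemma bes_derive_down (n : nat) t : 0 < t ->
 is_derive (bes (INR (S n))) t (2*bes (INR n) t-INR (S n)/t*bes (INR (S n)) t).
Proof.
 intros Ht. eapply isd_eq; [apply bes_derive|].
 have E := bes_rec (INR (S n)) t (sin_INR_PI _).
 replace (INR (S n)-1) with (INR n) in * by (rewrite S_INR; ring).
 apply Rmult_eq_reg_l with t; [|lra]. unfold Rdiv. 
 replace (t*(2*bes (INR n) t-INR (S n) * / t*bes (INR (S n)) t))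
  with (2*t*bes (INR n) t-INR (S n)*bes (INR (S n)) t) by fld. rewrite E. ring.
Qed.

Lemma bes_derive_up (n : nat) t : 0 < t ->
 is_derive (bes (INR n)) t (INR n/t*bes (INR n) t-2*bes (INR (S n)) t).
Proof.
 intros Ht. eapply isd_eq; [apply bes_derive|].
 have E := bes_rec (INR n) t (sin_INR_PI _).
 replace (INR n+1) with (INR (S n)) in * by (rewrite S_INR; ring).
 apply Rmult_eq_reg_l with t; [|lra].
 replace (t*(INR n/t*bes (INR n) t-2*bes (INR (S n)) t))
  with (INR n*bes (INR n) t-2*t*bes (INR (S n)) t) by fld. rewrite E. ring.
Qed.

Lemma bes_starts (n : nat) : starts_like n (4*INR n+2) (bes (INR n)).
Proof.
 induction n.
 - exists (1/4). split; [lra|split; [simpl; lra|]]. intros t Ht.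
  have := bes0_near t ok. simpl INR. lra.
 - rewrite S_INR at 1. replace (4*(INR n+1)+2) with ((4*INR n+2)+4) by ring.
  apply (starts_like_step n (4*INR n+2) 1 (bes (INR n)) (bes (INR (S n))) (fun t => 0)); auto.
  + have := pos_INR n; lra.
  + intros. eapply isd_eq; [now apply bes_derive_down|]. ring.
  + intros t Ht; lra.
  + intros t Ht. apply bes_bound.
Qed.

(** Both functions start like t^n/n!. This matches the nonlinear solution with the linear one as x
    -> +oo at fixed n. *)
Lemma dp2_bes_ratio (n : nat) (eps : R) : 0 < eps ->
 exists d, 0 < d /\ forall t, 0 < t <= d -> 0 < bes (INR n) t /\ Rabs (dp2 n t/bes (INR n) t-1) <= eps.
Proof.
 intros He. destruct (dp2_starts n) as [d1 [Hd1 [HK1 H1]]]. destruct (bes_starts n) as [d2 [Hd2 [HK2 H2]]].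
 set (K := 4*INR n+2). have HK: 2<=K by (unfold K; have := pos_INR n; lra).
 set (d := Rmin (Rmin d1 d2) (Rmin (/ (2*K)) (eps/(4*K)))).
 have: 0 < / (2*K) by pos.
 have: 0<eps/(4*K) by pos.
 assert (d<=d1 /\ d<=d2 /\ d <= / (2*K) /\ d<=eps/(4*K)) as [A1 [A2 [A3 A4]]].
 { unfold d. repeat split.
  - eapply Rle_trans; [apply Rmin_l|apply Rmin_l]. - eapply Rle_trans; [apply Rmin_l|apply Rmin_r].
  - eapply Rle_trans; [apply Rmin_r|apply Rmin_l]. - eapply Rle_trans; [apply Rmin_r|apply Rmin_r]. }
 have: 0<d by (repeat apply Rmin_glb_lt; lra).
 exists d; split; [assumption|]. intros t Ht. specialize (H1 t ok). specialize (H2 t ok).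
 have: 0<t^n/INR (fact n) by (apply Rdiv_lt_0_compat; [pos|apply INR_fact_lt_0]).
 set (q := t^n/INR (fact n)) in *.
 have Kt: K*t<=1/2.
 { trans (K * / (2*K)); [mono|]. right; field; lra. }
 have Kt2: K*t<=eps/4.
 { trans (K*(eps/(4*K))); [mono|]. right; field; lra. }
 fold K in H2. have Hb: q/2<=bes (INR n) t by nra. split; [lra|].
 have: q*(1-K*t)<=dp2 n t by (unfold K; nra).
 have E: dp2 n t=dp2 n t/bes (INR n) t*bes (INR n) t by fld.
 apply Rabs_le; split; nra.
Qed.

Lemma is_lim_inf_eps (f : R -> R) (l : R) :
 is_lim f p_infty l <-> forall eps, 0 < eps -> exists T, forall t, T < t -> Rabs (f t-l) < eps.
Proof.
 split.
 - intros H eps He. apply is_lim_spec in H. exact (H (mkposreal eps He)).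
 - intros H. apply is_lim_spec. intros [eps He]. exact (H eps He).
Qed.

Lemma is_lim_multR (f g : R -> R) (x : Rbar) (a b : R) :
 is_lim f x a -> is_lim g x b -> is_lim (fun t => f t*g t) x (a*b).
Proof. intros Hf Hg. exact (is_lim_mult f g x a b Hf Hg I). Qed.

(** Once R_n > 1/2 and (n+1)/t is small, R_(n+1) grows at rate at least eps/2 while it is at most 1
    - eps. So it exceeds 1 - eps at some time and cannot come back through that level. *)
Lemma dp2_lim (n : nat) : is_lim (dp2 n) p_infty 1.
Proof.
 induction n as [|n IH]; [apply (is_lim_ext (fun _ => 1)); [reflexivity|apply is_lim_const]|].
 apply is_lim_inf_eps. intros eps0 He0. set (eps := Rmin eps0 (1/2)).
 have: eps<=eps0 by apply Rmin_l. have: eps<=1/2 by apply Rmin_r.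
 have He: 0<eps by (apply Rmin_glb_lt; lra). 
 rewrite is_lim_inf_eps in IH. destruct (IH (1/2) ok) as [T0 HT0].
 have IN: 1<=INR (S n) by (apply (le_INR 1); lia).
 set (T := Rmax (T0+1) (2*INR (S n)/eps)).
 have A1: T0+1<=T by apply Rmax_l. have A2: 2*INR (S n)/eps<=T by apply Rmax_r.
 have: 0<2*INR (S n)/eps by pos.
 have Hm: forall t, T<=t -> INR (S n)/t<=eps/2.
 { intros t Ht. apply Rmult_le_reg_r with t; [lra|]. unfold Rdiv at 1. rewrite Rmult_assoc, Rinv_l, Rmult_1_r by lra.
  apply Rmult_le_compat_l with (r := eps/2) in A2; [|lra].
  replace (eps/2*(2*INR (S n)/eps)) with (INR (S n)) in A2 by fld. nra. }
 set (c := dp2 (S n)). set (c' := fun t => 2*(1-c t^2)*dp2 n t-INR (S n)/t*c t).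
 have Dc: forall t, T<=t -> is_derive c t (c' t) by (intros; apply dp2_derive; lra).
 have Rc: forall t, T<=t -> 0<c t<1 by (intros; apply dp2_range; lra).
 have Pc: forall t, T<=t -> c t<=1-eps -> eps/2<=c' t.
 { intros t Ht Hc. unfold c'. specialize (Hm t Ht). specialize (Rc t Ht).
  have Ha: 1/2<dp2 n t.
  { specialize (HT0 t ok). alra. }
  have: eps<=1-c t^2 by nra. nra. }
 have HL: exists t1, T<=t1 /\ 1-eps<c t1.
 { destruct (Rlt_le_dec (1-eps) (c T)) as [|]; [exists T; lra|].
  destruct (classic (exists t1, T<=t1 /\ 1-eps<c t1)) as [|HN]; [assumption|exfalso].
  have HN': forall t, T<=t -> c t<=1-eps.
  { intros t Ht. destruct (Rle_lt_dec (c t) (1-eps)); [assumption|]. exfalso; apply HN; now exists t. }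
  have: 0<4/eps by pos.
  have: c T-eps/2*T<=c (T+4/eps)-eps/2*(T+4/eps).
  { apply (derive_nonneg_le (fun t => c t-eps/2*t) (fun t => c' t-eps/2)); [lra| |].
   - intros x Hx. eapply isd_eq; [apply isd_minus; [apply Dc; lra|]|].
    + isd_. + cbv beta; ring.
   - intros x Hx. specialize (Pc x ok (HN' x ok)). lra. }
  replace (eps/2*(T+4/eps)) with (eps/2*T+2) in H3 by fld.
  have := Rc T ok. have := Rc (T+4/eps) ok. lra. }
 destruct HL as [t1 [Ht1 Hc1]]. exists t1. intros t Ht.
 have: (1-eps)-c t<0.
 { apply (no_crossing (fun t => (1-eps)-c t) (fun t => 0-c' t) t1 t); [| |  |lra].
  - intros x Hx. apply isd_minus; [isd_|apply Dc; lra].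
  - lra.
  - intros x Hx Hz. specialize (Pc x ok ok). lra. }
 specialize (Rc t ok). fold (c t). apply Rabs_lt_between. lra.
Qed.

Lemma is_lim_ext_pos (f g : R -> R) (l : R) :
 (forall t, 0 < t -> f t = g t) -> is_lim f p_infty l -> is_lim g p_infty l.
Proof. intros H. apply is_lim_ext_loc. exists 0. exact H. Qed.

Lemma is_lim_cont (f g : R -> R) (l : R) : is_lim f p_infty l -> continuous g l -> is_lim (fun t => g (f t)) p_infty (g l).
Proof.
 intros Hf Hg. apply (filterlim_comp _ _ _ f g _ (locally l)); [exact Hf|exact Hg].
Qed.

(** The recursion gives 2t(1 - R_(n+1)^2) = 2(n+1) R_(n+1)/(R_(n+2) + R_n), and all three R tend to
    1. *)
Lemma dp2_lim_compl (n : nat) : is_lim (fun t => 2*t*(1-dp2 (S n) t^2)) p_infty (INR (S n)).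
Proof.
 apply (is_lim_ext_pos (fun t => (2*INR (S n)*dp2 (S n) t) * / (dp2 (S (S n)) t+dp2 n t))).
 { intros t Ht. have := dp2_range n t Ht. 
  have IN: 1<=INR (S n) by (apply (le_INR 1); lia).
  rewrite dp2_SS in *. field. repeat split; try nra. }
 replace (Finite (INR (S n))) with (Finite ((2*INR (S n)*1) * / (1+1))) by (f_equal; field).
 apply is_lim_multR.
 - apply is_lim_multR; [apply is_lim_const|apply dp2_lim].
 - apply (is_lim_cont (fun t => dp2 (S (S n)) t+dp2 n t) Rinv).
  + apply is_lim_plus'; apply dp2_lim.
  + eapply isd_continuous. apply (isd_inv (fun x => x)); [isd_|lra].
Qed.

Lemma lim_of_derive_bound (h h' : R -> R) (T K : R) :
 0 < T -> (forall t, T <= t -> is_derive h t (h' t)) -> (forall t, T <= t -> Rabs (h' t) <= K/t^2) ->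
 exists l : R, is_lim h p_infty l.
Proof.
 intros HT Dh Bh.
 have HK: 0<=K.
 { specialize (Bh T ok). have := Rabs_pos (h' T). 
  have E: K=K/T^2*T^2 by fld. nra. }
 have B: forall s t, T<=s<=t -> Rabs (h t-h s)<=K/s.
 { intros s t Hst. trans (K/s-K/t).
  2:{ have: 0<=K/t by pos. lra. }
  apply Rabs_le; split.
  - assert (h s-K/s<=h t-K/t); [|lra].
   apply (derive_nonneg_le (fun t => h t-K/t) (fun t => h' t+K/t^2)); [lra| |].
   + intros x Hx. eapply isd_eq; [apply isd_minus; [apply Dh; lra|apply isd_div; [isd_|isd_|lra]]|].
    cbv beta. field. lra.
   + intros x Hx. specialize (Bh x ok). abs_in Bh. lra.
  - assert (- K/s-h s <= - K/t-h t); [|unfold Rdiv in *; lra].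
   apply (derive_nonneg_le (fun t => - K/t-h t) (fun t => K/t^2-h' t)); [lra| |].
   + intros x Hx. eapply isd_eq; [apply isd_minus; [apply isd_div; [isd_|isd_|lra]|apply Dh; lra]|].
    cbv beta. field. lra.
   + intros x Hx. specialize (Bh x ok). alra. }
 destruct (proj1 (filterlim_locally_cauchy (F := Rbar_locally p_infty) (U := R_CompleteSpace) h)) as [l Hl].
 - intros eps. exists (fun t => Rmax T (2*K/eps+1)<t). split; [now exists (Rmax T (2*K/eps+1))|].
  have P: forall s t, Rmax T (2*K/eps+1)<s -> s<=t -> Rabs (h t-h s)<eps.
  { intros s t Hs Hst. minmax. eapply Rle_lt_trans; [apply B; lra|]. have := cond_pos eps.
   apply Rmult_lt_reg_r with s; [lra|]. unfold Rdiv. rewrite Rmult_assoc, Rinv_l, Rmult_1_r by lra.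
   apply Rle_lt_trans with (eps*(K/eps)); [right; field; lra|]. apply Rmult_lt_compat_l; [lra|].
   have: 0<=K/eps by pos. unfold Rdiv in *. lra. }
  intros u v Hu Hv. destruct (Rle_dec u v) as [Huv|Huv].
  + apply (P u v Hu Huv).
  + apply ball_sym, (P v u Hv). lra.
 - now exists l.
Qed.

(* The constant is (2 pi)^(-1/2), but its value will drop out. *)
Lemma mbes0_asymptotic : exists k : R, is_lim (fun t => ln (mbes0 t)-2*t+1/2*ln (2*t)) p_infty k.
Proof.
 (* These are the first two terms of I_1/I_0 at 2t. With them the logarithmic derivative of I_0(2t)
    is 2 - 1/(2t) up to an integrable O(t^(-2)). *)
 set (b0 := fun t => 1 - / (4*t)).
 have Db: forall t, 0<t -> is_derive b0 t (/ (4*t^2)).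
 { intros t Ht. unfold b0. isd; [lra|]. field. lra. }
 set (e := fun t => dp2 1 t-b0 t).
 set (e' := fun t => - (2*(b0 t+dp2 1 t) + / t)*e t - / (8*t^2)).
 have De: forall t, 0<t -> is_derive e t (e' t).
 { intros t Ht. unfold e, e'. eapply isd_eq; [apply isd_minus; [now apply dp2_derive|now apply Db]|].
  rewrite dp2_0. unfold e, b0. simpl. field. lra. }
 have Cf: forall t, 2<=t -> 3/2<=2*(b0 t+dp2 1 t) + / t.
 { intros t Ht. have := dp2_range 0 t ok. unfold b0.
  have: / (4*t) <= / (4*2) by mono.
  have: 0 < / t by pos. lra. }
 have P3: forall t, 2<=t -> 2*8/t^3<=8/t^2.
 { intros t Ht. apply Rmult_le_reg_r with (t^3); [pos|].
  replace (2*8/t^3*t^3) with 16 by fld. replace (8/t^2*t^3) with (8*t) by fld. lra. }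
 have e2: -1<e 2<1.
 { have := dp2_range 0 2 ok. unfold e, b0. lra. }
 have DK: forall t, 2<=t -> is_derive (fun t => 8/t^2) t (- (2*8/t^3)).
 { intros t Ht. isd; [apply pow_nonzero; lra|]. simpl. field. lra. }
 have Be: forall t, 2<=t -> Rabs (e t)<=8/t^2.
 { intros t Ht. apply Rabs_le; split.
  - assert (- e t-8/t^2<0); [|lra].
   apply (no_crossing (fun t => - e t-8/t^2) (fun t => - e' t - - (2*8/t^3)) 2 t); [| | |lra].
   + intros x Hx. apply isd_minus; [apply isd_opp, De; lra|apply DK; lra].
   + lra.
   + intros x Hx Hz. specialize (Cf x ok). specialize (P3 x ok).
    have: 0 < / x^2 by pos.
    have E1: e x = - (8/x^2) by lra. unfold e'. rewrite E1.
    replace (/ (8*x^2)) with (/ x^2/8) by fld.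
    set (A := 2*(b0 x+dp2 1 x) + / x) in *. set (z := / x^2) in *.
    have: 3/2*z<=A*z by mono.
    unfold Rdiv in *. fold z in P3. fold z. lra.
  - assert (e t-8/t^2<0); [|lra].
   apply (no_crossing (fun t => e t-8/t^2) (fun t => e' t - - (2*8/t^3)) 2 t); [| | |lra].
   + intros x Hx. apply isd_minus; [apply De; lra|apply DK; lra].
   + lra.
   + intros x Hx Hz. specialize (Cf x ok). specialize (P3 x ok).
    have: 0 < / x^2 by pos.
    have E1: e x=8/x^2 by lra. unfold e'. rewrite E1.
    replace (/ (8*x^2)) with (/ x^2/8) by fld.
    set (A := 2*(b0 x+dp2 1 x) + / x) in *. set (z := / x^2) in *.
    have: 3/2*z<=A*z by mono.
    unfold Rdiv in *. fold z in P3. fold z. lra. }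
 destruct (lim_of_derive_bound (fun t => ln (mbes0 t)-2*t+1/2*ln (2*t)) (fun t => 2*e t) 2 16) as [k Hk].
 - lra.
 - intros t Ht. clear-Ht. have := mbes0_pos t. have := mbes0_derive t.
  isd; [assumption|lra|]. unfold e, b0. rewrite dp2_1. field. lra.
 - intros t Ht. specialize (Be t Ht). rewrite Rabs_mult, (Rabs_right 2) by lra. unfold Rdiv in *. lra.
 - now exists k.
Qed.

(* [ldet n t] is log D_n(t), D_n the Toeplitz determinant of exp (2 t cos th). *)
Fixpoint ldet_pair (n : nat) (t : R) : R*R :=
 match n with
 | O => (0, ln (mbes0 t))
 | S m => let p := ldet_pair m t in
      (snd p, 2*snd p-fst p+ln (1-dp2 (S m) t^2))
 end.
Definition ldet (n : nat) (t : R) : R := fst (ldet_pair n t).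

Lemma ldet_0 t : ldet 0 t = 0. Proof. reflexivity. Qed.
Lemma ldet_1 t : ldet 1 t = ln (mbes0 t). Proof. reflexivity. Qed.
Lemma ldet_SS n t : ldet (S (S n)) t = 2*ldet (S n) t-ldet n t+ln (1-dp2 (S n) t^2).
Proof. reflexivity. Qed.

(** * Determinants and the companion sum: derivatives and limits in t *)

Definition ldet' (n : nat) (t : R) : R :=
 2*t*(1-dp2 n t^2)*(1-dp2 (S n) t^2)+2*INR (S n)*(dp2 n t*dp2 (S n) t).

(** Two neighbouring indices are treated together because the recursion for log D is a second
    difference. That the two formulas agree at the shared index is an identity of the discrete
    Painleve equation (assertion [E]). *)
Lemma ldet_derive_both (n : nat) t : 0 < t ->
 is_derive (ldet (S n)) t (ldet' n t) /\ is_derive (ldet n) t (ldet' n t-2*dp2 n t*dp2 (S n) t).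
Proof.
 intros Ht. induction n as [|n [IH1 IH2]].
 - unfold ldet'. rewrite dp2_0. split.
  + eapply isd_eq; [apply (isd_ln mbes0); [apply mbes0_derive|apply mbes0_pos]|].
   rewrite dp2_1. have := mbes0_pos t. simpl. field; lra.
  + eapply isd_eq; [apply (isd_const 0 t)|]. simpl. ring.
 - have := dp2_range n t Ht.
  have E: ldet' (S n) t-2*dp2 (S n) t*dp2 (S (S n)) t=ldet' n t.
  { unfold ldet'. rewrite dp2_SS, !S_INR. field. split; [nra|lra]. }
  split; [|now rewrite E].
  eapply isd_eq.
  + apply (is_derive_ext (fun t => 2*ldet (S n) t-ldet n t+ln (1-dp2 (S n) t^2))); [reflexivity|].
   apply isd_plus; [apply isd_minus; [apply isd_mult; [isd_|exact IH1]|exact IH2]|].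
   apply isd_ln; [|nra]. apply isd_minus; [isd_|apply isd_pow, dp2_derive, Ht].
  + replace (ldet' (S n) t) with (ldet' n t+2*dp2 (S n) t*dp2 (S (S n)) t) by lra.
   rewrite dp2_SS. simpl pred. rewrite !S_INR. simpl INR. field. split; [nra|lra].
Qed.

Lemma ldet_derive (n : nat) t : 0 < t -> is_derive (ldet (S n)) t (ldet' n t).
Proof. apply ldet_derive_both. Qed.

(** A second derivative in log t eliminates the neighbours of R_(n+1): this is the radial Toda
    equation, and the source of V'' = q^2 after scaling. *)
Lemma t_ldet'_derive (n : nat) t : 0 < t ->
 is_derive (fun t => t*ldet' n t) t (4*t*(1-dp2 (S n) t^2)).
Proof.
 intros Ht. unfold ldet'.
 have D1 := dp2_derive n t Ht. have D0 := dp2_derive' n t Ht.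
 isd. rewrite !S_INR. simpl pred. simpl (INR 0). field. lra.
Qed.

Lemma ln_le_sub1 (x : R) : 0 < x -> ln x <= x-1.
Proof. intros H. have := exp_ineq1_le (ln x). rewrite exp_ln in H0 by lra. lra. Qed.

Lemma ln_ge_inv (x : R) : 0 < x -> 1 - / x <= ln x.
Proof.
 intros H. have := ln_le_sub1 (/ x) (Rinv_0_lt_compat _ H). rewrite ln_Rinv in H0 by lra. lra.
Qed.

Lemma ln_1m_bound (y : R) : 0 <= y <= 1/2 -> Rabs (ln (1-y)) <= 2*y.
Proof.
 intros Hy. have := ln_le_sub1 (1-y) ok. have := ln_ge_inv (1-y) ok.
 have: 1 - / (1-y) = - y/(1-y) by fld.
 have: - (2*y) <= - y/(1-y).
 { apply Rmult_le_reg_r with (1-y); [lra|]. unfold Rdiv. rewrite Rmult_assoc, Rinv_l by lra. nra. }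
 alra. Qed.

Lemma ldet_at_0 (n : nat) : exists K, forall t, 0 < t <= 1/4 -> Rabs (ldet n t) <= K*t /\ Rabs (ldet (S n) t) <= K*t.
Proof.
 induction n as [|n [K IH]].
 - exists 2. intros t Ht. rewrite ldet_0, Rabs_R0. split; [lra|]. rewrite ldet_1.
  have D: forall s, 0<=s<=t -> is_derive (fun s => ln (mbes0 s)) s (2*mbes1 s/mbes0 s).
  { intros s Hs. apply isd_ln; [apply mbes0_derive|apply mbes0_pos]. }
  have B := derive_bound (fun s => ln (mbes0 s)) (fun s => 2*mbes1 s/mbes0 s) 0 t 2 ok D.
  cbv beta in B. rewrite mbes0_0, ln_1, !Rminus_0_r in B. apply B.
  intros s Hs. destruct (Req_dec s 0) as [->|Hn].
  + rewrite mbes1_0, mbes0_0. replace (2*0/1) with 0 by field. rewrite Rabs_R0; lra.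
  + have R1 := dp2_range 0 s ok. rewrite dp2_1 in R1.
   apply Rabs_le. unfold Rdiv in *. lra.
 - exists (3*Rabs K+8). intros t Ht. destruct (IH t Ht) as [H1 H2]. have := Rle_abs K. have := Rabs_pos K.
  split; [nra|]. rewrite ldet_SS.
  have := dp2_range n t ok. have := dp2_le_lin n t Ht.
  have H5 := ln_1m_bound (dp2 (S n) t^2) ltac:(nra).
  abs_in H1. abs_in H2. abs_in H5.
  apply Rabs_le. nra.
Qed.

Fixpoint lbarnes_pair (k : R) (n : nat) : R*R :=
 match n with
 | O => (0, k)
 | S m => let p := lbarnes_pair k m in (snd p, 2*snd p-fst p+ln (INR (S m)))
 end.
(* [lbarnes k n] is n k + log G(n+1), G the Barnes function. *)
Definition lbarnes (k : R) (n : nat) : R := fst (lbarnes_pair k n).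

Lemma ln_compl_lim (n : nat) : is_lim (fun t => ln (1-dp2 (S n) t^2)+ln (2*t)) p_infty (ln (INR (S n))).
Proof.
 apply (is_lim_ext_pos (fun t => ln (2*t*(1-dp2 (S n) t^2)))).
 { intros t Ht. have := dp2_range n t Ht. rewrite ln_mult; [ring|lra|nra]. }
 apply (is_lim_cont (fun t => 2*t*(1-dp2 (S n) t^2)) ln); [apply dp2_lim_compl|].
 eapply isd_continuous, is_derive_ln, lt_0_INR. lia.
Qed.

(** The second differences in n of 2nt and of (n^2/2) log(2t) are 0 and log(2t), exactly what
    [ln_compl_lim] requires. The constants therefore obey the recursion of log G, started from 0 and
    k. *)
Lemma ldet_lim (k : R) (n : nat) :
 is_lim (fun t => ln (mbes0 t)-2*t+1/2*ln (2*t)) p_infty k ->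
 is_lim (fun t => ldet n t-2*INR n*t+INR n^2/2*ln (2*t)) p_infty (lbarnes k n) /\
 is_lim (fun t => ldet (S n) t-2*INR (S n)*t+INR (S n)^2/2*ln (2*t)) p_infty (lbarnes k (S n)).
Proof.
 intros Hk. induction n as [|n [IH1 IH2]].
 - split.
  + apply (is_lim_ext (fun _ => 0)); [intros; rewrite ldet_0; simpl; field|apply is_lim_const].
  + eapply is_lim_ext; [|exact Hk]. intros; rewrite ldet_1. simpl. field.
 - split; [exact IH2|].
  change (lbarnes k (S (S n))) with (2*lbarnes k (S n)-lbarnes k n+ln (INR (S n))).
  apply (is_lim_ext (fun t => 2*(ldet (S n) t-2*INR (S n)*t+INR (S n)^2/2*ln (2*t))
   - (ldet n t-2*INR n*t+INR n^2/2*ln (2*t))+(ln (1-dp2 (S n) t^2)+ln (2*t)))).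
  { intros t. rewrite ldet_SS, !S_INR. field. }
  apply is_lim_plus'; [apply is_lim_minus'; [|exact IH1]|apply ln_compl_lim].
  apply is_lim_multR; [apply is_lim_const|exact IH2].
Qed.

(* [psum n] is the sum of log((1+R_j)/(1-R_j)) over j > n. *)
Fixpoint psum (n : nat) (t : R) : R :=
 match n with
 | O => 2*t+ln (mbes0 t)
 | S m => psum m t-ln ((1+dp2 n t)/(1-dp2 n t))
 end.
(** Half of the term j = n+1 is dropped, as in a trapezoidal sum. The neighbours then enter the
    derivative only through R_n + R_(n+2), which the recursion expresses by R_(n+1) alone. *)
Definition hsum (n : nat) (t : R) : R := psum n t-1/2*ln ((1+dp2 (S n) t)/(1-dp2 (S n) t)).

(** This is the Schur flow for the Verblunsky coefficients. Its right-hand side telescopes in n, so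
    [psum] has a closed derivative. *)
Lemma atanh_derive (n : nat) t : 0 < t ->
 is_derive (fun t => ln ((1+dp2 (S n) t)/(1-dp2 (S n) t))) t (2*(dp2 n t-dp2 (S (S n)) t)).
Proof.
 intros Ht. have := dp2_range n t Ht. have D := dp2_derive n t Ht.
 eapply isd_eq.
 - apply isd_ln; [|pos]. apply isd_div; [|  |lra].
  + apply isd_plus; [isd_|exact D].
  + apply isd_minus; [isd_|exact D].
 - rewrite dp2_SS. field. repeat split; try lra; nra.
Qed.

Lemma psum_derive (n : nat) t : 0 < t -> is_derive (psum n) t (2*(dp2 n t+dp2 (S n) t)).
Proof.
 intros Ht. induction n.
 - eapply isd_eq.
  + apply (isd_plus (fun t => 2*t) (fun t => ln (mbes0 t))); [isd_|apply isd_ln; [apply mbes0_derive|apply mbes0_pos]].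
  + rewrite dp2_0, dp2_1. field. apply Rgt_not_eq, mbes0_pos.
 - eapply isd_eq.
  + apply (isd_minus (psum n)); [exact IHn|]. apply (atanh_derive n t Ht).
  + ring.
Qed.

Lemma hsum_derive (n : nat) t : 0 < t ->
 is_derive (hsum n) t (2*dp2 (S n) t+INR (S n)/t*(dp2 (S n) t/(1-dp2 (S n) t^2))).
Proof.
 intros Ht. have := dp2_range n t Ht. eapply isd_eq.
 - apply isd_minus; [now apply psum_derive|]. apply isd_mult; [isd_|now apply atanh_derive].
 - rewrite dp2_SS. field. split; [nra|lra].
Qed.

Lemma atanh_at_0 (n : nat) t : 0 < t <= 1/4 -> Rabs (ln ((1+dp2 (S n) t)/(1-dp2 (S n) t))) <= 6*t.
Proof.
 intros Ht. have := dp2_range n t ok. have := dp2_le_lin n t Ht.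
 rewrite ln_div by lra. have B := ln_1m_bound (dp2 (S n) t) ok. abs_in B.
 have := ln_le_sub1 (1+dp2 (S n) t) ok.
 have: 0<=ln (1+dp2 (S n) t) by (rewrite <- ln_1; apply ln_le; lra).
 alra. Qed.

Lemma hsum_at_0 (n : nat) : exists K, forall t, 0 < t <= 1/4 -> Rabs (hsum n t) <= K*t.
Proof.
 have P: exists K, forall t, 0<t<=1/4 -> Rabs (psum n t)<=K*t.
 { induction n as [|n [K IH]].
  - destruct (ldet_at_0 0) as [K HK]. exists (K+2). intros t Ht. destruct (HK t Ht) as [_ H]. rewrite ldet_1 in H.
   abs_in H. simpl. apply Rabs_le; lra.
  - exists (K+6). intros t Ht. specialize (IH t Ht). have A := atanh_at_0 n t Ht.
   simpl psum. abs_in A. abs_in IH. apply Rabs_le; lra. }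
 destruct P as [K HK]. exists (K+3). intros t Ht. specialize (HK t Ht). have A := atanh_at_0 n t Ht.
 unfold hsum. abs_in A. abs_in HK. apply Rabs_le; lra.
Qed.

Lemma atanh_lim (n : nat) :
 is_lim (fun t => ln ((1+dp2 (S n) t)/(1-dp2 (S n) t))-ln (8*t)) p_infty (- ln (INR (S n))).
Proof.
 apply (is_lim_ext_pos (fun t => (2*ln (1+dp2 (S n) t)-2*ln 2)-(ln (1-dp2 (S n) t^2)+ln (2*t)))).
 { intros t Ht. have := dp2_range n t Ht.
  replace (1-dp2 (S n) t^2) with ((1+dp2 (S n) t)*(1-dp2 (S n) t)) by ring.
  rewrite ln_div, ln_mult by lra. replace (8*t) with (2*2*(2*t)) by ring. rewrite !(ln_mult (2*2)), (ln_mult 2 2) by lra. ring. }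
 replace (Finite (- ln (INR (S n)))) with (Finite ((2*ln (1+1)-2*ln 2)-ln (INR (S n)))) by (f_equal; replace (1+1) with 2 by ring; ring).
 apply is_lim_minus'; [|apply ln_compl_lim]. apply is_lim_minus'; [|apply is_lim_const].
 apply is_lim_multR; [apply is_lim_const|]. apply (is_lim_cont (fun t => 1+dp2 (S n) t) ln).
 - apply is_lim_plus'; [apply is_lim_const|apply dp2_lim].
 - eapply isd_continuous, is_derive_ln. lra.
Qed.

(** Each removed term contributes a log(8t) and a constant -log j; the latter accumulate to log n!,
    and the half term adds (1/2) log(n+1). *)
Lemma hsum_lim (k : R) (n : nat) :
 is_lim (fun t => ln (mbes0 t)-2*t+1/2*ln (2*t)) p_infty k ->
 is_lim (fun t => hsum n t-4*t+1/2*ln (2*t)+(INR n+1/2)*ln (8*t)) p_infty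
  (k+ln (INR (fact n))+1/2*ln (INR (S n))).
Proof.
 intros Hk.
 have P: is_lim (fun t => psum n t-4*t+1/2*ln (2*t)+INR n*ln (8*t)) p_infty (k+ln (INR (fact n))).
 { induction n.
  - simpl (fact 0). simpl (INR 1). rewrite ln_1. replace (k+0) with k by ring.
   eapply is_lim_ext; [|exact Hk]. intros; simpl; ring.
  - replace (Finite (k+ln (INR (fact (S n))))) with (Finite ((k+ln (INR (fact n))) - - ln (INR (S n)))).
   2:{ f_equal. change (fact (S n)) with (S n*fact n)%nat. rewrite mult_INR, ln_mult; [ring|apply lt_0_INR; lia|apply INR_fact_lt_0]. }
   eapply is_lim_ext; [|apply is_lim_minus'; [exact IHn|exact (atanh_lim n)]].
   intros t. simpl psum. rewrite S_INR. ring. }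
 replace (Finite (k+ln (INR (fact n))+1/2*ln (INR (S n))))
  with (Finite (k+ln (INR (fact n))-1/2 * - ln (INR (S n)))) by (f_equal; ring).
 eapply is_lim_ext; [|apply is_lim_minus'; [exact P|apply (is_lim_multR (fun _ => 1/2)); [apply is_lim_const|exact (atanh_lim n)]]].
 intros t. unfold hsum. simpl. field.
Qed.

(** * The edge scaling and the scaled equations *)

(** The index n stands for N = n+1. In the edge window the Verblunsky coefficient has size gam =
    (2/N)^(1/3), and bet = gam^2/2 is the scale of log t. The relations N gam^3 = 2, N bet gam = 1
    and N^2 bet^3 = 1/2 are the ones used below. *)
Definition gam (n : nat) : R := Rpower (2/INR (S n)) (1/3).
Definition bet (n : nat) : R := gam n^2/2.
Definition tim (n : nat) (x : R) : R := INR (S n)/2*exp (- bet n*x).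

Lemma INR_S_pos n : 0 < INR (S n). Proof. apply lt_0_INR; lia. Qed.

Lemma gam_pos n : 0 < gam n. Proof. apply exp_pos. Qed.

Lemma gam_cube n : INR (S n)*gam n^3 = 2.
Proof.
 have := INR_S_pos n. unfold gam. rewrite <- Rpower_pow by apply exp_pos. rewrite Rpower_mult.
 replace (1/3*INR 3) with 1 by (simpl; field). rewrite Rpower_1; [field; lra|pos].
Qed.

Lemma bet_pos n : 0 < bet n.
Proof. unfold bet. have := gam_pos n. nra. Qed.

Lemma gam_sq n : gam n^2 = 2*bet n. Proof. unfold bet; field. Qed.

Lemma N_bet_gam n : INR (S n)*bet n*gam n = 1.
Proof. have := gam_cube n. unfold bet. simpl in *. lra. Qed.

Lemma N2_bet3 n : INR (S n)^2*bet n^3 = 1/2.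
Proof.
 have H := gam_cube n. unfold bet.
 replace (INR (S n)^2*(gam n^2/2)^3) with ((INR (S n)*gam n^3)^2/8) by field. rewrite H; field.
Qed.

Lemma bet_small (eps : R) : 0 < eps -> exists n0, forall n, (n0 <= n)%nat -> bet n < eps.
Proof.
 intros He. have He3: 0<2*eps^3 by (have: 0<eps^3 by pos; lra).
 destruct (archimed_cor1 (2*eps^3) He3) as [N [HN1 HN2]].
 exists N. intros n Hn. destruct (Rlt_le_dec (bet n) eps) as [|H]; [assumption|exfalso].
 have := N2_bet3 n. have := bet_pos n.
 have: eps^3<=bet n^3 by mono.
 have IN: INR N<=INR (S n) by (apply le_INR; lia).
 have: 0<INR N by (apply lt_0_INR; lia). have: 1<=INR N by (apply (le_INR 1); lia).
 have: INR N * / INR N=1 by fld. have: 0<eps^3 by pos.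
 have: 1<INR N*(2*eps^3) by nra.
 have: INR N<=INR (S n)^2 by nra. nra.
Qed.

Lemma gam_small (eps : R) : 0 < eps -> exists n0, forall n, (n0 <= n)%nat -> gam n < eps.
Proof.
 intros He. destruct (bet_small (eps^2/2)) as [n0 H]; [have: 0<eps^2 by pos; lra|].
 exists n0. intros n Hn. specialize (H n Hn). have := gam_sq n. have := gam_pos n. nra.
Qed.

Lemma tim_pos n x : 0 < tim n x.
Proof. unfold tim. have := INR_S_pos n. apply Rmult_lt_0_compat; [lra|pos]. Qed.

Lemma tim_derive n x : is_derive (tim n) x (- bet n*tim n x).
Proof. unfold tim. isd. ring. Qed.

Lemma tim_sq n x : 4*bet n^2*tim n x^2 = exp (- (2*bet n*x))/(2*bet n).
Proof.
 unfold tim. have := N2_bet3 n. have := bet_pos n.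
 replace (- (2*bet n*x)) with (- bet n*x + - bet n*x) by ring. rewrite exp_plus.
 apply Rmult_eq_reg_l with (2*bet n); [|lra].
 replace (2*bet n*(4*bet n^2*(INR (S n)/2*exp (- bet n*x))^2))
  with (INR (S n)^2*bet n^3*2*(exp (- bet n*x)*exp (- bet n*x))) by field.
 rewrite H. field. lra.
Qed.

Lemma tim_large n T : exists x0, forall x, x <= x0 -> T < tim n x.
Proof.
 have := INR_S_pos n. have := bet_pos n. exists (- (2*(Rabs T+1)/INR (S n))/bet n).
 intros x Hx. unfold tim. have := Rabs_pos T. have := Rle_abs T.
 have: 2*(Rabs T+1)/INR (S n) <= - bet n*x.
 { apply Rmult_le_compat_l with (r := bet n) in Hx; [|lra].
  replace (bet n*(- (2*(Rabs T+1)/INR (S n))/bet n)) with (- (2*(Rabs T+1)/INR (S n))) in Hx by fld. lra. }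
 have := exp_ineq1_le (- bet n*x).
 apply Rlt_le_trans with (INR (S n)/2*(2*(Rabs T+1)/INR (S n))); [|mono].
 replace (INR (S n)/2*(2*(Rabs T+1)/INR (S n))) with (Rabs T+1) by fld. lra.
Qed.

Lemma tim_le_inv n x : 0 < x -> tim n x <= INR (S n)/2/(1+bet n*x).
Proof.
 intros Hx. have := INR_S_pos n. have := bet_pos n. unfold tim.
 replace (- bet n*x) with (- (bet n*x)) by ring. rewrite exp_Ropp. 
 have := exp_ineq1_le (bet n*x). have: 0<bet n*x by nra.
 unfold Rdiv at 2. apply Rmult_le_compat_l; [lra|]. apply Rinv_le_contravar; lra.
Qed.

Lemma tim_small n d : 0 < d -> exists x0, 0 < x0 /\ forall x, x0 <= x -> tim n x <= d.
Proof.
 intros Hd. have := INR_S_pos n. have := bet_pos n.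
 have Hx0: 0<INR (S n)/(2*d*bet n).
 { apply Rdiv_lt_0_compat; [lra|]. apply Rmult_lt_0_compat; lra. }
 exists (INR (S n)/(2*d*bet n)). split; [assumption|]. intros x Hx.
 eapply Rle_trans; [apply tim_le_inv; lra|].
 apply Rmult_le_reg_r with (1+bet n*x); [nra|]. unfold Rdiv at 1. rewrite Rmult_assoc, Rinv_l, Rmult_1_r by nra.
 apply Rmult_le_compat_l with (r := d*bet n) in Hx; [|nra].
 replace (d*bet n*(INR (S n)/(2*d*bet n))) with (INR (S n)/2) in Hx by fld. nra.
Qed.

(** The arcsine removes the term in R'^2/(1 - R^2) from the second-order equation, so phi'' depends
    on x and phi only. *)
Definition phi (n : nat) (x : R) : R := asin (dp2 (S n) (tim n x)).
Definition phi1 (n : nat) (x : R) : R :=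
 - bet n*(2*tim n x*dp2 n (tim n x)*cos (phi n x)-INR (S n)*(sin (phi n x)/cos (phi n x))).

(* right-hand side of the scaled Painleve III equation phi'' = Fx b x phi, which tends to Painleve II as b -> 0 *)
Definition Fx (b x p : R) : R :=
 (sin p/cos p^3-exp (- (2*b*x))*(sin p*cos p))/(2*b).

Lemma sin_phi n x : sin (phi n x) = dp2 (S n) (tim n x).
Proof. unfold phi. have := dp2_range n _ (tim_pos n x). apply sin_asin. lra. Qed.

Lemma phi_range n x : 0 < phi n x < PI/2.
Proof.
 have E := sin_phi n x. have := dp2_range n _ (tim_pos n x).
 have B := asin_bound_lt (dp2 (S n) (tim n x)) ok. fold (phi n x) in B. split; [|lra].
 destruct (Rlt_le_dec 0 (phi n x)) as [|Hn]; [assumption|exfalso].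
 have Q := sin_ge_0 (- phi n x) ok ltac:(pose proof PI_RGT_0; lra). rewrite sin_neg in Q. lra.
Qed.

Lemma cos_phi_pos n x : 0 < cos (phi n x).
Proof. have := phi_range n x. apply cos_gt_0; lra. Qed.

Lemma cos2_phi n x : cos (phi n x)^2 = 1-dp2 (S n) (tim n x)^2.
Proof. rewrite <- sin_phi. have := sin2_cos2 (phi n x). unfold Rsqr in *. nra. Qed.

Lemma phi_derive n x : is_derive (phi n) x (phi1 n x).
Proof.
 have Ht := tim_pos n x. have Hr := dp2_range n _ Ht. have Hc := cos_phi_pos n x.
 eapply isd_eq.
 - unfold phi. apply (isd_comp asin).
  + have R1: -1<dp2 (S n) (tim n x)<1 by lra.
   apply is_derive_Reals, (derive_pt_eq_1 _ _ _ _ (derive_pt_asin _ R1)).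
  + apply (isd_comp (dp2 (S n))); [now apply dp2_derive|apply tim_derive].
 - unfold phi1. have E: sqrt (1-(dp2 (S n) (tim n x))²)=cos (phi n x).
  { unfold phi. rewrite cos_asin by lra. reflexivity. }
  rewrite E. rewrite <- sin_phi. have S2 := sin2_cos2 (phi n x). unfold Rsqr in S2.
  set (s := sin (phi n x)) in *. set (c := cos (phi n x)) in *. set (N := INR (S n)). set (a := dp2 n (tim n x)).
  replace (1-s^2) with (c^2) by nra. field. lra.
Qed.

Lemma phi1_derive n x : is_derive (phi1 n) x (Fx (bet n) x (phi n x)).
Proof.
 have Ht := tim_pos n x. have Hc := cos_phi_pos n x. have Dp := phi_derive n x.
 have Dt := tim_derive n x.
 have Da: is_derive (fun x => dp2 n (tim n x)) x
   ((INR n/tim n x*dp2 n (tim n x)-2*(1-dp2 n (tim n x)^2)*dp2 (S n) (tim n x))*(- bet n*tim n x)).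
 { apply (isd_comp (dp2 n)); [now apply dp2_derive'|exact Dt]. }
 rewrite <- sin_phi in Da. eapply isd_eq.
 - unfold phi1. apply isd_mult; [isd_|]. apply isd_minus.
  + apply isd_mult; [apply isd_mult; [apply isd_mult; [isd_|exact Dt]|exact Da]|apply isd_cos, Dp].
  + apply isd_mult; [isd_|]. apply isd_div; [apply isd_sin, Dp|apply isd_cos, Dp|lra].
 - cbv beta. unfold Fx. have T2 := tim_sq n x. unfold phi1.
  replace (exp (- (2*bet n*x))) with (8*bet n^3*tim n x^2) by (apply Rmult_eq_reg_r with (/ (2*bet n)); [|apply Rinv_neq_0_compat; have := bet_pos n; lra]; fold (Rdiv (exp (- (2*bet n*x))) (2*bet n)); rewrite <- T2; field; have := bet_pos n; lra).
  have NB := N2_bet3 n. rewrite !S_INR in *. have Hb := bet_pos n.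
  have S2 := sin2_cos2 (phi n x). unfold Rsqr in S2.
  set (s := sin (phi n x)) in *. set (c := cos (phi n x)) in *. set (N := INR n) in *. set (a := dp2 n (tim n x)).
  set (t := tim n x) in *. set (b := bet n) in *.
  have S2': s*s=1-c*c by lra.
  transitivity (b^2*((N+1)^2*s/c^3-4*t^2*s*c)).
  + apply Rmult_eq_reg_r with (c^3); [|apply pow_nonzero; lra].
   field_simplify; [|lra|lra].
   replace (s^3) with (s*(1-c*c)) by (rewrite <- S2'; ring).
   replace (s^2) with (1-c*c) by (rewrite <- S2'; ring). ring.
  + replace (b^2*((N+1)^2*s/c^3-4*t^2*s*c)) with
    (((N+1)^2*b^3)*(s/c^3/b)-4*b^2*t^2*s*c) by fld.
   rewrite NB. field. lra.
Qed.

(** J_(n+1)(2t)/gam solves y'' = [Xb] y, the linearisation at zero of the equation for phi/gam;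
    [Xb b x] tends to x as b -> 0, whence the limit Ai. *)
Definition bj (n : nat) (x : R) : R := bes (INR (S n)) (tim n x)/gam n.
Definition bj1 (n : nat) (x : R) : R :=
 - bet n*(2*tim n x*bes (INR n) (tim n x)-INR (S n)*bes (INR (S n)) (tim n x))/gam n.
Definition Xb (b x : R) : R := (1-exp (- (2*b*x)))/(2*b).

Lemma bj_derive n x : is_derive (bj n) x (bj1 n x).
Proof.
 have Ht := tim_pos n x. have := gam_pos n. eapply isd_eq.
 - unfold bj. apply (isd_mult (fun x => bes (INR (S n)) (tim n x)) (fun _ => / gam n)); [|isd_].
  apply (isd_comp (bes (INR (S n)))); [now apply bes_derive_down|apply tim_derive].
 - cbv beta. unfold bj1. field. lra.
Qed.

Lemma bj1_derive n x : is_derive (bj1 n) x (Xb (bet n) x*bj n x).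
Proof.
 have Ht := tim_pos n x. have := gam_pos n. have := bet_pos n.
 have Dt := tim_derive n x.
 have D1: is_derive (fun x => bes (INR (S n)) (tim n x)) x
   ((2*bes (INR n) (tim n x)-INR (S n)/tim n x*bes (INR (S n)) (tim n x))*(- bet n*tim n x)).
 { apply (isd_comp (bes (INR (S n)))); [now apply bes_derive_down|exact Dt]. }
 have D0: is_derive (fun x => bes (INR n) (tim n x)) x
   ((INR n/tim n x*bes (INR n) (tim n x)-2*bes (INR (S n)) (tim n x))*(- bet n*tim n x)).
 { apply (isd_comp (bes (INR n))); [now apply bes_derive_up|exact Dt]. }
 eapply isd_eq.
 - unfold bj1. apply (isd_mult (fun x => - bet n*(2*tim n x*bes (INR n) (tim n x)-INR (S n)*bes (INR (S n)) (tim n x))) (fun _ => / gam n)); [|isd_].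
  apply isd_mult; [isd_|]. apply isd_minus.
  + apply isd_mult; [apply isd_mult; [isd_|exact Dt]|exact D0].
  + apply isd_mult; [isd_|exact D1].
 - cbv beta. unfold Xb, bj. have T2 := tim_sq n x. have NB := N2_bet3 n.
  replace ((1-exp (- (2*bet n*x)))/(2*bet n)) with (bet n^2*(INR (S n)^2-4*tim n x^2)).
  2:{ transitivity (INR (S n)^2*bet n^3/bet n-4*bet n^2*tim n x^2); [field; lra|].
    rewrite NB, T2. field. lra. }
  rewrite !S_INR. field. lra.
Qed.

Definition lx (n : nat) (x : R) : R := ldet (S n) (tim n x).
Definition lx1 (n : nat) (x : R) : R := - bet n*(tim n x*ldet' n (tim n x)).

Lemma lx_derive n x : is_derive (lx n) x (lx1 n x).
Proof.
 have Ht := tim_pos n x. eapply isd_eq.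
 - unfold lx. apply (isd_comp (ldet (S n))); [now apply ldet_derive|apply tim_derive].
 - unfold lx1. ring.
Qed.

Lemma lx1_derive n x : is_derive (lx1 n) x (exp (- (2*bet n*x))/(2*bet n)*cos (phi n x)^2).
Proof.
 have Ht := tim_pos n x. eapply isd_eq.
 - unfold lx1. apply isd_mult; [isd_|].
  apply (isd_comp (fun t => t*ldet' n t)); [now apply t_ldet'_derive|apply tim_derive].
 - cbv beta. rewrite cos2_phi, <- tim_sq. ring.
Qed.

Definition hx (n : nat) (x : R) : R := hsum n (tim n x).

Lemma hx_derive n x : is_derive (hx n) x
 (- (/ gam n)*(exp (- bet n*x)*sin (phi n x)+sin (phi n x)/cos (phi n x)^2)).
Proof.
 have Ht := tim_pos n x. have := gam_pos n. eapply isd_eq.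
 - unfold hx. apply (isd_comp (hsum n)); [now apply hsum_derive|apply tim_derive].
 - rewrite cos2_phi, sin_phi. have := dp2_range n _ Ht.
  replace (/ gam n) with (INR (S n)*bet n) by (have E := N_bet_gam n; apply Rmult_eq_reg_r with (gam n); [rewrite E; field; lra|lra]).
  replace (exp (- bet n*x)) with (2*tim n x/INR (S n)) by (unfold tim; field; apply Rgt_not_eq, INR_S_pos).
  field. have := INR_S_pos n. split; [nra|lra].
Qed.

(** * Trigonometric inequalities for the scaled nonlinearity *)

Lemma sin_le_id (p : R) : 0 <= p -> sin p <= p.
Proof. intros Hp. have H := abs_sin_le p. rewrite (Rabs_right p) in H by lra. have := Rle_abs (sin p). lra. Qed.

Lemma cos_ge_quad (p : R) : 0 <= p -> 1-p^2/2 <= cos p.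
Proof.
 intros Hp. assert (cos 0+0^2/2<=cos p+p^2/2); [|rewrite cos_0 in *; lra].
 apply (derive_nonneg_le (fun s => cos s+s^2/2) (fun s => s-sin s)); [lra| |].
 - intros s Hs. isd; [lra|]. simpl. field.
 - intros s Hs. have := sin_le_id s ok. lra.
Qed.

Lemma sin_ge_cubic (p : R) : 0 <= p -> p-p^3/6 <= sin p.
Proof.
 intros Hp. assert (sin 0-(0-0^3/6)<=sin p-(p-p^3/6)); [|rewrite sin_0 in *; lra].
 apply (derive_nonneg_le (fun s => sin s-(s-s^3/6)) (fun s => cos s-(1-s^2/2))); [lra| |].
 - intros s Hs. isd; [lra|]. simpl. field.
 - intros s Hs. have := cos_ge_quad s ok. lra.
Qed.

Lemma cos_le_quartic (p : R) : 0 <= p -> cos p <= 1-p^2/2+p^4/24.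
Proof.
 intros Hp. assert ((1-0^2/2+0^4/24)-cos 0<=(1-p^2/2+p^4/24)-cos p); [|rewrite cos_0 in *; lra].
 apply (derive_nonneg_le (fun s => (1-s^2/2+s^4/24)-cos s) (fun s => sin s-(s-s^3/6))); [lra| |].
 - intros s Hs. isd; [lra|lra|]. simpl. field.
 - intros s Hs. have := sin_ge_cubic s ok. lra.
Qed.

Lemma sin_le_quintic (p : R) : 0 <= p -> sin p <= p-p^3/6+p^5/120.
Proof.
 intros Hp. assert ((0-0^3/6+0^5/120)-sin 0<=(p-p^3/6+p^5/120)-sin p); [|rewrite sin_0 in *; lra].
 apply (derive_nonneg_le (fun s => (s-s^3/6+s^5/120)-sin s) (fun s => (1-s^2/2+s^4/24)-cos s)); [lra| |].
 - intros s Hs. isd; [lra|lra|]. simpl. field.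
 - intros s Hs. have := cos_le_quartic s ok. lra.
Qed.

Lemma cos_lipschitz (a b : R) : Rabs (cos a-cos b) <= Rabs (a-b).
Proof.
 have P: forall a b, a<=b -> Rabs (cos b-cos a)<=1*(b-a).
 { intros u v Huv. apply (derive_bound cos (fun x => - sin x)); [lra|intros; apply is_derive_cos|].
  intros. rewrite Rabs_Ropp. have := SIN_bound x. apply Rabs_le; lra. }
 destruct (Rle_dec a b).
 - rewrite Rabs_minus_sym, (Rabs_minus_sym a). rewrite (Rabs_right (b-a)) by lra. specialize (P a b ok). lra.
 - rewrite (Rabs_right (a-b)) by lra. specialize (P b a ok). lra.
Qed.

Lemma exp_quad (z : R) : Rabs z <= 1 -> Rabs (1-exp (- z)-z) <= z^2.
Proof.
 intros Hz. abs_in Hz. have := exp_ineq1_le (- z).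
 assert (exp (- z)<=1-z+z^2); [|apply Rabs_le; nra].
 have: forall w, 0<=w<=1 -> exp w<=1+w+w^2.
 { intros w Hw. assert (exp (- 0)*(1+0+0^2)<=exp (- w)*(1+w+w^2)) as E.
  { apply (derive_nonneg_le (fun w => exp (- w)*(1+w+w^2)) (fun w => exp (- w)*(w*(1-w)))); [lra| |].
   - intros s Hs. isd. simpl. ring.
   - intros s Hs. have := exp_pos (- s). apply Rmult_le_pos; nra. }
  rewrite Ropp_0, exp_0 in E. rewrite exp_Ropp in E. have := exp_pos w.
  apply Rmult_le_reg_l with (/ exp w); [pos|]. rewrite Rinv_l by lra. lra. }
 destruct (Rle_dec 0 (- z)).
 - specialize (H0 (- z) ok). nra.
 - assert (exp (- 0)+0-0^2/2<=1 /\ forall w, 0<=w -> exp (- w)<=1-w+w^2) as [_ Q].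
  { split; [rewrite Ropp_0, exp_0; lra|]. intros w Hw.
   assert ((1-0+0^2)-exp (- 0)<=(1-w+w^2)-exp (- w)) as E.
   { apply (derive_nonneg_le (fun w => (1-w+w^2)-exp (- w)) (fun w => -1+2*w+exp (- w))); [lra| |].
    - intros s Hs. isd. simpl. ring.
    - intros s Hs. have := exp_ineq1_le (- s). lra. }
   rewrite Ropp_0, exp_0 in E. lra. }
  apply Q. lra.
Qed.

Lemma sin_cos_lt (y : R) : 0 < y -> y < PI -> y*cos y < sin y.
Proof.
 intros H1 H2. assert (sin 0-0*cos 0<sin y-y*cos y); [|rewrite sin_0 in *; lra].
 apply (derive_pos_lt (fun s => sin s-s*cos s) (fun s => s*sin s)); [lra| |].
 - intros s Hs. isd. ring.
 - intros s Hs. apply Rmult_lt_0_compat; [lra|]. apply sin_gt_0; lra.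
Qed.

Lemma sinc_decr (p q : R) : 0 < p -> p < q -> q < PI/2 -> p*(sin q*cos q) < q*(sin p*cos p).
Proof.
 intros Hp Hpq Hq.
 assert (- (sin p*cos p/p) < - (sin q*cos q/q)) as E.
 { apply (derive_pos_lt (fun s => - (sin s*cos s/s)) (fun s => (sin (2*s)/2-s*cos (2*s))/s^2)); [lra| |].
  - intros s Hs. isd; [lra|]. rewrite sin_2a, cos_2a. field. lra.
  - intros s Hs. have := sin_cos_lt (2*s) ok ok. apply Rdiv_lt_0_compat; [lra|pos]. }
 apply Rmult_lt_reg_r with (/ (p*q)); [pos|].
 replace (p*(sin q*cos q) * / (p*q)) with (sin q*cos q/q) by fld.
 replace (q*(sin p*cos p) * / (p*q)) with (sin p*cos p/p) by fld. lra.
Qed.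

Lemma sin_cos_le (s : R) : 0 <= s <= PI/2 -> sin s*cos s <= s.
Proof.
 intros Hs. have := sin_le_id s ok. have := COS_bound s.
 have: 0<=sin s by (apply sin_ge_0; have := PI_RGT_0; lra).
 have: 0<=cos s by (apply cos_ge_0; lra). nra.
Qed.

Lemma tan_ge_id (p : R) : 0 <= p < PI/2 -> p <= sin p/cos p.
Proof.
 intros Hp. have: 0<cos p by (apply cos_gt_0; lra).
 apply Rmult_le_reg_r with (cos p); [lra|]. unfold Rdiv. rewrite Rmult_assoc, Rinv_l, Rmult_1_r by lra.
 destruct (Req_dec p 0) as [->|]; [rewrite sin_0; lra|]. left. apply sin_cos_lt; lra.
Qed.

Lemma tanc_incr (p q : R) : 0 < p -> p < q -> q < PI/2 -> q*(sin p/cos p^3) <= p*(sin q/cos q^3).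
Proof.
 intros Hp Hpq Hq.
 have Hc: forall s, p<=s<=q -> 0<cos s by (intros; apply cos_gt_0; lra).
 assert (sin p/cos p/p<=sin q/cos q/q) as E.
 { apply (derive_nonneg_le (fun s => sin s/cos s/s) (fun s => (s-sin s*cos s)/(s^2*cos s^2))); [lra| |].
  - intros s Hs. specialize (Hc s Hs). isd; [lra|lra|]. have := sin2_cos2 s. unfold Rsqr in *.
   field_simplify; [|lra|lra]. replace (sin s^2) with (1-cos s^2) by (simpl; lra). field. lra.
  - intros s Hs. specialize (Hc s Hs). have := sin_cos_le s ok.
   apply Rmult_le_pos; [lra|]. apply Rlt_le, Rinv_0_lt_compat. apply Rmult_lt_0_compat; apply pow_lt; lra. }
 have := Hc p ok. have := Hc q ok.
 have: cos q<=cos p by (apply cos_decr_1; lra).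
 have E2: / cos p^2 <= / cos q^2 by mono.
 have: 0 < / cos p^2 by pos.
 have: 0<sin p/cos p/p.
 { apply Rdiv_lt_0_compat; [apply Rdiv_lt_0_compat; [apply sin_gt_0; lra|lra]|lra]. }
 replace (q*(sin p/cos p^3)) with (p*q*((sin p/cos p/p) * / cos p^2)) by fld.
 replace (p*(sin q/cos q^3)) with (p*q*((sin q/cos q/q) * / cos q^2)) by fld.
 apply Rmult_le_compat_l; [nra|]. apply Rmult_le_compat; lra.
Qed.

(** In Fx/p the part sin p/(p cos^3 p) does not decrease, while sin p cos p/p = sin(2p)/(2p)
    decreases strictly and has a negative coefficient. This is the sign of the Wronskian derivative
    that [ratio_max] asks for. *)
Lemma Fx_ratio (b x p q : R) : 0 < b -> 0 < p -> p < q -> q < PI/2 -> q*Fx b x p < p*Fx b x q.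
Proof.
 intros Hb H1 H2 H3. have := tanc_incr p q H1 H2 H3. have := sinc_decr p q H1 H2 H3.
 have He := exp_pos (- (2*b*x)). set (e := exp (- (2*b*x))) in *. unfold Fx. fold e.
 have: 0<cos p by (apply cos_gt_0; lra). have: 0<cos q by (apply cos_gt_0; lra).
 apply Rmult_lt_reg_r with (2*b); [lra|].
 replace (q*((sin p/cos p^3-e*(sin p*cos p))/(2*b))*(2*b)) with (q*(sin p/cos p^3)-e*(q*(sin p*cos p))) by fld.
 replace (p*((sin q/cos q^3-e*(sin q*cos q))/(2*b))*(2*b)) with (p*(sin q/cos q^3)-e*(p*(sin q*cos q))) by fld.
 have: e*(p*(sin q*cos q))<e*(q*(sin p*cos p)) by (apply Rmult_lt_compat_l; lra). lra.
Qed.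

(** sin p/cos^3 p = tan p (1 + tan^2 p) >= p + p^3, whereas sin p cos p <= p. With p = gam f the
    surplus p^2/(2b) is f^2. *)
Lemma Fx_lower (b x p : R) : 0 < b -> 0 < p < PI/2 -> p*(p^2/(2*b)+Xb b x) <= Fx b x p.
Proof.
 intros Hb Hp. have T := tan_ge_id p ok. have S := sin_cos_le p ok.
 have Hc: 0<cos p by (apply cos_gt_0; lra).
 have He := exp_pos (- (2*b*x)). unfold Fx, Xb. set (e := exp (- (2*b*x))) in *.
 have: p*(1+p^2)<=sin p/cos p^3.
 { replace (sin p/cos p^3) with (sin p/cos p*(1+(sin p/cos p)^2)).
  - set (t := sin p/cos p) in *. have: p^2<=t^2 by mono. nra.
  - have S2 := sin2_cos2 p. unfold Rsqr in S2.
   transitivity (sin p*(sin p*sin p+cos p*cos p)/cos p^3); [field; lra|]. rewrite S2. field. lra. }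
 apply Rmult_le_reg_r with (2*b); [lra|].
 replace (p*(p^2/(2*b)+(1-e)/(2*b))*(2*b)) with (p*(1+p^2)-e*p) by fld.
 replace ((sin p/cos p^3-e*(sin p*cos p))/(2*b)*(2*b)) with (sin p/cos p^3-e*(sin p*cos p)) by fld.
 have: e*(sin p*cos p)<=e*p by mono. lra.
Qed.

Lemma cos_inv3 (p : R) : 0 <= p <= 1/2 -> 0 < cos p /\ / cos p^3 <= 1+3*p^2.
Proof.
 intros Hp. have Hc := cos_ge_quad p ok. have: 0<cos p by nra. split; [assumption|].
 have: (1-p^2/2)^3<=cos p^3 by (apply pow_incr; nra).
 have Hy: 1<=(1-p^2/2)^3*(1+3*p^2).
 { set (y := p^2/2). have: 0<=y<=1/8 by (unfold y; nra). replace (3*p^2) with (6*y) by (unfold y; field).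
  have: 0<=y*(3-15*y+17*y^2-6*y^3) by (apply Rmult_le_pos; nra). nra. }
 have: 0<cos p^3 by pos.
 apply Rmult_le_reg_l with (cos p^3); [lra|]. rewrite Rinv_r by lra.
 apply Rle_trans with (1 := Hy). apply Rmult_le_compat_r; [nra|lra].
Qed.

Lemma sin_cos_ge (p : R) : 0 <= p <= 1/2 -> p-p^3 <= sin p*cos p.
Proof.
 intros Hp. have := cos_ge_quad p ok. have := sin_ge_cubic p ok.
 have: 0<=p-p^3/6 by nra. have: 0<=1-p^2/2 by nra.
 trans ((p-p^3/6)*(1-p^2/2)).
 - have: 0<=p^3*(1/3+p^2/12) by (apply Rmult_le_pos; [apply pow_le; lra|nra]). nra.
 - apply Rmult_le_compat; lra.
Qed.

Lemma Fx_upper (b x p : R) : 0 < b -> 0 <= x -> 0 < p <= 1/2 -> Fx b x p <= p*(Xb b x+4*(p^2/(2*b))).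
Proof.
 intros Hb Hx Hp. destruct (cos_inv3 p ok) as [Hc Hi]. have S := sin_cos_ge p ok.
 have He := exp_pos (- (2*b*x)). 
 have He1: exp (- (2*b*x))<=1 by mono.
 unfold Fx, Xb. set (e := exp (- (2*b*x))) in *.
 have: sin p/cos p^3<=p*(1+3*p^2).
 { unfold Rdiv. have := sin_le_id p ok. apply Rmult_le_compat; try lra.
  - apply sin_ge_0; have := PI2_1; lra. - apply Rlt_le, Rinv_0_lt_compat, pow_lt; lra. }
 apply Rmult_le_reg_r with (2*b); [lra|].
 replace (p*((1-e)/(2*b)+4*(p^2/(2*b)))*(2*b)) with (p*(1+4*p^2)-e*p) by fld.
 replace ((sin p/cos p^3-e*(sin p*cos p))/(2*b)*(2*b)) with (sin p/cos p^3-e*(sin p*cos p)) by fld.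
 have: e*(p-p^3)<=e*(sin p*cos p) by mono.
 have: 0<=(1-e)*p^3 by pos. lra.
Qed.

(** The nonlinearity splits into sin^3 p (1 + cos^2 p)/cos^3 p = 2p^3 + O(p^5), the source of 2f^3,
    and (1 - exp(-z)) sin p cos p with z = g^2 x, the source of xf. The error keeps the factor f, so
    it survives division by f where f is exponentially small. *)
Lemma Fx_limit (g b x f A M : R) : 0 < g -> b = g^2/2 -> Rabs x <= A -> 0 < f <= M -> g*M <= 1/2 -> g^2*A <= 1 ->
 Rabs (Fx b x (g*f)/g-f*(2*f^2+x)) <= g^2*(6*M^4+2*A*M^2+A^2)*f.
Proof.
 intros Hg -> Hx Hf HM HA. set (p := g*f). have Hp: 0<p<=1/2 by (unfold p; nra).
 destruct (cos_inv3 p ok) as [Hc Hi]. have S1 := sin_cos_ge p ok.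
 have S2 := sin_cos_le p ltac:(pose proof PI2_1; lra).
 have S3 := sin_le_id p ok. have S4 := sin_ge_cubic p ok.
 set (z := g^2*x).
 have HA0: 0<=A by (have := Rabs_pos x; lra).
 have Hg2: 0<g^2 by pos.
 have Hz: Rabs z<=g^2*A by (unfold z; rewrite Rabs_mult, (Rabs_right (g^2)) by lra; apply Rmult_le_compat_l; lra).
 have E := exp_quad z ok. 
 set (s3 := sin p^3*(1+cos p^2)/cos p^3).
 have Hs0: 0<=sin p by nra.
 have U3: s3<=2*p^3+6*p^5.
 { unfold s3, Rdiv. have: sin p^3<=p^3 by mono. have := COS_bound p.
  have: 1+cos p^2<=2 by nra. have: 0<=sin p^3 by pos.
  have: 0 <= / cos p^3 by pos.
  trans (p^3*2*(1+3*p^2)); [|right; ring].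
  apply Rmult_le_compat; try lra; [nra|]. apply Rmult_le_compat; try lra. nra. }
 have L3: 2*p^3-p^5<=s3.
 { unfold s3. trans (sin p^3*2).
  - have: (p-p^3/6)^3<=sin p^3 by (apply pow_incr; split; nra).
   have: p^3*(1-p^2/2)<=(p-p^3/6)^3.
   { replace ((p-p^3/6)^3) with (p^3*(1-p^2/6)^3) by field.
    apply Rmult_le_compat_l; [pos|]. set (y := p^2/6). replace (p^2/2) with (3*y) by (unfold y; field).
    have: 0<=y<=1 by (unfold y; nra). nra. }
   replace (p^5) with (p^3*p^2) by ring. lra.
  - unfold Rdiv. rewrite Rmult_assoc. apply Rmult_le_compat_l; [pos|].
   apply Rmult_le_reg_r with (cos p^3); [pos|]. rewrite Rmult_assoc, Rinv_l, Rmult_1_r by (apply pow_nonzero; lra).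
   have := COS_bound p. have: cos p^3<=cos p by (have: cos p^2<=1 by nra; nra). nra. }
 set (k := sin p*cos p) in *. set (w := 1-exp (- z)) in *.
 have EF: Fx (g^2/2) x p/g-f*(2*f^2+x) =
  ((s3-2*p^3)+(w*k-z*p))/g^3.
 { unfold Fx, s3, w, k, z. replace (2*(g^2/2)*x) with (g^2*x) by field.
  have S5 := sin2_cos2 p. unfold Rsqr in S5.
  have: sin p^3*(1+cos p^2)/cos p^3=sin p/cos p^3-sin p*cos p.
  { replace (sin p^3) with (sin p*(1-cos p^2)) by (replace (1-cos p^2) with (sin p*sin p) by (simpl; lra); ring). field; lra. }
  rewrite H. replace f with (p/g) by (unfold p; field; lra). field. lra. }
 rewrite EF. abs_in E. abs_in Hz.
 have Hwk: Rabs (w*k-z*p)<=2*(g^2*A)*p^3+(g^2*A)^2*p.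
 { have: z^2<=(g^2*A)^2 by nra. 
  have Hw: Rabs w<=2*(g^2*A) by (apply Rabs_le; nra).
  replace (w*k-z*p) with (w*(k-p)+(w-z)*p) by ring.
  le_trans Rabs_triang. rewrite !Rabs_mult. apply Rplus_le_compat.
  - apply Rmult_le_compat; try apply Rabs_pos; [exact Hw|]. apply Rabs_le; lra.
  - rewrite (Rabs_right p) by lra. apply Rmult_le_compat_r; [lra|]. apply Rabs_le; lra. }
 have H5: Rabs (s3-2*p^3)<=6*p^5 by (apply Rabs_le; have: 0<p^5 by pos; lra).
 unfold Rdiv. rewrite Rabs_mult, (Rabs_right (/ g^3)) by pos.
 apply Rmult_le_reg_r with (g^3); [pos|]. rewrite Rmult_assoc, Rinv_l, Rmult_1_r by (apply pow_nonzero; lra).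
 le_trans Rabs_triang.
 have Q4: p^4<=g^4*M^4 by (rewrite <- Rpow_mult_distr; apply pow_incr; unfold p; nra).
 have Q2: p^2<=g^2*M^2 by (rewrite <- Rpow_mult_distr; apply pow_incr; unfold p; nra).
 have: 0<=g^2*A by nra.
 have: 6*p^5<=6*(g^4*M^4)*p by (replace (p^5) with (p^4*p) by ring; have: p^4*p<=g^4*M^4*p by mono; lra).
 have: 2*(g^2*A)*p^3<=2*(g^2*A)*(g^2*M^2*p).
 { apply Rmult_le_compat_l; [lra|]. replace (p^3) with (p^2*p) by ring. apply Rmult_le_compat_r; lra. }
 replace (g^2*(6*M^4+2*A*M^2+A^2)*f*g^3) with
  (6*(g^4*M^4)*p+2*(g^2*A)*(g^2*M^2*p)+(g^2*A)^2*p) by (unfold p; ring). lra.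
Qed.

(** * Improper integrals and the limit of Bessel functions to Ai *)

Lemma is_RInt_gen_infty (f I : R -> R) (a L : R) :
 (forall b, a <= b -> is_RInt f a b (I b)) -> is_lim I p_infty L ->
 is_RInt_gen f (at_point a) (Rbar_locally p_infty) L.
Proof.
 intros HI HL P HP.
 apply (Filter_prod _ _ _ (fun u => u=a) (fun b => a<b /\ P (I b))).
 - reflexivity.
 - destruct (HL P HP) as [M HM]. exists (Rmax a M). intros b Hb.
  minmax. split; [lra|apply HM; lra].
 - intros u b -> [Hb Pb]. exists (I b). split; [apply HI; lra|exact Pb].
Qed.

Lemma RInt_gen_infty (f I : R -> R) (a L : R) :
 (forall b, a <= b -> is_RInt f a b (I b)) -> is_lim I p_infty L ->
 RInt_gen f (at_point a) (Rbar_locally p_infty) = L.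
Proof.
 intros HI HL. apply (is_RInt_gen_unique (V := RN)). now apply is_RInt_gen_infty with I.
Qed.

Lemma RInt_derive_upper (f : R -> R) (a x : R) : (forall x, continuous f x) -> is_derive (fun b => RInt f a b) x (f x).
Proof.
 intros Hc. apply (is_derive_RInt (V := R_NormedModule) f (fun b => RInt f a b) a x).
 - apply filter_forall. intros b. apply (RInt_correct (V := RN)). now apply cont_ex_RInt.
 - apply Hc.
Qed.

(* van der Corput's first-derivative estimate *)
Lemma oscillatory_bound (P P1 P2 : R -> R) (T b : R) : T <= b ->
 (forall x, is_derive P x (P1 x)) -> (forall x, is_derive P1 x (P2 x)) ->
 (forall x, T <= x <= b -> 0 < P1 x) -> (forall x, T <= x <= b -> 0 <= P2 x) ->
 Rabs (RInt (fun x => cos (P x)) T b) <= 2/P1 T.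
Proof.
 intros HTb D0 D1 Pos1 Pos2.
 have Hc: forall x, continuous (fun x => cos (P x)) x by (intros x; eapply isd_continuous, isd_cos, D0).
 set (A := fun x => RInt (fun x => cos (P x)) T x-sin (P x)/P1 x).
 have DA: forall x, T<=x<=b -> is_derive A x (sin (P x)*P2 x/P1 x^2).
 { intros x Hx. specialize (Pos1 x Hx). eapply isd_eq.
  - unfold A. apply isd_minus; [now apply RInt_derive_upper|]. apply isd_div; [apply isd_sin, D0|apply D1|lra].
  - cbv beta. field. lra. }
 have DI: forall x, T<=x<=b -> is_derive (fun x => - / P1 x) x (P2 x/P1 x^2).
 { intros x Hx. specialize (Pos1 x Hx). eapply isd_eq; [apply isd_opp, isd_inv; [apply D1|lra]|]. field. lra. }
 have B: Rabs (A b-A T) <= / P1 T - / P1 b.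
 { have Q: forall x, T<=x<=b -> - (P2 x/P1 x^2)<=sin (P x)*P2 x/P1 x^2<=P2 x/P1 x^2.
  { intros x Hx. specialize (Pos1 x Hx). specialize (Pos2 x Hx). have := SIN_bound (P x).
   have: 0 < / P1 x^2 by pos.
   have: 0<=P2 x * / P1 x^2 by nra. unfold Rdiv. rewrite Rmult_assoc. nra. }
  apply Rabs_le; split.
  - assert (A T + - / P1 T<=A b + - / P1 b); [|lra].
   apply (derive_nonneg_le (fun x => A x + - / P1 x) (fun x => sin (P x)*P2 x/P1 x^2+P2 x/P1 x^2)); [lra| |].
   + intros x Hx. apply isd_plus; [now apply DA|now apply DI].
   + intros x Hx. specialize (Q x Hx). lra.
  - assert (- / P1 T-A T <= - / P1 b-A b); [|lra].
   apply (derive_nonneg_le (fun x => - / P1 x-A x) (fun x => P2 x/P1 x^2-sin (P x)*P2 x/P1 x^2)); [lra| |].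
   + intros x Hx. apply isd_minus; [now apply DI|now apply DA].
   + intros x Hx. specialize (Q x Hx). lra. }
 have ET: RInt (fun x => cos (P x)) T T=0 :> R by apply (RInt_point (V := RN)).
 unfold A in B. rewrite ET in B. abs_in B.
 have := Pos1 b ok.
 have: 0 < / P1 b by pos.
 have := SIN_bound (P T). have := SIN_bound (P b). unfold Rdiv in *.
 apply Rabs_le. nra.
Qed.

Lemma Rabs_RInt_close (f g : R -> R) (a b M : R) : a <= b -> (forall x, continuous f x) -> (forall x, continuous g x) ->
 (forall x, a < x < b -> Rabs (f x-g x) <= M) -> Rabs (RInt f a b-RInt g a b) <= M*(b-a).
Proof.
 intros Hab Hf Hg HM.
 pose proof (RInt_bounds (fun x => 1*f x+(-1)*g x) a b (- M) M Hab) as [L U].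
 - intros x. apply (continuous_plus (fun x => 1*f x) (fun x => -1*g x)).
  + apply (continuous_mult (fun _ => 1) f); [apply continuous_const|apply Hf].
  + apply (continuous_mult (fun _ => -1) g); [apply continuous_const|apply Hg].
 - intros x Hx. specialize (HM x Hx). alra. - rewrite RInt_lin in L, U by assumption. alra. Qed.

Definition airy_part (x T : R) : R := RInt (fun t => cos (t^3/3+x*t)) 0 T.

Lemma airy_cont x t : continuous (fun t => cos (t^3/3+x*t)) t.
Proof. eapply isd_continuous. isd; [lra|reflexivity]. Qed.

Lemma RInt_split (f : R -> R) (a b c : R) : (forall x, continuous f x) -> RInt f a c = RInt f a b+RInt f b c :> R.
Proof.
 intros H. symmetry. apply (RInt_Chasles (V := RN)); now apply cont_ex_RInt.
Qed.

(** The phase derivative t^2 + x increases and is at least T^2 beyond T. The same estimate makes the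
    partial integrals a Cauchy family, so that [Ai] is a genuine limit. *)
Lemma Ai_tail (x T : R) : 0 <= x -> 1 <= T -> Rabs (PI*Ai x-airy_part x T) <= 2/T^2.
Proof.
 intros Hx HT.
 have OB: forall S b, 1<=S<=b -> Rabs (airy_part x b-airy_part x S)<=2/S^2.
 { intros S b HSb.
  have E: airy_part x b-airy_part x S=RInt (fun t => cos (t^3/3+x*t)) S b :> R.
  { have E0 := RInt_split _ 0 S b (airy_cont x).
   change (airy_part x b=airy_part x S+RInt (fun t => cos (t^3/3+x*t)) S b :> R) in E0. rewrite E0. ring. }
  rewrite E.
  eapply Rle_trans; [apply (oscillatory_bound _ (fun t => t^2+x) (fun t => 2*t)); [lra| | | |]|].
  - intros t. isd; [lra|]. simpl. field.
  - intros t. isd. simpl. ring.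
  - intros t Ht. nra.
  - intros t Ht. lra.
  - unfold Rdiv. apply Rmult_le_compat_l; [lra|]. apply Rinv_le_contravar; nra. }
 have HL: exists L : R, is_lim (airy_part x) p_infty L.
 { destruct (proj1 (filterlim_locally_cauchy (F := Rbar_locally p_infty) (U := R_CompleteSpace) (airy_part x))) as [l Hl]; [|now exists l].
  intros eps. exists (fun b => Rmax 1 (2/eps)<b). split; [now exists (Rmax 1 (2/eps))|].
  have Q: forall u v, Rmax 1 (2/eps)<u -> u<=v -> Rabs (airy_part x v-airy_part x u)<eps.
  { intros u v Hu Huv. minmax. have := cond_pos eps.
   eapply Rle_lt_trans; [apply OB; lra|]. apply Rmult_lt_reg_r with (u^2); [nra|].
   unfold Rdiv. rewrite Rmult_assoc, Rinv_l, Rmult_1_r by nra.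
   have E2: 2=eps*(2/eps) by fld.
   have: eps*(2/eps)<eps*u by (apply Rmult_lt_compat_l; lra).
   have: eps*u<=eps*u^2 by mono. lra. }
  intros u v Hu Hv. destruct (Rle_dec u v).
  - now apply Q. - apply ball_sym, Q; [assumption|lra]. }
 destruct HL as [L HL].
 have EA: PI*Ai x=L.
 { unfold Ai. rewrite (RInt_gen_infty _ (airy_part x) 0 L); [field; apply PI_neq0| |exact HL].
  intros b Hb. apply (RInt_correct (V := RN)). apply cont_ex_RInt. intros; apply airy_cont. }
 rewrite EA. apply Rnot_lt_le. intros Hn.
 rewrite is_lim_inf_eps in HL. destruct (HL (Rabs (L-airy_part x T)-2/T^2) ok) as [T1 HT1].
 set (b := Rmax T T1+1). have := Rmax_l T T1. have := Rmax_r T T1.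
 specialize (HT1 b ltac:(unfold b; lra)). specialize (OB T b ltac:(unfold b; lra)).
 have Tr := Rabs_triang (L-airy_part x b) (airy_part x b-airy_part x T).
 replace (L-airy_part x b+(airy_part x b-airy_part x T)) with (L-airy_part x T) in Tr by ring.
 rewrite (Rabs_minus_sym L (airy_part x b)) in Tr. lra.
Qed.

(** After th = gam s, the phase derivative beyond s = T is N(1 - e cos th) >= N(gam T)^2/4, where e
    = exp(-bet x) <= 1; N gam^3 = 2 turns van der Corput's bound into one free of n. *)
Lemma bes_tail (n : nat) (x T : R) : 0 <= x -> 1 <= T -> gam n*T <= 1 ->
 Rabs (PI*bj n x-RInt (fun s => cos (INR (S n)*(gam n*s)-2*tim n x*sin (gam n*s))) 0 T) <= 4/T^2.
Proof.
 intros Hx HT HgT. have Hg := gam_pos n. have HN := INR_S_pos n. have HPI := PI2_1.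
 set (N := INR (S n)) in *. set (g := gam n) in *. set (tt := tim n x).
 set (h := fun th => cos (N*th-2*tt*sin th)).
 have Hh: forall th, continuous h th by (intros; apply bes_cont).
 set (e := exp (- bet n*x)).
 have He: 0<e<=1.
 { split; [apply exp_pos|]. rewrite <- exp_0. apply exp_le_mono. have := bet_pos n. nra. }
 have Et: 2*tt=N*e by (unfold tt, tim; fold N; fold e; field).
 have Esub: RInt (fun s => cos (N*(g*s)-2*tt*sin (g*s))) 0 T = / g*RInt h 0 (g*T) :> R.
 { have E := RInt_comp_lin (V := RN) h g 0 0 T.
  rewrite Rmult_0_r, !Rplus_0_r in E. specialize (E (cont_ex_RInt h 0 (g*T) Hh)).
  have Hk: forall s, continuous (fun s => cos (N*(g*s)-2*tt*sin (g*s))) s.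
  { intros s. eapply isd_continuous. isd. reflexivity. }
  have E2 := RInt_lin _ _ 0 T g 0 Hk Hk.
  have E3: RInt h 0 (g*T)=g*RInt (fun s => cos (N*(g*s)-2*tt*sin (g*s))) 0 T +
    0*RInt (fun s => cos (N*(g*s)-2*tt*sin (g*s))) 0 T :> R.
  { etransitivity; [|exact E2]. etransitivity; [symmetry; exact E|]. apply RInt_extR. intros s _. unfold h, scal; simpl; unfold mult; simpl. rewrite Rplus_0_r. ring. }
  rewrite E3. symmetry. field. lra. }
 rewrite Esub.
 have Ebj: PI*bj n x = / g*(RInt h 0 (g*T)+RInt h (g*T) PI).
 { rewrite <- RInt_split by assumption. unfold bj, bes. fold N g tt. fold h. field. split; lra. }
 rewrite Ebj. replace (/ g*(RInt h 0 (g*T)+RInt h (g*T) PI) - / g*RInt h 0 (g*T)) with (/ g*RInt h (g*T) PI) by ring.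
 rewrite Rabs_mult, Rabs_right by pos.
 have: 0<g*T by nra.
 have Hcos: forall th, g*T<=th<=PI -> (g*T)^2/4<=1-e*cos th.
 { intros th Hth. have: cos th<=cos (g*T) by (apply cos_decr_1; lra).
  have := cos_le_quartic (g*T) ok. have: 0<=cos (g*T) by (apply cos_ge_0; lra).
  have: e*cos th<=cos (g*T) by (destruct (Rle_dec 0 (cos th)); nra).
  have: (g*T)^4<=(g*T)^2 by (replace ((g*T)^4) with ((g*T)^2*(g*T)^2) by ring;
   have: 0<=(g*T)^2 by pos; have: (g*T)^2<=1^2 by mono; rewrite pow1 in *; set (y2 := (g*T)^2) in *; trans (y2*1); [mono|lra]).
  have: 0<=(g*T)^2 by pos. lra. }
 have B: Rabs (RInt h (g*T) PI)<=2/(N*(1-e*cos (g*T))).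
 { apply (oscillatory_bound (fun th => N*th-2*tt*sin th) (fun th => N*(1-e*cos th)) (fun th => N*(e*sin th))); [lra| | | |].
  - intros th. isd. rewrite Et. ring.
  - intros th. isd. ring.
  - intros th Hth. specialize (Hcos th Hth). apply Rmult_lt_0_compat; [lra|]. have: 0<(g*T)^2 by pos. lra.
  - intros th Hth. apply Rmult_le_pos; [lra|]. apply Rmult_le_pos; [lra|]. apply sin_ge_0; lra. }
 specialize (Hcos (g*T) ok).
 have HgT2: 0<(g*T)^2 by pos.
 trans (/ g*(2/(N*((g*T)^2/4)))).
 - apply Rmult_le_compat_l; [pos|]. eapply Rle_trans; [exact B|].
  unfold Rdiv. apply Rmult_le_compat_l; [lra|]. apply Rinv_le_contravar; [pos|mono].
 - right. have G3 := gam_cube n. fold N g in G3. replace (/ g*(2/(N*((g*T)^2/4)))) with (8/(N*g^3*T^2)) by fld.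
  rewrite G3. field. lra.
Qed.

(** With th = gam s the leading terms of N th - N exp(-bet x) sin th are N th^3/6 = s^3/3 and N bet
    x th = x s; every other term carries gam^2. *)
Lemma bes_phase_close (n : nat) (x s T : R) : 0 <= x -> 0 <= s <= T -> gam n*T <= 1 -> bet n*x <= 1 ->
 Rabs (INR (S n)*(gam n*s)-2*tim n x*sin (gam n*s)-(s^3/3+x*s)) <=
 gam n^2*(T^5+x^2*T+x*T^3).
Proof.
 intros Hx Hs HgT Hbx. have Hg := gam_pos n. have HN := INR_S_pos n.
 have G3 := gam_cube n. have NBG := N_bet_gam n. have Hb := bet_pos n. have G2 := gam_sq n.
 set (e := exp (- bet n*x)).
 have Et: 2*tim n x=INR (S n)*e by (unfold tim; fold e; field).
 rewrite Et. set (N := INR (S n)) in *. set (g := gam n) in *. set (b := bet n) in *.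
 set (th := g*s). have Hth: 0<=th<=1 by (unfold th; nra).
 have := sin_ge_cubic th ok. have := sin_le_quintic th ok. have := sin_le_id th ok.
 have Hbx0: 0<=b*x by nra.
 have E := exp_quad (b*x) ltac:(rewrite Rabs_right; lra). abs_in E.
 replace (- (b*x)) with (- b*x) in E by ring. fold e in E.
 have F1: s^3/3=N*(th^3/6).
 { unfold th. transitivity (N*g^3*s^3/6); [rewrite G3; field|field]. }
 have F2: x*s=N*(b*x*th).
 { unfold th. transitivity (N*b*g*(x*s)); [rewrite NBG; ring|ring]. }
 rewrite F1, F2.
 have D1: Rabs (N*th-N*e*sin th-(N*(th^3/6)+N*(b*x*th))) <=
   N*(th^5/120+(b*x)^2*th+b*x*(th^3/6)).
 { replace (N*th-N*e*sin th-(N*(th^3/6)+N*(b*x*th))) with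
   (N*((th-sin th-th^3/6)+((1-e)-b*x)*sin th+b*x*(sin th-th))) by ring.
  rewrite Rabs_mult, Rabs_right by lra. apply Rmult_le_compat_l; [lra|].
  have: 0<=sin th by (apply sin_ge_0; have := PI2_1; lra).
  have: - ((b*x)^2*th)<=((1-e)-b*x)*sin th<=(b*x)^2*th by nra.
  have: - (b*x*(th^3/6))<=b*x*(sin th-th)<=0 by nra.
  alra. }
 eapply Rle_trans; [exact D1|].
 have Ng5: N*th^5=2*g^2*s^5 by (unfold th; transitivity (N*g^3*g^2*s^5); [ring|rewrite G3; ring]).
 have Nb2: N*((b*x)^2*th)=g^2/2*x^2*s by (unfold th; transitivity (N*b*g*(b*x^2*s)); [ring|rewrite NBG, G2; field]).
 have Nb3: N*(b*x*(th^3))=g^2*x*s^3 by (unfold th; transitivity (N*b*g*(g^2*x*s^3)); [ring|rewrite NBG; ring]).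
 replace (N*(th^5/120+(b*x)^2*th+b*x*(th^3/6))) with
  (N*th^5/120+N*((b*x)^2*th)+N*(b*x*(th^3))/6) by field.
 rewrite Ng5, Nb2, Nb3.
 have: s^5<=T^5 by mono. have: s^3<=T^3 by mono.
 have: 0<=s^3 by pos.
 have: s^5/60+x^2*s/2+x*s^3/6<=T^5+x^2*T+x*T^3 by nra.
 nra.
Qed.

(** T is chosen first, to make the two tails 4/T^2 and 2/T^2 small; n then grows so that the phases
    agree on [0, T]. *)
Lemma bj_lim (x : R) : 0 <= x -> is_lim_seq (fun n => bj n x) (Ai x).
Proof.
 intros Hx. apply is_lim_seq_spec. intros eps. destruct eps as [eps He]. simpl.
 have HPI := PI2_1.
 set (T := Rmax 1 (6/eps)). have T1 := Rmax_l 1 (6/eps). have T2 := Rmax_r 1 (6/eps). fold T in T1, T2.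
 have HT: 6/T^2<=eps.
 { apply Rmult_le_reg_r with (T^2); [nra|]. unfold Rdiv at 1. rewrite Rmult_assoc, Rinv_l, Rmult_1_r by nra.
  have E: 6=eps*(6/eps) by fld.
  have: eps*(6/eps)<=eps*T by mono.
  have: eps*T<=eps*T^2 by mono. lra. }
 set (K := T^5+x^2*T+x*T^3).
 have HK: 0<K.
 { unfold K. have: 0<T^5 by pos. have: 0<T^3 by pos. nra. }
 set (d := Rmin (/ T) (Rmin (/ (x+1)) (eps/(K*T+1)))).
 have HKT: 0<K*T by nra.
 have Hd1: d <= / T by apply Rmin_l.
 have Hd2: d <= / (x+1) by (eapply Rle_trans; [apply Rmin_r|apply Rmin_l]).
 have Hd3: d<=eps/(K*T+1) by (eapply Rle_trans; [apply Rmin_r|apply Rmin_r]).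
 have Hd0: 0<d.
 { repeat apply Rmin_glb_lt; [pos|pos|pos]. }
 destruct (gam_small d Hd0) as [n0 Hn0]. exists n0. intros n Hn. specialize (Hn0 n Hn).
 have Hg := gam_pos n. have G2 := gam_sq n.
 have HgT: gam n*T<=1.
 { trans (/ T*T); [mono|right; field; lra]. }
 have Hgx: gam n*(x+1)<=1.
 { trans (/ (x+1)*(x+1)); [mono|right; field; lra]. }
 have Hbx: bet n*x<=1 by nra.
 have B1 := bes_tail n x T Hx T1 HgT. have B2 := Ai_tail x T Hx T1.
 have B3: Rabs (RInt (fun s => cos (INR (S n)*(gam n*s)-2*tim n x*sin (gam n*s))) 0 T-airy_part x T)<=gam n^2*K*(T-0).
 { apply Rabs_RInt_close; [lra| | |].
  - intros s. eapply isd_continuous. isd. reflexivity.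
  - intros s. apply airy_cont.
  - intros s Hs. le_trans cos_lipschitz. apply bes_phase_close; lra. }
 have B4: gam n^2*K*T<eps.
 { apply Rle_lt_trans with (gam n*(K*T)).
  { replace (gam n^2*K*T) with (gam n*(gam n*(K*T))) by ring. have: 0<gam n*(K*T) by nra. nra. }
  apply Rle_lt_trans with (eps/(K*T+1)*(K*T)); [mono|].
  apply Rmult_lt_reg_r with (K*T+1); [lra|]. replace (eps/(K*T+1)*(K*T)*(K*T+1)) with (eps*(K*T)) by fld. nra. }
 abs_in B1. abs_in B2. abs_in B3.
 replace (4/T^2) with (6/T^2*(2/3)) in B1 by fld. replace (2/T^2) with (6/T^2*(1/3)) in B2 by fld.
 apply Rabs_lt_between. split; nra.
Qed.

(** * The rescaled solution on the right: decay and comparison with Bessel functions *)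

(** A positive slope h1 x of a convex function never decreases afterwards and would carry h above M
    within the length (M - h x)/h1 x + 1. *)
Lemma convex_bdd_decr (h h1 h2 : R -> R) (x0 M : R) :
 (forall x, x0 <= x -> is_derive h x (h1 x)) -> (forall x, x0 <= x -> is_derive h1 x (h2 x)) ->
 (forall x, x0 <= x -> 0 <= h2 x) -> (forall x, x0 <= x -> h x <= M) ->
 forall x, x0 <= x -> h1 x <= 0.
Proof.
 intros D D1 P B x Hx. apply Rnot_lt_le. intros Hn.
 have Hm: forall y, x<=y -> h1 x<=h1 y.
 { intros y Hy. apply (derive_nonneg_le h1 h2); [lra|intros; apply D1; lra|intros; apply P; lra]. }
 have := B x Hx. have: 0<=(M-h x)/h1 x by pos.
 set (y := x+(M-h x)/h1 x+1).
 have: h x-h1 x*x<=h y-h1 x*y.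
 { apply (derive_nonneg_le (fun s => h s-h1 x*s) (fun s => h1 s-h1 x)); [unfold y; lra| |].
  - intros s Hs. eapply isd_eq; [apply isd_minus; [apply D; lra|isd_]|]. cbv beta; ring.
  - intros s Hs. specialize (Hm s ok). lra. }
 have := B y ltac:(unfold y; lra). unfold y in *.
 replace (h1 x*(x+(M-h x)/h1 x+1)) with (h1 x*x+(M-h x)+h1 x) in * by fld. lra.
Qed.

Lemma convex_bdd_incr (h h1 h2 : R -> R) (x0 M : R) :
 (forall x, x <= x0 -> is_derive h x (h1 x)) -> (forall x, x <= x0 -> is_derive h1 x (h2 x)) ->
 (forall x, x <= x0 -> 0 <= h2 x) -> (forall x, x <= x0 -> h x <= M) ->
 forall x, x <= x0 -> 0 <= h1 x.
Proof.
 intros D D1 P B x Hx.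
 assert (- h1 (- (- x))<=0); [|rewrite Ropp_involutive in *; lra].
 apply (convex_bdd_decr (fun s => h (- s)) (fun s => - h1 (- s)) (fun s => h2 (- s)) (- x0) M); try lra.
 - intros s Hs. eapply isd_eq; [apply (isd_comp h (fun s => - s)); [apply D; lra|isd_]|]. cbv beta; ring.
 - intros s Hs. eapply isd_eq; [apply isd_opp, (isd_comp h1 (fun s => - s)); [apply D1; lra|isd_]|]. cbv beta; ring.
 - intros s Hs. apply P; lra.
 - intros s Hs. apply B; lra.
Qed.

(* Hard-to-soft edge rescaling of R_(n+1); solves a perturbed Painleve II equation. *)
Definition ff (n : nat) (x : R) : R := phi n x/gam n.
Definition ff1 (n : nat) (x : R) : R := phi1 n x/gam n.
Definition ff2 (n : nat) (x : R) : R := Fx (bet n) x (phi n x)/gam n.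

Lemma ff_derive n x : is_derive (ff n) x (ff1 n x).
Proof.
 unfold ff, ff1, Rdiv. eapply isd_eq; [apply isd_mult; [apply phi_derive|isd_]|]. cbv beta; ring.
Qed.
Lemma ff1_derive n x : is_derive (ff1 n) x (ff2 n x).
Proof.
 unfold ff1, ff2, Rdiv. eapply isd_eq; [apply isd_mult; [apply phi1_derive|isd_]|]. cbv beta; ring.
Qed.
Lemma ff_pos n x : 0 < ff n x.
Proof. unfold ff. apply Rdiv_lt_0_compat; [apply phi_range|apply gam_pos]. Qed.
Lemma phi_ff n x : phi n x = gam n*ff n x.
Proof. have := gam_pos n. unfold ff. field. lra. Qed.

Lemma ff2_lower n x : ff n x*(ff n x^2+Xb (bet n) x) <= ff2 n x.
Proof.
 have Hg := gam_pos n. have := bet_pos n. have L := Fx_lower (bet n) x (phi n x) ok (phi_range n x).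
 unfold ff2. rewrite phi_ff in L at 1 2. apply Rmult_le_reg_r with (gam n); [lra|].
 unfold Rdiv. rewrite (Rmult_assoc (Fx _ _ _)), Rinv_l, Rmult_1_r by lra.
 eapply Rle_trans; [|exact L]. right. rewrite Rpow_mult_distr, gam_sq. field. lra.
Qed.

Lemma ff2_upper n x : 0 <= x -> gam n*ff n x <= 1/2 -> ff2 n x <= ff n x*(Xb (bet n) x+4*ff n x^2).
Proof.
 intros Hx Hf. have Hg := gam_pos n. have := bet_pos n. 
 have Hp := phi_range n x. rewrite phi_ff in Hp.
 have U := Fx_upper (bet n) x (gam n*ff n x) ok Hx ok.
 unfold ff2. rewrite phi_ff. apply Rmult_le_reg_r with (gam n); [lra|].
 unfold Rdiv. rewrite (Rmult_assoc (Fx _ _ _)), Rinv_l, Rmult_1_r by lra.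
 eapply Rle_trans; [exact U|]. right. rewrite Rpow_mult_distr, gam_sq. field. lra.
Qed.

Lemma ff2_limit n x A M : Rabs x <= A -> ff n x <= M -> gam n*M <= 1/2 -> gam n^2*A <= 1 ->
 Rabs (ff2 n x-ff n x*(2*ff n x^2+x)) <= gam n^2*(6*M^4+2*A*M^2+A^2)*ff n x.
Proof.
 intros. unfold ff2. rewrite phi_ff. apply Fx_limit; auto; [apply gam_pos|]. split; [apply ff_pos|assumption].
Qed.

Lemma phi_le_sin n x : phi n x <= 3*sin (phi n x).
Proof.
 have := phi_range n x. have := PI_4. have := sin_ge_cubic (phi n x) ok. 
 set (p := phi n x) in *. have: p^3<=4*p by nra. lra.
Qed.

Lemma ff_to_0 n eps : 0 < eps -> exists x0, forall x, x0 <= x -> ff n x <= eps.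
Proof.
 intros He. have Hg := gam_pos n.
 destruct (tim_small n (Rmin (1/4) (eps*gam n/6))) as [x0 [_ Hx0]].
 { apply Rmin_glb_lt; [lra|]. apply Rdiv_lt_0_compat; [nra|lra]. }
 exists x0. intros x Hx. specialize (Hx0 x Hx).
 minmax. have := tim_pos n x. have L := dp2_le_lin n (tim n x) ok. rewrite <- sin_phi in L.
 have := phi_le_sin n x. unfold ff. apply Rmult_le_reg_r with (gam n); [lra|].
 unfold Rdiv. rewrite Rmult_assoc, Rinv_l, Rmult_1_r by lra. lra.
Qed.

Lemma ff_bj_to_1 n eps : 0 < eps -> exists x0, forall x, x0 <= x -> 0 < bj n x /\ Rabs (ff n x/bj n x-1) <= eps.
Proof.
 intros He0. set (eps' := Rmin eps 1). have He: 0<eps'<=1 by (split; [apply Rmin_glb_lt; lra|apply Rmin_r]).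
 have Hee: eps'<=eps by apply Rmin_l.
 have Hg := gam_pos n.
 destruct (dp2_bes_ratio (S n) (eps'/4)) as [d [Hd Hr]]; [lra|].
 destruct (tim_small n d Hd) as [x1 [_ Hx1]].
 destruct (ff_to_0 n (eps'/gam n)) as [x2 Hx2]; [pos|].
 exists (Rmax x1 x2). intros x Hx. minmax. specialize (Hx1 x ok). specialize (Hx2 x ok). have := tim_pos n x.
 specialize (Hr (tim n x) ok). destruct Hr as [HJ Hr].
 have Hp: phi n x<=eps'.
 { rewrite phi_ff. apply Rmult_le_compat_l with (r := gam n) in Hx2; [|lra]. replace (gam n*(eps'/gam n)) with eps' in Hx2 by fld. lra. }
 have Pr := phi_range n x. have S1 := sin_ge_cubic (phi n x) ok. have S2 := sin_le_id (phi n x) ok.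
 split; [unfold bj; apply Rdiv_lt_0_compat; lra|]. rewrite <- sin_phi in Hr.
 unfold ff, bj. set (J := bes (INR (S n)) (tim n x)) in *. set (p := phi n x) in *.
 replace (p/gam n/(J/gam n)) with (p/J) by fld.
 set (r := sin p/J) in *. have Er: sin p=r*J by (unfold r; field; lra).
 set (w := p/J). have Ew: p=w*J by (unfold w; field; lra).
 abs_in Hr.
 have: w*(1-eps'/6)<=r by (apply Rmult_le_reg_r with J; [lra|]; rewrite <- Er; nra).
 apply Rabs_le. nra.
Qed.

Lemma Xb_nonneg b x : 0 < b -> 0 <= x -> 0 <= Xb b x.
Proof.
 intros Hb Hx. unfold Xb. have: exp (- (2*b*x))<=1 by mono.
 apply Rmult_le_pos; [lra|]. apply Rlt_le, Rinv_0_lt_compat. lra.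
Qed.

Lemma Xb_ge_1 b x : 0 < b <= 1/8 -> 2 <= x -> 1 <= Xb b x.
Proof.
 intros Hb Hx. unfold Xb. have E := exp_quad (4*b) ltac:(apply Rabs_le; lra). abs_in E.
 have: exp (- (2*b*x))<=exp (- (4*b)) by mono.
 apply Rmult_le_reg_r with (2*b); [lra|]. unfold Rdiv. rewrite Rmult_assoc, Rinv_l, Rmult_1_r by lra.
 nra.
Qed.

Lemma Xb_lower b A x : 0 < b -> 0 < A -> 2*b*A <= 1 -> - A <= x -> - (2*A) <= Xb b x.
Proof.
 intros Hb HA HbA Hx. unfold Xb. have E := exp_quad (- (2*b*A)) ltac:(rewrite Rabs_Ropp; apply Rabs_le; nra).
 abs_in E. rewrite Ropp_involutive in E.
 have: exp (- (2*b*x))<=exp (2*b*A) by mono.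
 apply Rmult_le_reg_r with (2*b); [lra|]. unfold Rdiv. rewrite Rmult_assoc, Rinv_l, Rmult_1_r by lra.
 have: 0<2*b*A by nra. set (z := 2*b*A) in *. replace (- (2*A)*(2*b)) with (- (2*z)) by (unfold z; ring). nra.
Qed.

Lemma sqrt2_cube : sqrt 2*sqrt 2 = 2. Proof. apply sqrt_sqrt; lra. Qed.

(* Keller-Osserman barrier *)
Lemma ff_upper n A x : 0 < A -> 2*bet n*A <= 1 -> - A < x -> ff n x <= sqrt (2*A)+sqrt 2/(x+A).
Proof.
 intros HA HbA Hx. have Hb := bet_pos n. have Hg := gam_pos n.
 have S2: 0<sqrt 2 by pos. have SA: 0<sqrt (2*A) by pos.
 have S22 := sqrt2_cube. have SAA: sqrt (2*A)*sqrt (2*A)=2*A by (apply sqrt_sqrt; lra).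
 destruct (ff_to_0 n (sqrt (2*A)) SA) as [x1 Hx1].
 have := PI_RGT_0.
 set (k := PI/2/gam n). have Hk: 0<k by (unfold k; apply Rdiv_lt_0_compat; lra).
 have Hfk: forall s, ff n s<=k.
 { intros s. unfold ff, k, Rdiv. apply Rmult_le_compat_r; [pos|]. have := phi_range n s. lra. }
 (* At l the singular term sqrt 2/(x + A) already exceeds the trivial bound k = PI/(2 gam). *)
 set (l := Rmin x (- A+sqrt 2/k)). set (r := Rmax x x1).
 have: 0<sqrt 2/k by pos.
 have: l<=x by apply Rmin_l. have Hl2: l <= - A+sqrt 2/k by apply Rmin_r.
 have: - A<l by (apply Rmin_glb_lt; lra). have: x<=r by apply Rmax_l. have: x1<=r by apply Rmax_r.
 replace (sqrt (2*A)+sqrt 2/(x+A)) with (1*(sqrt (2*A)+sqrt 2/(x+A))) by ring.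
 (* sqrt 2/(x + A) solves y'' = y^3, and the constant sqrt(2A) absorbs the negative coefficient [Xb]
    >= -2A. *)
 apply (ratio_max (ff n) (ff1 n) (ff2 n) (fun x => sqrt (2*A)+sqrt 2/(x+A))
   (fun x => - sqrt 2/(x+A)^2) (fun x => 2*sqrt 2/(x+A)^3) l r 1); try lra.
 - intros; apply ff_derive.
 - intros; apply ff1_derive.
 - intros s Hs. isd; [lra|]. lra.
 - intros s Hs. isd; [apply pow_nonzero; lra|]. simpl. field. lra.
 - intros s Hs. have: 0<sqrt 2/(s+A) by pos. lra.
 - intros s Hs Hlt. have L := ff2_lower n s. have XL := Xb_lower (bet n) A s Hb HA HbA ok.
  set (a := ff n s) in *. set (w := / (s+A)). have Hw: 0<w by (apply Rinv_0_lt_compat; lra).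
  unfold Rdiv in *. fold w in Hlt. fold w.
  have E3: 2*sqrt 2 * / (s+A)^3=(sqrt 2*w)^3.
  { unfold w. replace ((sqrt 2 * / (s+A))^3) with (sqrt 2*sqrt 2*sqrt 2 * / (s+A)^3) by fld. rewrite S22. ring. }
  rewrite E3.
  set (y := sqrt 2*w) in *. set (z := sqrt (2*A)) in *.
  have Hy: 0<y by (unfold y; nra). 
  have: a*(a^2-z*z)<=ff2 n s by (rewrite SAA; eapply Rle_trans; [|exact L]; apply Rmult_le_compat_l; lra).
  have: a*(a^2-z*z)*(z+y)<=ff2 n s*(z+y) by mono.
  have: y^3<(a^2-z*z)*(z+y).
  { have: y^2<a^2-z*z by nra. nra. }
  have: a*y^3<a*((a^2-z*z)*(z+y)) by (apply Rmult_lt_compat_l; lra). lra.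
 - rewrite Rmult_1_l. specialize (Hfk l). assert (k<=sqrt 2/(l+A)); [|lra].
  apply Rmult_le_reg_r with (l+A); [lra|]. unfold Rdiv at 1. rewrite Rmult_assoc, Rinv_l, Rmult_1_r by lra.
  assert (l+A<=sqrt 2/k) as Q by lra. apply Rmult_le_compat_l with (r := k) in Q; [|lra].
  replace (k*(sqrt 2/k)) with (sqrt 2) in Q by fld. lra.
 - rewrite Rmult_1_l. specialize (Hx1 r ok). have: 0<sqrt 2/(r+A) by pos. lra.
Qed.

Lemma sqrt2_bounds : 1.4 < sqrt 2 < 1.5.
Proof. have := sqrt2_cube. have: 0<sqrt 2 by pos. split; nra. Qed.

Lemma ff_convex n x : 0 <= x -> 0 <= ff2 n x.
Proof.
 intros Hx. have := ff2_lower n x. have := ff_pos n x. have := Xb_nonneg (bet n) x (bet_pos n) Hx.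
 nra.
Qed.

Lemma ff_decr n x : 0 <= x -> ff1 n x <= 0.
Proof.
 apply (convex_bdd_decr (ff n) (ff1 n) (ff2 n) 0 (PI/2/gam n)); intros.
 - apply ff_derive. - apply ff1_derive. - now apply ff_convex.
 - unfold ff, Rdiv. apply Rmult_le_compat_r; [apply Rlt_le, Rinv_0_lt_compat, gam_pos|]. have := phi_range n x0. lra.
Qed.

(** (exp(-x)(f + f'))' = exp(-x)(f'' - f) >= 0 because [Xb] >= 1 for x >= 2. A positive value of f +
    f' would thus persist and grow, although f tends to 0 and f' <= 0. *)
Lemma ff_log_decr n x : bet n <= 1/8 -> 2 <= x -> ff n x+ff1 n x <= 0.
Proof.
 intros Hb Hx. apply Rnot_lt_le. intros Hn. set (c := ff n x+ff1 n x) in *.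
 destruct (ff_to_0 n (c/2)) as [x1 Hx1]; [lra|].
 set (y := Rmax x x1). have Y1 := Rmax_l x x1. have Y2 := Rmax_r x x1. fold y in Y1, Y2.
 have: exp (- x)*(ff n x+ff1 n x)<=exp (- y)*(ff n y+ff1 n y).
 { apply (derive_nonneg_le (fun s => exp (- s)*(ff n s+ff1 n s)) (fun s => exp (- s)*(ff2 n s-ff n s))); [lra| |].
  - intros s Hs. have := ff_derive n s. have := ff1_derive n s. isd. ring.
  - intros s Hs. apply Rmult_le_pos; [pos|].
   have := ff2_lower n s. have := ff_pos n s. have := Xb_ge_1 (bet n) s ltac:(pose proof (bet_pos n); lra) ok.
   nra. }
 have E: exp (- y)*exp y=1 by (rewrite <- exp_plus; replace (- y+y) with 0 by ring; apply exp_0).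
 have E2: exp (- x)*exp y >= 1 by (rewrite <- exp_plus, <- exp_0; apply Rle_ge, exp_le_mono; lra).
 fold c in H. specialize (Hx1 y Y2). have := ff_decr n y ok.
 have: exp (- x)*c*exp y<=exp (- y)*(ff n y+ff1 n y)*exp y by mono.
 replace (exp (- x)*c*exp y) with (c*(exp (- x)*exp y)) in H1 by ring.
 replace (exp (- y)*(ff n y+ff1 n y)*exp y) with ((ff n y+ff1 n y)*(exp (- y)*exp y)) in H1 by ring.
 rewrite E in H1. nra.
Qed.

(** The barrier with A = 1 gives f <= 2 at x = 2 independently of n, and exp(x) f decreases from
    there on. *)
Lemma ff_decay n x : bet n <= 1/8 -> 2 <= x -> ff n x <= 2*exp (2-x).
Proof.
 intros Hb Hx. 
 have H2: ff n 2<=2.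
 { have U := ff_upper n 1 2 ok ok ok. rewrite Rmult_1_r in U. have := sqrt2_bounds. lra. }
 have: - (exp 2*ff n 2) <= - (exp x*ff n x).
 { apply (derive_nonneg_le (fun s => - (exp s*ff n s)) (fun s => - (exp s*(ff n s+ff1 n s)))); [lra| |].
  - intros s Hs. have := ff_derive n s. isd. ring.
  - intros s Hs. have := ff_log_decr n s Hb ok. have := exp_pos s. nra. }
 unfold Rminus. rewrite exp_plus, exp_Ropp. have := exp_pos x. have := exp_pos 2.
 apply Rmult_le_reg_l with (exp x); [lra|]. replace (exp x*(2*(exp 2 * / exp x))) with (2*exp 2) by fld. nra.
Qed.

(** Near +oo the sign comes from the nonlinear solution, whose ratio to [bj] tends to 1. It is
    carried to the left by the linear equation, in which [Xb] >= 0. *)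
Lemma bj_pos n x : 0 <= x -> 0 < bj n x.
Proof.
 intros Hx. destruct (ff_bj_to_1 n (1/2)) as [x1 Hx1]; [lra|].
 set (x2 := Rmax x x1). have Y1 := Rmax_l x x1. have Y2 := Rmax_r x x1. fold x2 in Y1, Y2.
 have J2: forall y, x2<=y -> 0<bj n y by (intros; apply Hx1; lra).
 have D2: bj1 n x2<=0.
 { apply (convex_bdd_decr (bj n) (bj1 n) (fun s => Xb (bet n) s*bj n s) x2 (/ gam n)); [..|lra].
  - intros; apply bj_derive. - intros; apply bj1_derive.
  - intros s Hs. apply Rmult_le_pos; [apply Xb_nonneg; [apply bet_pos|lra]|apply Rlt_le, J2, Hs].
  - intros s Hs. unfold bj. have B := bes_bound (INR (S n)) (tim n s). abs_in B.
   have := Rinv_0_lt_compat _ (gam_pos n). unfold Rdiv. nra. }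
 have J2' := J2 x2 ok.
 (* j j' increases, so j^2 decreases up to x2 and j has no zero before x2 *)
 have Q: forall s, 0<=s<=x2 -> bj n s*bj1 n s<=0.
 { intros s Hs. trans (bj n x2*bj1 n x2); [|nra].
  apply (derive_nonneg_le (fun s => bj n s*bj1 n s) (fun s => bj1 n s*bj1 n s+bj n s*(Xb (bet n) s*bj n s))); [lra| |].
  - intros u Hu. apply isd_mult; [apply bj_derive|apply bj1_derive].
  - intros u Hu. have := Xb_nonneg (bet n) u (bet_pos n) ok.
   nra. }
 have SQ: forall s, 0<=s<=x2 -> bj n x2*bj n x2<=bj n s*bj n s.
 { intros s Hs. assert (- (bj n s*bj n s) <= - (bj n x2*bj n x2)); [|lra].
  apply (derive_nonneg_le (fun s => - (bj n s*bj n s)) (fun s => - (2*(bj n s*bj1 n s)))); [lra| |].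
  - intros u Hu. eapply isd_eq; [apply isd_opp, isd_mult; apply bj_derive|]. cbv beta; ring.
  - intros u Hu. specialize (Q u ok). lra. }
 destruct (Rlt_le_dec 0 (bj n x)) as [|Hneg]; [assumption|exfalso].
 destruct (IVT_gen (bj n) x x2 0) as [z [Hz1 Hz2]].
 { intros s. apply continuity_pt_filterlim. eapply isd_continuous, bj_derive. }
 { rewrite Rmin_left, Rmax_right by lra. lra. }
 rewrite Rmin_left, Rmax_right in Hz1 by lra. specialize (SQ z ok). rewrite Hz2 in SQ. nra.
Qed.

Lemma bj_decr n x : 0 <= x -> bj1 n x <= 0.
Proof.
 apply (convex_bdd_decr (bj n) (bj1 n) (fun s => Xb (bet n) s*bj n s) 0 (/ gam n)); intros.
 - apply bj_derive. - apply bj1_derive.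
 - apply Rmult_le_pos; [apply Xb_nonneg; [apply bet_pos|lra]|apply Rlt_le, bj_pos; lra].
 - unfold bj. have B := bes_bound (INR (S n)) (tim n x0). abs_in B.
  have := Rinv_0_lt_compat _ (gam_pos n). unfold Rdiv. nra.
Qed.

Definition wr (n : nat) (x : R) : R := ff1 n x*bj n x-ff n x*bj1 n x.

Lemma wr_derive n x : is_derive (wr n) x (ff2 n x*bj n x-ff n x*(Xb (bet n) x*bj n x)).
Proof.
 unfold wr. eapply isd_eq; [apply isd_minus; apply isd_mult; [apply ff1_derive|apply bj_derive|apply ff_derive|apply bj1_derive]|]. cbv beta; ring.
Qed.

Lemma ratio_derive n x : 0 <= x -> is_derive (fun s => ff n s/bj n s) x (wr n x/bj n x^2).
Proof.
 intros Hx. have := bj_pos n x Hx. eapply isd_eq; [apply isd_div; [apply ff_derive|apply bj_derive|lra]|]. reflexivity.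
Qed.

(** The Wronskian increases, since the nonlinear coefficient f''/f is at least [Xb]. If it were
    positive at x, the ratio [ff]/[bj] would grow at least linearly from x on, against its limit
    1. *)
Lemma wr_neg n x : 0 <= x -> wr n x <= 0.
Proof.
 intros Hx. apply Rnot_lt_le. intros Hn.
 have Inc: forall y, x<=y -> wr n x<=wr n y.
 { intros y Hy. apply (derive_nonneg_le (wr n) _ x y Hy (fun s _ => wr_derive n s)).
  intros s Hs. have := ff2_lower n s. have := ff_pos n s. have := bj_pos n s ok.
  have: ff n s*Xb (bet n) s<=ff2 n s by nra. nra. }
 destruct (ff_bj_to_1 n 1) as [x1 Hx1]; [lra|].
 have Jx := bj_pos n x Hx. set (c := wr n x/bj n x^2).
 have Hc: 0<c by (apply Rdiv_lt_0_compat; [lra|apply pow_lt; lra]).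
 set (y := Rmax x x1+3/c). have := Rmax_l x x1. have := Rmax_r x x1.
 have: 0<3/c by pos.
 have R1: ff n x/bj n x-c*x<=ff n y/bj n y-c*y.
 { apply (derive_nonneg_le (fun s => ff n s/bj n s-c*s) (fun s => wr n s/bj n s^2-c)); [unfold y; lra| |].
  - intros s Hs. eapply isd_eq; [apply isd_minus; [apply ratio_derive; lra|isd_]|]. cbv beta; ring.
  - intros s Hs. have Js := bj_pos n s ok. specialize (Inc s ok).
   have: bj n s<=bj n x.
   { assert (- bj n x <= - bj n s); [|lra].
    apply (derive_nonneg_le (fun s => - bj n s) (fun s => - bj1 n s)); [lra|intros; apply isd_opp, bj_derive|].
    intros u Hu. have := bj_decr n u ok. lra. }
   have: / bj n x^2 <= / bj n s^2 by mono.
   have: 0 < / bj n x^2 by pos.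
   unfold c, Rdiv. have: wr n x * / bj n x^2<=wr n s * / bj n s^2 by mono. lra. }
 destruct (Hx1 y ltac:(unfold y; lra)) as [_ Hy]. abs_in Hy.
 have: 0<ff n x/bj n x by (apply Rdiv_lt_0_compat; [apply ff_pos|lra]).
 have: c*(y-x) >= 3.
 { apply Rle_ge. trans (c*(3/c)); [right; field; lra|apply Rmult_le_compat_l; [lra|unfold y; lra]]. }
 lra.
Qed.

(** By the sign of the Wronskian the ratio decreases, and its limit at +oo is 1. *)
Lemma ff_ge_bj n x : 0 <= x -> 1 <= ff n x/bj n x.
Proof.
 intros Hx. apply Rnot_lt_le. intros Hn.
 destruct (ff_bj_to_1 n ((1-ff n x/bj n x)/2)) as [x1 Hx1]; [lra|].
 set (y := Rmax x x1). have Y1 := Rmax_l x x1. have Y2 := Rmax_r x x1. fold y in Y1, Y2.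
 destruct (Hx1 y ok) as [_ Hy]. abs_in Hy.
 assert (- (ff n x/bj n x) <= - (ff n y/bj n y)); [|lra].
 apply (derive_nonneg_le (fun s => - (ff n s/bj n s)) (fun s => - (wr n s/bj n s^2))); [lra| |].
 - intros s Hs. apply isd_opp, ratio_derive. lra.
 - intros s Hs. have := wr_neg n s ok. have := bj_pos n s ok.
  have: 0 < / bj n s^2 by pos. unfold Rdiv. nra.
Qed.

(** Minus the logarithmic derivative of [ff]/[bj], hence nonnegative on x >= 0 by [wr_neg]. *)
Definition lam (n : nat) (x : R) : R := bj1 n x/bj n x-ff1 n x/ff n x.

Lemma lam_derive n x : 0 <= x -> is_derive (lam n) x
 (- (ff2 n x/ff n x-Xb (bet n) x)-lam n x*(ff1 n x/ff n x+bj1 n x/bj n x)).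
Proof.
 intros Hx. have := bj_pos n x Hx. have := ff_pos n x. unfold lam. eapply isd_eq.
 - apply isd_minus; apply isd_div; [apply bj1_derive|apply bj_derive|lra|apply ff1_derive|apply ff_derive|lra].
 - field. lra.
Qed.

Lemma exp_m2_derive (k x : R) : is_derive (fun s => k*exp (- (2*s))) x (- (2*k)*exp (- (2*x))).
Proof. isd. ring. Qed.

Lemma ff_sq_decay n x : bet n <= 1/8 -> 2 <= x -> 4*ff n x^2 <= 16*exp 4*exp (- (2*x)).
Proof.
 intros Hb Hx. have := ff_decay n x Hb Hx. have := ff_pos n x.
 have: ff n x^2<=(2*exp (2-x))^2 by mono.
 replace (16*exp 4*exp (- (2*x))) with (4*(2*exp (2-x))^2); [lra|].
 replace (exp 4*exp (- (2*x))) with (exp (2-x)*exp (2-x)) by (rewrite <- !exp_plus; f_equal; ring).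
 rewrite Rmult_assoc, <- (exp_plus 4). replace (4 + - (2*x)) with ((2-x)+(2-x)) by ring. rewrite exp_plus. ring.
Qed.

(** The excess f''/f - [Xb] is at most 4f^2 <= 16 exp(4) exp(-2x), and the other term of lam' is
    nonnegative; so lam - 8 exp(4) exp(-2x) increases. A positive value c of it would force
    log([ff]/[bj]) to fall with slope at most -c, below its lower bound 0. *)
Lemma lam_bound n x : bet n <= 1/8 -> gam n <= 1/4 -> 2 <= x -> lam n x <= 8*exp 4*exp (- (2*x)).
Proof.
 intros Hb Hg Hx. apply Rnot_lt_le. intros Hn. set (c := lam n x-8*exp 4*exp (- (2*x))) in *.
 have Inc: forall y, x<=y -> c<=lam n y-8*exp 4*exp (- (2*y)).
 { intros y Hy. unfold c.
  apply (derive_nonneg_le (fun s => lam n s-8*exp 4*exp (- (2*s)))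
   (fun s => (- (ff2 n s/ff n s-Xb (bet n) s)-lam n s*(ff1 n s/ff n s+bj1 n s/bj n s))-(- (2*(8*exp 4))*exp (- (2*s))))); [lra| |].
  - intros s Hs. apply isd_minus; [apply lam_derive; lra|apply exp_m2_derive].
  - intros s Hs. have Fp := ff_pos n s. have Jp := bj_pos n s ok.
   have := ff_decr n s ok. have := bj_decr n s ok. have W := wr_neg n s ok.
   have Dc := ff_decay n s Hb ok. have := ff_sq_decay n s Hb ok.
   have: exp (2-s)<=1 by mono.
   have U := ff2_upper n s ok ltac:(nra).
   have: ff2 n s/ff n s<=Xb (bet n) s+4*ff n s^2.
   { apply Rmult_le_reg_r with (ff n s); [lra|]. unfold Rdiv. rewrite Rmult_assoc, Rinv_l by lra. lra. }
   have: 0<=lam n s.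
   { unfold lam. replace (bj1 n s/bj n s-ff1 n s/ff n s) with (- wr n s * / (ff n s*bj n s)) by (unfold wr; field; lra).
    apply Rmult_le_pos; [lra|]. apply Rlt_le, Rinv_0_lt_compat. nra. }
   have: ff1 n s/ff n s<=0 by (have := Rinv_0_lt_compat _ Fp; unfold Rdiv; nra).
   have: bj1 n s/bj n s<=0 by (have := Rinv_0_lt_compat _ Jp; unfold Rdiv; nra).
   nra. }
 have Hc: 0<c by (unfold c; lra).
 set (y := x+(ln (ff n x/bj n x)+1)/c).
 have := ff_ge_bj n x ok. have L0: 0<=ln (ff n x/bj n x) by (rewrite <- ln_1; apply ln_le; lra).
 have: 0<(ln (ff n x/bj n x)+1)/c by pos.
 have: - ln (ff n x/bj n x)-c*x <= - ln (ff n y/bj n y)-c*y.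
 { apply (derive_nonneg_le (fun s => - ln (ff n s/bj n s)-c*s) (fun s => lam n s-c)); [unfold y; lra| |].
  - intros s Hs. have Fp := ff_pos n s. have Jp := bj_pos n s ok. eapply isd_eq.
   + apply isd_minus; [apply isd_opp, isd_ln; [apply ratio_derive; lra|pos]|isd_].
   + unfold lam, wr. field. lra.
  - intros s Hs. specialize (Inc s ok). have := exp_pos (- (2*s)). have := exp_pos 4. nra. }
 have := ff_ge_bj n y ltac:(unfold y; lra). have: 0<=ln (ff n y/bj n y) by (rewrite <- ln_1; apply ln_le; lra).
 have: c*y=c*x+ln (ff n x/bj n x)+1 by (unfold y; field; lra). lra.
Qed.

(** [lam_bound] is integrated from x to +oo, where the logarithm of the ratio vanishes. The bound is
    uniform in n, unlike [ff_bj_to_1]. *)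
Lemma ff_le_bj n x : bet n <= 1/8 -> gam n <= 1/4 -> 2 <= x -> ff n x/bj n x <= exp (4*exp 4*exp (- (2*x))).
Proof.
 intros Hb Hg Hx. have Fp := ff_pos n x. have Jp := bj_pos n x ok.
 have: 0<ff n x/bj n x by pos.
 rewrite <- (exp_ln (ff n x/bj n x)) by assumption. apply exp_le_mono. apply Rnot_lt_le. intros Hn.
 set (c := ln (ff n x/bj n x)-4*exp 4*exp (- (2*x))) in *.
 destruct (ff_bj_to_1 n (c/2)) as [x1 Hx1]; [unfold c; lra|].
 set (y := Rmax x x1). have Y1 := Rmax_l x x1. have Y2 := Rmax_r x x1. fold y in Y1, Y2.
 destruct (Hx1 y Y2) as [_ Hy]. abs_in Hy.
 have Fy := ff_pos n y. have Jy := bj_pos n y ok.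
 have := ln_le_sub1 (ff n y/bj n y) ltac:(apply Rdiv_lt_0_compat; lra).
 have: c<=ln (ff n y/bj n y)-4*exp 4*exp (- (2*y)).
 { unfold c. apply (derive_nonneg_le (fun s => ln (ff n s/bj n s)-4*exp 4*exp (- (2*s))) (fun s => - lam n s-(- (2*(4*exp 4))*exp (- (2*s))))); [lra| |].
  - intros s Hs. have Fs := ff_pos n s. have Js := bj_pos n s ok. apply isd_minus; [|apply exp_m2_derive].
   eapply isd_eq; [apply isd_ln; [apply ratio_derive; lra|pos]|]. unfold lam, wr. field. lra.
  - intros s Hs. have := lam_bound n s Hb Hg ok. lra. }
 have := exp_pos (- (2*y)). have := exp_pos 4. nra.
Qed.

(** * Local bounds to the left, Gronwall's inequality and positivity of Ai *)

Lemma gam_sq_small (K eps : R) : 0 <= K -> 0 < eps -> exists n0, forall n, (n0 <= n)%nat -> gam n^2*K <= eps.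
Proof.
 intros HK He. destruct (bet_small (eps/(2*(K+1)))) as [n0 H]; [pos|].
 exists n0. intros n Hn. specialize (H n Hn). rewrite gam_sq. have := bet_pos n.
 trans (2*bet n*(K+1)); [nra|].
 trans (2*(eps/(2*(K+1)))*(K+1)); [mono|right; field; lra].
Qed.

(** e cos((PI/2)(x - x0)) vanishes at x0 - 1 and x0 + 1. On that window 2e^2 + x + (PI/2)^2 < 0,
    which makes it a strict subsolution wherever it exceeds [ff], up to an error O(gam^2) absorbed
    by half of the margin m. *)
Lemma ff_bump (x0 e : R) : 0 < e -> 2*e^2 < - x0-1-(PI/2)^2 ->
 exists n0, forall n, (n0 <= n)%nat -> e <= ff n x0.
Proof.
 intros He Hm. have Hx0: x0<0 by nra. set (A := - x0+1). have HA: 1<=A by (unfold A; nra).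
 set (K := 6*e^4+2*A*e^2+A^2).
 have HK: 0<=K by (unfold K; have: 0<e^4 by pos; nra).
 set (m := - x0-1-(PI/2)^2-2*e^2).
 destruct (gam_sq_small K (m/2) HK) as [n1 H1]; [unfold m; lra|].
 destruct (gam_sq_small A 1) as [n2 H2]; [lra|lra|].
 destruct (gam_small (/ (2*e))) as [n3 H3]; [pos|].
 exists (max n1 (max n2 n3)). intros n Hn.
 specialize (H1 n okn). specialize (H2 n okn). specialize (H3 n okn).
 have Hge: gam n*e<=1/2.
 { trans (/ (2*e)*e); [mono|right; field; lra]. }
 set (a := fun x => e*cos (PI/2*(x-x0))).
 have E0: a x0=e by (unfold a; replace (PI/2*(x0-x0)) with 0 by ring; rewrite cos_0; ring).
 rewrite <- E0 at 1. rewrite <- (Rmult_1_l (ff n x0)).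
 apply (ratio_max a (fun x => - e*(PI/2)*sin (PI/2*(x-x0))) (fun x => - (PI/2)^2*a x)
   (ff n) (ff1 n) (ff2 n) (x0-1) (x0+1) 1); try lra.
 - intros x Hx. unfold a. isd. field.
 - intros x Hx. unfold a. isd. field.
 - intros; apply ff_derive.
 - intros; apply ff1_derive.
 - intros; apply ff_pos.
 - intros x Hx Hlt. have Fp := ff_pos n x. unfold a in Hlt. have CB := COS_bound (PI/2*(x-x0)).
  have Hae: a x<=e by (unfold a; nra).
  have Hfe: ff n x<=e by (fold (a x) in Hlt; lra).
  have L := ff2_limit n x A e ltac:(apply Rabs_le; unfold A; lra) Hfe Hge H2. fold K in L.
  abs_in L. fold (a x) in Hlt. set (b := ff n x) in *.
  have: a x*(ff2 n x)<=a x*(b*(2*(e*e)+x+m/2)).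
  { apply Rmult_le_compat_l; [lra|]. have: gam n^2*K*b<=m/2*b by mono.
   have: b*(2*b^2+x)<=b*(2*(e*e)+x) by mono. lra. }
  have: 0<a x*b*(- (PI/2)^2-(2*(e*e)+x+m/2)).
  { apply Rmult_lt_0_compat; [pos|]. unfold m. lra. }
  lra.
 - unfold a. replace (PI/2*(x0-1-x0)) with (- (PI/2)) by ring. rewrite cos_neg, cos_PI2. have := ff_pos n (x0-1). lra.
 - unfold a. replace (PI/2*(x0+1-x0)) with (PI/2) by ring. rewrite cos_PI2. have := ff_pos n (x0+1). lra.
Qed.

(** The function exp((L+2)x)(d^2 + d'^2 + eps^2) increases, so the energy at x is controlled by that
    at r. *)
Lemma gronwall_left (d d1 d2 : R -> R) (l r L eps : R) :
 0 <= L -> l <= r ->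
 (forall x, l <= x <= r -> is_derive d x (d1 x)) -> (forall x, l <= x <= r -> is_derive d1 x (d2 x)) ->
 (forall x, l <= x <= r -> Rabs (d2 x) <= L*Rabs (d x)+eps) ->
 forall x, l <= x <= r -> d x^2+d1 x^2 <= (d r^2+d1 r^2+eps^2)*exp ((L+2)*(r-l)).
Proof.
 intros HL Hlr D D1 B x Hx.
 have E: exp ((L+2)*x)*(d x^2+d1 x^2+eps^2)<=exp ((L+2)*r)*(d r^2+d1 r^2+eps^2).
 { apply (derive_nonneg_le (fun x => exp ((L+2)*x)*(d x^2+d1 x^2+eps^2))
   (fun x => exp ((L+2)*x)*((L+2)*(d x^2+d1 x^2+eps^2)+2*d x*d1 x+2*d1 x*d2 x))); [lra| |].
  - intros s Hs. assert (Ds := D s ok). assert (D1s := D1 s ok). isd. simpl. ring.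
  - intros s Hs. specialize (B s ok). apply Rmult_le_pos; [pos|].
   have A1: - (Rabs (d s)*Rabs (d1 s))<=d s*d1 s by (rewrite <- Rabs_mult; have Q := Rle_abs (- (d s*d1 s)); rewrite Rabs_Ropp in Q; lra).
   have A2: - (Rabs (d1 s)*(L*Rabs (d s)+eps))<=d1 s*d2 s.
   { trans (- (Rabs (d1 s)*Rabs (d2 s))).
    - apply Ropp_le_contravar, Rmult_le_compat_l; [pos|lra].
    - rewrite <- Rabs_mult. have Q := Rle_abs (- (d1 s*d2 s)); rewrite Rabs_Ropp in Q; lra. }
   rewrite <- (pow2_abs (d s)), <- (pow2_abs (d1 s)). set (u := Rabs (d s)) in *. set (v := Rabs (d1 s)) in *.
   have: 2*(u*v)<=u^2+v^2 by (have := pow2_ge_0 (u-v); lra).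
   have: 2*(v*eps)<=v^2+eps^2 by (have := pow2_ge_0 (v-eps); lra).
   have: L*(2*(u*v))<=L*(u^2+v^2) by mono.
   have: 0<=L*eps^2 by pos.
   have := pow2_ge_0 u. have := pow2_ge_0 eps. lra. }
 replace ((L+2)*r) with ((L+2)*(r-x)+(L+2)*x) in E by ring. rewrite exp_plus in E.
 have P := exp_pos ((L+2)*x).
 have E2: d x^2+d1 x^2+eps^2<=exp ((L+2)*(r-x))*(d r^2+d1 r^2+eps^2).
 { apply Rmult_le_reg_l with (exp ((L+2)*x)); [lra|]. lra. }
 have: exp ((L+2)*(r-x))<=exp ((L+2)*(r-l)) by mono.
 have := pow2_ge_0 (d r). have := pow2_ge_0 (d1 r). have := pow2_ge_0 eps.
 eapply Rle_trans; [|apply Rmult_le_compat_l with (2 := H); lra]. lra.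
Qed.

(** The upper barrier is used with A + 1, whose pole stays at distance 1 from the half-line x >=
    -A. *)
Lemma ff_bounded_on (A : R) : 1 <= A -> exists M n0, 0 < M /\ forall n, (n0 <= n)%nat -> forall x, - A <= x -> ff n x <= M.
Proof.
 intros HA. exists (sqrt (2*(A+1))+sqrt 2).
 have: 0<sqrt (2*(A+1)) by pos. have: 0<sqrt 2 by pos.
 destruct (bet_small (/ (2*(A+1)))) as [n0 H1]; [pos|].
 exists n0. split; [lra|]. intros n Hn x Hx. specialize (H1 n Hn).
 have: 2*bet n*(A+1)<=1.
 { trans (2 * / (2*(A+1))*(A+1)); [mono|right; field; lra]. }
 eapply Rle_trans; [apply (ff_upper n (A+1)); lra|].
 apply Rplus_le_compat_l. unfold Rdiv. rewrite <- (Rmult_1_r (sqrt 2)) at 2. apply Rmult_le_compat_l; [lra|].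
 rewrite <- Rinv_1. apply Rinv_le_contravar; lra.
Qed.

Lemma Ai_ge_0 x : 0 <= x -> 0 <= Ai x.
Proof.
 intros Hx. have L := bj_lim x Hx.
 apply (is_lim_seq_le (fun _ => 0) (fun n => bj n x) 0 (Ai x)); [|apply is_lim_seq_const|exact L].
 intros n. apply Rlt_le, bj_pos, Hx.
Qed.

Lemma bj_le_ff n x : 0 <= x -> bj n x <= ff n x.
Proof.
 intros Hx. have H := ff_ge_bj n x Hx. have := bj_pos n x Hx.
 apply Rmult_le_compat_r with (r := bj n x) in H; [|lra]. unfold Rdiv in H. rewrite Rmult_assoc, Rinv_l in H by lra. lra.
Qed.

Lemma edge_params : exists n0, forall n, (n0 <= n)%nat -> bet n <= 1/8 /\ gam n <= 1/4.
Proof.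
 destruct (bet_small (1/8)) as [n1 H1]; [lra|]. destruct (gam_small (1/4)) as [n2 H2]; [lra|].
 exists (max n1 n2). intros n Hn. specialize (H1 n okn). specialize (H2 n okn). lra.
Qed.

Lemma Ai_decay x : 2 <= x -> Ai x <= 2*exp (2-x).
Proof.
 intros Hx. have L := bj_lim x ok. destruct edge_params as [n0 Hn0].
 apply (is_lim_seq_le_loc (fun n => bj n x) (fun _ => 2*exp (2-x)) (Ai x) (2*exp (2-x))); [|exact L|apply is_lim_seq_const].
 exists n0. intros n Hn. destruct (Hn0 n Hn). eapply Rle_trans; [apply bj_le_ff; lra|]. now apply ff_decay.
Qed.

Lemma lim_seq_eps (u : nat -> R) (l eps : R) : is_lim_seq u l -> 0 < eps -> exists n0, forall n, (n0 <= n)%nat -> Rabs (u n-l) < eps.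
Proof. intros H He. apply is_lim_seq_spec in H. exact (H (mkposreal eps He)). Qed.

Lemma MVT_simple (f f' : R -> R) (a b : R) : a < b -> (forall x, is_derive f x (f' x)) ->
 exists z, a < z < b /\ f b-f a = f' z*(b-a).
Proof.
 intros Hab D. destruct (MVT_cor2 f f' a b Hab) as [c [Hc1 Hc2]].
 - intros c _. apply is_derive_Reals, D. - exists c. split; lra.
Qed.

(* If Ai vanished somewhere on [2, +oo), the rescaled solutions would tend to 0 there together with a derivative,
  hence also at -6, against the lower bound of ff_bump. *)
Lemma Ai_pos x : 2 <= x -> 0 < Ai x.
Proof.
 intros Hx. have H0 := Ai_ge_0 x ok. destruct (Req_dec (Ai x) 0) as [Hz|]; [exfalso|lra].
 have L := bj_lim x ok. rewrite Hz in L.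
 destruct edge_params as [n0 Hn0].
 destruct (ff_bounded_on (x+6)) as [M [n1 [HM Hn1]]]; [lra|].
 set (A := x+6). set (K := 6*M^4+2*A*M^2+A^2).
 have HK: 0<=K by (unfold K, A; have: 0<M^4 by pos; nra).
 destruct (gam_sq_small K 1) as [n2 Hn2]; [lra|lra|].
 destruct (gam_sq_small A 1) as [n3 Hn3]; [unfold A; lra|lra|].
 destruct (gam_small (/ (2*M))) as [n4 Hn4]; [pos|].
 (* For e = 1 and x0 = -6 the condition is (PI/2)^2 < 3. The quartic bound makes cos 1.6 negative,
    so PI/2 <= 1.6. *)
 destruct (ff_bump (-6) 1) as [n5 Hn5]; [lra| |].
 { have := PI_RGT_0. have: PI<=2*(16/10).
  { apply Rnot_lt_le. intros Hn. have := cos_le_quartic (16/10) ok.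
   have: 0<cos (16/10) by (apply cos_gt_0; lra). lra. }
  nra. }
 set (L0 := 2*M^2+A+1). have HL0: 0<=L0 by (unfold L0, A; nra).
 set (G := exp ((L0+2)*(A+A))). have HG := exp_pos ((L0+2)*(A+A)). fold G in HG.
 set (C := exp (4*exp 4)). have HC := exp_pos (4*exp 4). fold C in HC.
 (* Small enough that after the factors C of the Bessel comparison and G of Gronwall the value at -6
    remains below 1. *)
 set (eta := / (8*(C+1)*(G+1))). have Heta: 0<eta by (unfold eta; apply Rinv_0_lt_compat; nra).
 destruct (lim_seq_eps _ _ eta L Heta) as [n6 Hn6].
 set (n := max n0 (max n1 (max n2 (max n3 (max n4 (max n5 n6)))))).
 destruct (Hn0 n okn) as [Hb Hg]. specialize (Hn1 n okn). specialize (Hn2 n okn). specialize (Hn3 n okn).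
 specialize (Hn4 n okn). specialize (Hn5 n okn). specialize (Hn6 n okn).
 rewrite Rminus_0_r in Hn6. apply Rabs_lt_between in Hn6.
 have Hfx: ff n x<=C*eta.
 { have Q := ff_le_bj n x Hb Hg Hx. have Jp := bj_pos n x ok.
  have: exp (4*exp 4*exp (- (2*x)))<=C.
  { apply exp_le_mono. have: exp (- (2*x))<=1 by mono. have := exp_pos 4. nra. }
  have E: ff n x=ff n x/bj n x*bj n x by fld. rewrite E. apply Rmult_le_compat; try lra.
  apply Rlt_le, Rdiv_lt_0_compat; [apply ff_pos|lra]. }
 destruct (MVT_simple (ff n) (ff1 n) x (x+1) ok (ff_derive n)) as [z [Hz1 Hz2]].
 have Hfz: ff n z<=ff n x.
 { assert (- ff n x <= - ff n z); [|lra]. apply (derive_nonneg_le (fun s => - ff n s) (fun s => - ff1 n s)); [lra| |].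
  - intros; apply isd_opp, ff_derive. - intros s Hs. have := ff_decr n s ok. lra. }
 have := ff_pos n z. have := ff_pos n (x+1).
 have Hf1z: - (C*eta)<=ff1 n z<=0.
 { have := ff_decr n z ok. replace (x+1-x) with 1 in Hz2 by ring. lra. }
 have GR := gronwall_left (ff n) (ff1 n) (ff2 n) (- A) z L0 0 HL0 ltac:(unfold A; lra)
  (fun s _ => ff_derive n s) (fun s _ => ff1_derive n s).
 have GB: forall s, - A<=s<=z -> Rabs (ff2 n s)<=L0*Rabs (ff n s)+0.
 { intros s Hs. have Fs := ff_pos n s. specialize (Hn1 s ltac:(unfold A in Hs; lra)).
  have Q := ff2_limit n s A M ltac:(apply Rabs_le; unfold A in *; lra) Hn1.
  have: gam n*M<=1/2 by (trans (/ (2*M)*M); [mono|right; field; lra]).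
  specialize (Q ok Hn3). fold K in Q. abs_in Q. rewrite (Rabs_right (ff n s)) by lra.
  have: gam n^2*K*ff n s<=1*ff n s by mono.
  have: ff n s^2<=M^2 by mono.
  have: -(ff n s*A)<=ff n s*(2*ff n s^2+s)<=ff n s*(2*M^2+A).
  { unfold A in *. split; [|mono]. nra. }
  have: 0<=ff n s*M^2 by pos.
  apply Rabs_le. unfold L0. lra. }
 specialize (GR GB (-6) ltac:(unfold A; lra)).
 have GE: exp ((L0+2)*(z - - A))<=G by (apply exp_le_mono; unfold A in *; nra).
 have: ff n z^2+ff1 n z^2+0^2<=2*(C*eta)^2.
 { have: ff n z^2<=(C*eta)^2 by mono. have: ff1 n z^2<=(C*eta)^2 by nra. lra. }
 have Cet: C*eta <= / (8*(G+1)).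
 { unfold eta. replace (C * / (8*(C+1)*(G+1))) with (C/(C+1) * / (8*(G+1))) by fld.
  have: C/(C+1)<=1 by (apply Rmult_le_reg_r with (C+1); [lra|]; unfold Rdiv; rewrite Rmult_assoc, Rinv_l by lra; lra).
  have: 0 < / (8*(G+1)) by pos. nra. }
 have Sm: 8*(G+1)*(C*eta)<=1.
 { trans (8*(G+1) * / (8*(G+1))); [mono|right; field; lra]. }
 nra.
Qed.

(** * Convergence of the rescaled solutions to q *)

Lemma HM_derive q : is_Hastings_McLeod q ->
 (forall x, is_derive q x (Derive q x)) /\ (forall x, is_derive (Derive q) x (2*q x^3+x*q x)).
Proof. intros [H _]. split; intros x; destruct (H x) as [H1 H2]; [now apply Derive_correct|exact H2]. Qed.

Lemma HM_Ai q eps : is_Hastings_McLeod q -> 0 < eps -> exists X, 2 <= X /\ forall x, X <= x -> Rabs (q x-Ai x) <= eps*Ai x.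
Proof.
 intros [_ H] He. destruct (H (mkposreal eps He)) as [M HM]. simpl in HM.
 exists (Rmax 2 (M+1)). have := Rmax_l 2 (M+1). have := Rmax_r 2 (M+1). split; [lra|].
 intros x Hx. specialize (HM x ok). unfold norm, minus, plus, opp in HM; simpl in HM. unfold abs in HM; simpl in HM.
 have := Ai_pos x ok. rewrite (Rabs_right (Ai x)) in HM by lra.
 replace (Ai x + - q x) with (- (q x-Ai x)) in HM by ring. rewrite Rabs_Ropp in HM. exact HM.
Qed.

(** For large x, q lies between Ai/2 and 3Ai/2. Being positive and bounded it satisfies q'' >= 0
    there, and a bounded convex function on a half-line to the right cannot increase. *)
Lemma HM_edge q : is_Hastings_McLeod q ->
 exists X, 5 <= X /\ forall x, X <= x -> 0 < q x <= 3*exp (2-x) /\ Derive q x <= 0.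
Proof.
 intros Hq. destruct (HM_derive q Hq) as [D D1]. destruct (HM_Ai q (1/2) Hq) as [X [HX H]]; [lra|].
 exists (Rmax 5 X). have := Rmax_l 5 X. have := Rmax_r 5 X. split; [lra|].
 have Q: forall x, Rmax 5 X<=x -> 0<q x<=3*exp (2-x).
 { intros x Hx. specialize (H x ok). abs_in H. have := Ai_pos x ok.
  have := Ai_decay x ok. lra. }
 intros x Hx. split; [now apply Q|].
 apply (convex_bdd_decr q (Derive q) (fun x => 2*q x^3+x*q x) (Rmax 5 X) 3); auto.
 - intros y Hy. specialize (Q y Hy). have: 0<q y^3 by pos. nra.
 - intros y Hy. specialize (Q y Hy). have: exp (2-y)<=1 by mono. lra.
Qed.

(** Followed to the left, mu' = w mu + h with w >= 1 is damped. In the barrier, C exp(-2s) answers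
    the forcing 3C exp(-2s), because (B' - B) contributes -3C exp(-2s), and e0 answers itself. The
    initial term decays at rate 1/2 rather than 1, which makes the contact inequality strict. *)
Lemma damped_left (mu w h : R -> R) (a z C e0 b0 : R) :
 a <= z -> 0 <= C -> 0 <= e0 -> 0 < b0 ->
 (forall s, a <= s <= z -> is_derive mu s (w s*mu s+h s)) ->
 (forall s, a <= s <= z -> 1 <= w s) ->
 (forall s, a <= s <= z -> Rabs (h s) <= 3*(C*exp (- (2*s)))+e0) ->
 Rabs (mu z) < b0 ->
 forall s, a <= s <= z -> Rabs (mu s) <= b0*exp ((s-z)/2)+C*exp (- (2*s))+e0.
Proof.
 intros Haz HC He0 Hb0 D Hw Hh Hz.
 set (B := fun s => b0*exp ((s-z)/2)+C*exp (- (2*s))+e0).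
 set (B' := fun s => b0/2*exp ((s-z)/2)-2*(C*exp (- (2*s)))).
 have DB: forall s, is_derive B s (B' s) by (intros s; unfold B, B'; isd; [lra|field]).
 have Bp: forall s, 0<b0*exp ((s-z)/2) /\ 0<=C*exp (- (2*s)).
 { intros s. have := exp_pos ((s-z)/2). have := exp_pos (- (2*s)). split; [nra|pos]. }
 have Bz: b0<=B z.
 { unfold B. replace ((z-z)/2) with 0 by field. rewrite exp_0. destruct (Bp z). lra. }
 (* the argument is symmetric in the sign of mu *)
 have W: forall sg, (sg=1 \/ sg = -1) -> forall s, a<=s<=z -> sg*mu s<B s.
 { intros sg Hsg s Hs. assert (sg*mu (- - s)-B (- - s)<0); [|rewrite Ropp_involutive in *; lra].
  apply (no_crossing (fun s => sg*mu (- s)-B (- s)) (fun s => - (sg*(w (- s)*mu (- s)+h (- s))-B' (- s))) (- z) (- a)); [| | |lra].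
  - intros x Hx. eapply isd_eq.
   + apply isd_minus; [apply isd_mult; [isd_|]|].
    * apply (isd_comp mu (fun s => - s)); [apply D; lra|isd_].
    * apply (isd_comp B (fun s => - s)); [apply DB|isd_].
   + cbv beta. ring.
  - rewrite Ropp_involutive. apply Rabs_lt_between in Hz. destruct Hsg as [-> | ->]; lra.
  - intros x Hx Hz0. set (y := - x) in *. have Hy: a<=y<=z by (unfold y; lra).
   specialize (Hw y Hy). specialize (Hh y Hy). abs_in Hh. destruct (Bp y) as [P1 P2].
   have E: sg*mu y=B y by lra.
   have: B y<=w y*(sg*mu y) by (rewrite E; unfold B; nra).
   have: B' y<B y-(3*(C*exp (- (2*y)))+e0) by (unfold B, B'; lra).
   destruct Hsg as [-> | ->]; lra. }
 intros s Hs. fold (B s). have := W 1 ok s Hs. have := W (-1) ok s Hs. apply Rabs_le. lra.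
Qed.

Definition lq (q : R -> R) (n : nat) (x : R) : R := ln (ff n x/q x).
Definition mq (q : R -> R) (n : nat) (x : R) : R := ff1 n x/ff n x-Derive q x/q x.

Lemma lq_derive q n x : is_Hastings_McLeod q -> 0 < q x -> is_derive (lq q n) x (mq q n x).
Proof.
 intros Hq Hp. destruct (HM_derive q Hq) as [D _]. have := ff_pos n x. unfold lq, mq.
 eapply isd_eq; [apply isd_ln; [apply isd_div; [apply ff_derive|apply D|lra]|pos]|]. cbv beta. field. lra.
Qed.

Lemma mq_derive q n x : is_Hastings_McLeod q -> 0 < q x -> is_derive (mq q n) x
 (- (ff1 n x/ff n x+Derive q x/q x)*mq q n x+(ff2 n x/ff n x-(2*q x^2+x))).
Proof.
 intros Hq Hp. destruct (HM_derive q Hq) as [D D1]. have := ff_pos n x. unfold mq.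
 eapply isd_eq; [apply isd_minus; apply isd_div; [apply ff1_derive|apply ff_derive|lra|apply D1|apply D|lra]|]. cbv beta. field. lra.
Qed.

Lemma ln_near_1 (r d : R) : 0 < d <= 1/2 -> Rabs (r-1) <= d -> Rabs (ln r) <= 2*d.
Proof.
 intros Hd Hr. abs_in Hr. have := ln_le_sub1 r ok. have := ln_ge_inv r ok.
 have: / r<=1+2*d by (apply Rmult_le_reg_l with r; [lra|]; rewrite Rinv_r by lra; nra). apply Rabs_le; lra.
Qed.

Lemma exp_near_0 (y : R) : Rabs y <= 1 -> Rabs (exp y-1) <= 2*Rabs y.
Proof.
 intros Hy. have E := exp_quad (- y) ltac:(now rewrite Rabs_Ropp). rewrite Ropp_involutive in E.
 abs_in E. have: (- y)^2<=Rabs y.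
 { replace ((- y)^2) with (Rabs y^2) by (rewrite pow2_abs; ring). have := Rabs_pos y. nra. }
 have := Rle_abs y. have A2 := Rle_abs (- y). rewrite Rabs_Ropp in A2. apply Rabs_le. lra.
Qed.

(** log([ff]/q) splits into log([ff]/[bj]), small uniformly in n for large X, log([bj]/Ai), small
    for large n at fixed X, and log(Ai/q), small by the hypothesis on q. *)
Lemma lq_small q d : is_Hastings_McLeod q -> 0 < d <= 1/10 -> exists X1, 5 <= X1 /\ forall X, X1 <= X ->
 exists n0, forall n, (n0 <= n)%nat -> Rabs (lq q n X) <= 5*d.
Proof.
 intros Hq Hd. destruct (HM_edge q Hq) as [X0 [HX0 E]]. destruct (HM_Ai q d Hq) as [X2 [HX2 A]]; [lra|].
 set (X3 := ln (4*exp 4/d)).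
 exists (Rmax (Rmax X0 X2) X3). have := Rmax_l (Rmax X0 X2) X3. have := Rmax_r (Rmax X0 X2) X3.
 have := Rmax_l X0 X2. have := Rmax_r X0 X2. split; [lra|]. intros X HX.
 specialize (E X ok). specialize (A X ok). have HA := Ai_pos X ok.
 have He: 4*exp 4*exp (- (2*X))<=d.
 { have HX3: exp (- (2*X))<=exp (- X3) by mono. unfold X3 in HX3. have := exp_pos 4.
  have: 0<4*exp 4/d by pos.
  rewrite (exp_Ropp (ln _)), exp_ln in HX3 by lra. trans (4*exp 4 * / (4*exp 4/d)); [mono|right; field; lra]. }
 destruct edge_params as [n0 Hn0]. destruct (lim_seq_eps _ _ (d*Ai X) (bj_lim X ok) ltac:(nra)) as [n1 Hn1].
 exists (max n0 n1). intros n Hn. destruct (Hn0 n okn) as [Hb Hg]. specialize (Hn1 n okn).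
 have U := ff_le_bj n X Hb Hg ok. have L := ff_ge_bj n X ok.
 have Jp := bj_pos n X ok. have Fp := ff_pos n X.
 have E1: lq q n X=ln (ff n X/bj n X)+ln (bj n X/Ai X)-ln (q X/Ai X).
 { unfold lq. rewrite !ln_div by lra. ring. }
 have B1: 0<=ln (ff n X/bj n X)<=d.
 { split; [rewrite <- ln_1; apply ln_le; lra|]. eapply Rle_trans; [|exact He].
  rewrite <- (ln_exp (4*exp 4*exp (- (2*X)))). apply ln_le; [pos|exact U]. }
 have B2: Rabs (ln (bj n X/Ai X))<=2*d.
 { apply ln_near_1; [lra|]. replace (bj n X/Ai X-1) with ((bj n X-Ai X) * / Ai X) by fld.
  rewrite Rabs_mult, (Rabs_right (/ Ai X)) by pos.
  apply Rmult_le_reg_r with (Ai X); [lra|]. rewrite Rmult_assoc, Rinv_l by lra. lra. }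
 have B3: Rabs (ln (q X/Ai X))<=2*d.
 { apply ln_near_1; [lra|]. replace (q X/Ai X-1) with ((q X-Ai X) * / Ai X) by fld.
  rewrite Rabs_mult, (Rabs_right (/ Ai X)) by pos.
  apply Rmult_le_reg_r with (Ai X); [lra|]. rewrite Rmult_assoc, Rinv_l by lra. lra. }
 abs_in B2. abs_in B3. rewrite E1. apply Rabs_le. lra.
Qed.

(* Closeness of ff and q at two far points X, X+1 propagates, thanks to the damping of the difference of
  logarithmic derivatives, down to the fixed point X0. *)
Lemma lq_uniform q : is_Hastings_McLeod q -> exists X0, 5 <= X0 /\
 (forall x, X0 <= x -> 0 < q x <= 3*exp (2-x) /\ Derive q x <= 0) /\
 forall eps, 0 < eps -> exists X1, X0 <= X1 /\ forall X, X1 <= X ->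
 exists n0, forall n, (n0 <= n)%nat -> forall s, X0 <= s <= X -> Rabs (lq q n s) <= eps /\ Rabs (mq q n s) <= eps.
Proof.
 intros Hq. destruct (HM_edge q Hq) as [XE [HXE E]].
 (* The shift by 10 yields 100 exp(6) exp(-2 X0) <= 1, the smallness that closes the absorption of
    [Sm] at the end. *)
 set (X0 := XE+10). exists X0. split; [unfold X0; lra|]. split; [intros; apply E; unfold X0 in *; lra|].
 intros eps Heps. set (d := Rmin (1/100) (eps/100)).
 have Hd1: d<=1/100 by apply Rmin_l. have Hd2: d<=eps/100 by apply Rmin_r.
 have Hd: 0<d by (apply Rmin_glb_lt; lra).
 destruct (lq_small q d Hq ok) as [X1 [HX1 Hl]].
 set (X2 := ln (100*exp 6/d)).
 exists (Rmax (Rmax X1 X0) X2). have := Rmax_l (Rmax X1 X0) X2. have := Rmax_r (Rmax X1 X0) X2.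
 have := Rmax_l X1 X0. have := Rmax_r X1 X0. split; [lra|]. intros X HX.
 have E4 := exp_pos 4. have E6 := exp_pos 6. have Ep2 := exp_pos 2.
 have E46: exp 4<=exp 6 by mono.
 have HeX: 100*exp 6*exp (- (2*X))<=d.
 { have HX3: exp (- (2*X))<=exp (- X2) by (apply exp_le_mono; unfold X0 in *; lra). unfold X2 in HX3.
  have: 0<100*exp 6/d by pos.
  rewrite (exp_Ropp (ln _)), exp_ln in HX3 by lra. trans (100*exp 6 * / (100*exp 6/d)); [mono|right; field; lra]. }
 have HeX0: 100*exp 6*exp (- (2*X0))<=1.
 { have: exp (- (2*X0))<=exp (-6)*exp (-20) by (rewrite <- exp_plus; apply exp_le_mono; unfold X0; lra).
  have: exp 6*exp (-6)=1 by (rewrite <- exp_plus; replace (6 + -6) with 0 by ring; apply exp_0).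
  have: exp (-20) <= / 100.
  { replace (-20) with (- (20)) by ring. rewrite exp_Ropp. apply Rinv_le_contravar; [lra|]. replace 20 with (10+10) by ring. rewrite exp_plus. have := exp_ineq1_le 10. nra. }
  have := exp_pos (-20). nra. }
 destruct (Hl X ok) as [n1 Hn1]. destruct (Hl (X+1) ok) as [n2 Hn2].
 destruct edge_params as [n3 Hn3].
 set (A := X+1). set (K := 6*2^4+2*A*2^2+A^2).
 have HK: 0<=K by (unfold K, A; unfold X0 in *; nra).
 (* The contribution of this constant error, integrated over [X0, z], is at most d. *)
 set (e0 := d/(X+1)). have He0: 0<e0 by (apply Rdiv_lt_0_compat; unfold X0 in *; lra).
 have He0X: e0*(X+1)=d by (unfold e0; field; unfold X0 in *; lra).
 have He0d: e0<=d by (unfold X0 in *; nra).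
 destruct (gam_sq_small K e0 HK He0) as [n4 Hn4]. destruct (gam_sq_small A 1) as [n5 Hn5]; [unfold A, X0 in *; lra|lra|].
 exists (max n1 (max n2 (max n3 (max n4 n5)))). intros n Hn.
 specialize (Hn1 n okn). specialize (Hn2 n okn). destruct (Hn3 n okn) as [Hb Hg]. specialize (Hn4 n okn). specialize (Hn5 n okn).
 have HXX0: X0<=X by lra. have HX0E: XE<=X0 by (unfold X0; lra). have HX05: 15<=X0 by (unfold X0; lra).
 clearbody X0 X2.
 have Qp: forall s, X0<=s -> 0<q s by (intros; apply E; lra).
 (* Only values of [lq] are known at X and X + 1; the mean value theorem yields a point z between
    them at which its derivative [mq] is small. *)
 destruct (MVT_cor2 (lq q n) (mq q n) X (X+1) ok) as [z [Hz1 Hz2]].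
 { intros s Hs. apply is_derive_Reals, lq_derive; [assumption|apply Qp; lra]. }
 replace (X+1-X) with 1 in Hz1 by ring.
 have Hmz: Rabs (mq q n z)<11*d.
 { abs_in Hn1. abs_in Hn2. apply Rabs_lt_between. lra. }
 set (w := fun s => - (ff1 n s/ff n s+Derive q s/q s)).
 set (h := fun s => ff2 n s/ff n s-(2*q s^2+s)).
 have Dm: forall s, X0<=s<=z -> is_derive (mq q n) s (w s*mq q n s+h s) by (intros; apply mq_derive; [assumption|apply Qp; lra]).
 have Hw: forall s, X0<=s<=z -> 1<=w s.
 { intros s Hs. have := ff_log_decr n s Hb ok. have Fp := ff_pos n s. destruct (E s ok) as [[Q1 _] Q2].
  have: ff1 n s/ff n s <= -1 by (apply Rmult_le_reg_r with (ff n s); [lra|]; unfold Rdiv; rewrite Rmult_assoc, Rinv_l by lra; lra).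
  have: Derive q s/q s<=0 by (apply Rmult_le_reg_r with (q s); [lra|]; unfold Rdiv; rewrite Rmult_assoc, Rinv_l by lra; lra).
  unfold w. lra. }
 have Hh0: forall s, X0<=s<=z -> Rabs (h s)<=Rabs (2*(ff n s^2-q s^2))+e0.
 { intros s Hs. have Fp := ff_pos n s. have Fd := ff_decay n s Hb ok.
  have: exp (2-s)<=1 by mono.
  have Q := ff2_limit n s A 2 ltac:(apply Rabs_le; unfold A; lra) ok ok Hn5. fold K in Q.
  replace (h s) with (2*(ff n s^2-q s^2)+(ff2 n s-ff n s*(2*ff n s^2+s))/ff n s) by (unfold h; field; lra).
  le_trans Rabs_triang. apply Rplus_le_compat_l.
  unfold Rdiv. rewrite Rabs_mult, (Rabs_right (/ ff n s)) by pos.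
  apply Rmult_le_reg_r with (ff n s); [lra|]. rewrite Rmult_assoc, Rinv_l, Rmult_1_r by lra.
  have: gam n^2*K*ff n s<=e0*ff n s by mono. lra. }
 have Qd: forall s, X0<=s -> q s^2<=9*(exp 4*exp (- (2*s))).
 { intros s Hs. destruct (E s ok) as [[Q1 Q2] _]. trans ((3*exp (2-s))^2); [mono|].
  right. replace (exp 4*exp (- (2*s))) with (exp (2-s)*exp (2-s)) by (rewrite <- !exp_plus; f_equal; ring). ring. }
 have Fd2: forall s, X0<=s -> 4*ff n s^2<=16*exp 4*exp (- (2*s)) by (intros; apply ff_sq_decay; lra).
 have Int: forall C b0 a z', X0<=a -> a<=z'<=z -> 0<=C -> 0<b0 ->
   (forall s, a<=s<=z' -> Rabs (mq q n s)<=b0*exp ((s-z)/2)+C*exp (- (2*s))+e0) ->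
   Rabs (lq q n z'-lq q n a)<=2*b0+C*exp (- (2*a))+d.
 { intros C b0 a z' Ha Haz HC Hb0 Hm.
  set (G := fun s => b0*(2*exp ((s-z)/2))+(- (C/2))*exp (- (2*s))+e0*s).
  have DG: forall s, is_derive G s (b0*exp ((s-z)/2)+C*exp (- (2*s))+e0) by (intros s; unfold G; isd; [lra|field]).
  have GB: G z'-G a<=2*b0+C*exp (- (2*a))+d.
  { unfold G. have := exp_pos ((a-z)/2). have := exp_pos (- (2*z')). have := exp_pos (- (2*a)).
   have: exp ((z'-z)/2)<=1 by mono.
   have: b0*exp ((z'-z)/2)<=b0*1 by mono.
   have: 0<=b0*exp ((a-z)/2) by pos.
   have: 0<=C*exp (- (2*z')) by pos. have: 0<=C*exp (- (2*a)) by pos.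
   have: e0*(z'-a)<=e0*(X+1) by mono. lra. }
  apply Rabs_le. split.
  - assert (lq q n a+G a<=lq q n z'+G z'); [|lra].
   apply (derive_nonneg_le (fun s => lq q n s+G s) (fun s => mq q n s+(b0*exp ((s-z)/2)+C*exp (- (2*s))+e0))); [lra| |].
   + intros s Hs. apply isd_plus; [apply lq_derive; [assumption|apply Qp; lra]|apply DG].
   + intros s Hs. specialize (Hm s Hs). abs_in Hm. lra.
  - assert (G a-lq q n a<=G z'-lq q n z'); [|lra].
   apply (derive_nonneg_le (fun s => G s-lq q n s) (fun s => (b0*exp ((s-z)/2)+C*exp (- (2*s))+e0)-mq q n s)); [lra| |].
   + intros s Hs. apply isd_minus; [apply DG|apply lq_derive; [assumption|apply Qp; lra]].
   + intros s Hs. specialize (Hm s Hs). abs_in Hm. lra. }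
 (* A crude pass: both f^2 and q^2 are O(exp(-2s)), and this already confines [lq] to [-1, 1] on the
    whole interval. *)
 have P1: forall s, X0<=s<=z -> Rabs (mq q n s)<=11*d*exp ((s-z)/2)+9*exp 4*exp (- (2*s))+e0.
 { apply (damped_left (mq q n) w h X0 z (9*exp 4) e0 (11*d)); auto; try lra.
  intros s Hs. eapply Rle_trans; [now apply Hh0|]. apply Rplus_le_compat_r. specialize (Qd s ok). specialize (Fd2 s ok).
  have := pow2_ge_0 (q s). have := pow2_ge_0 (ff n s). have := exp_pos (- (2*s)).
  have: 0<exp 4*exp (- (2*s)) by nra. apply Rabs_le. lra. }
 have Ehp: forall s t, s<=t -> exp (- (2*t))<=exp (- (2*s)) by (intros; apply exp_le_mono; lra).
 have Lz: Rabs (lq q n z)<=30*d.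
 { have I1 := Int (9*exp 4) (11*d) X z ok ok ok ok (fun s Hs => P1 s ok).
  have: 9*exp 4*exp (- (2*X))<=d by (have := exp_pos (- (2*X)); nra).
  abs_in I1. abs_in Hn1. apply Rabs_le. lra. }
 have L1: forall s, X0<=s<=z -> Rabs (lq q n s)<=1.
 { intros s Hs. have I1 := Int (9*exp 4) (11*d) s z ok ok ok ok (fun u Hu => P1 u ok).
  have: 9*exp 4*exp (- (2*s))<=1/10.
  { specialize (Ehp X0 s ok). have := exp_pos (- (2*s)). nra. }
  abs_in I1. abs_in Lz. apply Rabs_le. lra. }
 destruct (continuity_ab_maj (fun s => Rabs (lq q n s)) X0 z ok) as [m [Hm1 Hm2]].
 { intros s Hs. apply continuity_pt_filterlim. apply (continuous_comp (lq q n) Rabs); [|apply continuous_Rabs].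
  eapply isd_continuous, lq_derive; [assumption|apply Qp; lra]. }
 set (Sm := Rabs (lq q n m)) in *. have HSm: 0<=Sm<=1 by (split; [apply Rabs_pos|apply L1; lra]).
 (* A second pass: with |lq| <= [Sm] the forcing is proportional to [Sm]. Integration gives [Sm] <=
    53d + [Sm]/4. *)
 have P2: forall s, X0<=s<=z -> Rabs (mq q n s)<=11*d*exp ((s-z)/2)+(24*exp 6*Sm)*exp (- (2*s))+e0.
 { apply (damped_left (mq q n) w h X0 z (24*exp 6*Sm) e0 (11*d)); auto; try lra.
  { nra. }
  intros s Hs. eapply Rle_trans; [now apply Hh0|]. apply Rplus_le_compat_r. specialize (Qd s ok).
  have Fp := ff_pos n s. specialize (Qp s ok). specialize (L1 s Hs). specialize (Hm1 s Hs). cbv beta in Hm1.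
  have Ef: ff n s=q s*exp (lq q n s).
  { unfold lq. rewrite exp_ln by pos. field. lra. }
  set (y := lq q n s) in *. have N1 := exp_near_0 y L1.
  replace (2*(ff n s^2-q s^2)) with (2*q s^2*(exp y+1)*(exp y-1)) by (rewrite Ef; ring).
  have := exp_pos y. have := pow2_ge_0 (q s).
  rewrite Rabs_mult, (Rabs_right (2*q s^2*(exp y+1))) by pos.
  have := Rabs_pos y. have := Rle_abs (exp y-1).
  have Hey: exp y+1<=4 by lra.
  have X18: 2*q s^2*(exp y+1)<=8*q s^2 by nra.
  have: 2*q s^2*(exp y+1)*Rabs (exp y-1)<=8*q s^2*(2*Sm).
  { apply Rmult_le_compat; [pos|pos|lra|lra]. }
  have E2p: exp 4*3<=exp 6.
  { replace 6 with (4+2) by ring. rewrite exp_plus. have := exp_ineq1_le 2. nra. }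
  have Es := exp_pos (- (2*s)). set (e := exp (- (2*s))) in *.
  have: q s^2*Sm<=9*(exp 4*e)*Sm by mono.
  have: exp 4*3*(e*Sm)<=exp 6*(e*Sm) by mono.
  have: 0<=exp 6*(e*Sm) by pos. lra. }
 have SmB: Sm<=100*d.
 { have I1 := Int (24*exp 6*Sm) (11*d) m z ok ok ltac:(nra) ok (fun u Hu => P2 u ok).
  have: 24*exp 6*Sm*exp (- (2*m))<=1/4*Sm.
  { specialize (Ehp X0 m ok). have := exp_pos (- (2*m)).
   have: 24*exp 6*exp (- (2*m))<=1/4 by nra. nra. }
  have: Sm<=Rabs (lq q n z)+Rabs (lq q n z-lq q n m).
  { unfold Sm. replace (lq q n m) with (lq q n z + - (lq q n z-lq q n m)) at 1 by ring.
   le_trans Rabs_triang. rewrite Rabs_Ropp. lra. }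
  lra. }
 intros s Hs. split.
 - specialize (Hm1 s ok). cbv beta in Hm1. lra.
 - eapply Rle_trans; [apply P2; lra|].
  have: exp ((s-z)/2)<=1 by mono.
  have: 24*exp 6*Sm*exp (- (2*s))<=1/4*Sm.
  { specialize (Ehp X0 s ok). have := exp_pos (- (2*s)).
   have: 24*exp 6*exp (- (2*s))<=1/4 by nra. nra. }
  nra.
Qed.

(** To the right of X0 the logarithmic estimate applies directly. To its left the difference obeys a
    linear inequality with bounded coefficient, and Gronwall carries the smallness of [ff] - q and
    of its derivative from X0 down to -B. *)
Lemma ff_converges q A eps : is_Hastings_McLeod q -> 0 < eps -> exists n0, forall n, (n0 <= n)%nat ->
 forall x, - A <= x <= A -> Rabs (ff n x-q x) <= eps.
Proof.
 intros Hq Heps. destruct (HM_derive q Hq) as [D D1]. destruct (lq_uniform q Hq) as [X0 [HX0 [E U]]].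
 set (B := Rabs A+1). have HB: 1<=B /\ A<=B by (unfold B; have := Rabs_pos A; have := Rle_abs A; lra).
 destruct (continuity_ab_maj (fun s => Rabs (q s)) (- B) X0 ok) as [m [Hm1 Hm2]].
 { intros s Hs. apply continuity_pt_filterlim. apply (continuous_comp q Rabs); [|apply continuous_Rabs]. eapply isd_continuous, D. }
 destruct (ff_bounded_on B (proj1 HB)) as [M0 [n1 [HM0 Hn1]]].
 set (M := Rmax M0 (Rabs (q m))). have: M0<=M by apply Rmax_l. have HqM: Rabs (q m)<=M by apply Rmax_r.
 set (A' := B+X0). set (K := 6*M^4+2*A'*M^2+A'^2).
 have HK: 0<=K by (unfold K, A'; have: 0<M^4 by pos; nra).
 set (L := 6*M^2+A'). have HL: 0<=L by (unfold L, A'; nra).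
 set (G := exp ((L+2)*(X0 - - B))). have HG := exp_pos ((L+2)*(X0 - - B)). fold G in HG.
 set (e1 := Rmin eps 1/(4*(G+1))).
 have Hme: 0<Rmin eps 1 /\ Rmin eps 1<=eps /\ Rmin eps 1<=1 by (split; [pos|split; [apply Rmin_l|apply Rmin_r]]).
 have He1: 0<e1 by (unfold e1; apply Rdiv_lt_0_compat; lra).
 have He1': 4*(G+1)*e1=Rmin eps 1 by (unfold e1; field; lra).
 set (k := Rabs (Derive q X0)). have Hk: 0<=k by apply Rabs_pos.
 set (dl := Rmin 1 (e1/(20+4*k))).
 have Hdl: 0<dl by (apply Rmin_glb_lt; [lra|apply Rdiv_lt_0_compat; lra]).
 have Hdl1: dl<=1 by apply Rmin_l.
 have Hdl2: dl*(20+4*k)<=e1.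
 { trans (e1/(20+4*k)*(20+4*k)); [apply Rmult_le_compat_r; [lra|apply Rmin_r]|right; field; lra]. }
 destruct (U dl Hdl) as [X1 [HX1 U1]]. set (X := Rmax X1 B). have: X1<=X by apply Rmax_l. have: B<=X by apply Rmax_r.
 destruct (U1 X ok) as [n2 Hn2].
 destruct (gam_sq_small (K*M) e1) as [n3 Hn3]; [pos|lra|].
 destruct (gam_sq_small A' 1) as [n4 Hn4]; [unfold A'; lra|lra|].
 destruct (gam_small (/ (2*M))) as [n5 Hn5]; [pos|].
 exists (max n1 (max n2 (max n3 (max n4 n5)))). intros n Hn x Hx.
 specialize (Hn1 n okn). specialize (Hn2 n okn). specialize (Hn3 n okn). specialize (Hn4 n okn). specialize (Hn5 n okn).
 have Rt: forall s, X0<=s<=X -> Rabs (ff n s-q s)<=6*dl.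
 { intros s Hs. destruct (Hn2 s Hs) as [L1 _]. destruct (E s ok) as [[Q1 Q2] _]. have := ff_pos n s.
  have Ef: ff n s=q s*exp (lq q n s).
  { unfold lq. rewrite exp_ln by pos. field. lra. }
  rewrite Ef. replace (q s*exp (lq q n s)-q s) with (q s*(exp (lq q n s)-1)) by ring. rewrite Rabs_mult, Rabs_right by lra.
  have := exp_near_0 (lq q n s) ok. have: exp (2-s)<=1 by mono.
  trans (3*(2*dl)); [|lra]. apply Rmult_le_compat; [lra|pos|lra|lra]. }
 have Hdle: 6*dl<=eps.
 { have: dl*20<=e1 by nra. have: e1<=eps by nra. lra. }
 destruct (Rle_lt_dec X0 x) as [Hxr|Hxl]; [specialize (Rt x ok); lra|].
 have GR := gronwall_left (fun s => ff n s-q s) (fun s => ff1 n s-Derive q s) (fun s => ff2 n s-(2*q s^3+s*q s)) (- B) X0 L e1 HL ok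
  (fun s _ => isd_minus _ _ s _ _ (ff_derive n s) (D s)) (fun s _ => isd_minus _ _ s _ _ (ff1_derive n s) (D1 s)).
 cbv beta in GR. fold G in GR.
 have GB: forall s, - B<=s<=X0 -> Rabs (ff2 n s-(2*q s^3+s*q s))<=L*Rabs (ff n s-q s)+e1.
 { intros s Hs. have Fs := ff_pos n s. specialize (Hn1 s ok). specialize (Hm1 s ok). cbv beta in Hm1.
  have: gam n*M<=1/2 by (trans (/ (2*M)*M); [mono|right; field; lra]).
  have Q := ff2_limit n s A' M ltac:(apply Rabs_le; unfold A'; lra) ok ok Hn4. fold K in Q.
  have: gam n^2*K*ff n s<=e1.
  { trans (gam n^2*(K*M)); [|lra]. rewrite Rmult_assoc. apply Rmult_le_compat_l; [pos|]. apply Rmult_le_compat_l; lra. }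
  replace (ff2 n s-(2*q s^3+s*q s)) with ((2*(ff n s^2+ff n s*q s+q s^2)+s)*(ff n s-q s)+(ff2 n s-ff n s*(2*ff n s^2+s))) by ring.
  le_trans Rabs_triang. apply Rplus_le_compat; [|lra]. rewrite Rabs_mult. apply Rmult_le_compat_r; [pos|].
  have Hqs: - M<=q s<=M by (apply Rabs_le_between; lra).
  have: ff n s^2<=M^2 by mono. have: q s^2<=M^2 by nra.
  have: - M^2<=ff n s*q s<=M^2 by nra. have := pow2_ge_0 (ff n s). have := pow2_ge_0 (q s).
  have: ff n s^2+ff n s*q s+q s^2 >= 0 by nra.
  apply Rabs_le. unfold L, A'. lra. }
 specialize (GR GB x ok).
 have R0: (ff n X0-q X0)^2<=e1^2.
 { specialize (Rt X0 ok). rewrite <- pow2_abs. apply pow_incr. split; [pos|nra]. }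
 have R1: (ff1 n X0-Derive q X0)^2<=e1^2.
 { rewrite <- pow2_abs. apply pow_incr. split; [pos|].
  destruct (Hn2 X0 ok) as [L1 L2]. destruct (E X0 ok) as [[Q1 Q2] _]. have Fp := ff_pos n X0.
  specialize (Rt X0 ok). abs_in Rt. have: exp (2-X0)<=1 by mono.
  replace (ff1 n X0-Derive q X0) with (ff n X0*mq q n X0+Derive q X0*(exp (lq q n X0)-1)).
  2:{ unfold mq, lq. rewrite exp_ln by pos. field. lra. }
  le_trans Rabs_triang. rewrite !Rabs_mult. fold k. rewrite (Rabs_right (ff n X0)) by lra.
  have := exp_near_0 (lq q n X0) ok.
  have: ff n X0*Rabs (mq q n X0)<=9*dl by mono.
  have: k*Rabs (exp (lq q n X0)-1)<=k*(2*dl) by mono. nra. }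
 have RR: (ff n x-q x)^2<=3*e1^2*G.
 { have := pow2_ge_0 (ff1 n x-Derive q x). eapply Rle_trans; [|apply Rle_trans with (1 := GR)]; [lra|]. apply Rmult_le_compat_r; lra. }
 apply Rnot_lt_le. intros Hn0. rewrite <- pow2_abs in RR.
 have: eps^2<Rabs (ff n x-q x)^2 by (have: 0<=Rabs (ff n x-q x) by apply Rabs_pos; nra).
 have: 16*(G+1)^2*e1^2<=eps^2.
 { replace (16*(G+1)^2*e1^2) with ((4*(G+1)*e1)^2) by ring. rewrite He1'. apply pow_incr; lra. }
 have: 0<e1^2 by pos.
 have: 3*G<=16*(G+1)^2 by nra.
 have: 3*G*e1^2<=16*(G+1)^2*e1^2 by mono. lra.
Qed.

Lemma ff_lim q x : is_Hastings_McLeod q -> is_lim_seq (fun n => ff n x) (q x).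
Proof.
 intros Hq. apply is_lim_seq_spec. intros [eps He]; simpl.
 destruct (ff_converges q (Rabs x) (eps/2) Hq) as [n0 Hn0]; [lra|]. exists n0. intros n Hn.
 eapply Rle_lt_trans; [apply Hn0; [exact Hn|]|lra]. have := Rle_abs x. have Q := Rle_abs (- x). rewrite Rabs_Ropp in Q. lra.
Qed.

(** * Positivity of q and its expansion on the left *)

Lemma HM_ge_bump q x e : is_Hastings_McLeod q -> 0 < e -> 2*e^2 < - x-1-(PI/2)^2 -> e <= q x.
Proof.
 intros Hq He Hm. destruct (ff_bump x e He Hm) as [n0 Hn0].
 apply (is_lim_seq_le_loc (fun _ => e) (fun n => ff n x) e (q x)); [now exists n0|apply is_lim_seq_const|now apply ff_lim].
Qed.

Lemma HM_nonneg q x : is_Hastings_McLeod q -> 0 <= q x.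
Proof.
 intros Hq. apply (is_lim_seq_le (fun _ => 0) (fun n => ff n x) 0 (q x)); [|apply is_lim_seq_const|now apply ff_lim].
 intros n. apply Rlt_le, ff_pos.
Qed.

Lemma pi_half_sq : (PI/2)^2 <= 3.
Proof.
 have := PI_RGT_0. have: PI<=2*(16/10).
 { apply Rnot_lt_le. intros Hn. have := cos_le_quartic (16/10) ok.
  have: 0<cos (16/10) by (apply cos_gt_0; lra). lra. }
 nra.
Qed.

(** A zero of the nonnegative function q would be double, so q would vanish identically to its left
    by Gronwall, against the lower bound q >= 1 at some l <= -7. *)
Lemma HM_pos q x : is_Hastings_McLeod q -> 0 < q x.
Proof.
 intros Hq. destruct (HM_derive q Hq) as [D D1]. have H0 := HM_nonneg q x Hq.
 destruct (Req_dec (q x) 0) as [Hz|]; [exfalso|lra].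
 have Hd: Derive q x=0.
 { destruct (Rtotal_order (Derive q x) 0) as [Hn|[Hn|Hn]]; [exfalso|assumption|exfalso].
  - have Dn: is_derive (fun s => - q s) x (- Derive q x) by (apply isd_opp, D).
   destruct (derive_pos_right _ _ _ Dn ok) as [d [Hd1 Hd2]].
   specialize (Hd2 (x+d/2) ok). have := HM_nonneg q (x+d/2) Hq. lra.
  - have Dn: is_derive (fun s => - q s) x (- Derive q x) by (apply isd_opp, D).
   destruct (derive_neg_left _ _ _ Dn ok) as [d [Hd1 Hd2]].
   specialize (Hd2 (x-d/2) ok). have := HM_nonneg q (x-d/2) Hq. lra. }
 set (l := Rmin x (-7)). have: l<=x by apply Rmin_l. have: l <= -7 by apply Rmin_r.
 destruct (continuity_ab_maj (fun s => Rabs (2*q s^2+s)) l x ok) as [m [Hm1 Hm2]].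
 { intros s Hs. apply continuity_pt_filterlim. apply (continuous_comp (fun s => 2*q s^2+s) Rabs); [|apply continuous_Rabs].
  eapply isd_continuous. specialize (D s). isd. reflexivity. }
 have G := gronwall_left q (Derive q) (fun s => 2*q s^3+s*q s) l x (Rabs (2*q m^2+m)) 0 (Rabs_pos _) ok
  (fun s _ => D s) (fun s _ => D1 s).
 have B: forall s, l<=s<=x -> Rabs (2*q s^3+s*q s)<=Rabs (2*q m^2+m)*Rabs (q s)+0.
 { intros s Hs. specialize (Hm1 s Hs). replace (2*q s^3+s*q s) with ((2*q s^2+s)*q s) by ring.
  rewrite Rabs_mult, Rplus_0_r. apply Rmult_le_compat_r; [pos|exact Hm1]. }
 specialize (G B l ok). rewrite Hz, Hd in G. replace (0^2+0^2+0^2) with 0 in G by ring. rewrite Rmult_0_l in G.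
 have := pi_half_sq. have := HM_ge_bump q l 1 Hq ok ok. nra.
Qed.

Lemma HM_lower q X : is_Hastings_McLeod q -> 5 <= X -> sqrt ((X-5)/2) <= q (- X).
Proof.
 intros Hq HX. have := pi_half_sq. have Hp := HM_pos q (- X) Hq.
 destruct (Req_dec X 5) as [->|]; [replace ((5-5)/2) with 0 by field; rewrite sqrt_0; lra|].
 have: 0<sqrt ((X-5)/2) by pos.
 apply HM_ge_bump; [assumption|assumption|]. rewrite <- Rsqr_pow2, Rsqr_sqrt by lra. lra.
Qed.

(** The barrier sqrt((X+1)/2) + 1/(x+X+1) + 1/(1-X-x) blows up at both ends of [-X-1, -X+1]; each
    fraction solves y'' = 2y^3, and 2y^2 + x >= 0 for the constant part. At the centre the fractions
    add 2. The window is shrunk by d so that 1/d exceeds the maximum of q. *)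
Lemma HM_upper q X : is_Hastings_McLeod q -> 5 <= X -> q (- X) <= sqrt ((X+1)/2)+2.
Proof.
 intros Hq HX. destruct (HM_derive q Hq) as [D D1].
 set (M := (X+1)/2). set (r := sqrt M). have Hr: 0<r by (apply sqrt_lt_R0; unfold M; lra).
 have Hr2: r*r=M by (apply sqrt_sqrt; unfold M; lra).
 destruct (continuity_ab_maj q (- X-1) (- X+1) ok) as [m [Hm1 Hm2]].
 { intros s Hs. apply continuity_pt_filterlim. eapply isd_continuous, D. }
 have Qm := HM_pos q m Hq. set (d := Rmin (1/2) (/ q m)).
 have Hd1: d<=1/2 by apply Rmin_l. have Hd2: d <= / q m by apply Rmin_r.
 have Hd: 0<d by (apply Rmin_glb_lt; [lra|now apply Rinv_0_lt_compat]).
 have Hqd: q m <= / d by (rewrite <- (Rinv_inv (q m)); apply Rinv_le_contravar; [lra|exact Hd2]).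
 have Lt: forall s, - X-1+d<=s <= - X+1-d -> 0 < / (s+X+1) /\ 0 < / (1-X-s).
 { intros s Hs. split; apply Rinv_0_lt_compat; lra. }
 replace (r+2) with (1*(r+(/ (- X+X+1) + / (1-X - - X)))) by fld.
 apply (ratio_max q (Derive q) (fun x => 2*q x^3+x*q x) (fun x => r+(/ (x+X+1) + / (1-X-x)))
   (fun x => - / (x+X+1)^2 + / (1-X-x)^2) (fun x => 2 * / (x+X+1)^3+2 * / (1-X-x)^3)
   (- X-1+d) (- X+1-d) 1); try lra; auto.
 - intros s Hs. isd; [lra|lra|]. field. lra.
 - intros s Hs. isd; [apply pow_nonzero; lra|apply pow_nonzero; lra|]. simpl. field. lra.
 - intros s Hs. specialize (Lt s Hs). lra.
 - intros s Hs Hlt. specialize (Lt s ok). rewrite <- !pow_inv. set (u := / (s+X+1)) in *. set (v := / (1-X-s)) in *.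
  have Qs := HM_pos q s Hq. set (a := q s) in *. set (b := r+(u+v)) in *.
  have Hs2: 2*b^2+s >= 2*(u+v)^2 by (have: - 2*M<=s by (unfold M; lra); unfold b; nra).
  have: u^3+v^3<=(u+v)^3.
  { replace ((u+v)^3) with (u^3+v^3+3*(u*v*(u+v))) by ring. have: 0<=u*v*(u+v) by pos. lra. }
  have: 2*u^3+2*v^3<=b*(2*b^2+s).
  { trans ((u+v)*(2*(u+v)^2)); [lra|]. apply Rmult_le_compat; [lra|nra|unfold b; lra|lra]. }
  have: 0<a*b*(2*(a-b)*(a+b)).
  { have: 0<b by (unfold b; lra). apply Rmult_lt_0_compat; [nra|]. apply Rmult_lt_0_compat; lra. }
  nra.
 - specialize (Hm1 (- X-1+d) ok). replace (- X-1+d+X+1) with d by ring.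
  have: 0 < / (1-X-(- X-1+d)) by pos. lra.
 - specialize (Hm1 (- X+1-d) ok). replace (1-X-(- X+1-d)) with d by ring.
  have: 0 < / (- X+1-d+X+1) by pos. lra.
Qed.

Lemma HM_left_leading q eps : is_Hastings_McLeod q -> 0 < eps <= 1 -> exists X0, 10 <= X0 /\ forall X, X0 <= X ->
 (1-eps)*sqrt (X/2) <= q (- X) <= (1+eps)*sqrt (X/2).
Proof.
 intros Hq He. set (X0 := Rmax 10 (100/eps^2)). have HX1 := Rmax_l 10 (100/eps^2). have HX2 := Rmax_r 10 (100/eps^2).
 fold X0 in HX1, HX2. exists X0. split; [exact HX1|]. intros X HX.
 have He2: 0<eps^2<=1 by (split; [pos|nra]).
 have HeX: 100<=eps^2*X.
 { trans (eps^2*(100/eps^2)); [right; field; lra|]. apply Rmult_le_compat_l; lra. }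
 have L := HM_lower q X Hq ok. have U := HM_upper q X Hq ok.
 set (r := sqrt (X/2)). have Hr: 0<r by (apply sqrt_lt_R0; lra). have Hr2: r*r=X/2 by (apply sqrt_sqrt; lra).
 have Her: 7<=eps*r.
 { have: 0<eps*r by pos. apply Rnot_lt_le; intros Hn. nra. }
 split.
 - eapply Rle_trans; [|exact L]. apply Rsqr_incr_0_var; [|pos]. rewrite Rsqr_sqrt by lra. unfold Rsqr. 
  have: eps^2*X<=eps*X by mono.
  replace ((1-eps)*r*((1-eps)*r)) with ((1-2*eps+eps^2)*(r*r)) by ring. rewrite Hr2. lra.
 - eapply Rle_trans; [exact U|]. assert (sqrt ((X+1)/2)<=r+1); [|lra].
  apply Rsqr_incr_0_var; [|lra]. rewrite Rsqr_sqrt by lra. unfold Rsqr.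
  replace ((r+1)*(r+1)) with (r*r+2*r+1) by ring. rewrite Hr2. lra.
Qed.

(* Formal expansion of q at -oo with one adjustable coefficient; x < 0 *)
Definition pser (k x : R) : R := 1 + / (8*x^3)-73/(128*x^6)-k/x^9.
Definition pser' (k x : R) : R := - 3/(8*x^4)+6*73/(128*x^7)+9*k/x^10.
Definition pser'' (k x : R) : R := 12/(8*x^5)-42*73/(128*x^8)-90*k/x^11.
Definition qbar (k x : R) : R := sqrt (- x/2)*pser k x.
Definition qbar1 (k x : R) : R := sqrt (- x/2)*(pser k x/(2*x)+pser' k x).
Definition qbar2 (k x : R) : R := sqrt (- x/2)*(pser'' k x+pser' k x/x-pser k x/(4*x^2)).

Lemma pser_derive k x : x < 0 -> is_derive (pser k) x (pser' k x).
Proof.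
 intros Hx. have Hn: forall m, x^m <> 0 by (intros; apply pow_nonzero; lra).
 unfold pser, pser'. isd; [assert (A := Hn 3%nat); simpl in *; lra|assert (A := Hn 6%nat); simpl in *; lra|apply Hn|]. simpl. field. lra.
Qed.
Lemma pser'_derive k x : x < 0 -> is_derive (pser' k) x (pser'' k x).
Proof.
 intros Hx. have Hn: forall m, x^m <> 0 by (intros; apply pow_nonzero; lra).
 unfold pser', pser''. isd; [assert (A := Hn 4%nat); simpl in *; lra|assert (A := Hn 7%nat); simpl in *; lra|apply Hn|]. simpl. field. lra.
Qed.

Lemma sqrt_neg_derive x : x < 0 -> is_derive (fun x => sqrt (- x/2)) x (sqrt (- x/2)/(2*x)).
Proof.
 intros Hx. have Hs: 0<sqrt (- x/2) by pos.
 have Hs2: sqrt (- x/2)*sqrt (- x/2) = - x/2 by (apply sqrt_sqrt; lra).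
 isd; [lra|lra|]. apply Rmult_eq_reg_r with (2*sqrt (- x/2)); [|lra].
 transitivity (- 1/2); [field; lra|]. transitivity (sqrt (- x/2)*sqrt (- x/2)/x); [rewrite Hs2; field; lra|field; lra].
Qed.

Lemma qbar_derive k x : x < 0 -> is_derive (qbar k) x (qbar1 k x).
Proof.
 intros Hx. unfold qbar, qbar1. eapply isd_eq; [apply isd_mult; [now apply sqrt_neg_derive|now apply pser_derive]|]. cbv beta. field. lra.
Qed.
Lemma qbar1_derive k x : x < 0 -> is_derive (qbar1 k) x (qbar2 k x).
Proof.
 intros Hx. unfold qbar1, qbar2. eapply isd_eq.
 - apply isd_mult; [now apply sqrt_neg_derive|]. apply isd_plus; [|now apply pser'_derive].
  apply isd_div; [now apply pser_derive|isd_|lra].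
 - cbv beta. field. lra.
Qed.

(** The residual qbar'' - qbar(2 qbar^2 + x) is a positive multiple of a polynomial in z = 1/|x|^3.
    The coefficients 1/8 and 73/128 are those that cancel its orders z and z^2, so that k decides
    the sign. *)
Lemma qbar2_eq k x : x < 0 -> let z := - / x^3 in let P := 1-z/8-73/128*z^2+k*z^3 in
 pser k x = P /\
 qbar2 k x-qbar k x*(2*qbar k x^2+x) =
  sqrt (- x/2)/x^2 * / z*(z*(- 1/4-35/32*z-73*143/512*z^2+323/4*k*z^3)-P*(P^2-1)).
Proof.
 intros Hx z P. have EP: pser k x=P by (unfold pser, P, z; field; lra). split; [exact EP|].
 unfold qbar, qbar2. rewrite EP. set (s := sqrt (- x/2)).
 have Hs2: s^2 = - x/2 by (unfold s; rewrite <- Rsqr_pow2, Rsqr_sqrt; lra).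
 replace (s*P*(2*(s*P)^2+x)) with (s*P*(2*s^2*P^2+x)) by ring. rewrite Hs2.
 unfold pser', pser'', P, z. field. lra.
Qed.

(** The truncated series leaves z^3(10657/512 + ...), already of the right sign for a supersolution.
    The term e acts in the same direction, through a factor close to 2. *)
Lemma qbar_poly_upper z e : 0 < z <= 1/1000 -> 0 <= e <= 1/10 ->
 let P := 1-z/8-73/128*z^2+e in
 z*(- 1/4-35/32*z-73*143/512*z^2+323/4*e)-P*(P^2-1) <= 0.
Proof.
 intros Hz He P. set (m := 1-z/8-73/128*z^2).
 have Hm: 999/1000<=m<=1 by (unfold m; nra).
 have Hbr: 0<=m*(m^2-1)-z*(- 1/4-35/32*z-73*143/512*z^2).
 { replace (m*(m^2-1)-z*(- 1/4-35/32*z-73*143/512*z^2)) with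
   (z^3*(10657/512+15549/16384*z-15987/131072*z^2-389017/2097152*z^3)) by (unfold m; field).
  apply Rmult_le_pos; [pos|]. nra. }
 have: 0<=e*(3*m^2-1+3*m*e+e^2-323/4*z).
 { apply Rmult_le_pos; [lra|]. nra. }
 replace P with (m+e) by reflexivity. nra.
Qed.

(** Here the leftover, at most 22 z^3, has the wrong sign and must be outweighed by e times 3/2;
    hence the condition e >= 20 z^3. *)
Lemma qbar_poly_lower z e : 0 < z <= 1/1000 -> 20*z^3 <= e <= 1/10 ->
 let P := 1-z/8-73/128*z^2-e in
 0 <= z*(- 1/4-35/32*z-73*143/512*z^2-323/4*e)-P*(P^2-1).
Proof.
 intros Hz He P. set (m := 1-z/8-73/128*z^2).
 have Hm: 999/1000<=m<=1 by (unfold m; nra).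
 have Hz3: 0<z^3 by pos.
 have Hbr: m*(m^2-1)-z*(- 1/4-35/32*z-73*143/512*z^2)<=22*z^3.
 { replace (m*(m^2-1)-z*(- 1/4-35/32*z-73*143/512*z^2)) with
   (z^3*(10657/512+15549/16384*z-15987/131072*z^2-389017/2097152*z^3)) by (unfold m; field).
  rewrite (Rmult_comm 22). apply Rmult_le_compat_l; [lra|]. nra. }
 have: 15/10<=3*m^2-1-3*m*e+e^2-323/4*z by nra.
 have: e*(15/10)<=e*(3*m^2-1-3*m*e+e^2-323/4*z) by mono.
 replace P with (m-e) by reflexivity. nra.
Qed.

(** Allows a comparison to start at a far point, where the two functions agree only up to a factor 1
    + eta. *)
Lemma le_of_factor (a b : R) : 0 < b -> (forall eta, 0 < eta <= 1 -> a <= (1+eta)*b) -> a <= b.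
Proof.
 intros Hb H. apply Rnot_lt_le. intros Hn.
 set (eta := Rmin 1 ((a-b)/(2*b))).
 have: 0<(a-b)/(2*b) by pos.
 have: eta<=(a-b)/(2*b) by apply Rmin_r. have: eta<=1 by apply Rmin_l.
 have: 0<eta by (apply Rmin_glb_lt; lra). specialize (H eta ok).
 have: eta*b<=(a-b)/2.
 { trans ((a-b)/(2*b)*b); [mono|right; field; lra]. }
 lra.
Qed.

Lemma z_of_x (X0 x : R) : 10 <= X0 -> x <= - X0 -> 0 < - / x^3 <= / X0^3 /\ / X0^3 <= 1/1000.
Proof.
 intros H0 Hx. have Hx3: - / x^3 = / (- x)^3 by fld. rewrite Hx3.
 have: X0^3<=(- x)^3 by mono.
 have: 10^3<=X0^3 by mono.
 split; [split; [pos|mono]|].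
 replace (1/1000) with (/ 10^3) by field. apply Rinv_le_contravar; [lra|lra].
Qed.

(** K = X0^9/20 makes the correction K/X^9 equal to 1/20 at -X0, where the leading asymptotics with
    relative error 1/40 already place q between the two barriers. At a far point all three functions
    have ratio at most 1 + eta, and [ratio_max] covers what lies between. *)
Lemma HM_left_expansion q : is_Hastings_McLeod q -> exists X0 K, 10 <= X0 /\ 0 < K /\ K/X0^9 <= 1/20 /\
 forall x, x <= - X0 -> qbar (- K) x <= q x <= qbar K x.
Proof.
 intros Hq. destruct (HM_derive q Hq) as [D D1].
 destruct (HM_left_leading q (1/40) Hq ok) as [X0 [HX0 L0]].
 set (K := X0^9/20). 
 have HX9b: 10^9<=X0^9 by mono.
 have HK: 20<=K by (unfold K; lra).
 exists X0, K. split; [exact HX0|]. split; [lra|]. split; [unfold K; right; field; lra|].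
 have Hz: forall x, x <= - X0 -> let z := - / x^3 in 0<z<=1/1000 /\ 0<K*z^3<=1/20 /\ 20*z^3<=K*z^3.
 { intros x Hx z. destruct (z_of_x X0 x HX0 Hx) as [Z1 Z2]. fold z in Z1. split; [lra|].
  have: 0<z^3 by pos. split; [|mono]. split; [nra|].
  have: z^3<=(/ X0^3)^3 by mono.
  trans (K*(/ X0^3)^3); [mono|right; unfold K; field; lra]. }
 have Sp: forall x, x <= - X0 -> 0<sqrt (- x/2) by (intros; apply sqrt_lt_R0; lra).
 have Pb: forall x, x <= - X0 -> 94/100<=pser (- K) x<=1 /\ 999/1000<=pser K x<=11/10 /\ 1 + / x^3<=pser K x.
 { intros x Hx. destruct (Hz x Hx) as [Z1 [Z2 Z3]]. set (z := - / x^3) in *.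
  destruct (qbar2_eq K x ok) as [-> _]. destruct (qbar2_eq (- K) x ok) as [-> _]. fold z.
  replace (- K*z^3) with (- (K*z^3)) by ring. replace (/ x^3) with (- z) by (unfold z; ring). nra. }
 have Qb: forall k x, x <= - X0 -> (k=K \/ k = - K) -> 0<qbar k x.
 { intros k x Hx Hk. destruct (Pb x Hx) as [P1 [P2 _]]. unfold qbar. specialize (Sp x Hx). destruct Hk as [-> | ->]; apply Rmult_lt_0_compat; lra. }
 have Pre: forall x, x <= - X0 -> 0<sqrt (- x/2)/x^2 * / (- / x^3).
 { intros x Hx. destruct (Hz x Hx) as [Z1 _]. apply Rmult_lt_0_compat; [|pos].
  apply Rdiv_lt_0_compat; [now apply Sp|]. nra. }
 have Up: forall x, x <= - X0 -> qbar2 K x<=qbar K x*(2*qbar K x^2+x).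
 { intros x Hx. destruct (Hz x Hx) as [Z1 [Z2 Z3]]. destruct (qbar2_eq K x ok) as [_ E]. specialize (Pre x Hx).
  set (z := - / x^3) in *. have Q := qbar_poly_upper z (K*z^3) Z1 ok. cbv zeta in E, Q.
  replace (323/4*K*z^3) with (323/4*(K*z^3)) in E by ring. nra. }
 have Lo: forall x, x <= - X0 -> qbar (- K) x*(2*qbar (- K) x^2+x)<=qbar2 (- K) x.
 { intros x Hx. destruct (Hz x Hx) as [Z1 [Z2 Z3]]. destruct (qbar2_eq (- K) x ok) as [_ E]. specialize (Pre x Hx).
  set (z := - / x^3) in *. have Q := qbar_poly_lower z (K*z^3) Z1 ok. cbv zeta in E, Q.
  replace (323/4 * - K*z^3) with (- (323/4*(K*z^3))) in E by ring.
  replace (- K*z^3) with (- (K*z^3)) in E by ring. unfold Rminus in Q. unfold Rminus in E. nra. }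
 have Far: forall x eta, x <= - X0 -> 0<eta<=1 -> exists l, l<=x /\ q l<=(1+eta)*qbar K l /\ qbar (- K) l<=(1+eta)*q l.
 (* eta/3 leaves room for the product of two such errors: (1 + eta)(1 - eta/3) >= 1 for eta <= 1. *)
 { intros x eta Hx He. destruct (HM_left_leading q (eta/3) Hq ok) as [X1 [HX1 L1]].
  set (Y := Rmax (Rmax X1 (- x)) (3/eta)). have Y1 := Rmax_l (Rmax X1 (- x)) (3/eta). have Y2 := Rmax_r (Rmax X1 (- x)) (3/eta).
  minmax. fold Y in Y1, Y2. specialize (L1 Y ok).
  exists (- Y). have HY: - Y <= - X0 by lra. destruct (Pb (- Y) HY) as [P1 [P2 P3]]. specialize (Sp (- Y) HY).
  unfold qbar. rewrite Ropp_involutive in *. set (r := sqrt (Y/2)) in *.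
  have P4: 1-eta/3<=pser K (- Y).
  { eapply Rle_trans; [|exact P3]. have: / (- Y)^3 = - / Y^3 by fld. rewrite H1.
   have: / Y^3 <= / Y by mono.
   assert (/ Y<=eta/3); [|lra]. replace (eta/3) with (/ (3/eta)) by fld. apply Rinv_le_contravar; [pos|lra]. }
  split; [lra|]. split.
  - le_trans L1. nra.
  - 
   apply Rle_trans with r; [nra|]. trans ((1+eta)*((1-eta/3)*r)); [nra|]. apply Rmult_le_compat_l; lra. }
 intros x Hx. specialize (L0 X0 ok). 
 have S0 := Sp (- X0) ok. rewrite Ropp_involutive in S0.
 have Z0: K*(- / (- X0)^3)^3=1/20 by (unfold K; field; lra).
 have E1: 104/100<=pser K (- X0) /\ pser (- K) (- X0)<=95/100.
 { destruct (Hz (- X0) ok) as [Z1 _]. set (z := - / (- X0)^3) in *.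
  destruct (qbar2_eq K (- X0) ok) as [-> _]. destruct (qbar2_eq (- K) (- X0) ok) as [-> _]. fold z.
  replace (- K*z^3) with (- (K*z^3)) by ring. rewrite Z0. nra. }
 split; (apply le_of_factor; [first [apply HM_pos; assumption | apply Qb; [assumption|now left]]|]); intros eta He;
  destruct (Far x eta Hx He) as [l [Hl [F1 F2]]].
 - apply (ratio_max (qbar (- K)) (qbar1 (- K)) (qbar2 (- K)) q (Derive q) (fun x => 2*q x^3+x*q x) l (- X0) (1+eta)); auto; try lra.
  + intros; apply qbar_derive; lra. + intros; apply qbar1_derive; lra.
  + intros; apply HM_pos; assumption.
  + intros s Hs Hlt. have Qs := HM_pos q s Hq. specialize (Lo s ok).
   set (a := qbar (- K) s) in *. set (b := q s) in *.
   have: 0<a*b*(2*(a-b)*(a+b)) by pos. nra.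
  + unfold qbar. rewrite Ropp_involutive. nra.
 - apply (ratio_max q (Derive q) (fun x => 2*q x^3+x*q x) (qbar K) (qbar1 K) (qbar2 K) l (- X0) (1+eta)); auto; try lra.
  + intros; apply qbar_derive; lra. + intros; apply qbar1_derive; lra.
  + intros; apply Qb; [lra|now left].
  + intros s Hs Hlt. have Bs := Qb K s ok ltac:(now left). specialize (Up s ok).
   set (b := qbar K s) in *. set (a := q s) in *.
   have: 0<a*b*(2*(a-b)*(a+b)) by pos. nra.
  + unfold qbar. rewrite Ropp_involutive. set (r := sqrt (X0/2)) in *. have: r*(104/100)<=r*pser K (- X0) by mono. nra.
Qed.

(* Angles with prescribed squared cosine, and the scaled equation in terms of the latter. *)
Definition ang (C : R) : R := asin (sqrt (1-C)).

(** * Barriers for the squared cosine, uniform in N *)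

Lemma ang_facts C : 0 < C < 1 -> sin (ang C) = sqrt (1-C) /\ cos (ang C)^2 = C /\ 0 < ang C < PI/2 /\ 0 < cos (ang C) /\ 0 < sin (ang C).
Proof.
 intros HC. set (s := sqrt (1-C)). have Hs: 0<s by (apply sqrt_lt_R0; lra).
 have Hs2: s*s=1-C by (apply sqrt_sqrt; lra). have Hs1: s<1 by nra.
 have E: sin (ang C)=s by (apply sin_asin; fold s; lra).
 have B := asin_bound_lt s ok. fold s in E. unfold ang in *. fold s. fold s in E.
 have P: 0<asin s.
 { destruct (Rlt_le_dec 0 (asin s)) as [|Hn]; [assumption|exfalso].
  have Q := sin_ge_0 (- asin s) ok ltac:(pose proof PI_RGT_0; lra). rewrite sin_neg in Q. lra. }
 have Hc: 0<cos (asin s) by (apply cos_gt_0; lra).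
 have S2 := sin2_cos2 (asin s). unfold Rsqr in S2. rewrite E in *. repeat split; simpl; lra.
Qed.

Lemma ang_derive (C C1 : R -> R) x : 0 < C x < 1 -> is_derive C x (C1 x) ->
 is_derive (fun x => ang (C x)) x (- C1 x/(2*(sin (ang (C x))*cos (ang (C x))))).
Proof.
 intros HC D. destruct (ang_facts (C x) HC) as [E1 [E2 [E3 [E4 E5]]]].
 have Hs: 0<sqrt (1-C x)<1.
 { rewrite <- E1. split; [lra|]. have S2 := sin2_cos2 (ang (C x)). unfold Rsqr in S2. nra. }
 have R1: -1<sqrt (1-C x)<1 by lra.
 eapply isd_eq.
 - unfold ang. apply (isd_comp asin).
  + apply is_derive_Reals, (derive_pt_eq_1 _ _ _ _ (derive_pt_asin _ R1)).
  + apply isd_sqrt; [|lra]. apply isd_minus; [isd_|exact D].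
 - replace (sqrt (1-(sqrt (1-C x))²)) with (cos (ang (C x))) by (unfold ang; rewrite cos_asin by lra; reflexivity).
  rewrite <- E1. field. lra.
Qed.

Lemma ang_derive2 (C C1 C2 : R -> R) x : 0 < C x < 1 -> is_derive C x (C1 x) -> is_derive C1 x (C2 x) ->
 is_derive (fun x => - C1 x/(2*(sin (ang (C x))*cos (ang (C x))))) x
  (- (C2 x+C1 x^2*(2*C x-1)/(2*C x*(1-C x)))/(2*(sin (ang (C x))*cos (ang (C x))))).
Proof.
 intros HC D D1. destruct (ang_facts (C x) HC) as [E1 [E2 [E3 [E4 E5]]]].
 have DA := ang_derive C C1 x HC D. have S2 := sin2_cos2 (ang (C x)). unfold Rsqr in S2.
 eapply isd_eq.
 - apply isd_div; [apply isd_opp, D1| |nra]. apply isd_mult; [isd_|]. apply isd_mult; [apply isd_sin, DA|apply isd_cos, DA].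
 - cbv beta. set (s := sin (ang (C x))) in *. set (c := cos (ang (C x))) in *.
  have EC: C x=c^2 by lra. have ES: 1-C x=s^2 by (rewrite <- E2; simpl; lra). rewrite ES.
  replace (2*C x-1) with (c^2-s^2) by (rewrite <- ES, <- E2; ring). rewrite EC. field. lra.
Qed.

(** The residual Fx - A2 equals T/(4 b c^3 s^3) with c, s > 0. The sign of T, which contains no
    trigonometric functions any more, decides on which side the angle is a barrier. *)
Lemma ang_Fx b (C C1 C2 : R -> R) x : 0 < b -> 0 < C x < 1 ->
 let T := 2*b*C x*(1-C x)*C2 x+b*C1 x^2*(2*C x-1)+2*(1-C x)^2*(1-C x^2*exp (- (2*b*x))) in
 let A2 := - (C2 x+C1 x^2*(2*C x-1)/(2*C x*(1-C x)))/(2*(sin (ang (C x))*cos (ang (C x)))) in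
 (0 <= T -> A2 <= Fx b x (ang (C x))) /\ (T <= 0 -> Fx b x (ang (C x)) <= A2).
Proof.
 intros Hb HC T A2. destruct (ang_facts (C x) HC) as [E1 [E2 [E3 [E4 E5]]]].
 have S2 := sin2_cos2 (ang (C x)). unfold Rsqr in S2.
 set (s := sin (ang (C x))) in *. set (c := cos (ang (C x))) in *.
 have ES: 1-C x=s^2 by (rewrite <- E2; simpl; lra).
 have E: Fx b x (ang (C x))-A2=T/(4*b*c^3*s^3).
 { unfold Fx, A2, T. fold s c. rewrite ES. replace (2*C x-1) with (c^2-s^2) by (rewrite <- ES, <- E2; ring).
  rewrite <- E2. field. lra. }
 have P: 0 < / (4*b*c^3*s^3).
 { apply Rinv_0_lt_compat. have: 0<c^3 by pos. have: 0<s^3 by pos.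
  apply Rmult_lt_0_compat; [|lra]. apply Rmult_lt_0_compat; lra. }
 unfold Rdiv in E. split; intros HT; nra.
Qed.

(* approximate squared cosine; u = exp (b x), v = 1 - u, sg = +1 or -1 *)
Definition ceps (b sg u : R) : R := b^3*u^2/(1-u)^2*(1/4+sg*(b/(1-u))).
Definition ceps' (b sg u : R) : R := b^3*u^2/(1-u)^3*(1/2+sg*(b/(1-u))*(2+u)).
Definition ceps'' (b sg u : R) : R := b^3*u^2/(1-u)^4*(1/2*(2+u)+sg*(b/(1-u))*(4+7*u+u^2)).
Definition cbar (b sg x : R) : R := exp (b*x)*(1+ceps b sg (exp (b*x))).
Definition cbar1 (b sg x : R) : R := let u := exp (b*x) in b*u*(1+ceps b sg u+ceps' b sg u).
Definition cbar2 (b sg x : R) : R := let u := exp (b*x) in b^2*u*(1+ceps b sg u+2*ceps' b sg u+ceps'' b sg u).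

Lemma exp_neg_lt1 b x : 0 < b -> x < 0 -> 0 < exp (b*x) < 1.
Proof. intros. split; [pos|]. rewrite <- exp_0. apply exp_increasing. nra. Qed.

Lemma cbar_derive b sg x : 0 < b -> x < 0 -> is_derive (cbar b sg) x (cbar1 b sg x).
Proof.
 intros Hb Hx. have Hu := exp_neg_lt1 b x Hb Hx. unfold cbar, cbar1, ceps, ceps'.
 isd; [apply pow_nonzero; lra|lra|]. simpl. field. lra.
Qed.

Lemma cbar1_derive b sg x : 0 < b -> x < 0 -> is_derive (cbar1 b sg) x (cbar2 b sg x).
Proof.
 intros Hb Hx. have Hu := exp_neg_lt1 b x Hb Hx. unfold cbar1, cbar2, ceps, ceps', ceps''. cbv zeta.
 isd; try (apply pow_nonzero; lra); try lra. simpl. field. lra.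
Qed.

Lemma abs_prod2 (a b A B : R) : - A <= a <= A -> - B <= b <= B -> - (A*B) <= a*b <= A*B.
Proof. intros. nra. Qed.

(** Terms of order one cancel, and all remaining ones except -4 sg m (1 + E3) are O(g) with g = m^3
    <= m/100; the sign is therefore that of -sg. *)
Lemma barrier_algebra (sg v m g ee e1 r dd : R) :
 (sg = 1 \/ sg = -1) -> 0 < v < 1 -> 0 < m <= 1/10 -> g = m^3 ->
 - (1/2*g) <= ee <= 1/2*g -> - (3/2*g) <= e1 <= 3/2*g -> - (6*g) <= r <= 6*g -> - (1/2*g) <= dd <= 1/2*g ->
 let T := 2*(1+ee)*(1-dd)*(v+r)+(1-2*v+2*v*dd)*(1+e1)^2-(1-dd)^2*(1+4*sg*m)*(1+ee/2) in
 sg*T <= 0.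
Proof.
 intros Hsg Hv Hm Hg He H1 Hr Hd T.
 have Hgm: 0<g<=m/100 by (subst g; split; [pos|nra]).
 have Ped: - (g*(1/1000))<=ee*dd<=g*(1/1000) by (have := abs_prod2 ee dd (1/2*g) (1/2*g) He Hd; have: g*g<=g*(1/1000) by mono; lra).
 have P1: - (11/10*g)<=ee-dd-ee*dd<=11/10*g by lra.
 have P2: - (101/100)<=v+r<=101/100 by lra.
 have Q1 := abs_prod2 _ _ _ _ P2 P1.
 have P3: - (1/2*g)<=v*dd<=1/2*g by (have := abs_prod2 v dd 1 (1/2*g) ok Hd; lra).
 have P4: - (11/10)<=1-2*v+2*v*dd<=11/10 by lra.
 have P5: - (31/10*g)<=2*e1+e1^2<=31/10*g.
 { have := abs_prod2 e1 e1 (3/2*g) (3/2*g) H1 H1. have: g*g<=g*(1/1000) by mono. simpl; lra. }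
 have Q2 := abs_prod2 _ _ _ _ P4 P5.
 have Q3: - (2*g)<=(1-dd)^2*(1+ee/2)-1<=2*g.
 { have Hgg: g*g<=g*(1/1000) by mono.
  have D2 := abs_prod2 dd dd (1/2*g) (1/2*g) Hd Hd.
  set (W := - 2*dd+dd^2). have HW: - (11/10*g)<=W<=11/10*g by (unfold W; simpl; lra).
  have D3 := abs_prod2 W (ee/2) (11/10*g) (1/4*g) HW ok.
  replace ((1-dd)^2*(1+ee/2)-1) with (W+ee/2+W*(ee/2)) by (unfold W; ring). lra. }
 set (E3 := (1-dd)^2*(1+ee/2)-1) in *.
 have ET: T=2*r+2*((v+r)*(ee-dd-ee*dd))+2*(v*dd)+(1-2*v+2*v*dd)*(2*e1+e1^2)-E3-4*sg*m*(1+E3).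
 { unfold T, E3. ring. }
 have: m*(9/10)<=m*(1+E3) by mono.
 destruct Hsg as [-> | ->]; rewrite ET; lra.
Qed.

(** Writing b = m v with m <= 1/10, T factors as b^3 u^2 times the expression of [barrier_algebra].
    The coefficient 1/4 in [ceps] makes its leading terms 2v + (1 - 2v) - 1 cancel, and the term sg
    b/(1-u) then decides the sign. *)
Lemma cbar_T b sg x : 0 < b -> x < 0 -> (sg = 1 \/ sg = -1) -> b/(1-exp (b*x)) <= 1/10 ->
 let C := cbar b sg in
 (exp (b*x)*(1-1/10000) <= C x < 1) /\
 sg*(2*b*C x*(1-C x)*cbar2 b sg x+b*cbar1 b sg x^2*(2*C x-1)+2*(1-C x)^2*(1-C x^2*exp (- (2*b*x)))) <= 0.
Proof.
 intros Hb Hx Hsg Hm0 C. have Hu := exp_neg_lt1 b x Hb Hx.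
 have Eu2: exp (- (2*b*x)) = / exp (b*x)^2.
 { rewrite exp_Ropp. f_equal. replace (2*b*x) with (b*x+b*x) by ring. rewrite exp_plus. ring. }
 rewrite Eu2. unfold C, cbar, cbar1, cbar2. cbv zeta. set (u := exp (b*x)) in *. set (v := 1-u) in *.
 have Hv: 0<v<1 by (unfold v; lra). set (m := b/v) in *. have Hm: 0<m<=1/10 by (split; [unfold m; apply Rdiv_lt_0_compat; lra|exact Hm0]).
 have Eb: b=m*v by (unfold m; field; lra).
 set (g := m^3). have Hg: 0<g<=m/100 by (unfold g; split; [pos|nra]).
 set (ee := ceps b sg u). set (e1 := ceps' b sg u). set (e2 := ceps'' b sg u).
 have Eee: ee=g*(v*u^2*(1/4+sg*m)) by (unfold ee, ceps, g; fold v; fold m; rewrite Eb; field; lra).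
 have Ee1: e1=g*(u^2*(1/2+sg*m*(2+u))) by (unfold e1, ceps', g; fold v; fold m; rewrite Eb; field; lra).
 have Ee2: v*e2=g*(u^2*(1/2*(2+u)+sg*m*(4+7*u+u^2))) by (unfold e2, ceps'', g; fold v; fold m; rewrite Eb; field; lra).
 have Hu2: 0<u^2<1 by (split; [pos|nra]).
 have Hvu: 0<v*u^2<1 by (split; nra).
 have Hsm: - (1/10)<=sg*m<=1/10 by (destruct Hsg as [-> | ->]; lra).
 have Bee: 0<=ee /\ - (1/2*g*v)<=ee<=1/2*g*v /\ ee<=1/2*g.
 { rewrite Eee. have: 0<=v*u^2*(1/4+sg*m)<=1/2*v by (split; [pos|nra]).
  split; [nra|]. split; nra. }
 have Be1: - (g)<=e1<=g.
 { rewrite Ee1. assert (-1<=u^2*(1/2+sg*m*(2+u))<=1); [|nra].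
  have: - (3/10)<=sg*m*(2+u)<=3/10 by (have := abs_prod2 (sg*m) (2+u) (1/10) 3 Hsm ok; lra). nra. }
 have Be2: - (3*g)<=v*e2<=3*g.
 { rewrite Ee2. assert (-3<=u^2*(1/2*(2+u)+sg*m*(4+7*u+u^2))<=3); [|nra].
  have: - (12/10)<=sg*m*(4+7*u+u^2)<=12/10 by (have := abs_prod2 (sg*m) (4+7*u+u^2) (1/10) 12 Hsm ok; lra). nra. }
 set (dd := u*ee/v). have Ed: u*ee=v*dd by (unfold dd; field; lra).
 have Bdd: 0<=dd<=1/2*g.
 { nra. }
 split.
 - split; [nra|]. have: u*(1+ee)=1-v*(1-dd) by (replace (v*(1-dd)) with (v-v*dd) by ring; rewrite <- Ed; unfold v; ring).
  have: 0<v*(1-dd) by pos. lra.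
 - set (r := v*(ee+2*e1+e2)).
  have Br: - (6*g)<=r<=6*g.
  { have := abs_prod2 v ee 1 (1/2*g) ok ok. have := abs_prod2 v e1 1 g ok Be1.
   replace r with (v*ee+2*(v*e1)+v*e2) by (unfold r; ring). lra. }
  have Alg := barrier_algebra sg v m g ee (ee+e1) r dd Hsg Hv Hm eq_refl ok ok Br ok. cbv zeta in Alg.
  have EC: u*(1+ee)=1-v*(1-dd) by (replace (v*(1-dd)) with (v-v*dd) by ring; rewrite <- Ed; unfold v; ring).
  have E1C: 1-u*(1+ee)=v*(1-dd) by lra.
  match goal with |- sg * ?T<=0 => assert (ET : T=b^3*u^2*(2*(1+ee)*(1-dd)*(v+r)+(1-2*v+2*v*dd)*(1+(ee+e1))^2-(1-dd)^2*(1+4*sg*m)*(1+ee/2))) end.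
  { rewrite E1C. replace (1-(u*(1+ee))^2 * / u^2) with (- (ee*(2+ee))) by fld.
   replace (2*(u*(1+ee))-1) with (1-2*v+2*v*dd) by lra.
   replace (2*(v*(1-dd))^2 * - (ee*(2+ee))) with (- (b^3*u^2*((1-dd)^2*(1+4*sg*m)*(1+ee/2)))).
   - unfold r. ring.
   - replace (ee*(2+ee)) with (2*((g*(v*u^2*(1/4+sg*m)))*(1+ee/2))) by (rewrite <- Eee; field). unfold g. rewrite Eb. field. }
  rewrite ET. have: 0<b^3*u^2 by pos.
  match goal with |- sg*(?B * ?A)<=0 => replace (sg*(B*A)) with (- (B * - (sg*A))) by ring; have: 0<=B * - (sg*A) by pos; lra end.
Qed.

Lemma near_right_angle p e : 0 < p < PI/2 -> cos p <= e -> PI/2-3*e <= p.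
Proof.
 intros Hp Hc. set (y := PI/2-p). have Hy: 0<y<PI/2 by (unfold y; lra). have := PI_4.
 have S := sin_ge_cubic y ok. replace (sin y) with (cos p) in S by (unfold y; rewrite sin_shift; reflexivity).
 have: y^3<=4*y by nra. unfold y in *. lra.
Qed.

Lemma phi_near n e : 0 < e -> exists x0, forall x, x <= x0 -> PI/2-e <= phi n x.
Proof.
 intros He. have L := dp2_lim (S n). rewrite is_lim_inf_eps in L.
 destruct (L (Rmin 1 (e^2/18))) as [T HT].
 { apply Rmin_glb_lt; [lra|]. have: 0<e^2 by pos. lra. }
 destruct (tim_large n T) as [x0 Hx0]. exists x0. intros x Hx. specialize (Hx0 x Hx). specialize (HT _ Hx0).
 have P := phi_range n x. have C2 := cos2_phi n x.
 have R := dp2_range n _ (tim_pos n x). apply Rabs_lt_between in HT.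
 minmax.
 replace e with (3*(e/3)) by field. apply near_right_angle; [assumption|]. apply Rnot_lt_le. intros Hn. nra.
Qed.

Lemma cbar_near b sg e x0 : 0 < b -> (sg = 1 \/ sg = -1) -> 0 < e ->
 (forall x, x <= x0 -> x < 0 /\ b/(1-exp (b*x)) <= 1/10) ->
 exists x1, x1 <= x0 /\ forall x, x <= x1 -> PI/2-e <= ang (cbar b sg x).
Proof.
 intros Hb Hsg He Hx0. set (k := e^2/36). have Hk: 0<k by (unfold k; have: 0<e^2 by pos; lra).
 exists (Rmin x0 (ln k/b)). split; [apply Rmin_l|]. intros x Hx.
 minmax. destruct (Hx0 x ok) as [Hneg Hm].
 destruct (cbar_T b sg x Hb Hneg Hsg Hm) as [[C1 C2] _]. have Hu := exp_neg_lt1 b x Hb Hneg.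
 have HC: 0<cbar b sg x<1 by nra. destruct (ang_facts _ HC) as [_ [E2 [E3 [E4 _]]]].
 have Huk: exp (b*x)<=k.
 { rewrite <- (exp_ln k) by assumption. apply exp_le_mono. trans (b*(ln k/b)); [mono|right; field; lra]. }
 have HC2: cbar b sg x<=2*exp (b*x).
 { unfold cbar. set (u := exp (b*x)) in *. assert (ceps b sg u<=1); [|nra].
  unfold ceps. set (v := 1-u) in *. have Hv: 0<v<1 by (unfold v; lra).
  set (m := b/v) in *. have Eb: b=m*v by (unfold m; field; lra). have: 0<m by (apply Rdiv_lt_0_compat; lra).
  replace (b^3*u^2/v^2*(1/4+sg*m)) with (m^3*(v*u^2*(1/4+sg*m))) by (rewrite Eb; field; lra).
  have: - (1/10)<=sg*m<=1/10 by (destruct Hsg as [-> | ->]; lra).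
  have: 0<m^3<=1 by (split; [pos|]; have: m^3<=(1/10)^3 by mono; lra).
  have: 0<u^2<=1 by (split; nra). have: 0<v*u^2<=1 by (split; nra).
  have: 0<=v*u^2*(1/4+sg*m)<=1 by (split; [pos|nra]). nra. }
 replace e with (3*(e/3)) by field. apply near_right_angle; [assumption|]. apply Rnot_lt_le. intros Hn. unfold k in *. nra.
Qed.

Lemma le_ang_cos p C : 0 < p < PI/2 -> 0 < C < 1 -> (p <= ang C <-> C <= cos p^2).
Proof.
 intros Hp HC. destruct (ang_facts C HC) as [_ [E2 [E3 [E4 _]]]].
 have Hc: 0<cos p by (apply cos_gt_0; lra). split; intros H.
 - have: cos (ang C)<=cos p by (apply cos_decr_1; lra). nra.
 - apply cos_decr_0; try lra. apply Rnot_lt_le. intros Hn. nra.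
Qed.

Lemma ang_le_cos p C : 0 < p < PI/2 -> 0 < C < 1 -> (ang C <= p <-> cos p^2 <= C).
Proof.
 intros Hp HC. destruct (ang_facts C HC) as [_ [E2 [E3 [E4 _]]]].
 have Hc: 0<cos p by (apply cos_gt_0; lra). split; intros H.
 - have: cos p<=cos (ang C) by (apply cos_decr_1; lra). nra.
 - apply cos_decr_0; try lra. apply Rnot_lt_le. intros Hn. nra.
Qed.

(** As x -> -oo at fixed n, phi and both barrier angles tend to PI/2, so far to the left their
    ratios are below 1 + eta. Together with the bracket assumed at x0 this gives both ends of the
    interval, and [Fx_ratio] excludes an interior maximum. *)
Lemma cbar_compare n x0 : (forall x, x <= x0 -> x < 0 /\ bet n/(1-exp (bet n*x)) <= 1/10) ->
 cbar (bet n) (-1) x0 <= cos (phi n x0)^2 <= cbar (bet n) 1 x0 ->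
 forall x, x <= x0 -> cbar (bet n) (-1) x <= cos (phi n x)^2 <= cbar (bet n) 1 x.
Proof.
 intros Hx0 [B1 B2] x Hx. set (b := bet n) in *. have Hb: 0<b by apply bet_pos.
 have HC: forall sg, (sg=1 \/ sg = -1) -> forall s, s<=x0 -> 0<cbar b sg s<1.
 { intros sg Hsg s Hs. destruct (Hx0 s Hs) as [S1 S2]. destruct (cbar_T b sg s Hb S1 Hsg S2) as [[C1 C2] _].
  have := exp_pos (b*s). nra. }
 have S1: (1=1 \/ 1 = -1) by now left. have S2: (-1=1 \/ -1 = -1) by now right.
 set (w1 := fun sg s => - cbar1 b sg s/(2*(sin (ang (cbar b sg s))*cos (ang (cbar b sg s))))).
 set (w2 := fun sg s => - (cbar2 b sg s+cbar1 b sg s^2*(2*cbar b sg s-1)/(2*cbar b sg s*(1-cbar b sg s)))/(2*(sin (ang (cbar b sg s))*cos (ang (cbar b sg s))))).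
 have D1: forall sg, (sg=1 \/ sg = -1) -> forall s, s<=x0 -> is_derive (fun s => ang (cbar b sg s)) s (w1 sg s).
 { intros sg Hsg s Hs. destruct (Hx0 s Hs) as [Q1 Q2]. apply ang_derive; [now apply HC|now apply cbar_derive]. }
 have D2: forall sg, (sg=1 \/ sg = -1) -> forall s, s<=x0 -> is_derive (w1 sg) s (w2 sg s).
 { intros sg Hsg s Hs. destruct (Hx0 s Hs) as [Q1 Q2]. apply ang_derive2; [now apply HC|now apply cbar_derive|now apply cbar1_derive]. }
 have W: forall s, s<=x0 -> w2 (-1) s<=Fx b s (ang (cbar b (-1) s)) /\ Fx b s (ang (cbar b 1 s))<=w2 1 s.
 { intros s Hs. destruct (Hx0 s Hs) as [Q1 Q2]. split.
  - apply (ang_Fx b (cbar b (-1)) (cbar1 b (-1)) (cbar2 b (-1)) s Hb); [now apply HC|].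
   destruct (cbar_T b (-1) s Hb Q1 S2 Q2) as [_ T]. lra.
  - apply (ang_Fx b (cbar b 1) (cbar1 b 1) (cbar2 b 1) s Hb); [now apply HC|].
   destruct (cbar_T b 1 s Hb Q1 S1 Q2) as [_ T]. lra. }
 have AF: forall sg, (sg=1 \/ sg = -1) -> forall s, s<=x0 -> 0<ang (cbar b sg s)<PI/2.
 { intros sg Hsg s Hs. apply ang_facts. now apply HC. }
 have HPI := PI2_1.
 have Far: forall sg eta, (sg=1 \/ sg = -1) -> 0<eta<=1 -> exists l, l<=x /\ PI/2<=(1+eta)*phi n l /\ PI/2<=(1+eta)*ang (cbar b sg l).
 { intros sg eta Hsg He. destruct (phi_near n (eta/4)) as [y1 Y1]; [lra|].
  destruct (cbar_near b sg (eta/4) x0 Hb Hsg ok Hx0) as [y2 [Y2 Y3]].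
  exists (Rmin x (Rmin y1 y2)). minmax. set (l := Rmin x (Rmin y1 y2)) in *.
  specialize (Y1 l ok). specialize (Y3 l ok). split; [lra|]. split; nra. }
 have PR := phi_range n.
 split.
 - apply le_ang_cos; [apply PR|now apply HC|]. apply le_of_factor; [now apply AF|]. intros eta He.
  destruct (Far (-1) eta S2 He) as [l [Hl [F1 F2]]].
  apply (ratio_max (phi n) (phi1 n) (fun s => Fx b s (phi n s)) (fun s => ang (cbar b (-1) s)) (w1 (-1)) (w2 (-1)) l x0 (1+eta)); try lra.
  + intros; apply phi_derive. + intros; apply phi1_derive.
  + intros s Hs; apply D1; [assumption|lra]. + intros s Hs; apply D2; [assumption|lra].
  + intros s Hs; apply AF; [assumption|lra].
  + intros s Hs Hlt. have A := AF (-1) S2 s ok. have P := PR s. destruct (W s ok) as [W1 _].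
   have FR := Fx_ratio b s _ _ Hb (proj1 A) Hlt (proj2 P).
   have: phi n s*w2 (-1) s<=phi n s*Fx b s (ang (cbar b (-1) s)) by mono. lra.
  + have := PR l. lra.
  + have := AF (-1) S2 x0 ok. have: phi n x0<=ang (cbar b (-1) x0) by (apply le_ang_cos; [apply PR|apply HC; [assumption|lra]|exact B1]). nra.
 - apply ang_le_cos; [apply PR|now apply HC|]. apply le_of_factor; [apply PR|]. intros eta He.
  destruct (Far 1 eta S1 He) as [l [Hl [F1 F2]]].
  apply (ratio_max (fun s => ang (cbar b 1 s)) (w1 1) (w2 1) (phi n) (phi1 n) (fun s => Fx b s (phi n s)) l x0 (1+eta)); try lra.
  + intros s Hs; apply D1; [assumption|lra]. + intros s Hs; apply D2; [assumption|lra].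
  + intros; apply phi_derive. + intros; apply phi1_derive.
  + intros s Hs; apply PR.
  + intros s Hs Hlt. have A := AF 1 S1 s ok. have P := PR s. destruct (W s ok) as [_ W1].
   have FR := Fx_ratio b s _ _ Hb (proj1 P) Hlt (proj2 A).
   have: phi n s*Fx b s (ang (cbar b 1 s))<=phi n s*w2 1 s by mono. lra.
  + have := AF 1 S1 l ok. lra.
  + have := PR x0. have: ang (cbar b 1 x0)<=phi n x0 by (apply ang_le_cos; [apply PR|apply HC; [assumption|lra]|exact B2]). nra.
Qed.

Lemma barrier_side n X x : 20 <= X -> bet n*X <= 1/2 -> x <= - X -> x < 0 /\ bet n/(1-exp (bet n*x)) <= 1/10.
Proof.
 intros HX Hb Hx. split; [lra|]. have Hp := bet_pos n. set (b := bet n) in *.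
 have E := exp_quad (b*X) ltac:(rewrite Rabs_right; nra). abs_in E.
 have: exp (b*x)<=exp (- (b*X)) by mono.
 have Hv: 10*b<=1-exp (b*x).
 { have: 20*b<=b*X by (rewrite Rmult_comm; apply Rmult_le_compat_l; lra). set (y := b*X) in *. have: y^2<=y*(1/2) by (simpl; rewrite Rmult_1_r; apply Rmult_le_compat_l; lra). lra. }
 apply Rmult_le_reg_r with (1-exp (b*x)); [lra|]. unfold Rdiv at 1. rewrite Rmult_assoc, Rinv_l by lra. lra.
Qed.

Lemma bet_lim : is_lim_seq bet 0.
Proof.
 apply is_lim_seq_spec. intros [eps He]; simpl. destruct (bet_small eps He) as [n0 H]. exists n0. intros n Hn.
 rewrite Rminus_0_r, Rabs_right; [now apply H|]. apply Rle_ge, Rlt_le, bet_pos.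
Qed.

Lemma seq_eventually_neg (u : nat -> R) (l : R) : is_lim_seq u l -> l < 0 -> exists n0, forall n, (n0 <= n)%nat -> u n < 0.
Proof.
 intros H Hl. destruct (lim_seq_eps u l (- l) H ok) as [n0 H0]. exists n0. intros n Hn. specialize (H0 n Hn).
 alra. Qed.

(* The barriers bracket the solution at -X once bet n is small, because q lies strictly between their limits. *)
Lemma barrier_boundary q : is_Hastings_McLeod q -> exists X0, 20 <= X0 /\ exists n0, forall n, (n0 <= n)%nat ->
 bet n*X0 <= 1/2 /\ cbar (bet n) (-1) (- X0) <= cos (phi n (- X0))^2 <= cbar (bet n) 1 (- X0).
Proof.
 intros Hq. destruct (HM_left_expansion q Hq) as [X1 [K [HX1 [HK [HKX E]]]]].
 set (X := Rmax 20 (Rmax X1 (2*K))). have Y1 := Rmax_l 20 (Rmax X1 (2*K)). have Y2 := Rmax_r 20 (Rmax X1 (2*K)).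
 minmax. fold X in Y1, Y2. clearbody X.
 exists X. split; [exact Y1|]. specialize (E (- X) ok). set (q0 := q (- X)) in *.
 have Hq0: 0<q0 by (apply HM_pos; assumption).
 destruct (qbar2_eq K (- X) ok) as [P1 _]. destruct (qbar2_eq (- K) (- X) ok) as [P2 _]. cbv zeta in P1, P2.
 set (z := - / (- X)^3) in *. have Ez: z = / X^3 by (unfold z; field; lra).
 have HX3: 20^3<=X^3 by mono. have HzX: z*X^3=1 by (rewrite Ez; field; lra).
 have Hz: 0<z<=1/8000.
 { rewrite Ez. split; [pos|]. replace (1/8000) with (/ 20^3) by field. apply Rinv_le_contravar; lra. }
 have HKz: 0<K*z^3<=z/100.
 { split; [pos|]. 
  have: K*z<=1/100.
  { have: K*z<=X/2*z by mono. have: X*400<=X^3 by nra.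
   have: X*z*400<=1 by (replace (X*z*400) with (z*(X*400)) by ring; rewrite <- HzX; apply Rmult_le_compat_l; lra). lra. }
  replace (K*z^3) with (K*z*z*z) by ring. nra. }
 replace (- K*z^3) with (- (K*z^3)) in P2 by ring.
 set (s := sqrt (- - X/2)). have Hs: 0<s by (apply sqrt_lt_R0; lra). have Hs2: s*s=X/2 by (unfold s; rewrite sqrt_sqrt; lra).
 unfold qbar in E. fold s in E. rewrite P1, P2 in E.
 (* 2 q^2 versus X (1 - z/4 -+ z/X) *)
 have Hzz: 20*z^2<=z/X.
 { unfold Rdiv. replace (z^2) with (z*z) by ring. rewrite <- Rmult_assoc, (Rmult_comm 20), Rmult_assoc. apply Rmult_le_compat_l; [lra|].
  apply Rmult_le_reg_r with X; [lra|]. rewrite Rinv_l by lra. rewrite <- HzX. nra. }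
 have KK: K*z^3<=z^2/20.
 { assert (K*z<=1/20); [|replace (K*z^3) with (K*z*z^2) by ring; have: 0<z^2 by pos; nra].
  have: K*z<=X/2*z by mono. have: X*400<=X^3 by nra.
  have: X*z*400<=1 by (replace (X*z*400) with (z*(X*400)) by ring; rewrite <- HzX; apply Rmult_le_compat_l; lra). lra. }
 set (p1 := 1-z/8-73/128*z^2+K*z^3) in *. set (p2 := 1-z/8-73/128*z^2 + - (K*z^3)) in *.
 have p2p: 0<p2 by (unfold p2; nra).
 have Q2: X*p2^2<=2*q0^2 by (have: (s*p2)^2<=q0^2 by (apply pow_incr; split; [pos|lra]); replace ((s*p2)^2) with (s*s*p2^2) in * by ring; rewrite Hs2 in *; lra).
 have Q1': 2*q0^2<X-(1/4-1/X)/X^2.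
 { have: p1^2<1-z/4+z/X.
  { have: p1<=1-z/8 by (unfold p1; nra). have: 0<p1 by (unfold p1; nra). nra. }
  replace (X-(1/4-1/X)/X^2) with (X*(1-z/4+z/X)) by (rewrite Ez; field; lra). nra. }
 have Q2': X-(1/4+1/X)/X^2<2*q0^2.
 { have: 1-z/4-z/X<p2^2.
  { have Hp2l: 1-z/8-z^2<=p2 by (unfold p2; nra).
   have: 0<=1-z/8-z^2 by nra. have: (1-z/8-z^2)^2<=p2^2 by mono.
   have := pow2_ge_0 (z/8+z^2). lra. }
  replace (X-(1/4+1/X)/X^2) with (X*(1-z/4-z/X)) by (rewrite Ez; field; lra). nra. }
 have LF := ff_lim q (- X) Hq. fold q0 in LF. have LB := bet_lim.
 have LbX: is_lim_seq (fun n => 1-bet n*X) 1.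
 { replace (Finite 1) with (Finite (1-0*X)) by (f_equal; ring).
  apply is_lim_seq_minus'; [apply is_lim_seq_const|]. apply is_lim_seq_mult'; [exact LB|apply is_lim_seq_const]. }
 have LG: is_lim_seq (fun n => / (1-bet n*X)) 1.
 { replace (Finite 1) with (Rbar_inv (Finite 1)) by (simpl; f_equal; field).
  apply is_lim_seq_inv; [exact LbX|]. intros Q; injection Q; lra. }
 have LFF: is_lim_seq (fun n => ff n (- X)*ff n (- X)) (q0*q0) by (apply is_lim_seq_mult'; exact LF).
 (* [LU] and [LL] treat upper bounds for the two barrier defects divided by [bet n]. Their limits
    are negative by the strict inequalities just proved, so the bounds are negative from some n
    on. *)
 have LU: is_lim_seq (fun n => 2*(ff n (- X)*ff n (- X))-X+bet n*(X*X)+(1/4-1/X)/X^2*(/ (1-bet n*X) * / (1-bet n*X)))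
   (2*(q0*q0)-X+0*(X*X)+(1/4-1/X)/X^2*(1*1)).
 { apply is_lim_seq_plus'; [apply is_lim_seq_plus'; [apply is_lim_seq_minus'|]|].
  - apply is_lim_seq_mult'; [apply is_lim_seq_const|exact LFF].
  - apply is_lim_seq_const.
  - apply is_lim_seq_mult'; [exact LB|apply is_lim_seq_const].
  - apply is_lim_seq_mult'; [apply is_lim_seq_const|]. apply is_lim_seq_mult'; exact LG. }
 have LL: is_lim_seq (fun n => X-(1-bet n*X)*((1-bet n*X)*(1-bet n*X))*((1/4+1/X)/X^2)
   - 2*(ff n (- X)*ff n (- X))+2*(bet n*((ff n (- X)*ff n (- X))*(ff n (- X)*ff n (- X)))))
   (X-1*(1*1)*((1/4+1/X)/X^2)-2*(q0*q0)+2*(0*((q0*q0)*(q0*q0)))).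
 { apply is_lim_seq_plus'; [apply is_lim_seq_minus'; [apply is_lim_seq_minus'|]|].
  - apply is_lim_seq_const.
  - apply is_lim_seq_mult'; [|apply is_lim_seq_const]. apply is_lim_seq_mult'; [exact LbX|]. apply is_lim_seq_mult'; exact LbX.
  - apply is_lim_seq_mult'; [apply is_lim_seq_const|exact LFF].
  - apply is_lim_seq_mult'; [apply is_lim_seq_const|]. apply is_lim_seq_mult'; [exact LB|]. apply is_lim_seq_mult'; exact LFF. }
 destruct (seq_eventually_neg _ _ LU) as [n1 Hn1]; [simpl in Q1'; simpl; lra|].
 destruct (seq_eventually_neg _ _ LL) as [n2 Hn2]; [simpl in Q2'; simpl; lra|].
 destruct (bet_small (/ (2*X))) as [n3 Hn3]; [pos|].
 exists (max n1 (max n2 n3)). intros n Hn. specialize (Hn1 n okn). specialize (Hn2 n okn). specialize (Hn3 n okn). 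
 have Hb := bet_pos n. have HbX: bet n*X<=1/2.
 { trans (/ (2*X)*X); [mono|right; field; lra]. }
 split; [exact HbX|]. destruct (barrier_side n X (- X) Y1 HbX ok) as [_ Hm].
 have Pr := phi_range n (- X). have Ep := phi_ff n (- X). have G2 := gam_sq n.
 have S2 := sin2_cos2 (phi n (- X)). unfold Rsqr in S2.
 have Su := sin_le_id (phi n (- X)) ok. have Sl := sin_ge_cubic (phi n (- X)) ok. have P4 := PI_4.
 unfold cbar, ceps. set (F := ff n (- X)) in *. set (b := bet n) in *. set (u := exp (b * - X)) in *. set (p := phi n (- X)) in *. set (v := 1-u) in *.
 have HbX0: 0<b*X by pos.
 have Eq := exp_quad (b*X) ltac:(rewrite Rabs_right; lra). abs_in Eq. replace (- (b*X)) with (b * - X) in Eq by ring. fold u in Eq.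
 have Eu := exp_ineq1_le (b * - X). fold u in Eu. 
 have Hv1: b*X*(1-b*X)<=v by (unfold v; simpl in Eq; lra). have Hv2: v<=b*X by (unfold v; lra).
 have Hv0: 0<v by (apply Rlt_le_trans with (2 := Hv1); apply Rmult_lt_0_compat; lra).
 set (m := b/v) in *. have Hm1: 1/X<=m.
 { unfold m. apply Rmult_le_reg_r with (X*v); [pos|]. replace (1/X*(X*v)) with v by fld. replace (b/v*(X*v)) with (b*X) by fld. lra. }
 set (g := / (1-b*X)) in *. 
 have Hm2: m<=1/X*g.
 { unfold m, g. apply Rmult_le_reg_r with (X*v*(1-b*X)); [pos|].
  replace (b/v*(X*v*(1-b*X))) with (b*X*(1-b*X)) by fld.
  replace (1/X * / (1-b*X)*(X*v*(1-b*X))) with v by fld. lra. }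
 have EC: forall sg, u*(1+b^3*u^2/v^2*(1/4+sg*m))=1-v+b*(u^3*(m^2*(1/4+sg*m))).
 { intros sg. unfold m, v. field. unfold v in Hv0. lra. }
 rewrite !EC. have Hu1: u<1 by (unfold v in Hv0; lra).
 have HX1': 0<1/X<=1/20 by (split; [pos|]; apply Rmult_le_reg_r with X; [lra|]; replace (1/X*X) with 1 by fld; lra).
 have Hu3: (1-b*X)*((1-b*X)*(1-b*X))<=u^3<=1.
 { split; [replace ((1-b*X)*((1-b*X)*(1-b*X))) with ((1-b*X)^3) by ring; apply pow_incr; lra|]. replace 1 with (1^3) by ring. apply pow_incr; lra. }
 have Hcos: cos p^2=1-sin p*sin p by (simpl; lra). rewrite Hcos.
 have EXX: forall w, w/X^2=w*((1/X)*(1/X)) by (intros; field; lra). rewrite EXX in Hn1, Hn2.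
 set (y := 1/X) in *. have Hp2: p*p=2*b*(F*F) by (rewrite Ep; transitivity (gam n^2*(F*F)); [ring|rewrite G2; reflexivity]).
 have Hsin: 0<=sin p by (apply sin_ge_0; lra). split.
 - have: sin p*sin p<=2*b*(F*F) by (rewrite <- Hp2; apply Rmult_le_compat; lra).
  have: m^2<=(y*g)*(y*g) by (replace ((y*g)*(y*g)) with ((y*g)^2) by ring; apply pow_incr; lra).
  have: u^3*(m^2*(1/4 + -1*m))<=1*((y*g)*(y*g)*(1/4-y)).
  { apply Rmult_le_compat; [pos|pos|lra|].
   apply Rmult_le_compat; [pos|lra|lra|lra]. }
  have: b*(u^3*(m^2*(1/4 + -1*m)))<=b*(1*((y*g)*(y*g)*(1/4-y))) by mono.
  have: b*(2*(F*F)-X+b*(X*X)+(1/4-y)*(y*y)*(g*g))<=0 by (rewrite <- (Rmult_0_r b); apply Rmult_le_compat_l; lra).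
  lra.
 - have Hsq: 2*b*(F*F)*(1-b*(F*F))<=sin p*sin p.
  { rewrite <- Hp2. have: p*p<=2*2 by mono. 
   have: 0<=p*(1-p*p/6) by pos.
   trans (p*(1-p*p/6)*(p*(1-p*p/6))); [|mono].
   replace (b*(F*F)) with (p*p/2) by (rewrite Hp2; field). set (w := p*p) in *.
   replace (p*(1-w/6)*(p*(1-w/6))) with (w*((1-w/6)*(1-w/6))) by (unfold w; ring).
   have: 0<=w by (unfold w; apply Rmult_le_pos; lra).
   apply Rmult_le_compat_l; [assumption|]. have := pow2_ge_0 w. lra. }
  have: y*y<=m^2 by (replace (y*y) with (y^2) by ring; apply pow_incr; lra).
  have: (1-b*X)*((1-b*X)*(1-b*X))*(y*y*(1/4+y))<=u^3*(m^2*(1/4+1*m)).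
  { apply Rmult_le_compat; [pos|pos|lra|].
   apply Rmult_le_compat; [nra|lra|lra|lra]. }
  have: b*((1-b*X)*((1-b*X)*(1-b*X))*(y*y*(1/4+y)))<=b*(u^3*(m^2*(1/4+1*m))) by mono.
  have: b*(X-(1-b*X)*((1-b*X)*(1-b*X))*((1/4+y)*(y*y))-2*(F*F)+2*(b*(F*F*(F*F))))<=0 by (rewrite <- (Rmult_0_r b); apply Rmult_le_compat_l; lra).
  lra.
Qed.

(* Uniform left asymptotics: cos^2 phi = u (1 + b^3 u^2 / (4 v^2)) up to a relative error b^4 u^2 / v^3. *)
Lemma cos2_phi_uniform q : is_Hastings_McLeod q -> exists X0, 20 <= X0 /\ exists n0, forall n, (n0 <= n)%nat ->
 bet n*X0 <= 1/2 /\ forall x, x <= - X0 ->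
 cbar (bet n) (-1) x <= cos (phi n x)^2 <= cbar (bet n) 1 x.
Proof.
 intros Hq. destruct (barrier_boundary q Hq) as [X0 [HX0 [n0 Hn0]]]. exists X0. split; [exact HX0|]. exists n0. intros n Hn.
 destruct (Hn0 n Hn) as [Hb HB]. split; [exact Hb|]. apply cbar_compare; [|exact HB]. intros x Hx. now apply (barrier_side n X0).
Qed.

(** * The integrals of q^2 and q, and the Hamiltonian *)

Lemma improper_primitive (f : R -> R) (T K : R) : (forall x, continuous f x) -> 0 < T -> (forall t, T <= t -> Rabs (f t) <= K/t^2) ->
 (forall x, is_derive (int_to_infty f) x (- f x)) /\ is_lim (int_to_infty f) p_infty 0.
Proof.
 intros Hc HT HB. set (h := fun b => RInt f 0 b).
 have Dh: forall x, is_derive h x (f x) by (intros; now apply RInt_derive_upper).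
 destruct (lim_of_derive_bound h f T K HT (fun t _ => Dh t) HB) as [l Hl].
 have E: forall x, int_to_infty f x=l-h x.
 { intros x. unfold int_to_infty. apply (RInt_gen_infty f (fun b => h b-h x)).
  - intros b _. replace (h b-h x) with (RInt f x b :> R).
   + apply (RInt_correct (V := RN)). now apply cont_ex_RInt.
   + have S := RInt_split f 0 x b Hc. unfold h. rewrite S. match goal with |- _ = ?a + ?b - ?a => replace (a+b-a) with b by (symmetry; apply Rplus_minus_l) end. reflexivity.
  - apply is_lim_minus'; [exact Hl|apply is_lim_const]. }
 split.
 - intros x. apply (is_derive_ext (fun x => l-h x)); [intros; symmetry; apply E|].
  eapply isd_eq; [apply isd_minus; [isd_|apply Dh]|]. ring.
 - apply (is_lim_ext (fun x => l-h x)); [intros; symmetry; apply E|].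
  replace (Finite 0) with (Finite (l-l)) by (f_equal; ring). apply is_lim_minus'; [apply is_lim_const|exact Hl].
Qed.

Lemma exp_m2_le_inv t : 0 < t -> exp (- (2*t)) <= / t^2.
Proof.
 intros Ht. rewrite exp_Ropp. apply Rinv_le_contravar; [pos|]. replace (2*t) with (t+t) by ring. rewrite exp_plus.
 have := exp_ineq1_le t. nra.
Qed.
Lemma exp_m1_le_inv t : 0 < t -> exp (- t) <= 4 * / t^2.
Proof.
 intros Ht. have H := exp_m2_le_inv (t/2) ok. replace (2*(t/2)) with t in H by field.
 replace (4 * / t^2) with (/ (t/2)^2) by fld. exact H.
Qed.

(** The Hamiltonian of Painleve II. With derivative -q^2 and limit 0 at +oo it is the function R of
    the statement, now explicit in q and q'. *)
Definition ham (q : R -> R) (x : R) : R := Derive q x^2-x*q x^2-q x^4.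

Lemma ham_derive q x : is_Hastings_McLeod q -> is_derive (ham q) x (- q x^2).
Proof.
 intros Hq. destruct (HM_derive q Hq) as [D D1]. specialize (D x). specialize (D1 x). unfold ham.
 eapply isd_eq; [apply isd_minus; [apply isd_minus; [apply isd_pow, D1|apply isd_mult; [isd_|apply isd_pow, D]]|apply isd_pow, D]|].
 cbv beta. simpl. ring.
Qed.

(** q' increases there, so q'(x) is at least the mean slope q(x) - q(x-1) >= -q(x-1). *)
Lemma HM_right_bounds q : is_Hastings_McLeod q -> exists X, 6 <= X /\ forall x, X <= x ->
 0 < q x <= 3*exp (2-x) /\ - (3*exp (3-x)) <= Derive q x <= 0.
Proof.
 intros Hq. destruct (HM_derive q Hq) as [D D1]. destruct (HM_edge q Hq) as [X [HX E]].
 exists (X+1). split; [lra|]. intros x Hx. destruct (E x ok) as [E1 E2]. split; [exact E1|]. split; [|exact E2].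
 destruct (MVT_cor2 q (Derive q) (x-1) x ok) as [z [Hz1 Hz2]]; [intros; apply is_derive_Reals, D|].
 have: Derive q z<=Derive q x.
 { apply (derive_nonneg_le (Derive q) (fun s => 2*q s^3+s*q s)); [lra|intros; apply D1|].
  intros s Hs. destruct (E s ok) as [[Q1 _] _]. have: 0<q s^3 by pos. nra. }
 destruct (E (x-1) ok) as [[Q1 Q2] _]. replace (2-(x-1)) with (3-x) in Q2 by ring.
 replace (x-(x-1)) with 1 in Hz1 by ring. lra.
Qed.

Lemma is_lim_squeeze_0 (f : R -> R) (T C : R) : (forall t, T <= t -> Rabs (f t) <= C*exp (- t)) -> is_lim f p_infty 0.
Proof.
 intros H. apply is_lim_inf_eps. intros eps He. exists (Rmax T (Rmax 1 (4*(Rabs C+1)/eps))).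
 intros t Ht. minmax. rewrite Rminus_0_r. eapply Rle_lt_trans; [apply H; lra|].
 have := exp_m1_le_inv t ok. have := exp_pos (- t). have := Rle_abs C. have := Rabs_pos C.
 have HtC: 4*(Rabs C+1)<eps*t.
 { apply Rle_lt_trans with (eps*(4*(Rabs C+1)/eps)); [right; field; lra|apply Rmult_lt_compat_l; lra]. }
 apply Rle_lt_trans with ((Rabs C+1)*(4 * / t^2)).
 - trans ((Rabs C+1)*exp (- t)); [mono|mono].
 - apply Rmult_lt_reg_r with (t^2); [pos|]. rewrite !Rmult_assoc, Rinv_l, Rmult_1_r by (apply pow_nonzero; lra). nra.
Qed.

Lemma exp_shift a t : exp (a-t) = exp a*exp (- t).
Proof. unfold Rminus. apply exp_plus. Qed.

(** The upper bound is that of q'^2, the other two terms being negative. Nonnegativity holds because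
    the function decreases and tends to 0. *)
Lemma ham_right q : is_Hastings_McLeod q -> exists T C, 1 <= T /\ 0 < C /\ forall t, T <= t -> 0 <= ham q t <= C*exp (- (2*t)).
Proof.
 intros Hq. destruct (HM_right_bounds q Hq) as [X [HX E]].
 set (C := 9*exp 6). have HC: 0<C by (unfold C; have := exp_pos 6; lra).
 have U: forall t, X<=t -> ham q t<=C*exp (- (2*t)) /\ - (18*exp 4)*exp (- t)<=ham q t.
 { intros t Ht. destruct (E t Ht) as [[Q1 Q2] [Q3 Q4]]. unfold ham.
  have: Derive q t^2<=C*exp (- (2*t)).
  { replace (C*exp (- (2*t))) with ((3*exp (3-t))^2); [nra|]. unfold C.
   rewrite Rpow_mult_distr. replace (exp (3-t)^2) with (exp (3-t)*exp (3-t)) by ring. rewrite <- exp_plus.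
   rewrite Rmult_assoc, <- exp_plus. replace (3-t+(3-t)) with (6 + - (2*t)) by ring. ring. }
  have Q5: 0<=q t^2<=9*(exp 4*exp (- t)*exp (- t)).
  { split; [pos|]. trans ((3*exp (2-t))^2); [mono|].
   right. replace (exp 4*exp (- t)*exp (- t)) with (exp (2-t)*exp (2-t)); [ring|]. rewrite <- !exp_plus. f_equal. ring. }
  have: 0<=q t^4 by pos.
  have Q6: t*exp (- t)<=1.
  { rewrite exp_Ropp. apply Rmult_le_reg_r with (exp t); [pos|]. rewrite Rmult_assoc, Rinv_l by (apply Rgt_not_eq, exp_pos). have := exp_ineq1_le t. lra. }
  have Ep := exp_pos (- t). have E4 := exp_pos 4.
  split; [nra|].
  have: q t<=1.
  { apply Rle_trans with (1 := Q2). rewrite exp_shift. have: exp (-t)<=exp (-6) by mono.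
   assert (exp 2*exp (-6)<=1/3); [|have := exp_pos 2; nra]. rewrite <- exp_plus. replace (2 + -6) with (- (4)) by ring. rewrite exp_Ropp.
   replace (1/3) with (/ 3) by field. apply Rinv_le_contravar; [lra|]. have := exp_ineq1_le 4. lra. }
  have: q t^4<=q t^2 by (replace (q t^4) with (q t^2*q t^2) by ring; have: q t^2<=1 by (replace 1 with (1^2) by ring; apply pow_incr; lra); nra).
  have: t*q t^2<=t*(9*(exp 4*exp (- t)*exp (- t))) by mono.
  have: t*(9*(exp 4*exp (- t)*exp (- t)))<=9*exp 4*exp (- t).
  { replace (t*(9*(exp 4*exp (- t)*exp (- t)))) with (9*(exp 4*exp (- t))*(t*exp (- t))) by ring.
   rewrite <- (Rmult_1_r (9*exp 4*exp (- t))). replace (9*exp 4*exp (- t)) with (9*(exp 4*exp (- t))) by ring.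
   apply Rmult_le_compat_l; [nra|lra]. }
  have: exp (- t)<=1 by mono.
  have: 9*(exp 4*exp (- t)*exp (- t))<=9*exp 4*exp (- t) by nra.
  have := pow2_ge_0 (Derive q t). lra. }
 exists X, C. split; [lra|]. split; [exact HC|]. intros t Ht. split; [|now apply U].
 apply Rnot_lt_le. intros Hn.
 have L: is_lim (ham q) p_infty 0.
 { apply (is_lim_squeeze_0 _ X (C+18*exp 4)). intros s Hs. destruct (U s Hs) as [U1 U2]. have := exp_pos (- s). have := exp_pos 4.
  have: exp (- (2*s))<=exp (- s) by mono. apply Rabs_le. nra. }
 rewrite is_lim_inf_eps in L. destruct (L (- ham q t/2) ok) as [T1 HT1].
 set (s := Rmax t T1+1). have := Rmax_l t T1. have := Rmax_r t T1. specialize (HT1 s ltac:(unfold s; lra)).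
 have: - ham q t <= - ham q s.
 { apply (derive_nonneg_le (fun s => - ham q s) (fun s => - - q s^2)); [unfold s; lra| |].
  - intros y _. now apply isd_opp, ham_derive. - intros y _. have := pow2_ge_0 (q y). lra. }
 alra. Qed.

Lemma HM_continuous q x : is_Hastings_McLeod q -> continuous q x.
Proof. intros Hq. destruct (HM_derive q Hq) as [D _]. eapply isd_continuous, D. Qed.

Lemma TW_R_ham q x : is_Hastings_McLeod q -> TW_R q x = ham q x.
Proof.
 intros Hq. destruct (HM_derive q Hq) as [D _]. destruct (ham_right q Hq) as [T [C [HT [HC HB]]]].
 unfold TW_R, int_to_infty. apply (RInt_gen_infty _ (fun b => - ham q b - - ham q x)).
 - intros b Hb. apply (is_RInt_derive (V := RN) (fun b => - ham q b) (fun s => q s^2)).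
  + intros s _. eapply isd_eq; [apply isd_opp; now apply ham_derive|]. ring.
  + intros s _. eapply isd_continuous. apply isd_pow, D.
 - replace (Finite (ham q x)) with (Finite (- 0 - - ham q x)) by (f_equal; ring).
  apply is_lim_minus'; [|apply is_lim_const]. apply (is_lim_opp (ham q) p_infty (Finite 0)). apply (is_lim_squeeze_0 _ T C).
  intros t Ht. destruct (HB t Ht). rewrite Rabs_right by lra. eapply Rle_trans; [eassumption|]. apply Rmult_le_compat_l; [lra|]. apply exp_le_mono; lra.
Qed.

(* V'' = q^2 and V -> 0: the Tracy-Widom distribution F_2 is exp (- V). *)
Definition VV (q : R -> R) (x : R) : R := int_to_infty (TW_R q) x.
Definition SS (q : R -> R) (x : R) : R := int_to_infty q x.

Lemma VV_facts q : is_Hastings_McLeod q -> (forall x, is_derive (VV q) x (- ham q x)) /\ is_lim (VV q) p_infty 0.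
Proof.
 intros Hq. destruct (ham_right q Hq) as [T [C [HT [HC HB]]]].
 have E: forall x, TW_R q x=ham q x by (intros; now apply TW_R_ham).
 destruct (improper_primitive (TW_R q) T C) as [P1 P2]; [| lra | |].
 - intros x. apply (continuous_ext (ham q)); [intros; symmetry; apply E|]. eapply isd_continuous. now apply ham_derive.
 - intros t Ht. rewrite E. destruct (HB t Ht). rewrite Rabs_right by lra. have := exp_m2_le_inv t ok. unfold Rdiv. nra.
 - split; [|exact P2]. intros x. rewrite <- E. apply P1.
Qed.

Lemma SS_facts q : is_Hastings_McLeod q -> (forall x, is_derive (SS q) x (- q x)) /\ is_lim (SS q) p_infty 0.
Proof.
 intros Hq. destruct (HM_right_bounds q Hq) as [X [HX E]].
 apply (improper_primitive q X (12*exp 2)); [intros; now apply HM_continuous|lra|].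
 intros t Ht. destruct (E t Ht) as [[Q1 Q2] _]. rewrite Rabs_right by lra. rewrite exp_shift in Q2.
 have := exp_m1_le_inv t ok. have := exp_pos 2. unfold Rdiv. nra.
Qed.

(** * Limits of the determinants and of the companion sum at fixed x *)

(** log(exp(-t^2) D_(n+1)) in the variable x. [kx] is minus its second derivative and tends to
    q^2. *)
Definition lamx (n : nat) (x : R) : R := lx n x-tim n x^2.
Definition lamx1 (n : nat) (x : R) : R := lx1 n x+2*bet n*tim n x^2.
Definition kx (n : nat) (x : R) : R := exp (- (2*bet n*x))*(sin (phi n x)/gam n)^2.

Lemma lamx_derive n x : is_derive (lamx n) x (lamx1 n x).
Proof.
 unfold lamx, lamx1. eapply isd_eq; [apply isd_minus; [apply lx_derive|apply isd_pow, tim_derive]|]. simpl. ring.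
Qed.
Lemma lamx1_derive n x : is_derive (lamx1 n) x (- kx n x).
Proof.
 unfold lamx1, kx. have Hg := gam_pos n. have := bet_pos n.
 eapply isd_eq; [apply isd_plus; [apply lx1_derive|apply isd_mult; [isd_|apply isd_pow, tim_derive]]|].
 cbv beta. have T := tim_sq n x. 
 replace (0*tim n x^2+2*bet n*(INR 2*(- bet n*tim n x)*tim n x^Init.Nat.pred 2)) with (- (4*bet n^2*tim n x^2)) by (simpl; ring).
 rewrite T. unfold Rdiv. rewrite (Rpow_mult_distr (sin (phi n x))), pow_inv, gam_sq. have S2 := sin2_cos2 (phi n x). unfold Rsqr in S2.
 replace (cos (phi n x)^2) with (1-sin (phi n x)^2) by (simpl; lra). field. lra.
Qed.

Lemma kx_bound n x : bet n <= 1/8 -> 2 <= x -> 0 <= kx n x <= 4*exp 4*exp (- (2*x)).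
Proof.
 intros Hb Hx. have Hg := gam_pos n. have := bet_pos n. unfold kx. have P := phi_range n x.
 have := sin_le_id (phi n x) ok. have: 0<=sin (phi n x) by (apply sin_ge_0; lra).
 have := exp_pos (- (2*bet n*x)). have: exp (- (2*bet n*x))<=1 by mono.
 have: 0<=sin (phi n x)/gam n<=ff n x.
 { unfold ff, Rdiv. have: 0 < / gam n by pos. split; [pos|mono]. }
 have: (sin (phi n x)/gam n)^2<=ff n x^2 by mono. have := pow2_ge_0 (sin (phi n x)/gam n).
 have := ff_sq_decay n x Hb Hx. split; [pos|nra].
Qed.

Lemma lamx_to_0 n eps : 0 < eps -> exists x0, forall x, x0 <= x -> Rabs (lamx n x) <= eps.
Proof.
 intros He. destruct (ldet_at_0 (S n)) as [K HK].
 set (d := Rmin (1/4) (eps/(Rabs K+1))). have := Rabs_pos K. have := Rle_abs K.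
 have Hd: 0<d by (apply Rmin_glb_lt; [lra|apply Rdiv_lt_0_compat; lra]).
 have: d<=1/4 by apply Rmin_l. have Hd2: d<=eps/(Rabs K+1) by apply Rmin_r.
 destruct (tim_small n d Hd) as [x0 [_ Hx0]]. exists x0. intros x Hx. specialize (Hx0 x Hx). have := tim_pos n x.
 destruct (HK (tim n x) ok) as [H1' _]. unfold lamx, lx. apply Rabs_le_between in H1'.
 have: tim n x*(Rabs K+1)<=eps.
 { trans (eps/(Rabs K+1)*(Rabs K+1)); [mono|right; field; lra]. }
 apply Rabs_le. nra.
Qed.

Lemma decreasing_to_0 (h h1 : R -> R) (x0 : R) : (forall x, x0 <= x -> is_derive h x (h1 x)) -> (forall x, x0 <= x -> h1 x <= 0) ->
 (forall eps, 0 < eps -> exists y, forall x, y <= x -> Rabs (h x) <= eps) -> forall x, x0 <= x -> 0 <= h x.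
Proof.
 intros D N L x Hx. apply Rnot_lt_le. intros Hn. destruct (L (- h x/2) ok) as [y Hy].
 have := Rmax_l x y. have := Rmax_r x y. specialize (Hy (Rmax x y) ok). abs_in Hy.
 assert (- h x <= - h (Rmax x y)); [|lra].
 apply (derive_nonneg_le (fun s => - h s) (fun s => - h1 s)); [lra|intros; apply isd_opp, D; lra|]. intros s Hs. specialize (N s ok). lra.
Qed.

Lemma exp_m2_small C eps : 0 < eps -> exists y, forall x, y <= x -> Rabs (C*exp (- (2*x))) <= eps.
Proof.
 intros He. have L: is_lim (fun x => C*exp (- (2*x))) p_infty 0.
 { apply (is_lim_squeeze_0 _ 0 (Rabs C)). intros t Ht. rewrite Rabs_mult, (Rabs_right (exp _)) by pos.
  apply Rmult_le_compat_l; [pos|mono]. }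
 rewrite is_lim_inf_eps in L. destruct (L eps He) as [T HT]. exists (T+1). intros x Hx. specialize (HT x ok). rewrite Rminus_0_r in HT. lra.
Qed.

(** -[lamx] is convex and tends to 0 as x -> +oo, which fixes the signs of [lamx] and [lamx1]. The
    same argument for [lamx] + exp(4) exp(-2x), convex because [kx] <= 4 exp(4) exp(-2x), gives the
    opposite bounds. *)
Lemma lamx_tail n x : bet n <= 1/8 -> 2 <= x -> - (exp 4*exp (- (2*x))) <= lamx n x <= 0 /\ 0 <= lamx1 n x <= 2*exp 4*exp (- (2*x)).
Proof.
 intros Hb Hx. have E4 := exp_pos 4.
 have D1: forall s, is_derive (fun s => - lamx n s) s (- lamx1 n s) by (intros; apply isd_opp, lamx_derive).
 have D2: forall s, is_derive (fun s => - lamx1 n s) s (kx n s) by (intros s; eapply isd_eq; [apply isd_opp, lamx1_derive|ring]).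
 have L0: forall eps, 0<eps -> exists y, forall x, y<=x -> Rabs (- lamx n x)<=eps.
 { intros eps He. destruct (lamx_to_0 n eps He) as [y Hy]. exists y. intros s Hs. rewrite Rabs_Ropp. now apply Hy. }
 have Bd: forall (h h1 h2 : R -> R), (forall s, is_derive h s (h1 s)) -> (forall s, is_derive h1 s (h2 s)) -> (forall s, 2<=s -> 0<=h2 s) ->
  (forall eps, 0<eps -> exists y, forall x, y<=x -> Rabs (h x)<=eps) -> forall s, 2<=s -> h1 s<=0.
 { intros h h1 h2 Dh Dh1 P L s Hs. destruct (L 1 ok) as [y Hy]. apply Rnot_lt_le. intros Hn.
  have M1 := Rmax_l s y. have M2 := Rmax_r s y.
  have: h1 (Rmax s y)<=0.
  { apply (convex_bdd_decr h h1 h2 (Rmax s y) 1); auto; [intros; apply P; lra| |lra]. intros z Hz. specialize (Hy z ok). abs_in Hy; lra. }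
  have: h1 s<=h1 (Rmax s y) by (apply (derive_nonneg_le h1 h2); [lra|intros; apply Dh1|intros; apply P; lra]). lra. }
 have Q1: forall s, 2<=s -> - lamx1 n s<=0 by (apply (Bd _ _ _ D1 D2); [intros; now apply kx_bound|exact L0]).
 have Q2: forall s, 2<=s -> 0 <= - lamx n s by (apply (decreasing_to_0 _ (fun s => - lamx1 n s)); auto).
 set (h := fun s => lamx n s+exp 4*exp (- (2*s))). set (h1 := fun s => lamx1 n s + - (2*exp 4)*exp (- (2*s))).
 set (h2 := fun s => - kx n s+4*exp 4*exp (- (2*s))).
 have Dh: forall s, is_derive h s (h1 s) by (intros; apply isd_plus; [apply lamx_derive|apply exp_m2_derive]).
 have Dh1: forall s, is_derive h1 s (h2 s).
 { intros s. eapply isd_eq; [apply isd_plus; [apply lamx1_derive|apply exp_m2_derive]|]. unfold h2. ring. }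
 have Lh: forall eps, 0<eps -> exists y, forall x, y<=x -> Rabs (h x)<=eps.
 { intros eps He. destruct (lamx_to_0 n (eps/2)) as [y1 Y1]; [lra|]. destruct (exp_m2_small (exp 4) (eps/2)) as [y2 Y2]; [lra|].
  exists (Rmax y1 y2). intros s Hs. minmax. specialize (Y1 s ok). specialize (Y2 s ok).
  unfold h. le_trans Rabs_triang. lra. }
 have Q3: forall s, 2<=s -> h1 s<=0.
 { apply (Bd _ _ _ Dh Dh1); [|exact Lh]. intros s Hs. unfold h2. have := kx_bound n s Hb Hs. lra. }
 have Q4: forall s, 2<=s -> 0<=h s by (apply (decreasing_to_0 _ h1); auto).
 specialize (Q1 x Hx). specialize (Q2 x Hx). specialize (Q3 x Hx). specialize (Q4 x Hx). unfold h, h1 in *. lra.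
Qed.

Lemma Taylor2_bound (h h1 h2 : R -> R) (x X M : R) : x <= X -> (forall s, is_derive h s (h1 s)) -> (forall s, is_derive h1 s (h2 s)) ->
 (forall s, x <= s <= X -> Rabs (h2 s) <= M) -> Rabs (h x) <= Rabs (h X)+(X-x)*(Rabs (h1 X)+M*(X-x)).
Proof.
 intros Hx D D1 HM. have HM0: 0<=M by (specialize (HM x ok); have := Rabs_pos (h2 x); lra).
 have B1: forall s, x<=s<=X -> Rabs (h1 s)<=Rabs (h1 X)+M*(X-x).
 { intros s Hs. have B := derive_bound h1 h2 s X M ok (fun u _ => D1 u) (fun u Hu => HM u ok).
  replace (h1 s) with (h1 X + - (h1 X-h1 s)) by ring. le_trans Rabs_triang. rewrite Rabs_Ropp.
  have: M*(X-s)<=M*(X-x) by mono. lra. }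
 have B := derive_bound h h1 x X _ Hx (fun u _ => D u) B1.
 replace (h x) with (h X + - (h X-h x)) by ring. le_trans Rabs_triang. rewrite Rabs_Ropp. lra.
Qed.

Lemma sq_le_of_abs z a : a <= 1 -> Rabs z <= a -> z^2 <= a.
Proof. intros Ha H. abs_in H. nra. Qed.
Lemma mul_le_between a b A B : - A <= a <= A -> 0 <= b <= B -> - (A*B) <= a*b <= A*B.
Proof. intros. split; nra. Qed.

(** On a fixed window f is bounded and p = gam f. Then sin p/gam, 1/cos^2 p and the exponentials
    differ from f, 1 and 1 by O(gam^2), and f is replaced by q through uniform convergence; d
    collects all the gam^2 errors. *)
Lemma edge_uniform q x X eps : is_Hastings_McLeod q -> 0 < eps -> exists n0, forall n, (n0 <= n)%nat -> forall s, x <= s <= X ->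
 Rabs (kx n s-q s^2) <= eps /\
 Rabs (/ gam n*(exp (- bet n*s)*sin (phi n s)+sin (phi n s)/cos (phi n s)^2)-2*q s) <= eps.
Proof.
 intros Hq He. set (A := Rmax 1 (Rmax (Rabs x) (Rabs X))).
 have HA: 1<=A by apply Rmax_l.
 have HAx: Rabs x<=A /\ Rabs X<=A.
 { split; (eapply Rle_trans; [|apply Rmax_r]); [apply Rmax_l|apply Rmax_r]. }
 destruct (ff_bounded_on A HA) as [M0 [n1 [HM0 Hn1]]]. set (M := M0+1).
 set (Kc := 100*A*M^4). have HM1: 1<=M by (unfold M; lra). have HM4: 1<=M^4 by (replace 1 with (1^4) by ring; apply pow_incr; lra).
 have HK: 100<=Kc by (unfold Kc; nra).
 destruct (ff_converges q A (Rmin 1 (eps/(8*M))) Hq) as [n2 Hn2]; [apply Rmin_glb_lt; [lra|apply Rdiv_lt_0_compat; lra]|].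
 destruct (gam_sq_small Kc (Rmin 1 (eps/2))) as [n3 Hn3]; [lra|apply Rmin_glb_lt; lra|].
 destruct (gam_small (/ (2*M))) as [n4 Hn4]; [pos|].
 exists (max n1 (max n2 (max n3 n4))). intros n Hn s Hs. specialize (Hn1 n okn). specialize (Hn2 n okn). specialize (Hn3 n okn). specialize (Hn4 n okn).
 have HsA: - A<=s<=A.
 { destruct HAx as [H1 H2]. alra. }
 specialize (Hn1 s ok). specialize (Hn2 s HsA). have Fp := ff_pos n s. have Qp := HM_pos q s Hq.
 minmax. have Hg := gam_pos n. have Hb := bet_pos n. have G2 := gam_sq n.
 have HgM: gam n*M<=1/2 by (trans (/ (2*M)*M); [mono|right; field; lra]).
 have Pr := phi_range n s. have Ep := phi_ff n s.
 set (g := gam n) in *. set (b := bet n) in *. set (f := ff n s) in *. set (p := phi n s) in *.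
 have HfM: f<=M by (unfold M; lra). have Hp: p<=1/2 by (rewrite Ep; nra).
 have Hg2: 0<g^2 by pos.
 have Hf2: f^2<=M^2 by mono.
 have M24: M^2<=M^4 /\ M<=M^4 /\ M^3<=M^4.
 { have: 1<=M^2 by nra. have: 1<=M^3 by (replace 1 with (1^3) by ring; apply pow_incr; lra). repeat split; nra. }
 have S1 := sin_le_id p ok. have S2 := sin_ge_cubic p ok.
 (* sigma = sin p / g lies in [f (1 - g^2 M^2), f] *)
 set (sg := sin p/g).
 have Sg: f*(1-g^2*M^2)<=sg<=f.
 { unfold sg. split; apply Rmult_le_reg_r with g; try lra; unfold Rdiv; rewrite ?(Rmult_assoc (sin p)), ?Rinv_l, ?Rmult_1_r by lra.
  - rewrite Ep in *. replace ((g*f)^3) with (g*f*(g^2*f^2)) in S2 by ring.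
   have: g*f*(g^2*f^2)<=g*f*(g^2*M^2) by mono.
   have: 0<=g*f*(g^2*M^2) by pos. lra.
  - rewrite Ep in *; lra. }
 have HgA: g^2*(A*M^4)<=1/100 by (unfold Kc in Hn3; lra).
 have HA2: g^2*A<=g^2*(A*M^4) by mono.
 have HM2: g^2*M^2<=g^2*(A*M^4) by mono.
 have Hz1: Rabs (2*b*s)<=g^2*A.
 { rewrite <- G2, Rabs_mult, (Rabs_right (g^2)) by lra. apply Rmult_le_compat_l; [lra|apply Rabs_le; lra]. }
 have X1 := exp_quad (2*b*s) ok. have X2 := exp_quad (b*s).
 have Hz2: Rabs (b*s)<=g^2*A.
 { eapply Rle_trans; [|exact Hz1]. replace (2*b*s) with (2*(b*s)) by ring. rewrite (Rabs_mult 2), (Rabs_right 2) by lra. have := Rabs_pos (b*s). lra. }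
 specialize (X2 ok). replace (- (b*s)) with (- b*s) in X2 by ring.
 set (e1 := exp (- (2*b*s))) in *. set (e2 := exp (- b*s)) in *.
 set (d := g^2*(A*M^4)) in *.
 have He1: - (2*(g^2*A))<=1-e1<=2*(g^2*A).
 { abs_in X1. apply sq_le_of_abs in Hz1 as Hz1'; [|lra]. alra. }
 have He2: - (2*(g^2*A))<=1-e2<=2*(g^2*A).
 { abs_in X2. apply sq_le_of_abs in Hz2 as Hz2'; [|lra]. alra. }
 have HKd: Kc*g^2=100*d by (unfold Kc, d; ring).
 have Hd100: 100*d<=eps/2 by lra.
 have Hfq: Rabs (f-q s)<=eps/(8*M) by lra.
 have Heps8: eps/(8*M)*M=eps/8 by fld.
 have Heps9: eps/(8*M)<=eps/8 by (have: 0<eps/(8*M) by pos; clear-H3 Heps8 HM1; nra).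
 abs_in Hfq.
 have Hq2: q s<=M by (have: Rabs (f-q s)<=1 by lra; abs_in H3; unfold M; lra).
 have M4A: 0<=M^4<=A*M^4 by (clear-HM4 HA; nra).
 have HMd: g^2*M^2*M^2<=d by (unfold d; replace (g^2*M^2*M^2) with (g^2*M^4) by ring; apply Rmult_le_compat_l; lra).
 have HAMd: g^2*A*M^2<=d by (unfold d; rewrite Rmult_assoc; apply Rmult_le_compat_l; [lra|mono]).
 have HAMd1: g^2*A*M<=d by (unfold d; rewrite Rmult_assoc; apply Rmult_le_compat_l; [lra|mono]).
 have HMd3: g^2*M^2*M<=d by (unfold d; replace (g^2*M^2*M) with (g^2*M^3) by ring; apply Rmult_le_compat_l; lra).
 have: 0<=g^2*A by pos. have: 0<=g^2*M^2<=1/100 by (split; [pos|lra]).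
 have Hsg0: 0<=sg by (apply Rle_trans with (2 := proj1 Sg); apply Rmult_le_pos; lra).
 split.
 - unfold kx. fold b g p. fold sg. fold e1.
  have D1: - (2*d)<=sg^2-f^2<=0.
  { split; [|have: sg^2<=f^2 by mono; lra]. have: f^2*(1-2*(g^2*M^2))<=sg^2.
   { have: (f*(1-g^2*M^2))^2<=sg^2 by (apply pow_incr; split; [pos|lra]). have := pow2_ge_0 (f*(g^2*M^2)). lra. }
   have: f^2*(g^2*M^2)<=M^2*(g^2*M^2) by mono. lra. }
  have D2: - (2*d)<=(e1-1)*sg^2<=2*d.
  { have: 0<=sg^2<=M^2 by (split; [pos|mono]).
   assert (Q := mul_le_between (e1-1) (sg^2) (2*(g^2*A)) (M^2) ok ok). lra. }
  have D3: - (eps/4)<=f^2-q s^2<=eps/4.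
  { replace (f^2-q s^2) with ((f-q s)*(f+q s)) by ring.
   assert (Q := mul_le_between (f-q s) (f+q s) (eps/(8*M)) (2*M) ok ok). lra. }
  replace (e1*sg^2-q s^2) with ((e1-1)*sg^2+(sg^2-f^2)+(f^2-q s^2)) by ring. alra. - destruct (cos_inv3 p ok) as [Hc Hi]. have CB := COS_bound p.
  have Hc2: 1 <= / cos p^2<=1+3*p^2.
  { split.
   - rewrite <- Rinv_1. apply Rinv_le_contravar; [pos|]. clear-CB Hc; nra.
   - eapply Rle_trans; [|exact Hi]. apply Rinv_le_contravar; [pos|]. clear-CB Hc; have: 0<=cos p^2 by apply pow2_ge_0; simpl in *; nra. }
  replace (/ g*(e2*sin p+sin p/cos p^2)) with (e2*sg+sg * / cos p^2) by (unfold sg; field; lra).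
  set (ic := / cos p^2) in *. have Hp2: p^2<=g^2*M^2 by (rewrite Ep, Rpow_mult_distr; apply Rmult_le_compat_l; lra).
  have D0: - d<=sg-f<=0.
  { split; [|lra]. have: f*(g^2*M^2)<=M*(g^2*M^2) by mono. lra. }
  have D2: - (2*d)<=(e2-1)*sg<=2*d.
  { assert (Q := mul_le_between (e2-1) sg (2*(g^2*A)) M ok ok). lra. }
  have D3: 0<=sg*(ic-1)<=3*d.
  { split; [pos|]. have: sg*(ic-1)<=M*(3*(g^2*M^2)) by mono. lra. }
  replace (e2*sg+sg*ic-2*q s) with ((e2-1)*sg+sg*(ic-1)+2*(sg-f)+2*(f-q s)) by ring. alra. Qed.

Lemma seq_lim_of_eps (u : nat -> R) (l : R) :
 (forall eps, 0 < eps -> exists n0, forall n, (n0 <= n)%nat -> Rabs (u n-l) <= eps) -> is_lim_seq u l.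
Proof.
 intros H. apply is_lim_seq_spec. intros eps. destruct (H (eps/2)) as [n0 Hn]; [destruct eps; simpl; lra|].
 exists n0. intros n Hle. specialize (Hn n Hle). destruct eps; simpl in *; lra.
Qed.

Lemma exp_m1_small C eps : 0 < eps -> exists y, forall x, y <= x -> Rabs (C*exp (- x)) <= eps.
Proof.
 intros He. have L: is_lim (fun x => C*exp (- x)) p_infty 0.
 { apply (is_lim_squeeze_0 _ 0 (Rabs C)). intros t Ht. rewrite Rabs_mult, (Rabs_right (exp _)) by pos. lra. }
 rewrite is_lim_inf_eps in L. destruct (L eps He) as [T HT]. exists (T+1). intros x Hx. specialize (HT x ok). rewrite Rminus_0_r in HT. lra.
Qed.

Lemma id_exp_le t : t*exp (- t) <= 1.
Proof.
 rewrite exp_Ropp. apply Rmult_le_reg_r with (exp t); [pos|]. rewrite Rmult_assoc, Rinv_l by (apply Rgt_not_eq, exp_pos).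
 have := exp_ineq1_le t. lra.
Qed.

(** At a large X both functions and their slopes are small uniformly in n. On [x, X] the second
    derivatives are uniformly close and the difference is integrated twice. *)
Lemma lamx_lim q x : is_Hastings_McLeod q -> is_lim_seq (fun n => lamx n x) (- VV q x).
Proof.
 intros Hq. destruct (VV_facts q Hq) as [DV LV]. destruct (ham_right q Hq) as [T [C [HT [HC HB]]]].
 apply seq_lim_of_eps. intros eps He.
 (* The factor exp(-x) pays for the length of the interval: (X - x) exp(-2X) <= exp(-x) exp(-X). *)
 set (K := exp 4+(2*exp 4+C)*exp (- x)). have E4 := exp_pos 4. 
 destruct (exp_m1_small K (eps/4)) as [X1 HX1]; [lra|]. rewrite is_lim_inf_eps in LV. destruct (LV (eps/4)) as [X2 HX2]; [lra|].
 set (X := Rmax (Rmax X1 (X2+1)) (Rmax (Rmax T 2) x)).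
 have HXs: X1<=X /\ X2+1<=X /\ T<=X /\ 2<=X /\ x<=X.
 { unfold X. minmax. lra. }
 destruct HXs as [A1 [A2 [A3 [A4 A5]]]]. clearbody X. specialize (HX1 X A1). specialize (HX2 X ok). specialize (HB X A3).
 set (D := X-x+1). have HD: 1<=D by (unfold D; lra).
 destruct (edge_uniform q x X (eps/(4*D^2)) Hq) as [n1 Hn1].
 { apply Rdiv_lt_0_compat; [lra|]. have: 0<D^2 by pos. lra. }
 destruct (bet_small (1/8)) as [n2 Hn2]; [lra|]. exists (max n1 n2). intros n Hn. specialize (Hn1 n okn). specialize (Hn2 n okn).
 replace (lamx n x - - VV q x) with (lamx n x+VV q x) by ring.
 have TB := Taylor2_bound (fun s => lamx n s+VV q s) (fun s => lamx1 n s + - ham q s) (fun s => - kx n s + - - q s^2) x X (eps/(4*D^2)) A5.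
 le_trans TB.
 - intros s. apply isd_plus; [apply lamx_derive|apply DV].
 - intros s. apply isd_plus; [apply lamx1_derive|apply isd_opp; now apply ham_derive].
 - intros s Hs. destruct (Hn1 s Hs) as [B _]. replace (- kx n s + - - q s^2) with (- (kx n s-q s^2)) by ring. now rewrite Rabs_Ropp.
 - destruct (lamx_tail n X ok A4) as [T1 T2]. rewrite Rminus_0_r in HX2.
  have B0: Rabs (lamx n X+VV q X)<=exp 4*exp (- (2*X))+eps/4.
  { le_trans Rabs_triang. have: Rabs (lamx n X)<=exp 4*exp (- (2*X)) by (apply Rabs_le; lra). lra. }
  have B1: Rabs (lamx1 n X + - ham q X)<=(2*exp 4+C)*exp (- (2*X)) by (apply Rabs_le; lra).
  have B2: (X-x)*exp (- (2*X))<=exp (- x)*exp (- X).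
  { replace (exp (- (2*X))) with (exp (- (X-x))*(exp (- x)*exp (- X))) by (rewrite <- !exp_plus; f_equal; ring).
   rewrite <- Rmult_assoc. rewrite <- (Rmult_1_l (exp (- x)*exp (- X))) at 2. apply Rmult_le_compat_r; [|apply id_exp_le].
   apply Rmult_le_pos; apply Rlt_le, exp_pos. }
  have B3: eps/(4*D^2)*(X-x)*(X-x)<=eps/4.
  { trans (eps/(4*D^2)*D^2); [|right; field; lra]. rewrite Rmult_assoc. apply Rmult_le_compat_l.
   - apply Rlt_le, Rdiv_lt_0_compat; [lra|]. have: 0<D^2 by pos. lra.
   - unfold D. nra. }
  have B4: exp (- (2*X))<=exp (- X) by mono.
  abs_in HX1. unfold K in HX1.
  have B5: (X-x)*Rabs (lamx1 n X + - ham q X)<=(2*exp 4+C)*(exp (- x)*exp (- X)).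
  { trans ((X-x)*((2*exp 4+C)*exp (- (2*X)))); [mono|].
   replace ((X-x)*((2*exp 4+C)*exp (- (2*X)))) with ((2*exp 4+C)*((X-x)*exp (- (2*X)))) by ring.
   apply Rmult_le_compat_l; lra. }
  have B6: exp 4*exp (- (2*X))<=exp 4*exp (- X) by mono.
  lra.
Qed.

Lemma hx_tail n x : gam n <= 1/4 -> 2 <= x -> 0 <= hx n x <= 6*exp (2-x).
Proof.
 intros Hg Hx. have Gp := gam_pos n. have G2 := gam_sq n.
 have Hb: bet n<=1/8 by nra.
 set (h1 := fun s => / gam n*(exp (- bet n*s)*sin (phi n s)+sin (phi n s)/cos (phi n s)^2)).
 have H1: forall s, 2<=s -> 0<=h1 s<=6*exp (2-s).
 { intros s Hs. have P := phi_range n s. have Ep := phi_ff n s. have Fd := ff_decay n s Hb Hs.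
  have: exp (2-s)<=1 by mono.
  have Hp: phi n s<=1/2 by (rewrite Ep; nra).
  have S1 := sin_le_id (phi n s) ok. have S0: 0<=sin (phi n s) by (apply sin_ge_0; lra).
  destruct (cos_inv3 (phi n s) ok) as [Hc Hi]. have CB := COS_bound (phi n s).
  have Hc2: 0 < / cos (phi n s)^2<=2.
  { split; [pos|]. trans (/ cos (phi n s)^3); [|nra].
   apply Rinv_le_contravar; [pos|]. simpl in *; nra. }
  have Sf: 0 <= / gam n*sin (phi n s)<=ff n s.
  { have: 0 < / gam n by pos. split; [pos|]. apply Rmult_le_reg_l with (gam n); [lra|].
   rewrite <- Rmult_assoc, Rinv_r, Rmult_1_l by lra. lra. }
  have He: 0<exp (- bet n*s)<=1 by (split; [pos|mono]).
  unfold h1. replace (/ gam n*(exp (- bet n*s)*sin (phi n s)+sin (phi n s)/cos (phi n s)^2)) with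
   (/ gam n*sin (phi n s)*(exp (- bet n*s) + / cos (phi n s)^2)) by (unfold Rdiv; ring).
  set (B := exp (- bet n*s) + / cos (phi n s)^2). have: 0<=B<=3 by (unfold B; lra).
  split; [pos|]. trans (ff n s*3); [mono|lra]. }
 have D: forall s, is_derive (hx n) s (- h1 s) by (intros s; eapply isd_eq; [apply hx_derive|unfold h1; ring]).
 have L: forall eps, 0<eps -> exists y, forall s, y<=s -> Rabs (hx n s)<=eps.
 { intros eps He. destruct (hsum_at_0 n) as [K HK]. have := Rle_abs K. have := Rabs_pos K.
  destruct (tim_small n (Rmin (1/4) (eps/(Rabs K+1)))) as [y [_ Hy]]; [pos|].
  exists y. intros s Hs. specialize (Hy s Hs). have := tim_pos n s. minmax. unfold hx. eapply Rle_trans; [apply HK; lra|].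
  trans ((Rabs K+1)*(eps/(Rabs K+1))); [|right; field; lra].
  trans ((Rabs K+1)*tim n s); [mono|mono]. }
 split.
 - apply (decreasing_to_0 _ (fun s => - h1 s) 2); auto; intros s Hs. specialize (H1 s Hs). lra.
 - have Q: 0<=6*exp 2*exp (- x)-hx n x.
  { apply (decreasing_to_0 (fun s => 6*exp 2*exp (- s)-hx n s) (fun s => 6*exp 2 * - exp (- s) - - h1 s) 2); auto.
   - intros s Hs. eapply isd_eq; [apply isd_minus; [apply isd_mult; [isd_|apply isd_exp, isd_opp, isd_id]|apply D]|]. cbv beta. ring.
   - intros s Hs. specialize (H1 s Hs). rewrite exp_shift in H1. lra.
   - intros eps He. destruct (exp_m1_small (6*exp 2) (eps/2)) as [y1 Y1]; [lra|]. destruct (L (eps/2)) as [y2 Y2]; [lra|].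
    exists (Rmax y1 y2). intros s Hs. minmax. specialize (Y1 s ok). specialize (Y2 s ok).
    unfold Rminus. le_trans Rabs_triang. rewrite Rabs_Ropp. lra. }
  rewrite exp_shift. lra.
Qed.

(** The limit is -4 log E. The derivative of [hx] tends to -2q uniformly on [x, X], and the values
    at X are uniformly small. *)
Lemma hx_lim q x : is_Hastings_McLeod q -> is_lim_seq (fun n => hx n x) (2*SS q x).
Proof.
 intros Hq. destruct (SS_facts q Hq) as [DS LS]. apply seq_lim_of_eps. intros eps He.
 destruct (exp_m1_small (6*exp 2) (eps/4)) as [X1 HX1]; [lra|]. rewrite is_lim_inf_eps in LS. destruct (LS (eps/8)) as [X2 HX2]; [lra|].
 set (X := Rmax (Rmax X1 (X2+1)) (Rmax 2 x)).
 have HXs: X1<=X /\ X2+1<=X /\ 2<=X /\ x<=X.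
 { unfold X. minmax. lra. }
 destruct HXs as [A1 [A2 [A4 A5]]]. clearbody X. specialize (HX1 X A1). specialize (HX2 X ok). rewrite Rminus_0_r in HX2.
 set (D := X-x+1). have HD: 1<=D by (unfold D; lra).
 destruct (edge_uniform q x X (eps/(4*D)) Hq) as [n1 Hn1]; [pos|].
 destruct (gam_small (1/4)) as [n2 Hn2]; [lra|]. exists (max n1 n2). intros n Hn. specialize (Hn1 n okn). specialize (Hn2 n okn).
 have DB := derive_bound (fun s => hx n s-2*SS q s) (fun s => - (/ gam n*(exp (- bet n*s)*sin (phi n s)+sin (phi n s)/cos (phi n s)^2)-2*q s))
  x X (eps/(4*D)) A5.
 have DB': Rabs (hx n X-2*SS q X-(hx n x-2*SS q x))<=eps/4.
 { le_trans DB.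
  - intros s _. eapply isd_eq; [apply isd_minus; [apply hx_derive|apply isd_mult; [isd_|apply DS]]|]. cbv beta. ring.
  - intros s Hs. rewrite Rabs_Ropp. now apply Hn1.
  - trans (eps/(4*D)*D); [apply Rmult_le_compat_l; [pos|unfold D; lra]|right; field; lra]. }
 have HT := hx_tail n X ok A4. rewrite exp_shift in HT.
 apply Rabs_le_between in DB'. alra. Qed.

(** * Left asymptotics of the finite-N quantities with errors uniform in N *)

Definition van_minfty (h : R -> R) : Prop := forall eps, 0 < eps -> exists y, forall x, x <= y -> Rabs (h x) <= eps.

Lemma van_minfty_ext f g : (forall x, x <= 0 -> f x = g x) -> van_minfty f -> van_minfty g.
Proof.
 intros E H eps He. destruct (H eps He) as [y Hy]. exists (Rmin y 0). intros x Hx. minmax. rewrite <- E by lra. apply Hy. lra.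
Qed.
Lemma van_minfty_plus f g : van_minfty f -> van_minfty g -> van_minfty (fun x => f x+g x).
Proof.
 intros F G eps He. destruct (F (eps/2)) as [y1 H1]; [lra|]. destruct (G (eps/2)) as [y2 H2]; [lra|]. exists (Rmin y1 y2).
 intros x Hx. minmax. specialize (H1 x ok). specialize (H2 x ok).
 le_trans Rabs_triang. lra.
Qed.
Lemma van_minfty_opp f : van_minfty f -> van_minfty (fun x => - f x).
Proof. intros F eps He. destruct (F eps He) as [y H]. exists y. intros x Hx. rewrite Rabs_Ropp. now apply H. Qed.
Lemma van_minfty_minus f g : van_minfty f -> van_minfty g -> van_minfty (fun x => f x-g x).
Proof. intros F G. apply van_minfty_plus; [exact F|now apply van_minfty_opp]. Qed.

Lemma van_minfty_exp (G : R -> R) (b : R) : 0 < b -> continuous G 0 -> G 0 = 0 -> van_minfty (fun x => G (exp (b*x))).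
Proof.
 intros Hb HG G0 eps He. apply continuity_pt_filterlim in HG. destruct (HG eps He) as [d [Hd HdG]]. exists (ln (d/2)/b).
 intros x Hx. have Hp := exp_pos (b*x). have: exp (b*x)<=d/2.
 { rewrite <- (exp_ln (d/2)) by lra. apply exp_le_mono. trans (b*(ln (d/2)/b)); [mono|right; field; lra]. }
 specialize (HdG (exp (b*x))). unfold D_x, no_cond, R_met in HdG. simpl in HdG. unfold Rdist in HdG. rewrite G0 in HdG. rewrite !Rminus_0_r in HdG.
 apply Rlt_le, HdG. split; [split; [exact I|lra]|]. rewrite Rabs_right; lra.
Qed.

Lemma van_minfty_tim (h : R -> R) (l : R) n : is_lim h p_infty l -> van_minfty (fun x => h (tim n x)-l).
Proof.
 intros H eps He. rewrite is_lim_inf_eps in H. destruct (H eps He) as [T HT]. destruct (tim_large n T) as [y Hy]. exists y. intros x Hx.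
 apply Rlt_le, HT, Hy, Hx.
Qed.

Lemma incr_van_nonneg (h h1 : R -> R) (x0 : R) : (forall x, x <= x0 -> is_derive h x (h1 x)) -> (forall x, x <= x0 -> 0 <= h1 x) ->
 van_minfty h -> forall x, x <= x0 -> 0 <= h x.
Proof.
 intros D P L x Hx. apply Rnot_lt_le. intros Hn. destruct (L (- h x/2)) as [y Hy]; [lra|]. have := Rmin_l x y. have := Rmin_r x y.
 specialize (Hy (Rmin x y) ok). abs_in Hy.
 assert (h (Rmin x y)<=h x); [|lra]. apply (derive_nonneg_le h h1); [lra| |]; intros; [apply D|apply P]; lra.
Qed.

Lemma convex_van_nonneg (h h1 h2 : R -> R) (x0 : R) : (forall x, x <= x0 -> is_derive h x (h1 x)) -> (forall x, x <= x0 -> is_derive h1 x (h2 x)) ->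
 (forall x, x <= x0 -> 0 <= h2 x) -> van_minfty h -> forall x, x <= x0 -> 0 <= h x.
Proof.
 intros D D1 P L. apply (incr_van_nonneg h h1); auto. intros x Hx.
 destruct (L 1 ok) as [y Hy]. have := Rmin_l x y. have := Rmin_r x y.
 trans (h1 (Rmin x y)).
 - apply (convex_bdd_incr h h1 h2 (Rmin x y) 1); [intros; apply D; lra|intros; apply D1; lra|intros; apply P; lra| |lra].
  intros s Hs. specialize (Hy s ok). alra. - apply (derive_nonneg_le h1 h2); [lra|intros; apply D1; lra|intros; apply P; lra].
Qed.

(* The leading left asymptotics of log D_N at fixed N and x -> -oo, with v = 1 - exp (b x). *)
Definition lxm (k : R) (n : nat) (x : R) : R :=
 2*INR (S n)*tim n x-INR (S n)^2/2*ln (2*tim n x)+lbarnes k (S n)-1/8*ln (1-exp (bet n*x)).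

Lemma ln_2tim n x : ln (2*tim n x) = ln (INR (S n))-bet n*x.
Proof.
 unfold tim. have := INR_S_pos n. replace (2*(INR (S n)/2*exp (- bet n*x))) with (INR (S n)*exp (- bet n*x)) by field.
 rewrite ln_mult, ln_exp; [ring|lra|pos].
Qed.

Lemma v_derive b x : is_derive (fun x => 1-exp (b*x)) x (- (b*exp (b*x))).
Proof. isd. ring. Qed.

Lemma u_derive b x : is_derive (fun x => exp (b*x)) x (b*exp (b*x)).
Proof. isd. ring. Qed.

Definition lxm1 (n : nat) (x : R) : R :=
 - (2*INR (S n)*bet n*tim n x)+INR (S n)^2/2*bet n+1/8*(bet n*exp (bet n*x)/(1-exp (bet n*x))).
Definition lxm2 (n : nat) (x : R) : R :=
 2*INR (S n)*bet n^2*tim n x+1/8*(bet n^2*exp (bet n*x)/(1-exp (bet n*x))^2).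

Lemma v_pos b x : 0 < b -> x < 0 -> 0 < exp (b*x) < 1.
Proof. intros. split; [pos|]. rewrite <- exp_0. apply exp_increasing. nra. Qed.

Lemma lxm_derive k n x : x < 0 -> is_derive (lxm k n) x (lxm1 n x) /\ is_derive (lxm1 n) x (lxm2 n x).
Proof.
 intros Hx. have Hb := bet_pos n. destruct (v_pos (bet n) x Hb Hx) as [U1 U2]. split.
 - apply (is_derive_ext (fun x => 2*INR (S n)*tim n x-INR (S n)^2/2*(ln (INR (S n))-bet n*x)+lbarnes k (S n)-1/8*ln (1-exp (bet n*x)))).
  { intros s. unfold lxm. now rewrite ln_2tim. }
  unfold lxm1. eapply isd_eq.
  { apply isd_minus; [apply isd_plus; [apply isd_minus; [apply isd_mult; [isd_|apply tim_derive]|isd_]|isd_]|apply isd_mult; [isd_|apply isd_ln; [apply v_derive|lra]]]. }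
  cbv beta. field. lra.
 - unfold lxm1, lxm2. eapply isd_eq.
  { apply isd_plus; [apply isd_plus; [apply isd_opp, isd_mult; [isd_|apply tim_derive]|isd_]|apply isd_mult; [isd_|apply isd_div; [apply isd_mult; [isd_|apply u_derive]|apply v_derive|lra]]]. }
  cbv beta. field. lra.
Qed.

Lemma van_lx (k : R) n : is_lim (fun t => ln (mbes0 t)-2*t+1/2*ln (2*t)) p_infty k -> van_minfty (fun x => lx n x-lxm k n x).
Proof.
 intros Hk. destruct (ldet_lim k n Hk) as [_ L]. have Hb := bet_pos n.
 apply (van_minfty_ext (fun x => (ldet (S n) (tim n x)-2*INR (S n)*tim n x+INR (S n)^2/2*ln (2*tim n x)-lbarnes k (S n))+1/8*ln (1-exp (bet n*x)))).
 { intros x _. unfold lx, lxm. ring. }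
 apply van_minfty_plus; [exact (van_minfty_tim _ _ n L)|].
 apply (van_minfty_exp (fun u => 1/8*ln (1-u))); [exact Hb| |rewrite Rminus_0_r, ln_1; ring].
 eapply isd_continuous. apply isd_mult; [isd_|]. apply isd_ln; [isd_|lra].
Qed.

Lemma van_vinv b m : 0 < b -> van_minfty (fun x => m*(/ (1-exp (b*x))-1)).
Proof.
 intros Hb. apply (van_minfty_exp (fun u => m*(/ (1-u)-1))); [exact Hb| |rewrite Rminus_0_r, Rinv_1; ring].
 eapply isd_continuous. apply isd_mult; [isd_|]. apply isd_minus; [|isd_]. apply isd_inv; [isd_|lra].
Qed.

(** Inserting the barriers for cos^2 phi into the second derivative of [lx] gives that of [lxm] up
    to (b^3/2) u/v^3; the correction b^3 u^2/(4v^2) is what produces -(1/8) log v. B is chosen with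
    B'' = (b^3/2) u(1+u)/v^3, larger than this error, and both B and the difference vanish at -oo,
    so convexity concludes. *)
Lemma lx_left q (k : R) : is_Hastings_McLeod q -> is_lim (fun t => ln (mbes0 t)-2*t+1/2*ln (2*t)) p_infty k ->
 exists X0, 20 <= X0 /\ exists n0, forall n, (n0 <= n)%nat -> forall x, x <= - X0 ->
 Rabs (lx n x-lxm k n x) <= bet n/2*(/ (1-exp (bet n*x))-1).
Proof.
 intros Hq Hk. destruct (cos2_phi_uniform q Hq) as [X0 [HX0 [n0 H]]]. exists X0. split; [exact HX0|]. exists n0. intros n Hn.
 destruct (H n Hn) as [HbX HB]. have Hb := bet_pos n. have HN := N2_bet3 n.
 set (B := fun x => bet n/2*(/ (1-exp (bet n*x))-1)).
 set (B1 := fun x => bet n/2*(bet n*exp (bet n*x)/(1-exp (bet n*x))^2)).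
 set (B2 := fun x => bet n^3/2*(exp (bet n*x)*(1+exp (bet n*x))/(1-exp (bet n*x))^3)).
 have DB: forall x, x<0 -> is_derive B x (B1 x) /\ is_derive B1 x (B2 x).
 { intros x Hx. destruct (v_pos (bet n) x Hb Hx) as [U1 U2]. unfold B, B1, B2. split.
  - eapply isd_eq; [apply isd_mult; [isd_|apply isd_minus; [apply isd_inv; [apply v_derive|lra]|isd_]]|]. cbv beta. field. lra.
  - eapply isd_eq; [apply isd_mult; [isd_|apply isd_div; [apply isd_mult; [isd_|apply u_derive]|apply isd_pow, v_derive|apply pow_nonzero; lra]]|].
   simpl. field. lra. }
 have E: forall x, x <= - X0 -> Rabs (exp (- (2*bet n*x))/(2*bet n)*cos (phi n x)^2-lxm2 n x)<=B2 x.
 { intros x Hx. destruct (HB x Hx) as [C1 C2]. destruct (v_pos (bet n) x Hb ok) as [U1 U2]. unfold cbar, ceps in C1, C2. unfold lxm2, B2.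
  have Et: 2*INR (S n)*bet n^2*tim n x = / (2*bet n*exp (bet n*x)).
  { unfold tim. replace (- bet n*x) with (- (bet n*x)) by ring. rewrite exp_Ropp.
   transitivity (INR (S n)^2*bet n^3/(bet n*exp (bet n*x))); [|rewrite HN]; field; lra. }
  rewrite Et. replace (- (2*bet n*x)) with (- (bet n*x) + - (bet n*x)) by ring. rewrite exp_plus, !exp_Ropp.
  set (u := exp (bet n*x)) in *. set (b := bet n) in *. 
  set (P := / u * / u/(2*b)). have HP: 0<P.
  { unfold P, Rdiv. repeat apply Rmult_lt_0_compat; apply Rinv_0_lt_compat; lra. }
  set (m := / (2*b*u)+1/8*(b^2*u/(1-u)^2)).
  have E1: P*(u*(1+b^3*u^2/(1-u)^2*(1/4 + -1*(b/(1-u)))))=m-b^3/2*(u/(1-u)^3) by (unfold P, m; field; lra).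
  have E2: P*(u*(1+b^3*u^2/(1-u)^2*(1/4+1*(b/(1-u)))))=m+b^3/2*(u/(1-u)^3) by (unfold P, m; field; lra).
  have C1' := Rmult_le_compat_l P _ _ ok C1. have C2' := Rmult_le_compat_l P _ _ ok C2. rewrite E1 in C1'. rewrite E2 in C2'.
  have: b^3/2*(u/(1-u)^3)<=b^3/2*(u*(1+u)/(1-u)^3).
  { have: 0<b^3 by pos. apply Rmult_le_compat_l; [lra|]. apply Rmult_le_compat_r; [pos|nra]. }
  alra. }
 have V: van_minfty (fun x => lx n x-lxm k n x) by (now apply van_lx). have VB: van_minfty B by (now apply van_vinv).
 intros x Hx.
 have P1: 0<=B x+(lx n x-lxm k n x).
 { apply (convex_van_nonneg (fun x => B x+(lx n x-lxm k n x)) (fun x => B1 x+(lx1 n x-lxm1 n x))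
   (fun x => B2 x+(exp (- (2*bet n*x))/(2*bet n)*cos (phi n x)^2-lxm2 n x)) (- X0)); [| | | |exact Hx].
  - intros s Hs. apply isd_plus; [apply DB; lra|]. apply isd_minus; [apply lx_derive|apply lxm_derive; lra].
  - intros s Hs. apply isd_plus; [apply DB; lra|]. apply isd_minus; [apply lx1_derive|apply (lxm_derive k); lra].
  - intros s Hs. specialize (E s Hs). alra. - now apply van_minfty_plus. }
 have P2: 0<=B x-(lx n x-lxm k n x).
 { apply (convex_van_nonneg (fun x => B x-(lx n x-lxm k n x)) (fun x => B1 x-(lx1 n x-lxm1 n x))
   (fun x => B2 x-(exp (- (2*bet n*x))/(2*bet n)*cos (phi n x)^2-lxm2 n x)) (- X0)); [| | | |exact Hx].
  - intros s Hs. apply isd_minus; [apply DB; lra|]. apply isd_minus; [apply lx_derive|apply lxm_derive; lra].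
  - intros s Hs. apply isd_minus; [apply DB; lra|]. apply isd_minus; [apply lx1_derive|apply (lxm_derive k); lra].
  - intros s Hs. specialize (E s Hs). alra. - now apply van_minfty_minus. }
 apply Rabs_le. unfold B in *. lra.
Qed.

(** The constant for which [hx] - [hxm] vanishes as x -> -oo. The nonconstant part of [hxm] is the
    primitive of -(2/gam) sqrt(1-u)/u, with u = exp(bx), that is, of the derivative of [hx] with
    cos^2 phi replaced by u. *)
Definition hxc (k : R) (n : nat) : R := k+ln (INR (fact n))+1/2*ln (INR (S n))+INR (S n)-INR (S n)*ln (INR (S n))+ln 2.
Definition hxm (k : R) (n : nat) (x : R) : R :=
 4*tim n x*sqrt (1-exp (bet n*x))-INR (S n)*(2*ln (1+sqrt (1-exp (bet n*x)))-bet n*x)+hxc k n.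

Lemma r_derive b x : 0 < b -> x < 0 -> is_derive (fun x => sqrt (1-exp (b*x))) x (- (b*exp (b*x))/(2*sqrt (1-exp (b*x)))).
Proof. intros Hb Hx. destruct (v_pos b x Hb Hx). apply (isd_sqrt (fun x => 1-exp (b*x))); [apply v_derive|lra]. Qed.

Lemma hxm_derive k n x : x < 0 -> is_derive (hxm k n) x (- (2/gam n*(sqrt (1-exp (bet n*x))/exp (bet n*x)))).
Proof.
 intros Hx. have Hb := bet_pos n. destruct (v_pos _ x Hb Hx) as [U1 U2]. have Dr := r_derive (bet n) x Hb Hx.
 have Hr: 0<sqrt (1-exp (bet n*x)) by pos. have R2 := sqrt_sqrt (1-exp (bet n*x)) ok.
 unfold hxm. eapply isd_eq.
 { apply isd_plus; [|isd_]. apply isd_minus; [apply isd_mult; [apply isd_mult; [isd_|apply tim_derive]|exact Dr]|].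
  apply isd_mult; [isd_|]. apply isd_minus; [apply isd_mult; [isd_|apply isd_ln; [apply isd_plus; [isd_|exact Dr]|lra]]|isd_]. }
 have HN := N_bet_gam n. have Hg := gam_pos n.
 replace (2/gam n) with (2*(INR (S n)*bet n)) by (apply Rmult_eq_reg_r with (gam n); [|lra]; unfold Rdiv; rewrite !Rmult_assoc, Rinv_l by lra; rewrite <- (Rmult_assoc (INR (S n))), HN; ring).
 unfold tim. replace (- bet n*x) with (- (bet n*x)) by ring. rewrite exp_Ropp.
 set (r := sqrt (1-exp (bet n*x))) in *. clearbody r. have E: exp (bet n*x)=1-r*r by lra. rewrite E in *. field. lra.
Qed.

Lemma van_hx (k : R) n : is_lim (fun t => ln (mbes0 t)-2*t+1/2*ln (2*t)) p_infty k -> van_minfty (fun x => hx n x-hxm k n x).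
Proof.
 intros Hk. have L := hsum_lim k n Hk. have Hb := bet_pos n. 
 set (L0 := k+ln (INR (fact n))+1/2*ln (INR (S n))) in *.
 set (G := fun u => L0-hxc k n-INR (S n)*ln (INR (S n))-(INR (S n)-1/2)*ln 4+2*INR (S n) * / (1+sqrt (1-u))+2*INR (S n)*ln (1+sqrt (1-u))).
 apply (van_minfty_ext (fun x => (hsum n (tim n x)-4*tim n x+1/2*ln (2*tim n x)+(INR n+1/2)*ln (8*tim n x)-L0)+G (exp (bet n*x)))).
 { intros x Hx. have Ht := tim_pos n x. unfold hx, hxm, G.
  replace (8*tim n x) with (4*(2*tim n x)) by ring. rewrite (ln_mult 4) by lra. rewrite ln_2tim.
  have U: 0<exp (bet n*x)<=1 by (split; [pos|mono]).
  have R0 := sqrt_pos (1-exp (bet n*x)). have R2 := sqrt_sqrt (1-exp (bet n*x)) ok.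
  have Et: 4*tim n x*sqrt (1-exp (bet n*x))=4*tim n x-2*INR (S n) * / (1+sqrt (1-exp (bet n*x))).
  { unfold tim. replace (- bet n*x) with (- (bet n*x)) by ring. rewrite exp_Ropp.
   set (u := exp (bet n*x)) in *. set (r := sqrt (1-u)) in *. clearbody r. have E: u=1-r*r by lra. rewrite E in *. field. lra. }
  rewrite Et. rewrite S_INR. field. lra. }
 apply van_minfty_plus; [exact (van_minfty_tim _ _ n L)|].
 apply (van_minfty_exp G); [exact Hb| |].
 - unfold G. have Q: forall s, s<1 -> is_derive (fun u => 1+sqrt (1-u)) s (0+(0-1)/(2*sqrt (1-s))).
  { intros s Hs. apply isd_plus; [isd_|]. apply isd_sqrt; [|lra]. isd_. }
  have := sqrt_pos (1-0). eapply isd_continuous. apply isd_plus; [apply isd_plus; [isd_|]|].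
  + apply isd_mult; [isd_|]. apply isd_inv; [apply Q; lra|lra].
  + apply isd_mult; [isd_|]. apply isd_ln; [apply Q; lra|lra].
 - unfold G, hxc, L0. rewrite Rminus_0_r, sqrt_1. replace (1+1) with 2 by ring. replace 4 with (2*2) by ring. rewrite ln_mult by lra. field.
Qed.

(* sin (1/u + 1/c) against its value at c = u = cos^2 phi, the leading left behaviour. *)
Lemma hx_integrand u v r c s d : 0 < u -> 0 < r -> r^2 = v -> v = 1-u -> 0 < s -> s^2 = 1-c -> u <= c <= u*(1+d) -> 0 <= d ->
 0 <= 2*(r/u)-s*(/ u + / c) <= 2*d/r+r*d/u.
Proof.
 intros Hu Hr Er Ev Hs Es Hc Hd.
 have Hsr: s<=r by (apply Rnot_lt_le; intros H; have: r^2<s^2 by (simpl; nra); lra).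
 have H1: r-s<=u*d/r.
 { apply Rmult_le_reg_r with r; [lra|]. unfold Rdiv. rewrite (Rmult_assoc (u*d)), Rinv_l, Rmult_1_r by lra. nra. }
 have Hic: / c <= / u by mono.
 have Hic2: (1-d) * / u <= / c.
 { apply Rmult_le_reg_r with (u*c); [nra|]. replace ((1-d) * / u*(u*c)) with ((1-d)*c) by fld. replace (/ c*(u*c)) with u by fld.
  destruct (Rle_dec d 1); nra. }
 have Hiu: 0 < / u by pos. 
 unfold Rdiv. replace (2*(r * / u)-s*(/ u + / c)) with (2*((r-s) * / u)+s*(/ u - / c)) by ring.
 have: 0<=(r-s) * / u by pos. have: 0<=s*(/ u - / c) by pos.
 split; [lra|].
 have A1: (r-s) * / u<=d * / r.
 { trans (u*d/r * / u); [mono|right; field; lra]. }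
 have A2: s*(/ u - / c)<=r*(d * / u) by mono.
 lra.
Qed.

(** From u <= cos^2 phi <= u(1 + D/3) with D = b^3 u^2/v^2, the integrand falls short of its leading
    value by at most B', and one integration from -oo suffices. *)
Lemma hx_left q (k : R) : is_Hastings_McLeod q -> is_lim (fun t => ln (mbes0 t)-2*t+1/2*ln (2*t)) p_infty k ->
 exists X0, 20 <= X0 /\ exists n0, forall n, (n0 <= n)%nat -> forall x, x <= - X0 ->
 Rabs (hx n x-hxm k n x) <= bet n^2/gam n*(/ sqrt (1-exp (bet n*x))^3-1).
Proof.
 intros Hq Hk. destruct (cos2_phi_uniform q Hq) as [X0 [HX0 [n0 H]]]. exists X0. split; [exact HX0|]. exists n0. intros n Hn.
 destruct (H n Hn) as [HbX HB]. clear H. have Hb := bet_pos n. have Hg := gam_pos n.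
 set (B := fun x => bet n^2/gam n*(/ sqrt (1-exp (bet n*x))^3-1)).
 set (B1 := fun x => bet n^2/gam n*(3/2*(bet n*exp (bet n*x)/sqrt (1-exp (bet n*x))^5))).
 have DB: forall x, x<0 -> is_derive B x (B1 x).
 { intros x Hx. destruct (v_pos (bet n) x Hb Hx) as [U1 U2]. have R0: 0<sqrt (1-exp (bet n*x)) by pos. unfold B, B1.
  eapply isd_eq; [apply isd_mult; [isd_|apply isd_minus; [apply isd_inv; [apply isd_pow, r_derive; lra|apply pow_nonzero; lra]|isd_]]|]. simpl. field. lra. }
 set (H1 := fun x => / gam n*(exp (- bet n*x)*sin (phi n x)+sin (phi n x)/cos (phi n x)^2)).
 set (M1 := fun x => 2/gam n*(sqrt (1-exp (bet n*x))/exp (bet n*x))).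
 have E: forall x, x <= - X0 -> 0<=M1 x-H1 x<=B1 x.
 { intros x Hx. destruct (HB x Hx) as [C1 C2]. destruct (v_pos (bet n) x Hb ok) as [U1 U2]. unfold cbar, ceps in C1, C2.
  (* Sharper than the factor 10 required of the barriers: it gives b/v <= 1/12, hence 1/4 + b/v <=
     1/3. *)
  have Hv: 12*bet n<=1-exp (bet n*x).
  { have: exp (bet n*x)<=exp (- (20*bet n)) by mono.
   have B20: 20*bet n<=1/2 by nra. have Q := exp_quad (20*bet n). rewrite (Rabs_right (20*bet n)) in Q by lra. specialize (Q ok).
   abs_in Q.
   assert (exp (- (20*bet n))<=1-12*bet n); [|lra]. trans (/ (1+20*bet n)).
   - rewrite exp_Ropp. apply Rinv_le_contravar; [lra|]. apply exp_ineq1_le.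
   - apply Rmult_le_reg_r with (1+20*bet n); [lra|]. rewrite Rinv_l by lra.
    nra. }
  have Pr := phi_range n x. have Sp: 0<sin (phi n x) by (apply sin_gt_0; lra).
  have SC := sin2_cos2 (phi n x). unfold Rsqr in SC. have R0: 0<sqrt (1-exp (bet n*x)) by pos. have R2 := pow2_sqrt (1-exp (bet n*x)) ok.
  unfold M1, H1, B1. replace (- bet n*x) with (- (bet n*x)) by ring. rewrite exp_Ropp.
  set (u := exp (bet n*x)) in *. set (b := bet n) in *. set (c := cos (phi n x)^2) in *. set (v := 1-u) in *. set (r := sqrt v) in *. set (s := sin (phi n x)) in *.
  have Hbv: 0<b/v <= / 12.
  { split; [pos|]. apply Rmult_le_reg_r with v; [lra|]. unfold Rdiv. rewrite Rmult_assoc, Rinv_l by lra. lra. }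
  set (D := b^3*u^2/v^2) in *. have HD: 0<D.
  { unfold D. apply Rdiv_lt_0_compat; [pos|pos]. }
  assert (Q := hx_integrand u v r c s (D/3) U1 R0 R2 eq_refl Sp ltac:(unfold c; simpl; lra)).
  destruct Q as [Q1 Q2]; [split; [nra|]|lra|].
  { apply Rle_trans with (1 := C2). apply Rmult_le_compat_l; [lra|]. nra. }
  have Hgi: 0 < / gam n by pos.
  replace (2/gam n*(r/u) - / gam n*(/ u*s+s/c)) with (/ gam n*(2*(r/u)-s*(/ u + / c))) by (unfold Rdiv; ring).
  split; [pos|].
  trans (/ gam n*(2*(D/3)/r+r*(D/3)/u)); [mono|].
  replace (b^2/gam n*(3/2*(b*u/r^5))) with (/ gam n*(3/2*(b^3*u/r^5))) by fld.
  apply Rmult_le_compat_l; [lra|].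
  replace (2*(D/3)/r+r*(D/3)/u) with (b^3*u/r^5*((2*u+v)/3)).
  - have: 0<b^3*u/r^5 by pos.
   rewrite (Rmult_comm (3/2)). apply Rmult_le_compat_l; [lra|unfold v; lra].
  - unfold D. rewrite <- R2. field. lra. }
 have V: van_minfty (fun x => hx n x-hxm k n x) by (now apply van_hx).
 have VB: van_minfty B.
 { apply (van_minfty_exp (fun u => bet n^2/gam n*(/ sqrt (1-u)^3-1))); [exact Hb| |rewrite Rminus_0_r, sqrt_1, pow1, Rinv_1; ring].
  have: 0<sqrt (1-0) by pos.
  eapply isd_continuous. apply isd_mult; [isd_|]. apply isd_minus; [|isd_]. apply isd_inv; [apply isd_pow, isd_sqrt; [isd_|lra]|apply pow_nonzero; lra]. }
 have DD: forall s, s <= - X0 -> is_derive (fun x => hx n x-hxm k n x) s (M1 s-H1 s).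
 { intros s Hs. eapply isd_eq; [apply isd_minus; [apply hx_derive|apply hxm_derive; lra]|]. unfold M1, H1. ring. }
 intros x Hx.
 have P1: 0<=hx n x-hxm k n x.
 { apply (incr_van_nonneg (fun x => hx n x-hxm k n x) (fun x => M1 x-H1 x) (- X0)); [exact DD|intros s Hs; apply E, Hs|exact V|exact Hx]. }
 have P2: 0<=B x-(hx n x-hxm k n x).
 { apply (incr_van_nonneg (fun x => B x-(hx n x-hxm k n x)) (fun x => B1 x-(M1 x-H1 x)) (- X0)); [| | |exact Hx].
  - intros s Hs. apply isd_minus; [apply DB; lra|apply DD, Hs].
  - intros s Hs. specialize (E s Hs). lra.
  - now apply van_minfty_minus. }
 rewrite Rabs_right by lra. unfold B in P2. lra.
Qed.

(** * Stirling's formula, the hyperfactorial and the constants at fixed x *)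

Lemma ln1p_taylor x : 0 <= x -> x-x^2/2+x^3/3-x^4/4 <= ln (1+x) <= x-x^2/2+x^3/3-x^4/4+x^5/5.
Proof.
 intros Hx. set (p := fun t => t-t^2/2+t^3/3-t^4/4).
 have Dl: forall t, 0<=t -> is_derive (fun t => ln (1+t)) t (/ (1+t)).
 { intros t Ht. eapply isd_eq; [apply isd_ln; [isd_|lra]|]. cbv beta. field. lra. }
 have Dp: forall t, is_derive p t (1-t+t^2-t^3).
 { intros t. unfold p, Rdiv. eapply isd_eq.
  - isd_.
  - simpl. field. }
 split.
 - have H: ln (1+0)-p 0<=ln (1+x)-p x.
  { apply (derive_nonneg_le (fun t => ln (1+t)-p t) (fun t => / (1+t)-(1-t+t^2-t^3))); [exact Hx| |].
   - intros t Ht. apply isd_minus; [apply Dl; lra|apply Dp].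
   - intros t Ht. replace (/ (1+t)-(1-t+t^2-t^3)) with (t^4/(1+t)) by fld.
    apply Rdiv_le_0_compat; [pos|lra]. }
  rewrite Rplus_0_r, ln_1 in H. unfold p in H. lra.
 - have H: p 0+0^5 * / 5-ln (1+0)<=p x+x^5 * / 5-ln (1+x).
  { apply (derive_nonneg_le (fun t => p t+t^5 * / 5-ln (1+t)) (fun t => 1-t+t^2-t^3+t^4 - / (1+t))); [exact Hx| |].
   - intros t Ht. eapply isd_eq; [apply isd_minus; [apply isd_plus; [apply Dp|isd_]|apply Dl; lra]|].
    simpl. field. lra.
   - intros t Ht. replace (1-t+t^2-t^3+t^4 - / (1+t)) with (t^5/(1+t)) by fld.
    apply Rdiv_le_0_compat; [pos|lra]. }
  rewrite Rplus_0_r, ln_1 in H. unfold p in H. lra.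
Qed.

(** x + w decreases, x - w increases, and the two have a common limit; this also gives the rate
    w. *)
Lemma telescoping_lim (x w : nat -> R) : (forall n, Rabs (x (S n)-x n) <= w n-w (S n)) -> is_lim_seq w 0 ->
 exists l : R, is_lim_seq x l /\ forall n, Rabs (x n-l) <= w n.
Proof.
 intros H Hw.
 have Hd: forall n, w (S n)<=w n by (intros n; specialize (H n); have := Rabs_pos (x (S n)-x n); lra).
 have W0: forall n, 0<=w n.
 { intros n. apply (is_lim_seq_decr_compare w 0 Hw Hd). }
 have Hu: forall n, x (S n)+w (S n)<=x n+w n by (intros n; specialize (H n); abs_in H; lra).
 have Hl: forall n, x n-w n<=x (S n)-w (S n) by (intros n; specialize (H n); abs_in H; lra).
 have Hb: forall n, x 0%nat-w 0%nat<=x n-w n by (induction n; [lra|specialize (Hl n); lra]).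
 destruct (ex_finite_lim_seq_decr (fun n => x n+w n) (x 0%nat-w 0%nat) Hu) as [l L].
 { intros n. specialize (Hb n). specialize (W0 n). lra. }
 exists l.
 have Lx: is_lim_seq x l.
 { apply (is_lim_seq_ext (fun n => (x n+w n)-w n)); [intros; ring|]. replace (Finite l) with (Finite (l-0)) by (f_equal; ring). now apply is_lim_seq_minus'. }
 split; [exact Lx|]. intros n.
 have L2: is_lim_seq (fun n => x n-w n) l.
 { replace (Finite l) with (Finite (l-0)) by (f_equal; ring). now apply is_lim_seq_minus'. }
 have := is_lim_seq_decr_compare _ _ L Hu n. have := is_lim_seq_incr_compare _ _ L2 Hl n. simpl in *. alra. Qed.

Lemma inv_INR_lim : is_lim_seq (fun n => / INR (S n)) 0.
Proof.
 apply seq_lim_of_eps. intros eps He. destruct (INR_unbounded (/ eps)) as [m Hm]. exists m. intros n Hn. have HN := INR_S_pos n.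
 rewrite Rminus_0_r, Rabs_right by pos.
 rewrite <- (Rinv_inv eps). apply Rinv_le_contravar; [pos|]. apply le_INR in Hn. rewrite S_INR. lra.
Qed.

(** With N = n+1, [stir] is the remainder of Stirling's formula with the term 1/(12N) taken out, and
    [hyp] that of the logarithm of the hyperfactorial; the limit of [hyp] is the logarithm of
    Glaisher's constant. *)
Definition stir (n : nat) : R := ln (INR (fact (S n)))-(INR (S n)+1/2)*ln (INR (S n))+INR (S n) - / (12*INR (S n)).
Definition hyp (n : nat) : R := sum_n (fun j => INR (S j)*ln (INR (S j))) n-(INR (S n)^2/2+INR (S n)/2+1/12)*ln (INR (S n))+INR (S n)^2/4.

Lemma ln_INR_SS n : ln (INR (S (S n))) = ln (INR (S n))+ln (1 + / INR (S n)).
Proof.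
 have := INR_S_pos n. have: 0 < / INR (S n) by pos.
 rewrite <- ln_mult by lra. f_equal. rewrite (S_INR (S n)). field. lra.
Qed.

Lemma ln_fact_S n : ln (INR (fact (S n))) = ln (INR (S n))+ln (INR (fact n)).
Proof.
 rewrite fact_simpl, mult_INR, ln_mult; [reflexivity|apply INR_S_pos|]. apply INR_fact_lt_0.
Qed.

Lemma N_ge_1 n : 1 <= INR (S n).
Proof. rewrite S_INR. have := pos_INR n. lra. Qed.

Lemma stir_lim : exists kap : R, is_lim_seq stir kap /\ forall n, Rabs (stir n-kap) <= / INR (S n)^2.
Proof.
 apply telescoping_lim.
 - intros n. unfold stir. rewrite ln_fact_S, ln_INR_SS, (S_INR (S n)). have HN := N_ge_1 n. set (N := INR (S n)) in *.
  set (x := / N). have Hx: 0<x<=1 by (unfold x; split; [apply Rinv_0_lt_compat; lra|mono]).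
  have T := ln1p_taylor x ok. set (L := ln (1+x)) in *.
  have EN: N = / x by (unfold x; now rewrite Rinv_inv).
  match goal with |- Rabs ?e<=_ => replace e with (1-(/ x+1/2)*L+x^2/(12*(1+x))) end.
  2:{ fold x L. rewrite EN. field. lra. }
  replace (/ N^2 - / (N+1)^2) with (x^3*(2+x)/(1+x)^2) by (rewrite EN; field; lra).
  have P: 0 < / x+1/2 by (have: 0 < / x by (apply Rinv_0_lt_compat; lra); lra).
  have T1 := Rmult_le_compat_l _ _ _ (Rlt_le _ _ P) (proj1 T). have T2 := Rmult_le_compat_l _ _ _ (Rlt_le _ _ P) (proj2 T).
  replace ((/ x+1/2)*(x-x^2/2+x^3/3-x^4/4)) with (1+x^2/12-x^3/12-x^4/8) in T1 by fld.
  replace ((/ x+1/2)*(x-x^2/2+x^3/3-x^4/4+x^5/5)) with (1+x^2/12-x^3/12+3/40*x^4+x^5/10) in T2 by fld.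
  replace (x^2/(12*(1+x))) with (x^2/12-x^3/12+x^4/(12*(1+x))) by fld.
  have Hi: 0<=x^4/(12*(1+x))<=x^4/12.
  { have: 0<x^4 by (apply pow_lt; lra). split; [apply Rdiv_le_0_compat; lra|]. unfold Rdiv. apply Rmult_le_compat_l; [lra|mono]. }
  have Hw: x^3*(1/2)<=x^3*(2+x)/(1+x)^2.
  { unfold Rdiv. rewrite Rmult_assoc. have: 0<x^3 by (apply pow_lt; lra). apply Rmult_le_compat_l; [lra|].
   apply Rmult_le_reg_r with ((1+x)^2); [apply pow_lt; lra|]. rewrite (Rmult_assoc (2+x)), Rinv_l, Rmult_1_r by (apply pow_nonzero; lra). nra. }
  have: x^4<=x^3 by (simpl; have: 0<x^3 by (apply pow_lt; lra); simpl in *; nra).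
  have: x^5<=x^3 by (have: 0<x^3 by (apply pow_lt; lra); replace (x^5) with (x^3*(x*x)) by ring; nra).
  have: 0<x^4 by (apply pow_lt; lra). have: 0<x^5 by (apply pow_lt; lra).
  clearbody L. alra. - replace (Finite 0) with (Finite (0*0)) by (f_equal; ring). apply (is_lim_seq_ext (fun n => / INR (S n) * / INR (S n))).
  { intros n. have := INR_S_pos n. field. lra. }
  apply is_lim_seq_mult'; apply inv_INR_lim.
Qed.

Lemma hyp_lim : exists a : R, is_lim_seq hyp a.
Proof.
 destruct (telescoping_lim hyp (fun n => / INR (S n))) as [a [Ha _]]; [|apply inv_INR_lim|exists a; exact Ha].
 intros n. unfold hyp. rewrite sum_Sn. unfold plus; simpl AbelianMonoid.sort. change (plus ?a ?b) with (a+b).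
 set (S0 := sum_n _ n). rewrite ln_INR_SS, (S_INR (S n)). have HN := N_ge_1 n. set (N := INR (S n)) in *.
 set (x := / N). have Hx: 0<x<=1 by (unfold x; split; [pos|mono]).
 have T := ln1p_taylor x ok. set (L := ln (1+x)) in *.
 have EN: N = / x by (unfold x; now rewrite Rinv_inv).
 match goal with |- Rabs ?e<=_ => replace e with (1/(2*x)+1/4-(1/(2*x^2)+1/(2*x)+1/12)*L) end.
 2:{ simpl. fold x L. rewrite EN. field. lra. }
 replace (x - / (N+1)) with (x^2/(1+x)) by (rewrite EN; field; lra).
 have P: 0<1/(2*x^2)+1/(2*x)+1/12.
 { have: 0<1/(2*x^2) by (apply Rdiv_lt_0_compat; [lra|]; have: 0<x^2 by pos; lra). have: 0<1/(2*x) by pos. lra. }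
 have T1 := Rmult_le_compat_l _ _ _ (Rlt_le _ _ P) (proj1 T). have T2 := Rmult_le_compat_l _ _ _ (Rlt_le _ _ P) (proj2 T).
 set (Q := 1/(2*x^2)+1/(2*x)+1/12) in *.
 replace (Q*(x-x^2/2+x^3/3-x^4/4)) with (1/(2*x)+1/4-7/72*x^3-x^4/48) in T1 by (unfold Q; field; lra).
 replace (Q*(x-x^2/2+x^3/3-x^4/4+x^5/5)) with (1/(2*x)+1/4+1/360*x^3+19/240*x^4+x^5/60) in T2 by (unfold Q; field; lra).
 have Hw: x^2*(1/2)<=x^2/(1+x).
 { unfold Rdiv. have: 0<x^2 by pos. apply Rmult_le_compat_l; [lra|]. replace (1 * / 2) with (/ 2) by ring. apply Rinv_le_contravar; lra. }
 have X2: 0<x^2 by pos.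
 have: x^3<=x^2 by (replace (x^3) with (x^2*x) by ring; nra).
 have: x^4<=x^3 by (replace (x^4) with (x^3*x) by ring; have: 0<x^3 by pos; nra).
 have: x^5<=x^4 by (replace (x^5) with (x^4*x) by ring; have: 0<x^4 by pos; nra).
 have: 0<x^3 by pos. have: 0<x^4 by pos. have: 0<x^5 by pos.
 clearbody L. alra. Qed.

Lemma lbarnes_0 k : lbarnes k 0 = 0. Proof. reflexivity. Qed.
Lemma lbarnes_incr k n : lbarnes k (S n)-lbarnes k n = k+ln (INR (fact n)).
Proof.
 induction n as [|n IH].
 - unfold lbarnes. simpl. rewrite ln_1. ring.
 - change (lbarnes k (S (S n))) with (2*lbarnes k (S n)-lbarnes k n+ln (INR (S n))). rewrite ln_fact_S. lra.
Qed.

(** This is G(N+1) = (N!)^N divided by the hyperfactorial of N, which reduces the Barnes function to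
    [stir] and [hyp]. *)
Lemma lbarnes_sum k n : lbarnes k (S n) = INR (S n)*k+INR (S n)*ln (INR (fact (S n)))-sum_n (fun j => INR (S j)*ln (INR (S j))) n.
Proof.
 induction n as [|n IH].
 - have H := lbarnes_incr k 0. rewrite lbarnes_0 in H. rewrite sum_O. simpl in *. rewrite ln_1 in *. lra.
 - have H := lbarnes_incr k (S n). rewrite sum_Sn. change plus with Rplus. rewrite (ln_fact_S (S n)).
  set (S0 := sum_n _ n) in *. rewrite (S_INR (S n)) in *. lra.
Qed.

(** Stirling's remainder gets multiplied by N; hence its rate N^(-2) is used, not only its limit. *)
Lemma lbarnes_lim (k kap a : R) : (forall n, Rabs (stir n-kap) <= / INR (S n)^2) -> is_lim_seq hyp a ->
 is_lim_seq (fun n => lbarnes k (S n)-(INR (S n)*(k+kap)+(INR (S n)^2/2-1/12)*ln (INR (S n))-3/4*INR (S n)^2)) (1/12-a).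
Proof.
 intros Hs Ha. apply (is_lim_seq_ext (fun n => INR (S n)*(stir n-kap)+(1/12-hyp n))).
 { intros n. rewrite lbarnes_sum. unfold stir, hyp. have := INR_S_pos n. set (S0 := sum_n _ n). field. lra. }
 replace (Finite (1/12-a)) with (Finite (0+(1/12-a))) by (f_equal; ring). apply is_lim_seq_plus'.
 - apply (is_lim_seq_le_le (fun n => - / INR (S n)) _ (fun n => / INR (S n))).
  + intros n. have HN := INR_S_pos n. specialize (Hs n). apply Rabs_le_between. rewrite Rabs_mult, (Rabs_right (INR (S n))) by lra.
   trans (INR (S n) * / INR (S n)^2); [mono|right; field; lra].
  + replace (Finite 0) with (Rbar_opp (Finite 0)) by (simpl; f_equal; ring). apply (is_lim_seq_opp (fun n => / INR (S n)) 0), inv_INR_lim.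
  + apply inv_INR_lim.
 - apply is_lim_seq_minus'; [apply is_lim_seq_const|exact Ha].
Qed.

Lemma hxc_lim (k kap : R) : is_lim_seq stir kap -> is_lim_seq (hxc k) (k+kap+ln 2).
Proof.
 intros H. apply (is_lim_seq_ext (fun n => k+(stir n+1/12 * / INR (S n))+ln 2)).
 { intros n. unfold stir, hxc. have := INR_S_pos n. rewrite ln_fact_S. field. lra. }
 apply is_lim_seq_plus'; [|apply is_lim_seq_const]. apply is_lim_seq_plus'; [apply is_lim_seq_const|].
 replace (Finite kap) with (Finite (kap+1/12*0)) by (f_equal; ring). apply is_lim_seq_plus'; [exact H|].
 apply is_lim_seq_mult'; [apply is_lim_seq_const|apply inv_INR_lim].
Qed.

Lemma exp_taylor3 w : 0 <= w <= 1 -> 0 <= exp w-(1+w+w^2/2+w^3/6) <= w^4.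
Proof.
 intros Hw.
 have St: forall (f g : R -> R) , (forall t, is_derive f t (g t)) -> f 0=0 -> (forall t, 0<=t<=1 -> 0<=g t) -> forall t, 0<=t<=1 -> 0<=f t.
 { intros f g D F0 G t Ht. rewrite <- F0. apply (derive_nonneg_le f g); [lra|intros; apply D|intros; apply G; lra]. }
 have E2: forall t, 0<=t<=1 -> 0<=exp t-(1+t).
 { intros t Ht. have := exp_ineq1_le t. lra. }
 have E3: forall t, 0<=t<=1 -> 0<=exp t-(1+t+t^2 * / 2).
 { apply (St _ (fun t => exp t-(1+t))); [|rewrite exp_0; ring|exact E2]. intros t.
  isd. simpl. field. }
 have E4: forall t, 0<=t<=1 -> 0<=exp t-(1+t+t^2 * / 2+t^3 * / 6).
 { apply (St _ (fun t => exp t-(1+t+t^2 * / 2))); [|rewrite exp_0; ring|exact E3]. intros t.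
  isd. simpl. field. }
 have H3 := exp_le_3.
 have F1: forall t, 0<=t<=1 -> 0<=1+2*t-exp t.
 { intros t Ht. apply Rnot_lt_le. intros Hn. assert (Hc : exp t<=1+2*t); [|lra]. destruct (Req_dec t 0) as [->|Ht0]; [rewrite exp_0; lra|].
  have Hf: exp t-1<=(exp 1-1)*t.
  { destruct (MVT_cor2 exp exp 0 t ok) as [z1 [Z1 Z2]]; [intros; apply derivable_pt_lim_exp|]. destruct (Req_dec t 1) as [->|Ht1]; [lra|].
   destruct (MVT_cor2 exp exp t 1 ok) as [z2 [Z3 Z4]]; [intros; apply derivable_pt_lim_exp|]. rewrite exp_0 in Z1.
   have: exp z1<=exp z2 by mono.
   have: exp z1*(1-t)<=exp z2*(1-t) by mono. rewrite Rminus_0_r in Z1. rewrite Z1. apply Rmult_le_compat_r; lra. }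
  nra. }
 have F2: forall t, 0<=t<=1 -> 0<=1+t+t^2-exp t.
 { apply (St _ (fun t => 1+2*t-exp t)); [|rewrite exp_0; ring|exact F1]. intros t.
  isd. simpl. ring. }
 have F3: forall t, 0<=t<=1 -> 0<=1+t+t^2 * / 2+t^3 * / 3-exp t.
 { apply (St _ (fun t => 1+t+t^2-exp t)); [|rewrite exp_0; ring|exact F2]. intros t.
  isd. simpl. field. }
 have F4: forall t, 0<=t<=1 -> 0<=1+t+t^2 * / 2+t^3 * / 6+t^4 * / 12-exp t.
 { apply (St _ (fun t => 1+t+t^2 * / 2+t^3 * / 3-exp t)); [|rewrite exp_0; ring|exact F3]. intros t.
  isd. simpl. field. }
 specialize (E4 w Hw). specialize (F4 w Hw). lra.
Qed.

Lemma atanh_taylor r : 0 <= r <= 1/2 -> 0 <= 2*r/(1-r^2)-(2*ln (1+r)-ln (1-r^2))-4/3*r^3 <= 3*r^5.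
Proof.
 intros Hr. set (f := fun r => 2*r/(1-r^2)-(2*ln (1+r)-ln (1-r^2))-4/3*r^3).
 set (f1 := fun r => 4*r^2/(1-r^2)^2-4*r^2).
 have D: forall t, 0<=t<=1/2 -> is_derive f t (f1 t).
 { intros t Ht. have: 0<1-t^2 by nra. unfold f. eapply isd_eq.
  - apply isd_minus; [apply isd_minus; [apply isd_div; [isd_|isd_|lra]|
   apply isd_minus; [apply isd_mult; [isd_|apply isd_ln; [isd_|lra]]|apply isd_ln; [isd_|lra]]]|isd_].
  - unfold f1. simpl. field. repeat split; simpl in *; nra. }
 have B: forall t, 0<=t<=1/2 -> 0<=f1 t<=15*t^4.
 { intros t Ht. unfold f1. have H1: 3/4<=1-t^2<=1 by nra. set (w := 1-t^2) in *.
  have W2: 9/16<=w^2<=1 by nra. have Hi: 1 <= / w^2 by (rewrite <- Rinv_1; apply Rinv_le_contravar; lra).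
  have Hi2: / w^2-1<=15/4*t^2.
  { apply Rmult_le_reg_r with (w^2); [lra|]. rewrite Rmult_minus_distr_r, Rinv_l by lra. 
   have: 1-w^2<=2*t^2 by (unfold w; nra). nra. }
  unfold Rdiv. replace (4*t^2 * / w^2-4*t^2) with (4*t^2*(/ w^2-1)) by ring. replace (15*t^4) with (4*t^2*(15/4*t^2)) by fld.
  split; [pos|mono]. }
 have F0: f 0=0 by (unfold f; replace (1-0^2) with 1 by ring; rewrite Rplus_0_r, ln_1; field).
 split; [change (0<=f r); rewrite <- F0; apply (derive_nonneg_le f f1); [lra|intros; apply D; lra|intros; apply B; lra]|].
 change (f r<=3*r^5). have H: 3*0^5-f 0<=3*r^5-f r.
 { apply (derive_nonneg_le (fun r => 3*r^5-f r) (fun r => 15*r^4-f1 r)); [lra| |].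
  - intros t Ht. eapply isd_eq; [apply isd_minus; [isd_|apply D; lra]|]. simpl. ring.
  - intros t Ht. specialize (B t ok). lra. }
 rewrite F0 in H. replace (3*0^5-0) with 0 in H by ring. lra.
Qed.

Lemma v_over_b X : 0 < X -> is_lim_seq (fun n => (1-exp (bet n * - X))/bet n) X.
Proof.
 intros HX. apply seq_lim_of_eps. intros eps He. destruct (bet_small (Rmin (/ X) (eps/X^2))) as [n0 Hn].
 { apply Rmin_glb_lt; [pos|pos]. }
 exists n0. intros n Hle. specialize (Hn n Hle). have Hb := bet_pos n. minmax. have X2: 0<X^2 by pos.
 have: bet n*X<=1 by (trans (/ X*X); [mono|right; field; lra]).
 have: bet n*X^2<=eps by (trans (eps/X^2*X^2); [mono|right; field; lra]).
 have: 0<bet n*X by pos.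
 have Q := exp_quad (bet n*X). rewrite (Rabs_right (bet n*X)) in Q by lra. specialize (Q ok).
 replace (bet n * - X) with (- (bet n*X)) by ring.
 replace ((1-exp (- (bet n*X)))/bet n-X) with ((1-exp (- (bet n*X))-bet n*X)/bet n) by fld.
 unfold Rdiv. rewrite Rabs_mult, (Rabs_right (/ bet n)) by pos.
 trans ((bet n*X)^2 * / bet n); [mono|].
 replace ((bet n*X)^2 * / bet n) with (bet n*X^2) by fld. lra.
Qed.

Lemma is_lim_seq_cont (f : R -> R) (u : nat -> R) (l d : R) : is_derive f l d -> is_lim_seq u l -> is_lim_seq (fun n => f (u n)) (f l).
Proof. intros D L. apply is_lim_seq_continuous; [|exact L]. apply continuity_pt_filterlim. eapply isd_continuous, D. Qed.

Lemma ln_N_bet n : ln (INR (S n)) = - (3/2)*ln (bet n)-ln 2/2.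
Proof.
 have H := N2_bet3 n. have HN := INR_S_pos n. have Hb := bet_pos n.
 apply (f_equal ln) in H. rewrite ln_mult, !ln_pow in H by pos. replace (1/2) with (/ 2) in H by field. rewrite ln_Rinv in H by lra. replace (INR 2) with 2 in H by (simpl; ring). replace (INR 3) with 3 in H by (simpl; ring). lra.
Qed.

(** The expected log F_2 at -X without its O(X^(-3)) correction, with z in the place of
    zeta'(-1). *)
Definition lamL (X z : R) : R := - X^3/12-1/8*ln X+ln 2/24+z.

(** The terms N^2 log N cancel. The term -(1/12) log N of the Barnes function equals (1/8) log b +
    (log 2)/24 and turns -(1/8) log v into -(1/8) log(v/b), where v/b -> X. The exponential bracket
    in G is -w^3/6 + O(w^4) with w = bX, and N^2 b^3 = 1/2. *)
Lemma lxm_lim (k kap a X : R) : (forall n, Rabs (stir n-kap) <= / INR (S n)^2) -> is_lim_seq hyp a -> 0 < X ->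
 is_lim_seq (fun n => lxm k n (- X)-tim n (- X)^2-INR (S n)*(k+kap)) (lamL X (1/12-a)).
Proof.
 intros Hs Ha HX. have HL := lbarnes_lim k kap a Hs Ha.
 set (Lam := fun n => lbarnes k (S n)-(INR (S n)*(k+kap)+(INR (S n)^2/2-1/12)*ln (INR (S n))-3/4*INR (S n)^2)) in HL.
 set (G := fun n => INR (S n)^2*(exp (bet n*X)-exp (2*(bet n*X))/4-bet n*X/2-3/4)).
 apply (is_lim_seq_ext (fun n => G n + - (1/8)*ln ((1-exp (bet n * - X))/bet n)+ln 2/24+Lam n)).
 { intros n. unfold G, Lam, lxm. rewrite ln_2tim. have Hb := bet_pos n. destruct (v_pos (bet n) (- X) Hb ok).
  replace (ln ((1-exp (bet n * - X))/bet n)) with (ln (1-exp (bet n * - X))-ln (bet n)) by (unfold Rdiv; rewrite ln_mult, ln_Rinv by pos; ring).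
  unfold tim. replace (- bet n * - X) with (bet n*X) by ring. replace (2*(bet n*X)) with (bet n*X+bet n*X) by ring. rewrite exp_plus.
  have Q: ln (INR (S n))*(1/12)=(- (3/2)*ln (bet n)-ln 2/2)*(1/12) by (now rewrite <- ln_N_bet).
  lra. }
 unfold lamL. replace (Finite (- X^3/12-1/8*ln X+ln 2/24+(1/12-a))) with (Finite (- X^3/12 + - (1/8)*ln X+ln 2/24+(1/12-a))) by (f_equal; field).
 apply is_lim_seq_plus'; [|exact HL]. apply is_lim_seq_plus'; [|apply is_lim_seq_const]. apply is_lim_seq_plus'.
 - apply seq_lim_of_eps. intros eps He. destruct (bet_small (Rmin (/ (2*X)) (eps/(3*X^4)))) as [n0 Hn].
  { have: 0<X^4 by pos. apply Rmin_glb_lt; [pos|pos]. }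
  exists n0. intros n Hle. specialize (Hn n Hle). have Hb := bet_pos n. minmax. have X4: 0<X^4 by pos.
  have Hw1: bet n*X<=1/2 by (trans (/ (2*X)*X); [mono|right; field; lra]).
  have Hw2: bet n*(3*X^4)<=eps by (trans (eps/(3*X^4)*(3*X^4)); [mono|right; field; lra]).
  have Hw0: 0<bet n*X by pos. have HN := N2_bet3 n.
  have T1 := exp_taylor3 (bet n*X) ok. have T2 := exp_taylor3 (2*(bet n*X)) ok.
  unfold G. set (w := bet n*X) in *. set (e1 := exp w) in *. set (e2 := exp (2*w)) in *. set (N2 := INR (S n)^2) in *.
  have HN2: 0<=N2 by apply pow2_ge_0.
  have HX3: - X^3/12=N2*(- w^3/6).
  { unfold w. replace (N2*(- (bet n*X)^3/6)) with (N2*bet n^3*(- X^3/6)) by fld. rewrite HN. field. }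
  rewrite HX3, <- Rmult_minus_distr_l, Rabs_mult, (Rabs_right N2) by lra.
  have HA: Rabs (e1-e2/4-w/2-3/4 - - w^3/6)<=5*w^4.
  { replace ((2*w)^4) with (16*w^4) in T2 by ring. replace ((2*w)^3) with (8*w^3) in T2 by ring. replace ((2*w)^2) with (4*w^2) in T2 by ring. alra. }
  trans (N2*(5*w^4)); [mono|].
  replace (N2*(5*w^4)) with (N2*bet n^3*(5*(bet n*X^4))) by (unfold w; ring). rewrite HN. lra.
 - apply is_lim_seq_mult'; [apply is_lim_seq_const|]. apply (is_lim_seq_cont ln _ X (1/X)); [apply (isd_ln (fun x => x)); [isd_|lra]|now apply v_over_b].
Qed.

Lemma b_over_v X : 0 < X -> is_lim_seq (fun n => bet n/2*(/ (1-exp (bet n * - X))-1)) (/ (2*X)).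
Proof.
 intros HX. apply (is_lim_seq_ext (fun n => / 2 * / ((1-exp (bet n * - X))/bet n)-bet n * / 2)).
 { intros n. have Hb := bet_pos n. destruct (v_pos (bet n) (- X) Hb ok). field. lra. }
 replace (Finite (/ (2*X))) with (Finite (/ 2 * / X-0 * / 2)) by (f_equal; field; lra).
 apply is_lim_seq_minus'.
 - apply is_lim_seq_mult'; [apply is_lim_seq_const|]. apply (is_lim_seq_cont Rinv _ X (- 1/X^2)); [apply (isd_inv (fun x => x)); [isd_|lra]|now apply v_over_b].
 - apply is_lim_seq_mult'; [apply bet_lim|apply is_lim_seq_const].
Qed.

Lemma abs_lim_le (u w : nat -> R) (lu lw : R) n0 : is_lim_seq u lu -> is_lim_seq w lw -> (forall n, (n0 <= n)%nat -> Rabs (u n) <= w n) -> Rabs lu <= lw.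
Proof.
 intros Hu Hw H. assert (L : Rbar_le (Rbar_abs lu) lw); [|exact L].
 apply (is_lim_seq_le_loc (fun n => Rabs (u n)) w); [now exists n0|now apply is_lim_seq_abs|exact Hw].
Qed.

(** [lamx] converges at -X0, whereas [lxm] contains N(k + kap); division by N leaves k + kap = 0,
    and with it the constant term can be read off. *)
Lemma VV_const q (k kap a : R) : is_Hastings_McLeod q -> is_lim (fun t => ln (mbes0 t)-2*t+1/2*ln (2*t)) p_infty k ->
 (forall n, Rabs (stir n-kap) <= / INR (S n)^2) -> is_lim_seq hyp a ->
 k+kap = 0 /\ exists X0, 20 <= X0 /\ forall X, X0 <= X -> Rabs (VV q (- X)+lamL X (1/12-a)) <= / (2*X).
Proof.
 intros Hq Hk Hs Ha. destruct (lx_left q k Hq Hk) as [X0 [HX0 [n0 H]]].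
 have Lw: forall X, X0<=X -> is_lim_seq (fun n => lamx n (- X)-(lxm k n (- X)-tim n (- X)^2-INR (S n)*(k+kap))) (- VV q (- X)-lamL X (1/12-a)).
 { intros X HX. apply is_lim_seq_minus'; [now apply lamx_lim|apply lxm_lim; auto; lra]. }
 have K0: k+kap=0.
 { have Lb: Rabs 0<=0 /\ is_lim_seq (fun n => / INR (S n)*(lamx n (- X0)-(lxm k n (- X0)-tim n (- X0)^2-INR (S n)*(k+kap)))) 0.
  { split; [rewrite Rabs_R0; lra|]. replace (Finite 0) with (Finite (0*(- VV q (- X0)-lamL X0 (1/12-a)))) by (f_equal; ring).
   apply is_lim_seq_mult'; [apply inv_INR_lim|apply Lw; lra]. }
  destruct Lb as [_ Lb].
  have Lc: is_lim_seq (fun n => / INR (S n)*(lamx n (- X0)-(lxm k n (- X0)-tim n (- X0)^2-INR (S n)*(k+kap)))-(k+kap)) (0-(k+kap)) by (apply is_lim_seq_minus'; [exact Lb|apply is_lim_seq_const]).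
  have Ld: Rabs (0-(k+kap))<=0 * / (2*X0).
  { apply (abs_lim_le _ (fun n => / INR (S n)*(bet n/2*(/ (1-exp (bet n * - X0))-1))) _ _ n0 Lc).
   - apply is_lim_seq_mult'; [apply inv_INR_lim|apply b_over_v; lra].
   - intros n Hn. specialize (H n Hn (- X0) ok). have HN := INR_S_pos n. have: 0 < / INR (S n) by pos.
    replace (/ INR (S n)*(lamx n (- X0)-(lxm k n (- X0)-tim n (- X0)^2-INR (S n)*(k+kap)))-(k+kap)) with (/ INR (S n)*(lx n (- X0)-lxm k n (- X0))).
    + rewrite Rabs_mult, Rabs_right by lra. apply Rmult_le_compat_l; [lra|exact H].
    + unfold lamx. field. lra. }
  alra. }
 split; [exact K0|]. exists X0. split; [exact HX0|]. intros X HX. specialize (Lw X HX). rewrite K0 in Lw.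
 replace (VV q (- X)+lamL X (1/12-a)) with (- (- VV q (- X)-lamL X (1/12-a))) by ring. rewrite Rabs_Ropp.
 apply (abs_lim_le _ (fun n => bet n/2*(/ (1-exp (bet n * - X))-1)) _ _ n0 Lw); [apply b_over_v; lra|].
 intros n Hn. specialize (H n Hn (- X) ok).
 replace (lamx n (- X)-(lxm k n (- X)-tim n (- X)^2-INR (S n)*0)) with (lx n (- X)-lxm k n (- X)) by (unfold lamx; ring). exact H.
Qed.

Lemma N_r3 n X : 0 < X -> INR (S n)*sqrt (1-exp (bet n * - X))^3 = sqrt (((1-exp (bet n * - X))/bet n)^3 * / 2).
Proof.
 intros HX. have Hb := bet_pos n. destruct (v_pos (bet n) (- X) Hb ok) as [U1 U2]. have HN := INR_S_pos n. have H := N2_bet3 n.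
 set (v := 1-exp (bet n * - X)) in *. have Hv: 0<v by (unfold v; lra). have R0 := sqrt_lt_R0 v Hv. have R2 := pow2_sqrt v ok.
 symmetry. apply sqrt_lem_1.
 - have: 0<v/bet n by pos. have: 0<(v/bet n)^3 by pos. lra.
 - apply Rmult_le_pos; [lra|pos].
 - replace (INR (S n)*sqrt v^3*(INR (S n)*sqrt v^3)) with (INR (S n)^2*(sqrt v^2)^3) by ring. rewrite R2.
  replace (INR (S n)^2) with (1/2/bet n^3) by (rewrite <- H; field; lra). field. lra.
Qed.

(** With r = sqrt(1-u), [hxm] - [hxc] = N(2r/(1-r^2) - log((1+r)/(1-r))) = (4/3) N r^3 + O(N r^5),
    while r -> 0 and N r^3 -> sqrt(X^3/2). *)
Lemma hxm_lim (k kap X : R) : is_lim_seq stir kap -> 0 < X -> is_lim_seq (fun n => hxm k n (- X)) (4/3*sqrt (X^3 * / 2)+(k+kap+ln 2)).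
Proof.
 intros Hs HX. set (A := fun n => INR (S n)*sqrt (1-exp (bet n * - X))^3).
 have LA: is_lim_seq A (sqrt (X^3 * / 2)).
 { apply (is_lim_seq_ext (fun n => sqrt (((1-exp (bet n * - X))/bet n)^3 * / 2))); [intros; symmetry; now apply N_r3|].
  have: 0<X^3 by pos.
  eapply (is_lim_seq_cont (fun y => sqrt (y^3 * / 2))); [apply isd_sqrt; [isd_|lra]|now apply v_over_b]. }
 have Lv: is_lim_seq (fun n => 1-exp (bet n * - X)) 0.
 { apply (is_lim_seq_ext (fun n => (1-exp (bet n * - X))/bet n*bet n)); [intros n; have := bet_pos n; field; lra|].
  replace (Finite 0) with (Finite (X*0)) by (f_equal; ring). apply is_lim_seq_mult'; [now apply v_over_b|apply bet_lim]. }
 apply (is_lim_seq_ext (fun n => 4/3*A n+hxc k n+(hxm k n (- X)-hxc k n-4/3*A n))); [intros; ring|].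
 replace (Finite (4/3*sqrt (X^3 * / 2)+(k+kap+ln 2))) with (Finite (4/3*sqrt (X^3 * / 2)+(k+kap+ln 2)+0)) by (f_equal; ring).
 apply is_lim_seq_plus'; [apply is_lim_seq_plus'; [apply is_lim_seq_mult'; [apply is_lim_seq_const|exact LA]|now apply hxc_lim]|].
 destruct (lim_seq_eps _ _ (1/4) Lv ok) as [n0 Hn0].
 apply (is_lim_seq_le_le_loc (fun _ => 0) _ (fun n => 3*(A n*(1-exp (bet n * - X))))).
 - exists n0. intros n Hn. specialize (Hn0 n Hn). rewrite Rminus_0_r in Hn0. have Hb := bet_pos n. destruct (v_pos (bet n) (- X) Hb ok) as [U1 U2].
  rewrite Rabs_right in Hn0 by lra. unfold A, hxm. have HN := INR_S_pos n.
  unfold tim. replace (- bet n * - X) with (- (bet n * - X)) by ring. rewrite exp_Ropp. have Eu := ln_exp (bet n * - X).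
  set (u := exp (bet n * - X)) in *. have R0 := sqrt_lt_R0 (1-u) ok. have R2 := pow2_sqrt (1-u) ok. set (r := sqrt (1-u)) in *.
  have Hr: r<=1/2 by (apply Rnot_lt_le; intros Hn'; nra).
  have T := atanh_taylor r ok. rewrite R2 in T. replace (1-(1-u)) with u in T by ring.
  rewrite <- Eu. match goal with |- 0 <= ?e /\ ?e<=_ => replace e with (INR (S n)*(2*r/u-(2*ln (1+r)-ln u)-4/3*r^3)) by fld end.
  replace (3*(INR (S n)*r^3*(1-u))) with (INR (S n)*(3*r^5)) by (rewrite <- R2; ring).
  split; [pos|mono].
 - apply is_lim_seq_const.
 - replace (Finite 0) with (Finite (3*(sqrt (X^3 * / 2)*0))) by (f_equal; ring). apply is_lim_seq_mult'; [apply is_lim_seq_const|now apply is_lim_seq_mult'].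
Qed.

Lemma SS_const q (k kap : R) : is_Hastings_McLeod q -> is_lim (fun t => ln (mbes0 t)-2*t+1/2*ln (2*t)) p_infty k ->
 is_lim_seq stir kap -> k+kap = 0 ->
 exists X0, 20 <= X0 /\ forall X, X0 <= X -> Rabs (2*SS q (- X)-(4/3*sqrt (X^3 * / 2)+ln 2)) <= / (2*sqrt (X^3 * / 2)).
Proof.
 intros Hq Hk Hs K0. destruct (hx_left q k Hq Hk) as [X0 [HX0 [n0 H]]]. exists X0. split; [exact HX0|]. intros X HX.
 have X3: 0<X^3 by pos.
 have Lw: is_lim_seq (fun n => hx n (- X)-hxm k n (- X)) (2*SS q (- X)-(4/3*sqrt (X^3 * / 2)+ln 2)).
 { apply is_lim_seq_minus'; [now apply hx_lim|]. have L := hxm_lim k kap X Hs ok. rewrite K0, Rplus_0_l in L. exact L. }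
 set (A := fun n => INR (S n)*sqrt (1-exp (bet n * - X))^3).
 have S0: 0<sqrt (X^3 * / 2) by pos.
 have LA: is_lim_seq A (sqrt (X^3 * / 2)).
 { apply (is_lim_seq_ext (fun n => sqrt (((1-exp (bet n * - X))/bet n)^3 * / 2))); [intros; symmetry; apply N_r3; lra|].
  eapply (is_lim_seq_cont (fun y => sqrt (y^3 * / 2))); [apply isd_sqrt; [isd_|lra]|apply v_over_b; lra]. }
 apply (abs_lim_le _ (fun n => / 2 * / A n) _ _ n0 Lw).
 - replace (Finite (/ (2*sqrt (X^3 * / 2)))) with (Finite (/ 2 * / sqrt (X^3 * / 2))) by (f_equal; field; lra).
  apply is_lim_seq_mult'; [apply is_lim_seq_const|]. eapply (is_lim_seq_cont Rinv); [apply (isd_inv (fun x => x)); [isd_|lra]|exact LA].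
 - intros n Hn. specialize (H n Hn (- X) ok). apply Rle_trans with (1 := H). unfold A. have Hb := bet_pos n. destruct (v_pos (bet n) (- X) Hb ok) as [U1 U2].
  have HN := INR_S_pos n. have Hg := gam_pos n. have NB := N_bet_gam n. have G2 := gam_sq n.
  have R0 := sqrt_lt_R0 (1-exp (bet n * - X)) ok. set (r := sqrt (1-exp (bet n * - X))) in *. 
  have E: bet n^2/gam n = / (2*INR (S n)).
  { have E1: bet n=gam n^2/2 by lra. have E2: INR (S n) = / (bet n*gam n) by (apply Rmult_eq_reg_r with (bet n*gam n); [rewrite Rinv_l; [lra|nra]|nra]).
   rewrite E2, E1. field. lra. }
  rewrite E. replace (/ 2 * / (INR (S n)*r^3)) with (/ (2*INR (S n)) * / r^3) by fld.
  have: 0 < / (2*INR (S n)) by pos. apply Rmult_le_compat_l; lra.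
Qed.

(** * Complex differentiability, Goursat's theorem and a Cauchy estimate *)

Lemma Cminus_neq0 (z w : C) : z <> w -> (z-w)%C <> RtoC 0.
Proof. intros N Q. apply N. replace z with (z-w+w)%C by ring. rewrite Q. ring. Qed.

Definition ccont (f : C -> C) (p : C) : Prop := forall eps, 0 < eps -> exists d, 0 < d /\ forall z, Cmod (z-p) < d -> Cmod (f z-f p) <= eps.

(* Caratheodory's form of complex differentiability at p: the slope extends continuously. *)
Definition chol (f : C -> C) (p : C) : Prop := exists g, ccont g p /\ exists d, 0 < d /\ forall z, Cmod (z-p) < d -> f z = (f p+g z*(z-p))%C.

Lemma Cmod_tri_minus (a b c : C) : Cmod (a-c) <= Cmod (a-b)+Cmod (b-c).
Proof. replace (a-c)%C with ((a-b)+(b-c))%C by ring. apply Cmod_triangle. Qed.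

Lemma ccont_local f g p : (exists d, 0 < d /\ forall z, Cmod (z-p) < d -> f z = g z) -> ccont f p -> ccont g p.
Proof.
 intros [d0 [H0 E]] Hf eps He. destruct (Hf eps He) as [d [Hd H]]. exists (Rmin d d0). split; [pos|].
 intros z Hz. minmax. rewrite <- !E; [apply H; lra| |lra].
 replace (p-p)%C with (RtoC 0) by ring. rewrite Cmod_0. lra.
Qed.
Lemma ccont_const c p : ccont (fun _ => c) p.
Proof. intros eps He. exists 1. split; [lra|]. intros z _. replace (c-c)%C with (RtoC 0) by ring. rewrite Cmod_0. lra. Qed.
Lemma ccont_id p : ccont (fun z => z) p.
Proof. intros eps He. exists eps. split; [lra|]. intros z Hz. lra. Qed.
Lemma ccont_plus f g p : ccont f p -> ccont g p -> ccont (fun z => f z+g z)%C p.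
Proof.
 intros F G eps He. destruct (F (eps/2)) as [d1 [H1 E1]]; [lra|]. destruct (G (eps/2)) as [d2 [H2 E2]]; [lra|].
 exists (Rmin d1 d2). split; [pos|]. intros z Hz. minmax. specialize (E1 z ok). specialize (E2 z ok).
 replace (f z+g z-(f p+g p))%C with ((f z-f p)+(g z-g p))%C by ring. le_trans Cmod_triangle. lra.
Qed.
Lemma ccont_mult f g p : ccont f p -> ccont g p -> ccont (fun z => f z*g z)%C p.
Proof.
 intros F G eps He. have Pf := Cmod_ge_0 (f p). have Pg := Cmod_ge_0 (g p).
 set (K := Cmod (f p)+Cmod (g p)+1). have HK: 1<=K by (unfold K; lra).
 set (e := Rmin 1 (eps/(2*K))). have He0: 0<e by (apply Rmin_glb_lt; [lra|apply Rdiv_lt_0_compat; lra]).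
 have He1: e<=1 by apply Rmin_l. have He2: e*(2*K)<=eps.
 { trans (eps/(2*K)*(2*K)); [apply Rmult_le_compat_r; [lra|apply Rmin_r]|right; field; lra]. }
 destruct (F e He0) as [d1 [H1 E1]]. destruct (G e He0) as [d2 [H2 E2]].
 exists (Rmin d1 d2). split; [pos|]. intros z Hz. minmax. specialize (E1 z ok). specialize (E2 z ok).
 replace (f z*g z-f p*g p)%C with ((f z-f p)*g p+((f z-f p)*(g z-g p)+f p*(g z-g p)))%C by ring.
 le_trans Cmod_triangle. eapply Rle_trans; [apply Rplus_le_compat_l, Cmod_triangle|]. rewrite !Cmod_mult.
 have := Cmod_ge_0 (f z-f p). 
 set (fp := Cmod (f p)) in *. set (gp := Cmod (g p)) in *.
 unfold K in *. clearbody fp gp. nra.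
Qed.
Lemma ccont_comp f g p : ccont f (g p) -> ccont g p -> ccont (fun z => f (g z)) p.
Proof.
 intros F G eps He. destruct (F eps He) as [d1 [H1 E1]]. destruct (G (d1/2)) as [d2 [H2 E2]]; [lra|]. exists d2. split; [exact H2|].
 intros z Hz. apply E1. specialize (E2 z Hz). lra.
Qed.
Lemma ccont_opp f p : ccont f p -> ccont (fun z => - f z)%C p.
Proof.
 intros F eps He. destruct (F eps He) as [d [Hd H]]. exists d. split; [exact Hd|]. intros z Hz. replace (- f z - - f p)%C with (- (f z-f p))%C by ring. rewrite Cmod_opp. now apply H.
Qed.

Lemma ccont_neq0 f p : ccont f p -> f p <> (RtoC 0) -> exists d, 0 < d /\ forall z, Cmod (z-p) < d -> Cmod (f p)/2 <= Cmod (f z).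
Proof.
 intros F Hp. apply Cmod_gt_0 in Hp. destruct (F (Cmod (f p)/2)) as [d [Hd H]]; [lra|]. exists d. split; [exact Hd|]. intros z Hz. specialize (H z Hz).
 have T := Cmod_triangle (f z) (- (f z-f p)). rewrite Cmod_opp in T. replace (f z + - (f z-f p))%C with (f p) in T by ring. lra.
Qed.
Lemma Cmod_neq0 z r : 0 < r -> r <= Cmod z -> z <> (RtoC 0).
Proof. intros Hr H E. rewrite E, Cmod_0 in H. lra. Qed.

Lemma ccont_inv f p : ccont f p -> f p <> (RtoC 0) -> ccont (fun z => / f z)%C p.
Proof.
 intros F Hp. destruct (ccont_neq0 f p F Hp) as [d0 [Hd0 H0]]. have Hm := Hp. apply Cmod_gt_0 in Hm. intros eps He. set (m := Cmod (f p)) in *.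
 destruct (F (eps*(m^2/2))) as [d [Hd H]]. { have: 0<m^2 by pos. apply Rmult_lt_0_compat; lra. }
 exists (Rmin d0 d). split; [pos|]. intros z Hz. minmax. specialize (H z ok). specialize (H0 z ok). have Hz0: f z <> (RtoC 0) by (apply (Cmod_neq0 _ (m/2)); lra).
 replace (/ f z - / f p)%C with (- (f z-f p) * / (f z*f p))%C by (field; split; assumption).
 rewrite Cmod_mult, Cmod_opp, Cmod_inv, Cmod_mult by (now apply Cmult_neq_0). fold m.
 have Q: / (Cmod (f z)*m) <= / (m^2/2) by (apply Rinv_le_contravar; [have: 0<m^2 by pos; lra|nra]).
 trans (eps*(m^2/2) * / (m^2/2)).
 - apply Rmult_le_compat; [pos| |exact H|exact Q]. apply Rlt_le, Rinv_0_lt_compat. nra.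
 - right. field. lra.
Qed.

Lemma chol_ccont f p : chol f p -> ccont f p.
Proof.
 intros [g [Hg [d [Hd E]]]]. apply (ccont_local (fun z => f p+g z*(z-p))%C).
 { exists d. split; [exact Hd|]. intros z Hz. symmetry. now apply E. }
 apply ccont_plus; [apply ccont_const|]. apply ccont_mult; [exact Hg|]. unfold Cminus. apply ccont_plus; [apply ccont_id|apply ccont_const].
Qed.

Lemma chol_eps f p : chol f p -> exists l, forall eps, 0 < eps -> exists d, 0 < d /\ forall z, Cmod (z-p) < d -> Cmod (f z-f p-l*(z-p)) <= eps*Cmod (z-p).
Proof.
 intros [g [Hg [d0 [Hd0 E]]]]. exists (g p). intros eps He. destruct (Hg eps He) as [d [Hd H]]. exists (Rmin d0 d). split; [pos|].
 intros z Hz. minmax. rewrite E by lra. replace (f p+g z*(z-p)-f p-g p*(z-p))%C with ((g z-g p)*(z-p))%C by ring.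
 rewrite Cmod_mult. apply Rmult_le_compat_r; [pos|apply H; lra].
Qed.

Lemma chol_of_eps f p l : (forall eps, 0 < eps -> exists d, 0 < d /\ forall z, Cmod (z-p) < d -> Cmod (f z-f p-l*(z-p)) <= eps*Cmod (z-p)) -> chol f p.
Proof.
 intros H. exists (fun z => if excluded_middle_informative (z=p) then l else ((f z-f p)/(z-p))%C). split.
 - intros eps He. destruct (H eps He) as [d [Hd Hz]]. exists d. split; [exact Hd|]. intros z Hzd. destruct (excluded_middle_informative (p=p)) as [_|N]; [|congruence].
  destruct (excluded_middle_informative (z=p)) as [_|N]; [replace (l-l)%C with (RtoC 0) by ring; rewrite Cmod_0; lra|].
  have N0: (z-p)%C <> (RtoC 0) by (intros Q; apply N; replace z with (z-p+p)%C by ring; rewrite Q; ring).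
  replace ((f z-f p)/(z-p)-l)%C with ((f z-f p-l*(z-p)) * / (z-p))%C by (field; exact N0). rewrite Cmod_mult, Cmod_inv by exact N0.
  specialize (Hz z Hzd). apply Cmod_gt_0 in N0. apply Rmult_le_reg_r with (Cmod (z-p)); [exact N0|]. rewrite Rmult_assoc, Rinv_l by lra. lra.
 - exists 1. split; [lra|]. intros z _. destruct (excluded_middle_informative (z=p)) as [->|N]; [ring|].
  have N0: (z-p)%C <> (RtoC 0) by (intros Q; apply N; replace z with (z-p+p)%C by ring; rewrite Q; ring). field. exact N0.
Qed.

Lemma chol_of_ex_derive (f : C -> C) p : ex_derive (K := C_AbsRing) (V := C_NormedModule) f p -> chol f p.
Proof.
 intros [l [Hl H]]. apply (chol_of_eps f p l). intros eps He.
 destruct (H p (fun P HP => HP) (mkposreal eps He)) as [d Hd]. exists d. split; [apply cond_pos|]. intros z Hz.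
 specialize (Hd z Hz). rewrite (Cmult_comm l). exact Hd.
Qed.

Lemma chol_const c p : chol (fun _ => c) p.
Proof. exists (fun _ => (RtoC 0)). split; [apply ccont_const|]. exists 1. split; [lra|]. intros z _. ring. Qed.
Lemma chol_id p : chol (fun z => z) p.
Proof. exists (fun _ => (RtoC 1)). split; [apply ccont_const|]. exists 1. split; [lra|]. intros z _. ring. Qed.
Lemma chol_plus f g p : chol f p -> chol g p -> chol (fun z => f z+g z)%C p.
Proof.
 intros [f1 [Hf [d1 [D1 E1]]]] [g1 [Hg [d2 [D2 E2]]]]. exists (fun z => f1 z+g1 z)%C. split; [now apply ccont_plus|].
 exists (Rmin d1 d2). split; [pos|]. intros z Hz. minmax. rewrite E1, E2 by lra. ring.
Qed.
Lemma chol_mult f g p : chol f p -> chol g p -> chol (fun z => f z*g z)%C p.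
Proof.
 intros Cf Cg. have Hgc := chol_ccont g p Cg. destruct Cf as [f1 [Hf [d1 [D1 E1]]]]. destruct Cg as [g1 [Hg [d2 [D2 E2]]]].
 exists (fun z => f1 z*g z+f p*g1 z)%C. split; [apply ccont_plus; apply ccont_mult; auto; apply ccont_const|].
 exists (Rmin d1 d2). split; [pos|]. intros z Hz. minmax. rewrite E1 by lra. rewrite E2 by lra. ring.
Qed.
Lemma chol_scal c f p : chol f p -> chol (fun z => c*f z)%C p.
Proof. intros H. apply chol_mult; [apply chol_const|exact H]. Qed.
Lemma chol_opp f p : chol f p -> chol (fun z => - f z)%C p.
Proof.
 intros [f1 [Hf [d [Hd E]]]]. exists (fun z => - f1 z)%C. split; [now apply ccont_opp|]. exists d. split; [exact Hd|]. intros z Hz. rewrite E by exact Hz. ring.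
Qed.
Lemma chol_minus f g p : chol f p -> chol g p -> chol (fun z => f z-g z)%C p.
Proof. intros. apply chol_plus; [assumption|now apply chol_opp]. Qed.
Lemma chol_comp f g p : chol f (g p) -> chol g p -> chol (fun z => f (g z)) p.
Proof.
 intros Cf Cg. have Hgc := chol_ccont g p Cg. destruct Cf as [f1 [Hf [d1 [D1 E1]]]]. destruct Cg as [g1 [Hg [d2 [D2 E2]]]].
 exists (fun z => f1 (g z)*g1 z)%C. split; [apply ccont_mult; [now apply (ccont_comp f1 g)|exact Hg]|].
 destruct (Hgc (d1/2)) as [d3 [D3 E3]]; [lra|].
 exists (Rmin d2 d3). split; [pos|]. intros z Hz. minmax. specialize (E3 z ok). rewrite E1 by lra. rewrite (E2 z) at 2 by lra. ring.
Qed.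
Lemma chol_inv f p : chol f p -> f p <> (RtoC 0) -> chol (fun z => / f z)%C p.
Proof.
 intros Cf Hp. have Hfc := chol_ccont f p Cf. destruct (ccont_neq0 f p Hfc Hp) as [d0 [Hd0 H0]]. destruct Cf as [f1 [Hf [d1 [D1 E1]]]].
 exists (fun z => - f1 z * / (f z*f p))%C. split.
 - apply ccont_mult; [now apply ccont_opp|]. apply (ccont_inv (fun z => f z*f p)%C); [|now apply Cmult_neq_0]. apply ccont_mult; [exact Hfc|apply ccont_const].
 - exists (Rmin d0 d1). split; [pos|]. intros z Hz. minmax. specialize (H0 z ok). have Hm := Hp. apply Cmod_gt_0 in Hm. have Hz0: f z <> (RtoC 0) by (apply (Cmod_neq0 _ (Cmod (f p)/2)); lra).
  specialize (E1 z ok). replace (- f1 z * / (f z*f p)*(z-p))%C with (- (f z-f p) * / (f z*f p))%C by (rewrite E1; ring).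
  field. split; assumption.
Qed.

Definition Cexp (z : C) : C := (exp (fst z)*cos (snd z), exp (fst z)*sin (snd z)).

Lemma Cexp_plus a b : Cexp (a+b) = (Cexp a*Cexp b)%C.
Proof.
 unfold Cexp. destruct a as [a1 a2]. destruct b as [b1 b2]. unfold Cplus, Cmult. simpl. rewrite exp_plus, cos_plus, sin_plus. f_equal; ring.
Qed.
Lemma Cmod_Cexp z : Cmod (Cexp z) = exp (fst z).
Proof.
 unfold Cmod, Cexp. simpl. have H := sin2_cos2 (snd z). unfold Rsqr in H. have := exp_pos (fst z).
 replace (exp (fst z)*cos (snd z)*(exp (fst z)*cos (snd z)*1)+exp (fst z)*sin (snd z)*(exp (fst z)*sin (snd z)*1))
  with (exp (fst z)^2*(sin (snd z)*sin (snd z)+cos (snd z)*cos (snd z))) by ring.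
 rewrite H, Rmult_1_r. apply sqrt_pow2. lra.
Qed.

Lemma Cmod_le_sum (z : C) : Cmod z <= Rabs (fst z)+Rabs (snd z).
Proof.
 unfold Cmod. have := Rabs_pos (fst z). have := Rabs_pos (snd z). rewrite <- (sqrt_pow2 (Rabs (fst z)+Rabs (snd z))) by lra.
 apply sqrt_le_1_alt. rewrite <- (pow2_abs (fst z)), <- (pow2_abs (snd z)). nra.
Qed.
Lemma abs_fst_Cmod (z : C) : Rabs (fst z) <= Cmod z.
Proof. apply re_le_Cmod. Qed.
Lemma abs_snd_Cmod (z : C) : Rabs (snd z) <= Cmod z.
Proof. eapply Rle_trans; [apply Rmax_r|apply Rmax_Cmod]. Qed.

Lemma Cexp_near_0 h : Cmod h <= 1 -> Cmod (Cexp h-1-h) <= 12*Cmod h^2.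
Proof.
 intros Hh. have Hx := abs_fst_Cmod h. have Hy := abs_snd_Cmod h. destruct h as [x y]. simpl in Hx, Hy. set (m := Cmod (x, y)) in *.
 have E1: Rabs (exp x-1-x)<=m^2.
 { have Q := exp_quad (- x). rewrite Rabs_Ropp in Q. specialize (Q ok). rewrite Ropp_involutive in Q.
  replace (exp x-1-x) with (- (1-exp x - - x)) by ring. rewrite Rabs_Ropp. eapply Rle_trans; [exact Q|].
  replace ((- x)^2) with (Rabs x^2) by (rewrite pow2_abs; ring). apply pow_incr. split; [pos|exact Hx]. }
 have E2: Rabs (cos y-1)<=m^2.
 { have Q: 1-y^2<=cos y<=1.
  { have := COS_bound y. split; [|lra]. replace y with (2*(y/2)) at 2 by field. rewrite cos_2a_sin.
   have S := abs_sin_le (y/2). have: (sin (y/2))^2<=(y/2)^2 by (rewrite <- (pow2_abs (sin _)), <- (pow2_abs (y/2)); apply pow_incr; split; [pos|exact S]). have := pow2_ge_0 y. lra. }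
  have: y^2<=m^2 by (rewrite <- (pow2_abs y); apply pow_incr; split; [pos|exact Hy]). alra. }
 have E3: Rabs (sin y-y)<=m^2.
 { have Q: forall t, 0<=t<=1 -> Rabs (sin t-t)<=t^2.
  { intros t Ht. have := sin_le_id t ok. have := sin_ge_cubic t ok. apply Rabs_le. split; nra. }
  have Q2: Rabs (sin y-y)<=Rabs y^2.
  { destruct (Rle_dec 0 y) as [P|P].
   - rewrite (Rabs_right y) in * by lra. apply Q. lra.
   - rewrite (Rabs_left y) in * by lra. specialize (Q (- y) ok). rewrite sin_neg in Q. replace (sin y-y) with (- (- sin y - - y)) by ring. now rewrite Rabs_Ropp. }
  eapply Rle_trans; [exact Q2|]. apply pow_incr. split; [pos|exact Hy]. }
 have Hm0: 0<=m by apply Cmod_ge_0.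
 have Em: Rabs (exp x-1)<=2*m.
 { replace (exp x-1) with ((exp x-1-x)+x) by ring. le_trans Rabs_triang. nra. }
 le_trans Cmod_le_sum. simpl.
 have A1: Rabs (exp x*cos y + - (1) + - x)<=4*m^2.
 { replace (exp x*cos y + - (1) + - x) with ((exp x-1-x)+((exp x-1)*(cos y-1)+(cos y-1))) by ring.
  le_trans Rabs_triang. eapply Rle_trans; [apply Rplus_le_compat_l, Rabs_triang|]. rewrite Rabs_mult.
  have: Rabs (exp x-1)*Rabs (cos y-1)<=2*m^2 by mono. lra. }
 have A2: Rabs (exp x*sin y + - 0 + - y)<=5*m^2.
 { replace (exp x*sin y + - 0 + - y) with ((exp x-1)*(sin y-y)+((exp x-1)*y+(sin y-y))) by ring.
  le_trans Rabs_triang. eapply Rle_trans; [apply Rplus_le_compat_l, Rabs_triang|]. rewrite !Rabs_mult.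
  have: Rabs (exp x-1)*Rabs (sin y-y)<=2*m^2 by mono.
  have: Rabs (exp x-1)*Rabs y<=2*m*m by mono. nra. }
 have: 0<=m^2 by apply pow2_ge_0. lra.
Qed.

Lemma chol_Cexp p : chol Cexp p.
Proof.
 apply (chol_of_eps Cexp p (Cexp p)). intros eps He. have Ep := exp_pos (fst p). set (K := 12*exp (fst p)).
 exists (Rmin 1 (eps/K)). split; [apply Rmin_glb_lt; [lra|apply Rdiv_lt_0_compat; unfold K; lra]|]. intros z Hz.
 minmax. have := Cmod_ge_0 (z-p).
 replace (Cexp z-Cexp p-Cexp p*(z-p))%C with (Cexp p*(Cexp (z-p)-1-(z-p)))%C.
 - rewrite Cmod_mult, Cmod_Cexp. have Q := Cexp_near_0 (z-p) ok. set (m := Cmod (z-p)) in *.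
  trans (exp (fst p)*(12*m^2)); [mono|].
  have: K*m<=eps. { trans (K*(eps/K)); [apply Rmult_le_compat_l; unfold K in *; lra|right; field; unfold K; lra]. }
  unfold K in *. nra.
 - replace (Cexp z) with (Cexp p*Cexp (z-p))%C by (rewrite <- Cexp_plus; f_equal; ring). ring.
Qed.

Lemma chol_exp f p : chol f p -> chol (fun z => Cexp (f z)) p.
Proof. intros H. apply (chol_comp Cexp f); [apply chol_Cexp|exact H]. Qed.

(* The real part of the contour integral of F around the rectangle [a,b] x [c,d], counterclockwise. *)
Definition RI (F : C -> C) (a b c d : R) : R :=
 RInt (fun x => fst (F (x, c))-fst (F (x, d))) a b-RInt (fun y => snd (F (b, y))-snd (F (a, y))) c d.

Definition on_rect (P : C -> Prop) (a b c d : R) : Prop := forall x y, a <= x <= b -> c <= y <= d -> P (x, y).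

Lemma Cmod_hor (x x' y : R) : Cmod ((x, y)-(x', y)) = Rabs (x-x').
Proof. replace ((x, y)-(x', y))%C with (RtoC (x-x')); [apply Cmod_R|]. unfold RtoC, Cminus, Cplus, Copp. simpl. f_equal; ring. Qed.
Lemma Cmod_ver (x y y' : R) : Cmod ((x, y)-(x, y')) = Rabs (y-y').
Proof.
 replace ((x, y)-(x, y'))%C with (Ci*RtoC (y-y'))%C; [rewrite Cmod_mult, Cmod_Ci, Cmod_R; ring|]. unfold RtoC, Cminus, Cplus, Copp, Cmult, Ci. simpl. f_equal; ring.
Qed.

Lemma real_continuous (f : R -> R) (x : R) : (forall eps, 0 < eps -> exists d, 0 < d /\ forall y, Rabs (y-x) < d -> Rabs (f y-f x) <= eps) -> continuous f x.
Proof.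
 intros H. apply continuity_pt_filterlim. intros eps He. destruct (H (eps/2)) as [d [Hd Hy]]; [lra|]. exists d. split; [exact Hd|].
 intros y [_ Hyd]. simpl in *. unfold Rdist in *. specialize (Hy y Hyd). lra.
Qed.

Lemma cont_hor_fst F x y : ccont F (x, y) -> continuous (fun s => fst (F (s, y))) x.
Proof.
 intros H. apply real_continuous. intros eps He. destruct (H eps He) as [d [Hd Hz]]. exists d. split; [exact Hd|]. intros s Hs.
 specialize (Hz (s, y)). rewrite Cmod_hor in Hz. eapply Rle_trans; [|apply Hz, Hs]. apply (abs_fst_Cmod (F (s, y)-F (x, y))%C).
Qed.
Lemma cont_ver_snd F x y : ccont F (x, y) -> continuous (fun s => snd (F (x, s))) y.
Proof.
 intros H. apply real_continuous. intros eps He. destruct (H eps He) as [d [Hd Hz]]. exists d. split; [exact Hd|]. intros s Hs.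
 specialize (Hz (x, s)). rewrite Cmod_ver in Hz. eapply Rle_trans; [|apply Hz, Hs]. apply (abs_snd_Cmod (F (x, s)-F (x, y))%C).
Qed.

Lemma ex_hor F a b c d y a' b' : on_rect (ccont F) a b c d -> a <= a' -> a' <= b' -> b' <= b -> c <= y <= d -> ex_RInt (fun x => fst (F (x, y))) a' b'.
Proof.
 intros H H1 H2 H3 Hy. apply (ex_RInt_continuous (V := RN)). intros z. rewrite Rmin_left, Rmax_right by lra. intros Hz.
 apply cont_hor_fst, H; lra.
Qed.
Lemma ex_ver F a b c d x c' d' : on_rect (ccont F) a b c d -> c <= c' -> c' <= d' -> d' <= d -> a <= x <= b -> ex_RInt (fun y => snd (F (x, y))) c' d'.
Proof.
 intros H H1 H2 H3 Hy. apply (ex_RInt_continuous (V := RN)). intros z. rewrite Rmin_left, Rmax_right by lra. intros Hz.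
 apply cont_ver_snd, H; lra.
Qed.

Lemma RI_alt F a b c d : on_rect (ccont F) a b c d -> a <= b -> c <= d ->
 RI F a b c d = RInt (fun x => fst (F (x, c))) a b-RInt (fun x => fst (F (x, d))) a b-(RInt (fun y => snd (F (b, y))) c d-RInt (fun y => snd (F (a, y))) c d).
Proof.
 intros H Hab Hcd. unfold RI. f_equal.
 - apply (RInt_minus (V := RN)); apply (ex_hor F a b c d); auto; lra.
 - f_equal. apply (RInt_minus (V := RN)); apply (ex_ver F a b c d); auto; lra.
Qed.

Lemma on_rect_sub P a b c d a' b' c' d' : on_rect P a b c d -> a <= a' -> b' <= b -> c <= c' -> d' <= d -> on_rect P a' b' c' d'.
Proof. intros H H1 H2 H3 H4 x y Hx Hy. apply H; lra. Qed.

Lemma RI_split_x F a m b c d : on_rect (ccont F) a b c d -> a <= m -> m <= b -> c <= d -> RI F a b c d = RI F a m c d+RI F m b c d.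
Proof.
 intros H H1 H2 H3. rewrite !RI_alt; try lra; try (eapply on_rect_sub; [exact H|lra..]).
 have E1: RInt (fun x => fst (F (x, c))) a b=RInt (fun x => fst (F (x, c))) a m+RInt (fun x => fst (F (x, c))) m b :> R.
 { symmetry. apply (RInt_Chasles (V := RN)); apply (ex_hor F a b c d); auto; lra. }
 have E2: RInt (fun x => fst (F (x, d))) a b=RInt (fun x => fst (F (x, d))) a m+RInt (fun x => fst (F (x, d))) m b :> R.
 { symmetry. apply (RInt_Chasles (V := RN)); apply (ex_hor F a b c d); auto; lra. }
 rewrite E1, E2. ring.
Qed.
Lemma RI_split_y F a b c m d : on_rect (ccont F) a b c d -> a <= b -> c <= m -> m <= d -> RI F a b c d = RI F a b c m+RI F a b m d.
Proof.
 intros H H1 H2 H3. rewrite !RI_alt; try lra; try (eapply on_rect_sub; [exact H|lra..]).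
 have E1: RInt (fun y => snd (F (a, y))) c d=RInt (fun y => snd (F (a, y))) c m+RInt (fun y => snd (F (a, y))) m d :> R.
 { symmetry. apply (RInt_Chasles (V := RN)); apply (ex_ver F a b c d); auto; lra. }
 have E2: RInt (fun y => snd (F (b, y))) c d=RInt (fun y => snd (F (b, y))) c m+RInt (fun y => snd (F (b, y))) m d :> R.
 { symmetry. apply (RInt_Chasles (V := RN)); apply (ex_ver F a b c d); auto; lra. }
 rewrite E1, E2. ring.
Qed.

Lemma RI_minus F G a b c d : on_rect (ccont F) a b c d -> on_rect (ccont G) a b c d -> a <= b -> c <= d ->
 RI (fun z => F z-G z)%C a b c d = RI F a b c d-RI G a b c d.
Proof.
 intros HF HG Hab Hcd.
 have HFG: on_rect (ccont (fun z => F z-G z)%C) a b c d.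
 { intros x y Hx Hy. apply ccont_plus; [now apply HF|]. apply (ccont_opp G). now apply HG. }
 rewrite !RI_alt; auto.
 have E1: forall y, c<=y<=d -> RInt (fun x => fst (F (x, y)-G (x, y))%C) a b=RInt (fun x => fst (F (x, y))) a b-RInt (fun x => fst (G (x, y))) a b :> R.
 { intros y Hy. rewrite <- (RInt_minus (V := RN)); [reflexivity|apply (ex_hor F a b c d); auto; lra|apply (ex_hor G a b c d); auto; lra]. }
 have E2: forall x, a<=x<=b -> RInt (fun y => snd (F (x, y)-G (x, y))%C) c d=RInt (fun y => snd (F (x, y))) c d-RInt (fun y => snd (G (x, y))) c d :> R.
 { intros y Hy. rewrite <- (RInt_minus (V := RN)); [reflexivity|apply (ex_ver F a b c d); auto; lra|apply (ex_ver G a b c d); auto; lra]. }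
 rewrite !E1, !E2 by lra. ring.
Qed.

Lemma RI_bound F a b c d M : on_rect (ccont F) a b c d -> a <= b -> c <= d ->
 (forall x, a <= x <= b -> Cmod (F (x, c)) <= M /\ Cmod (F (x, d)) <= M) -> (forall y, c <= y <= d -> Cmod (F (a, y)) <= M /\ Cmod (F (b, y)) <= M) ->
 Rabs (RI F a b c d) <= 2*M*((b-a)+(d-c)).
Proof.
 intros H Hab Hcd B1 B2. rewrite RI_alt by auto.
 have E1: forall y, c<=y<=d -> (forall x, a<=x<=b -> Cmod (F (x, y))<=M) -> Rabs (RInt (fun x => fst (F (x, y))) a b)<=(b-a)*M.
 { intros y Hy B. apply abs_RInt_le_const; [lra|apply (ex_hor F a b c d); auto; lra|]. intros t Ht. eapply Rle_trans; [apply abs_fst_Cmod|now apply B]. }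
 have E2: forall x, a<=x<=b -> (forall y, c<=y<=d -> Cmod (F (x, y))<=M) -> Rabs (RInt (fun y => snd (F (x, y))) c d)<=(d-c)*M.
 { intros y Hy B. apply abs_RInt_le_const; [lra|apply (ex_ver F a b c d); auto; lra|]. intros t Ht. eapply Rle_trans; [apply abs_snd_Cmod|now apply B]. }
 have P1 := E1 c ok (fun x Hx => proj1 (B1 x Hx)). have P2 := E1 d ok (fun x Hx => proj2 (B1 x Hx)).
 have P3 := E2 a ok (fun x Hx => proj1 (B2 x Hx)). have P4 := E2 b ok (fun x Hx => proj2 (B2 x Hx)).
 alra. Qed.

Lemma RI_affine (al be : C) a b c d : RI (fun z => al+be*z)%C a b c d = 0.
Proof.
 unfold RI.
 have E1: RInt (fun x => fst (al+be*(x, c))%C-fst (al+be*(x, d))%C) a b=(b-a)*(snd be*(d-c)) :> R.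
 { transitivity (RInt (fun _ => snd be*(d-c)) a b : R); [|rewrite (RInt_const (V := RN)); reflexivity].
  apply (RInt_ext (V := RN)). intros x _. destruct al, be. simpl. ring. }
 have E2: RInt (fun y => snd (al+be*(b, y))%C-snd (al+be*(a, y))%C) c d=(d-c)*(snd be*(b-a)) :> R.
 { transitivity (RInt (fun _ => snd be*(b-a)) c d : R); [|rewrite (RInt_const (V := RN)); reflexivity].
  apply (RInt_ext (V := RN)). intros x _. destruct al, be. simpl. ring. }
 rewrite E1, E2. ring.
Qed.

Lemma Goursat F a b c d : on_rect (chol F) a b c d -> a <= b -> c <= d -> RI F a b c d = 0.
Proof.
 intros H Hab Hcd. have Hc: on_rect (ccont F) a b c d by (intros x y Hx Hy; now apply chol_ccont, H).
 set (A := b-a). set (B := d-c). set (S := A+B). have HA: 0<=A by (unfold A; lra). have HB: 0<=B by (unfold B; lra).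
 destruct (Req_dec (RI F a b c d) 0) as [E|E]; [exact E|exfalso].
 apply Rabs_pos_lt in E. set (I := Rabs (RI F a b c d)) in *.
 set (h := fun n : nat => / 2^n). have Hh: forall n, 0<h n<=1.
 { intros n. unfold h. have: 1<=2^n by (apply pow_R1_Rle; lra). split; [pos|mono]. }
 have HhS: forall n, h n=2*h (Datatypes.S n) by (intros n; unfold h; simpl; field; apply pow_nonzero; lra).
 (* The rectangle with lower left corner p and sides scaled by 2^(-n) still carries at least the
    fraction 4^(-n) of the integral; one of its four quarters inherits this. *)
 set (bad := fun (n : nat) (p : R*R) => a<=fst p /\ fst p+A*h n<=b /\ c<=snd p /\ snd p+B*h n<=d /\
  I*h n^2<=Rabs (RI F (fst p) (fst p+A*h n) (snd p) (snd p+B*h n))).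
 have Step: forall n p, bad n p -> exists p', bad (Datatypes.S n) p' /\ fst p<=fst p'<=fst p+A*h (Datatypes.S n) /\ snd p<=snd p'<=snd p+B*h (Datatypes.S n).
 { intros n [x y] [P1 [P2 [P3 [P4 P5]]]]. simpl fst in *. simpl snd in *. specialize (Hh (Datatypes.S n)). specialize (HhS n). set (k := h (Datatypes.S n)) in *. rewrite HhS in *.
  have: 0<=A*k by pos. have: 0<=B*k by pos.
  replace (x+A*(2*k)) with (x+A*k+A*k) in * by ring. replace (y+B*(2*k)) with (y+B*k+B*k) in * by ring.
  rewrite (RI_split_x F x (x+A*k)) in P5; [|eapply on_rect_sub; [exact Hc|lra..]|lra..].
  rewrite (RI_split_y F x (x+A*k) y (y+B*k)) in P5; [|eapply on_rect_sub; [exact Hc|lra..]|lra..].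
  rewrite (RI_split_y F (x+A*k) (x+A*k+A*k) y (y+B*k)) in P5; [|eapply on_rect_sub; [exact Hc|lra..]|lra..].
  set (I1 := RI F x (x+A*k) y (y+B*k)) in *. set (I2 := RI F x (x+A*k) (y+B*k) (y+B*k+B*k)) in *.
  set (I3 := RI F (x+A*k) (x+A*k+A*k) y (y+B*k)) in *. set (I4 := RI F (x+A*k) (x+A*k+A*k) (y+B*k) (y+B*k+B*k)) in *.
  destruct (Rle_dec (I*k^2) (Rabs I1)) as [Q1|Q1]; [exists (x, y); unfold bad; simpl fst; simpl snd; fold k; repeat split; try lra; exact Q1|].
  destruct (Rle_dec (I*k^2) (Rabs I2)) as [Q2|Q2]; [exists (x, y+B*k); unfold bad; simpl fst; simpl snd; fold k; repeat split; try lra; exact Q2|].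
  destruct (Rle_dec (I*k^2) (Rabs I3)) as [Q3|Q3]; [exists (x+A*k, y); unfold bad; simpl fst; simpl snd; fold k; repeat split; try lra; exact Q3|].
  destruct (Rle_dec (I*k^2) (Rabs I4)) as [Q4|Q4]; [exists (x+A*k, y+B*k); unfold bad; simpl fst; simpl snd; fold k; repeat split; try lra; exact Q4|].
  exfalso. have := Rabs_triang (I1+I2) (I3+I4). have := Rabs_triang I1 I2. have := Rabs_triang I3 I4. replace (I*(2*k)^2) with (4*(I*k^2)) in P5 by ring. lra. }
 have B0: bad 0%nat (a, c).
 { unfold bad. simpl fst; simpl snd. have: h 0%nat=1 by (unfold h; simpl; field). rewrite H0. replace (a+A*1) with b by (unfold A; ring). replace (c+B*1) with d by (unfold B; ring).
  repeat split; try lra. unfold I. lra. }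
 set (nxt := fun (n : nat) (s : {p | bad n p}) => let (p', Hp) := constructive_indefinite_description _ (Step n (proj1_sig s) (proj2_sig s)) in exist (bad (Datatypes.S n)) p' (proj1 Hp)).
 set (sq := fix sq (n : nat) : {p | bad n p} := match n with 0%nat => exist _ (a, c) B0 | Datatypes.S m => nxt m (sq m) end).
 set (p := fun n => proj1_sig (sq n)).
 have Hp: forall n, bad n (p n) by (intros n; exact (proj2_sig (sq n))).
 have Hs: forall n, fst (p n)<=fst (p (Datatypes.S n))<=fst (p n)+A*h (Datatypes.S n) /\ snd (p n)<=snd (p (Datatypes.S n))<=snd (p n)+B*h (Datatypes.S n).
 { intros n. unfold p. simpl sq. unfold nxt. destruct (constructive_indefinite_description _ _) as [p' Hp']. exact (proj2 Hp'). }
 have Lim1: forall (u : nat -> R) (K M0 : R), 0<=K -> (forall n, u n<=u (Datatypes.S n)<=u n+K*h (Datatypes.S n)) -> (forall n, u n<=M0) ->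
  exists l, forall n, u n<=l<=u n+K*h n.
 { intros u K M0 HK Hu HM. destruct (ex_finite_lim_seq_incr u M0 (fun n => proj1 (Hu n)) HM) as [l Hl]. exists l. intros n.
  split; [apply (is_lim_seq_incr_compare u l Hl (fun n => proj1 (Hu n)))|].
  have Q: forall m, u (m+n)%nat<=u n+K*h n-K*h (m+n)%nat.
  { induction m as [|m IH]; [simpl; lra|]. destruct (Hu (m+n)%nat) as [_ U]. have E2 := HhS (m+n)%nat. change (Datatypes.S m+n)%nat with (Datatypes.S (m+n)). rewrite E2 in IH. lra. }
  have Q': forall m, u (m+n)%nat<=u n+K*h n.
  { intros m. specialize (Q m). specialize (Hh (m+n)%nat). have: 0<=K*h (m+n)%nat by pos. lra. }
  apply (is_lim_seq_incr_n _ n) in Hl. apply (is_lim_seq_le _ (fun _ => u n+K*h n) l (u n+K*h n) Q' Hl).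
  apply is_lim_seq_const. }
 destruct (Lim1 (fun n => fst (p n)) A b HA (fun n => proj1 (Hs n))) as [px Hpx].
 { intros n. destruct (Hp n) as [_ [Q _]]. specialize (Hh n). have := Rmult_le_pos A (h n) HA ok. lra. }
 destruct (Lim1 (fun n => snd (p n)) B d HB (fun n => proj2 (Hs n))) as [py Hpy].
 { intros n. destruct (Hp n) as [_ [_ [_ [Q _]]]]. specialize (Hh n). have := Rmult_le_pos B (h n) HB ok. lra. }
 have Pin: a<=px<=b /\ c<=py<=d.
 { destruct (Hp 0%nat) as [Q1 [Q2 [Q3 [Q4 _]]]]. specialize (Hpx 0%nat). specialize (Hpy 0%nat). lra. }
 destruct (chol_eps F (px, py) (H px py (proj1 Pin) (proj2 Pin))) as [l Hl].
 set (eps := I/(4*(S+1)^2)). have HS: 0<=S by (unfold S; lra). have HS2: 1<=(S+1)^2 by nra.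
 have He: 0<eps by (apply Rdiv_lt_0_compat; lra).
 destruct (Hl eps He) as [dl [Hdl Hloc]].
 have Hn: exists n, (S+1)*h n<dl.
 { destruct (pow_lt_1_zero (1/2)) with (y := dl/(S+1)) as [n Hn]; [rewrite Rabs_right; lra|pos|]. exists n. specialize (Hn n (le_n n)).
  unfold h. replace (/ 2^n) with ((1/2)^n) by (unfold Rdiv; rewrite Rmult_1_l; apply pow_inv). rewrite Rabs_right in Hn by pos.
  apply Rlt_le_trans with ((S+1)*(dl/(S+1))); [apply Rmult_lt_compat_l; lra|right; field; lra]. }
 destruct Hn as [n Hn]. destruct (Hp n) as [P1 [P2 [P3 [P4 P5]]]]. specialize (Hpx n). specialize (Hpy n). specialize (Hh n).
 set (x := fst (p n)) in *. set (y := snd (p n)) in *. set (k := h n) in *. change (fst (p n)) with x in Hpx. change (snd (p n)) with y in Hpy.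
 set (G := fun z => ((F (px, py)-l*(px, py))+l*z)%C).
 have Gc: on_rect (ccont G) x (x+A*k) y (y+B*k) by (intros s t _ _; apply ccont_plus; [apply ccont_const|apply ccont_mult; [apply ccont_const|apply ccont_id]]).
 have Fc: on_rect (ccont F) x (x+A*k) y (y+B*k) by (eapply on_rect_sub; [exact Hc|lra..]).
 have RM := RI_minus F G x (x+A*k) y (y+B*k) Fc Gc ok ok. unfold G in RM at 2. rewrite RI_affine, Rminus_0_r in RM.
 have Pt: forall s t, x<=s<=x+A*k -> y<=t<=y+B*k -> Cmod (F (s, t)-G (s, t))<=eps*(S*k).
 { intros s t Hs' Ht. have Q: Cmod ((s, t)-(px, py))<=S*k.
  { le_trans Cmod_le_sum. simpl. replace (s + - px) with (s-px) by ring. replace (t + - py) with (t-py) by ring.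
   have: Rabs (s-px)<=A*k by (apply Rabs_le; lra). have: Rabs (t-py)<=B*k by (apply Rabs_le; lra). unfold S. lra. }
  replace (F (s, t)-G (s, t))%C with (F (s, t)-F (px, py)-l*((s, t)-(px, py)))%C by (unfold G; ring).
  eapply Rle_trans; [apply Hloc|mono]. apply Rle_lt_trans with (S*k); [exact Q|]. lra. }
 have Bd: Rabs (RI (fun z => F z-G z)%C x (x+A*k) y (y+B*k))<=2*(eps*(S*k))*((x+A*k-x)+(y+B*k-y)).
 { apply RI_bound; [|lra|lra| |].
  - intros s t Hs' Ht. apply ccont_plus; [now apply Fc|]. apply (ccont_opp G). now apply Gc.
  - intros s Hs'. split; apply Pt; lra.
  - intros s Hs'. split; apply Pt; lra. }
 rewrite RM in Bd. replace ((x+A*k-x)+(y+B*k-y)) with (S*k) in Bd by (unfold S; ring).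
 replace (2*(eps*(S*k))*(S*k)) with (2*eps*S^2*k^2) in Bd by ring.
 have: 0<k^2 by pos. have Hi: I*k^2<=2*eps*S^2*k^2 by lra. apply Rmult_le_reg_r in Hi; [|assumption].
 have: eps*(4*(S+1)^2)=I by (unfold eps; field; lra). nra.
Qed.

Definition cslope (G : C -> C) (w l z : C) : C := if excluded_middle_informative (z = w) then l else ((G z-G w)/(z-w))%C.

Lemma cslope_eq G w l z : z <> w -> cslope G w l z = ((G z-G w)/(z-w))%C.
Proof. intros N. unfold cslope. now destruct (excluded_middle_informative (z=w)). Qed.

Lemma cslope_chol G w l p : p <> w -> chol G p -> chol (cslope G w l) p.
Proof.
 intros N H. have C: chol (fun z => (G z-G w)/(z-w))%C p.
 { unfold Cdiv. apply chol_mult; [apply chol_minus; [exact H|apply chol_const]|]. apply (chol_inv (fun z => z-w)%C); [apply chol_minus; [apply chol_id|apply chol_const]|now apply Cminus_neq0]. }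
 destruct C as [g [Hg [d [Hd E]]]]. exists g. split; [exact Hg|]. have N0 := Cminus_neq0 _ _ N. apply Cmod_gt_0 in N0.
 exists (Rmin d (Cmod (p-w))). split; [pos|]. intros z Hz. minmax. rewrite !cslope_eq; [apply E; lra|exact N|]. intros Q. rewrite Q in Hz. replace (w-p)%C with (- (p-w))%C in Hz by ring. rewrite Cmod_opp in Hz. lra.
Qed.

Lemma cslope_ccont G w : chol G w -> exists l, ccont (cslope G w l) w.
Proof.
 intros H. destruct (chol_eps G w H) as [l Hl]. exists l. intros eps He. destruct (Hl eps He) as [d [Hd E]]. exists d. split; [exact Hd|]. intros z Hz.
 have Ew: cslope G w l w=l by (unfold cslope; now destruct (excluded_middle_informative (w=w))). rewrite Ew.
 destruct (excluded_middle_informative (z=w)) as [->|N]; [rewrite Ew; replace (l-l)%C with (RtoC 0) by ring; rewrite Cmod_0; lra|].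
 rewrite cslope_eq by exact N. have N0 := Cminus_neq0 _ _ N.
 replace ((G z-G w)/(z-w)-l)%C with ((G z-G w-l*(z-w)) * / (z-w))%C by (field; exact N0). rewrite Cmod_mult, Cmod_inv by exact N0.
 specialize (E z Hz). apply Cmod_gt_0 in N0. apply Rmult_le_reg_r with (Cmod (z-w)); [exact N0|]. rewrite Rmult_assoc, Rinv_l by lra. lra.
Qed.

(** Goursat's theorem removes everything but a square of side 2e around the puncture, whose
    contribution is O(e) because F is bounded near it. *)
Lemma Goursat_punctured F a b c d x0 y0 : on_rect (ccont F) a b c d -> a < x0 < b -> c < y0 < d ->
 (forall x y, a <= x <= b -> c <= y <= d -> (x, y) <> (x0, y0) -> chol F (x, y)) -> RI F a b c d = 0.
Proof.
 intros Hc Hx0 Hy0 H.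
 destruct (Hc x0 y0 ok ok 1 ok) as [dl [Hdl Hb]]. set (M := Cmod (F (x0, y0))+1).
 set (r := Rmin (Rmin (x0-a) (b-x0)) (Rmin (y0-c) (d-y0))).
 have Hr: 0<r /\ r<=x0-a /\ r<=b-x0 /\ r<=y0-c /\ r<=d-y0.
 { unfold r. split; [pos|]. minmax. lra. }
 have S: forall e, 0<e -> e<r -> RI F a b c d=RI F (x0-e) (x0+e) (y0-e) (y0+e).
 { intros e He Her.
  rewrite (RI_split_x F a (x0-e) b c d Hc) by lra. rewrite (Goursat F a (x0-e) c d); [|intros x y Hx Hy; apply H; try lra; intros Q; injection Q; lra|lra|lra].
  rewrite (RI_split_x F (x0-e) (x0+e) b c d); [|eapply on_rect_sub; [exact Hc|lra..]|lra..]. rewrite (Goursat F (x0+e) b c d); [|intros x y Hx Hy; apply H; try lra; intros Q; injection Q; lra|lra|lra].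
  rewrite (RI_split_y F (x0-e) (x0+e) c (y0-e) d); [|eapply on_rect_sub; [exact Hc|lra..]|lra..]. rewrite (Goursat F (x0-e) (x0+e) c (y0-e)); [|intros x y Hx Hy; apply H; try lra; intros Q; injection Q; lra|lra|lra].
  rewrite (RI_split_y F (x0-e) (x0+e) (y0-e) (y0+e) d); [|eapply on_rect_sub; [exact Hc|lra..]|lra..]. rewrite (Goursat F (x0-e) (x0+e) (y0+e) d); [|intros x y Hx Hy; apply H; try lra; intros Q; injection Q; lra|lra|lra].
  ring. }
 have HM: 1<=M by (unfold M; have := Cmod_ge_0 (F (x0, y0)); lra).
 have B: forall e, 0<e -> e<r -> 2*e<dl -> Rabs (RI F a b c d)<=8*M*e.
 { intros e He Her Hed. rewrite (S e He Her). replace (8*M*e) with (2*M*((x0+e-(x0-e))+(y0+e-(y0-e)))) by ring.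
  have P: forall x y, x0-e<=x<=x0+e -> y0-e<=y<=y0+e -> Cmod (F (x, y))<=M.
  { intros x y Hx Hy. have Q: Cmod ((x, y)-(x0, y0))<dl.
   { eapply Rle_lt_trans; [apply Cmod_le_sum|]. simpl. have: Rabs (x + - x0)<=e by (apply Rabs_le; lra). have: Rabs (y + - y0)<=e by (apply Rabs_le; lra). lra. }
   specialize (Hb (x, y) Q). have T := Cmod_triangle (F (x, y)-F (x0, y0)) (F (x0, y0)). replace (F (x, y)-F (x0, y0)+F (x0, y0))%C with (F (x, y)) in T by ring. unfold M. lra. }
  apply RI_bound; [eapply on_rect_sub; [exact Hc|lra..]|lra|lra| |]; intros; split; apply P; lra. }
 destruct (Req_dec (RI F a b c d) 0) as [E|E]; [exact E|exfalso]. apply Rabs_pos_lt in E. set (I := Rabs (RI F a b c d)) in *.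
 set (e := Rmin (r/2) (Rmin (dl/4) (I/(16*M)))).
 have He: 0<e by (unfold e; repeat apply Rmin_glb_lt; try lra; apply Rdiv_lt_0_compat; lra).
 have M1 := Rmin_l (r/2) (Rmin (dl/4) (I/(16*M))). have M2 := Rmin_r (r/2) (Rmin (dl/4) (I/(16*M))). fold e in M1, M2.
 minmax. specialize (B e He ok ok). have: 8*M*e<=8*M*(I/(16*M)) by mono.
 replace (8*M*(I/(16*M))) with (I/2) in H2 by fld. lra.
Qed.

Lemma RInt_le_const (f : R -> R) a b m : a <= b -> ex_RInt f a b -> (forall x, a <= x <= b -> f x <= m) -> RInt f a b <= (b-a)*m.
Proof.
 intros Hab Hf Hm. replace ((b-a)*m) with (RInt (fun _ => m) a b).
 - apply RInt_le; [exact Hab|exact Hf|apply ex_RInt_const|intros x Hx; apply Hm; lra].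
 - rewrite (RInt_const (V := RN)). reflexivity.
Qed.

(* Testing the Cauchy kernel against -i conj(G w0) makes its contribution to RI a
  definite multiple of |G w0|^2. *)
Lemma Cauchy_estimate G a b c d x0 y0 rho M : on_rect (chol G) a b c d -> 0 < rho -> a+rho <= x0 <= b-rho -> c+rho <= y0 <= d-rho ->
 (forall x, a <= x <= b -> Cmod (G (x, c)) <= M /\ Cmod (G (x, d)) <= M) -> (forall y, c <= y <= d -> Cmod (G (a, y)) <= M /\ Cmod (G (b, y)) <= M) ->
 Cmod (G (x0, y0)) <= M*(((b-a)^2+(d-c)^2)/rho^2).
Proof.
 intros H Hr Hx Hy B1 B2. set (w := (x0, y0)). set (g0 := G w). set (D2 := (b-a)^2+(d-c)^2).
 have HM: 0<=M by (destruct (B1 a ok) as [Q _]; have := Cmod_ge_0 (G (a, c)); lra).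
 have HD: 0<D2 by (unfold D2; have: 0<(b-a)^2 by pos; have := pow2_ge_0 (d-c); lra).
 destruct (cslope_ccont G w (H x0 y0 ok ok)) as [l Hl].
 set (ka := (- Ci*Cconj g0)%C). set (F := fun z => (ka*cslope G w l z)%C).
 have Fh: forall x y, a<=x<=b -> c<=y<=d -> (x, y) <> (x0, y0) -> chol F (x, y).
 { intros x y Hx' Hy' N. apply chol_scal. apply cslope_chol; [exact N|now apply H]. }
 have Fc: on_rect (ccont F) a b c d.
 { intros x y Hx' Hy'. destruct (excluded_middle_informative ((x, y)=(x0, y0))) as [->|N].
  - apply ccont_mult; [apply ccont_const|exact Hl]. - now apply chol_ccont, Fh. }
 have I0 := Goursat_punctured F a b c d x0 y0 Fc ok ok Fh.
 set (m := Cmod g0). have Hm: 0<=m by apply Cmod_ge_0.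
 have Fe: forall p q, (p, q) <> (0, 0) -> a<=x0+p<=b -> c<=y0+q<=d -> Cmod (G (x0+p, y0+q))<=M -> rho^2<=p^2+q^2 ->
  Rabs (fst (F (x0+p, y0+q))-m^2*q/(p^2+q^2))<=m*M/rho /\ Rabs (snd (F (x0+p, y0+q))-m^2*p/(p^2+q^2))<=m*M/rho.
 { intros p q N Hp Hq HG Hpq. set (z := (x0+p, y0+q)). have Ez: (z-w)%C=(p, q) by (unfold z, w, Cminus, Cplus, Copp; simpl; f_equal; ring).
  have Nz: z <> w. { intros Q. apply N. rewrite <- Ez, Q. unfold Cminus, Cplus, Copp. destruct w. simpl. f_equal; ring. }
  have N0: (p, q) <> RtoC 0 by exact N.
  have P0: 0<p^2+q^2 by (have: 0<rho^2 by pos; lra).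
  set (kk := (m^2*q/(p^2+q^2), m^2*p/(p^2+q^2)) : C).
  have EF: F z=(ka*G z * / (p, q)+kk)%C.
  { unfold F. rewrite cslope_eq by exact Nz. rewrite Ez. fold g0.
   have Ek: (- (ka*g0) * / (p, q))%C=kk.
   { have E2: (ka*g0)%C=(0, - m^2).
    { unfold ka. replace (- Ci*Cconj g0*g0)%C with (- Ci*(g0*Cconj g0))%C by ring. rewrite <- Cmod2_conj. fold m. unfold Ci, Cmult, Copp, Cpow, RtoC. simpl. f_equal; ring. }
    rewrite E2. unfold kk, Cinv, Cmult, Copp. simpl. f_equal; field; simpl in P0; lra. }
   rewrite <- Ek. field. exact N0. }
  have Bd: Cmod (ka*G z * / (p, q))<=m*M/rho.
  { rewrite !Cmod_mult, Cmod_inv by exact N0. unfold ka. rewrite Cmod_mult, Cmod_opp, Cmod_Ci, Cmod_conj. fold m. rewrite Rmult_1_l.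
   have R1: rho<=Cmod (p, q). { unfold Cmod. simpl fst. simpl snd. rewrite <- (sqrt_pow2 rho) by lra. apply sqrt_le_1_alt. exact Hpq. }
   unfold Rdiv. apply Rmult_le_compat; [pos|pos| |mono].
   apply Rmult_le_compat_l; [lra|exact HG]. }
  fold z. rewrite EF. split.
  - eapply Rle_trans; [|exact Bd]. eapply Rle_trans; [|apply abs_fst_Cmod]. right. f_equal. set (T := (ka*G z * / (p, q))%C). destruct T. simpl. ring.
  - eapply Rle_trans; [|exact Bd]. eapply Rle_trans; [|apply abs_snd_Cmod]. right. f_equal. set (T := (ka*G z * / (p, q))%C). destruct T. simpl. ring. }
 (* On each side the kernel has a definite sign and contributes at least m^2 rho/D2, where D2 is the
    squared diagonal of the rectangle. *)
 have Gb: forall t s, rho<=t -> t^2+s^2<=D2 -> m^2*rho/D2<=m^2*t/(t^2+s^2).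
 { intros t s Ht Hts. unfold Rdiv. have := pow2_ge_0 m. have := pow2_ge_0 s. have: 0<t^2 by pos. apply Rmult_le_compat; [nra|pos|mono|mono]. }
 set (V := 2*(m*M/rho-m^2*rho/D2)).
 have Sq: forall t, (- t)^2=t^2 by (intros; ring).
 have X1: RInt (fun x => fst (F (x, c))-fst (F (x, d))) a b<=(b-a)*V.
 { apply RInt_le_const; [lra| |].
  - apply (ex_RInt_minus (V := RN)); apply (ex_hor F a b c d); auto; lra.
  - intros x Hx'. destruct (B1 x Hx') as [Bc Bd].
   destruct (Fe (x-x0) (c-y0)) as [F1 _]; try lra; [intros Q; injection Q; lra| | |].
   { replace (x0+(x-x0)) with x by ring. replace (y0+(c-y0)) with c by ring. exact Bc. }
   { have := pow2_ge_0 (x-x0). nra. }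
   destruct (Fe (x-x0) (d-y0)) as [F2 _]; try lra; [intros Q; injection Q; lra| | |].
   { replace (x0+(x-x0)) with x by ring. replace (y0+(d-y0)) with d by ring. exact Bd. }
   { have := pow2_ge_0 (x-x0). nra. }
   replace (x0+(x-x0)) with x in * by ring. replace (y0+(c-y0)) with c in * by ring. replace (y0+(d-y0)) with d in * by ring.
   have G1 := Gb (y0-c) (x-x0) ok ltac:(unfold D2; nra). have G2 := Gb (d-y0) (x-x0) ok ltac:(unfold D2; nra).
   replace (m^2*(c-y0)/((x-x0)^2+(c-y0)^2)) with (- (m^2*(y0-c)/((y0-c)^2+(x-x0)^2))) in F1.
   2:{ replace ((y0-c)^2+(x-x0)^2) with ((x-x0)^2+(c-y0)^2) by ring. unfold Rdiv. ring. }
   rewrite (Rplus_comm ((d-y0)^2)) in G2. abs_in F1. abs_in F2. unfold V. lra. }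
 have X2: RInt (fun y => snd (F (a, y))-snd (F (b, y))) c d<=(d-c)*V.
 { apply RInt_le_const; [lra| |].
  - apply (ex_RInt_minus (V := RN)); apply (ex_ver F a b c d); auto; lra.
  - intros y Hy'. destruct (B2 y Hy') as [Ba Bb].
   destruct (Fe (a-x0) (y-y0)) as [_ F1]; try lra; [intros Q; injection Q; lra| | |].
   { replace (x0+(a-x0)) with a by ring. replace (y0+(y-y0)) with y by ring. exact Ba. }
   { have := pow2_ge_0 (y-y0). nra. }
   destruct (Fe (b-x0) (y-y0)) as [_ F2]; try lra; [intros Q; injection Q; lra| | |].
   { replace (x0+(b-x0)) with b by ring. replace (y0+(y-y0)) with y by ring. exact Bb. }
   { have := pow2_ge_0 (y-y0). nra. }
   replace (x0+(a-x0)) with a in * by ring. replace (x0+(b-x0)) with b in * by ring. replace (y0+(y-y0)) with y in * by ring.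
   have G1 := Gb (x0-a) (y-y0) ok ltac:(unfold D2; nra). have G2 := Gb (b-x0) (y-y0) ok ltac:(unfold D2; nra).
   replace (m^2*(a-x0)/((a-x0)^2+(y-y0)^2)) with (- (m^2*(x0-a)/((x0-a)^2+(y-y0)^2))) in F1.
   2:{ replace ((x0-a)^2) with ((a-x0)^2) by ring. unfold Rdiv. ring. }
   abs_in F1. abs_in F2. unfold V. lra. }
 have X3: RInt (fun y => snd (F (b, y))-snd (F (a, y))) c d = - RInt (fun y => snd (F (a, y))-snd (F (b, y))) c d :> R.
 { rewrite <- (RInt_opp (V := RN)); [|apply (ex_RInt_minus (V := RN)); apply (ex_ver F a b c d); auto; lra].
  apply (RInt_ext (V := RN)). intros y _. unfold opp. simpl. ring. }
 unfold RI in I0. rewrite X3 in I0.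
 (* The vanishing integral is at most the half-perimeter times V. So V cannot be negative, and V >=
    0 is the claim after division by m. *)
 have HV: 0<=V. { apply Rnot_lt_le. intros HV. have: (b-a+(d-c))*V<0 by (apply Rmult_pos_neg; lra). lra. }
 fold g0 m. unfold V in HV. destruct (Req_dec m 0) as [->|Hm0].
 { apply Rmult_le_pos; [lra|]. apply Rlt_le, Rdiv_lt_0_compat; [exact HD|pos]. }
 apply Rmult_le_reg_l with (m*(rho/D2)); [pos|].
 replace (m*(rho/D2)*(M*(D2/rho^2))) with (m*M/rho) by fld.
 replace (m*(rho/D2)*m) with (m^2*rho/D2) by fld. lra.
Qed.

(** * Euler-Maclaurin approximations of zeta and their convergence *)

(** The step 1 is replaced by a variable h. The error g and its derivative g1 vanish at h = 0 and
    g'' = g2 is bounded by K, so [derive_bound] is applied twice. *)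
Lemma Euler_Maclaurin (Phi f f1 f2 f3 : R -> R) (a K : R) :
 (forall x, a <= x <= a+1 -> is_derive Phi x (f x) /\ is_derive f x (f1 x) /\ is_derive f1 x (f2 x) /\ is_derive f2 x (f3 x) /\ Rabs (f3 x) <= K) ->
 Rabs ((f a+f (a+1))/2-(Phi (a+1)-Phi a)-(f1 (a+1)-f1 a)/12) <= K.
Proof.
 intros H. have HK: 0<=K by (destruct (H a ok) as [_ [_ [_ [_ Q]]]]; have := Rabs_pos (f3 a); lra).
 have Sh: forall (g : R -> R) h l, is_derive g (a+h) l -> is_derive (fun h => g (a+h)) h l.
 { intros g h l D. eapply isd_eq; [apply (isd_comp g (fun h => a+h)); [exact D|isd_]|ring]. }
 set (k := fun h => h*f2 (a+h)-(f1 (a+h)-f1 a)).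
 have Bk: forall h, 0<=h<=1 -> Rabs (k h)<=K.
 { intros h Hh. have B := derive_bound k (fun h => h*f3 (a+h)) 0 h K ok.
  have: k 0=0 by (unfold k; rewrite Rplus_0_r; ring). rewrite H0, Rminus_0_r, Rminus_0_r in B.
  eapply Rle_trans; [apply B| ].
  - intros t Ht. destruct (H (a+t) ok) as [_ [_ [D1 [D2 _]]]]. unfold k. eapply isd_eq.
   + apply isd_minus; [apply isd_mult; [isd_|apply Sh, D2]|apply isd_minus; [apply Sh, D1|isd_]]. + cbv beta. ring.
  - intros t Ht. destruct (H (a+t) ok) as [_ [_ [_ [_ D3]]]]. rewrite Rabs_mult, (Rabs_right t) by lra. have := Rabs_pos (f3 (a+t)).
   trans (1*K); [mono|lra].
  - nra. }
 set (g2 := fun h => / 6*k h-h^2/12*f3 (a+h)).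
 have B2: forall h, 0<=h<=1 -> Rabs (g2 h)<=K.
 { intros h Hh. specialize (Bk h Hh). destruct (H (a+h) ok) as [_ [_ [_ [_ D3]]]]. unfold g2.
  have: Rabs (h^2/12*f3 (a+h)) <= / 12*K.
  { rewrite Rabs_mult, Rabs_right by (have := pow2_ge_0 h; lra). apply Rmult_le_compat; [have := pow2_ge_0 h; lra|pos|nra|exact D3]. }
  alra. }
 set (g1 := fun h => / 2*(f a-f (a+h))+h * / 2*f1 (a+h)-h * / 6*(f1 (a+h)-f1 a)-h^2 * / 12*f2 (a+h)).
 have D1: forall h, 0<=h<=1 -> is_derive g1 h (g2 h).
 { intros h Hh. destruct (H (a+h) ok) as [_ [Df [Df1 [Df2 _]]]]. unfold g1. eapply isd_eq.
  - apply isd_minus; [apply isd_minus; [apply isd_plus; [apply isd_mult; [isd_|apply isd_minus; [isd_|apply Sh, Df]]|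
    apply isd_mult; [isd_|apply Sh, Df1]]|
    apply isd_mult; [isd_|apply isd_minus; [apply Sh, Df1|isd_]]]|
    apply isd_mult; [isd_|apply Sh, Df2]].
  - unfold g2, k. simpl. field. }
 have B1: forall h, 0<=h<=1 -> Rabs (g1 h)<=K.
 { intros h Hh. have B := derive_bound g1 g2 0 h K ok (fun t Ht => D1 t ok) (fun t Ht => B2 t ok).
  have: g1 0=0 by (unfold g1; rewrite Rplus_0_r; ring). rewrite H0, Rminus_0_r, Rminus_0_r in B. nra. }
 set (g := fun h => h * / 2*(f a+f (a+h))-(Phi (a+h)-Phi a)-h^2 * / 12*(f1 (a+h)-f1 a)).
 have D0: forall h, 0<=h<=1 -> is_derive g h (g1 h).
 { intros h Hh. destruct (H (a+h) ok) as [Dp [Df [Df1 [Df2 _]]]]. unfold g. eapply isd_eq.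
  - apply isd_minus; [apply isd_minus; [apply isd_mult; [isd_|apply isd_plus; [isd_|apply Sh, Df]]|apply isd_minus; [apply Sh, Dp|isd_]]|
    apply isd_mult; [isd_|apply isd_minus; [apply Sh, Df1|isd_]]].
  - unfold g1. simpl. field. }
 have B := derive_bound g g1 0 1 K ok D0 B1. have G0: g 0=0 by (unfold g; rewrite Rplus_0_r; ring).
 rewrite G0, Rminus_0_r, Rminus_0_r, Rmult_1_r in B. unfold g in B.
 replace ((f a+f (a+1))/2-(Phi (a+1)-Phi a)-(f1 (a+1)-f1 a)/12) with (1 * / 2*(f a+f (a+1))-(Phi (a+1)-Phi a)-1^2 * / 12*(f1 (a+1)-f1 a)) by field. exact B.
Qed.

(* x^(-s) *)
Definition cpw (s : C) (x : R) : C := Cexp (- (s*RtoC (ln x))).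

Lemma Cmod_cpw s x : Cmod (cpw s x) = exp (- (fst s*ln x)).
Proof. unfold cpw. rewrite Cmod_Cexp. f_equal. destruct s. simpl. ring. Qed.

Lemma cpw_shift s x : 0 < x -> cpw (s+1) x = (cpw s x*RtoC (/ x))%C.
Proof.
 intros Hx. unfold cpw. replace (- ((s+1)*RtoC (ln x)))%C with (- (s*RtoC (ln x))+RtoC (- ln x))%C by (rewrite RtoC_opp; ring).
 rewrite Cexp_plus. f_equal. unfold Cexp, RtoC. simpl. rewrite cos_0, sin_0, exp_Ropp, exp_ln by exact Hx. f_equal; ring.
Qed.

Lemma cpw_derive (c s : C) x : 0 < x -> is_derive (fun x => fst (c*cpw s x)%C) x (fst (- s*c*cpw (s+1) x)%C) /\ is_derive (fun x => snd (c*cpw s x)%C) x (snd (- s*c*cpw (s+1) x)%C).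
Proof.
 intros Hx. rewrite (cpw_shift s x Hx). destruct c as [c1 c2]. destruct s as [s1 s2].
 have Dl: forall k : R, is_derive (fun x => - (k*ln x)) x (- (k * / x)).
 { intros k. eapply isd_eq; [apply isd_opp, isd_mult; [isd_|apply (isd_ln (fun x => x)); [isd_|exact Hx]]|]. cbv beta. field. lra. }
 have Ec: forall x, cpw (s1, s2) x=(exp (- (s1*ln x))*cos (- (s2*ln x)), exp (- (s1*ln x))*sin (- (s2*ln x))).
 { intros y. unfold cpw, Cexp, RtoC, Cmult, Copp. cbn [fst snd].
  replace (- (s1*ln y-s2*0)) with (- (s1*ln y)) by ring. replace (- (s1*0+s2*ln y)) with (- (s2*ln y)) by ring. reflexivity. }
 have Dr: is_derive (fun x => fst (cpw (s1, s2) x)) x (fst (- (s1, s2)*cpw (s1, s2) x*RtoC (/ x))%C).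
 { apply (is_derive_ext (fun x => exp (- (s1*ln x))*cos (- (s2*ln x)))); [intros t; now rewrite Ec|]. rewrite Ec.
  eapply isd_eq; [apply isd_mult; [apply isd_exp, Dl|apply isd_cos, Dl]|]. simpl. field. lra. }
 have Di: is_derive (fun x => snd (cpw (s1, s2) x)) x (snd (- (s1, s2)*cpw (s1, s2) x*RtoC (/ x))%C).
 { apply (is_derive_ext (fun x => exp (- (s1*ln x))*sin (- (s2*ln x)))); [intros t; now rewrite Ec|]. rewrite Ec.
  eapply isd_eq; [apply isd_mult; [apply isd_exp, Dl|apply isd_sin, Dl]|]. simpl. field. lra. }
 split.
 - apply (is_derive_ext (fun x => c1*fst (cpw (s1, s2) x)-c2*snd (cpw (s1, s2) x))); [intros; reflexivity|].
  eapply isd_eq; [apply isd_minus; (apply isd_mult; [isd_|]); [exact Dr|exact Di]|]. set (w := cpw (s1, s2) x). destruct w. simpl. ring.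
 - apply (is_derive_ext (fun x => c1*snd (cpw (s1, s2) x)+c2*fst (cpw (s1, s2) x))); [intros; reflexivity|].
  eapply isd_eq; [apply isd_plus; (apply isd_mult; [isd_|]); [exact Di|exact Dr]|]. set (w := cpw (s1, s2) x). destruct w. simpl. ring.
Qed.

(* The Euler-Maclaurin approximation of the tail sum of k^(-s) over k >= x. *)
Definition PE (x : R) (s : C) : C := (cpw (s-1) x * / (s-1)+RtoC (/ 2)*cpw s x+RtoC (/ 12)*s*cpw (s+1) x)%C.

Fixpoint csum (m : nat) (s : C) : C := match m with O => RtoC 0 | S m => (csum m s+cpw s (INR (S m)))%C end.
Definition zM (m : nat) (s : C) : C := (csum m s+PE (INR (S m)) s)%C.

(** The increment is the Euler-Maclaurin error on [m+1, m+2]: T is x^(1-s)/(1-s) and T0, ..., T3 are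
    its successive derivatives in x. The factor 2 comes from treating real and imaginary parts
    separately. *)
Lemma zM_step m s K : s <> RtoC 1 -> (forall x, INR (S m) <= x -> Cmod (s*(s+1)*(s+2))*exp (- ((fst s+3)*ln x)) <= K) ->
 Cmod (zM (S m) s-zM m s) <= 2*K.
Proof.
 intros Hs HK. set (n := INR (S m)) in *. have Hn: 1<=n by apply N_ge_1.
 have Hs1: (s-1)%C <> RtoC 0 by (now apply Cminus_neq0).
 set (T := fun x => (- / (s-1)*cpw (s-1) x)%C). set (T0 := fun x => (1*cpw s x)%C). set (T1 := fun x => (- s*cpw (s+1) x)%C).
 set (T2 := fun x => (s*(s+1)*cpw (s+1+1) x)%C). set (T3 := fun x => (- (s*(s+1)*(s+2))*cpw (s+1+1+1) x)%C).
 have E: (zM (S m) s-zM m s)%C=((T0 n+T0 (n+1)%R)*RtoC (/ 2)-(T (n+1)%R-T n)-(T1 (n+1)%R-T1 n)*RtoC (/ 12))%C.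
 { unfold zM. change (csum (S m) s) with (csum m s+cpw s (INR (S m)))%C. fold n. have En: INR (S (S m))=n+1 by (unfold n; apply S_INR). rewrite En. unfold PE, T, T0, T1.
  have Hh: cpw s n=((RtoC (/ 2)+RtoC (/ 2))*cpw s n)%C by (rewrite <- RtoC_plus; replace (/ 2 + / 2) with 1 by field; ring).
  set (h := RtoC (/ 2)) in *. set (k := RtoC (/ 12)). clearbody h k. rewrite Hh at 1. ring. }
 rewrite E. 
 have D: forall x, n<=x<=n+1 -> (is_derive (fun x => fst (T x)) x (fst (T0 x)) /\ is_derive (fun x => fst (T0 x)) x (fst (T1 x)) /\ is_derive (fun x => fst (T1 x)) x (fst (T2 x)) /\ is_derive (fun x => fst (T2 x)) x (fst (T3 x)) /\ Rabs (fst (T3 x))<=K) /\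
  (is_derive (fun x => snd (T x)) x (snd (T0 x)) /\ is_derive (fun x => snd (T0 x)) x (snd (T1 x)) /\ is_derive (fun x => snd (T1 x)) x (snd (T2 x)) /\ is_derive (fun x => snd (T2 x)) x (snd (T3 x)) /\ Rabs (snd (T3 x))<=K).
 { intros x Hx. have Hx0: 0<x by lra.
  have M3: Cmod (T3 x)<=K.
  { unfold T3. rewrite Cmod_mult, Cmod_opp, Cmod_cpw. replace (fst (s+1+1+1)%C) with (fst s+3) by (destruct s; simpl; ring). apply HK. lra. }
  have Q0: (- (s-1) * - / (s-1)*cpw (s-1+1) x)%C=T0 x by (unfold T0; replace (s-1+1)%C with s by ring; field; exact Hs1).
  have Q1: (- s*1*cpw (s+1) x)%C=T1 x by (unfold T1; ring).
  have Q2: (- (s+1) * - s*cpw (s+1+1) x)%C=T2 x by (unfold T2; ring).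
  have Q3: (- (s+1+1)*(s*(s+1))*cpw (s+1+1+1) x)%C=T3 x.
  { unfold T3. replace (RtoC 2) with (1+1)%C by (rewrite <- RtoC_plus; f_equal; ring). ring. }
  have P0 := cpw_derive (- / (s-1))%C (s-1)%C x Hx0. rewrite Q0 in P0. have P1 := cpw_derive 1%C s x Hx0. rewrite Q1 in P1.
  have P2 := cpw_derive (- s)%C (s+1)%C x Hx0. rewrite Q2 in P2. have P3 := cpw_derive (s*(s+1))%C (s+1+1)%C x Hx0. rewrite Q3 in P3.
  split; (split; [apply P0|split; [apply P1|split; [apply P2|split; [apply P3|eapply Rle_trans; [|exact M3]]]]]); [apply abs_fst_Cmod|apply abs_snd_Cmod]. }
 have E1 := Euler_Maclaurin _ _ _ _ _ n K (fun x Hx => proj1 (D x Hx)). have E2 := Euler_Maclaurin _ _ _ _ _ n K (fun x Hx => proj2 (D x Hx)).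
 le_trans Cmod_le_sum. replace (2*K) with (K+K) by ring. apply Rplus_le_compat.
 - eapply Rle_trans; [|exact E1]. right. f_equal. set (a1 := T0 n). set (a2 := T0 (n+1)). set (a3 := T n). set (a4 := T (n+1)). set (a5 := T1 n). set (a6 := T1 (n+1)).
  destruct a1, a2, a3, a4, a5, a6. simpl. field.
 - eapply Rle_trans; [|exact E2]. right. f_equal. set (a1 := T0 n). set (a2 := T0 (n+1)). set (a3 := T n). set (a4 := T (n+1)). set (a5 := T1 n). set (a6 := T1 (n+1)).
  destruct a1, a2, a3, a4, a5, a6. simpl. field.
Qed.

(** For Re s >= -3/2 the third derivative is O(x^(-3/2)), and the tails of the sum of such errors
    have this size. *)
Definition wM (m : nat) : R := / sqrt (INR (S m)).

Lemma wM_pos m : 0 < wM m.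
Proof. apply Rinv_0_lt_compat, sqrt_lt_R0, INR_S_pos. Qed.

Lemma wM_lim : is_lim_seq wM 0.
Proof.
 apply seq_lim_of_eps. intros eps He. destruct (INR_unbounded (/ eps^2)) as [m Hm]. exists m. intros n Hn. have Hw := wM_pos n.
 rewrite Rminus_0_r, Rabs_right by lra. unfold wM. rewrite <- (Rinv_inv eps). apply Rinv_le_contravar; [pos|].
 rewrite <- (sqrt_pow2 (/ eps)) by pos. apply sqrt_le_1_alt. rewrite pow_inv. apply le_INR in Hn. rewrite S_INR. lra.
Qed.

Lemma wM_step m x : INR (S m) <= x -> exp (- (3/2*ln x)) <= 4*(wM m-wM (S m)).
Proof.
 intros Hx. have Hn := N_ge_1 m. set (n := INR (S m)) in *.
 have E1: exp (- (3/2*ln x))<=exp (- (3/2*ln n)).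
 { apply exp_le_mono. have: ln n<=ln x by (destruct (Rle_lt_or_eq_dec _ _ Hx) as [L|L]; [apply Rlt_le, ln_increasing; lra|rewrite L; lra]). lra. }
 have S0 := sqrt_lt_R0 n ok. have S1 := sqrt_sqrt n ok.
 have E2: exp (- (3/2*ln n)) = / (n*sqrt n).
 { rewrite exp_Ropp. f_equal. replace (3/2*ln n) with (ln n+ln (sqrt n)).
  - rewrite exp_plus, !exp_ln; lra.
  - rewrite <- S1 at 1 3. rewrite ln_mult by lra. field. }
 unfold wM. rewrite (S_INR (S m)). fold n. have S2 := sqrt_lt_R0 (n+1) ok. have S3 := sqrt_sqrt (n+1) ok.
 rewrite E2 in E1. apply Rle_trans with (1 := E1).
 set (p := sqrt n) in *. set (q := sqrt (n+1)) in *. 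
 have Hd: / p - / q = / (p*q*(p+q)).
 { have Q: (q-p)*(p+q)=1 by (replace ((q-p)*(p+q)) with (q*q-p*p) by ring; lra).
  apply Rmult_eq_reg_r with (p*q*(p+q)); [|repeat apply Rmult_neq_0; lra]. rewrite Rinv_l by (repeat apply Rmult_neq_0; lra). rewrite <- Q. field. lra. }
 rewrite Hd. replace (4 * / (p*q*(p+q))) with (/ (p*q*(p+q)/4)) by (field; repeat split; lra).
 apply Rinv_le_contravar; [have: 0<p*q*(p+q) by pos; lra|].
 have A1: p*q*(p+q)<=p*(2*(n+1)).
 { rewrite Rmult_assoc. apply Rmult_le_compat_l; [lra|]. rewrite <- S3. nra. }
 nra.
Qed.

(** 10560 = 2 * 1320 * 4, with 1320 = 10 * 11 * 12 from |s|, |s+1|, |s+2| and 4 from [wM_step]. *)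
Lemma zM_cauchy s : s <> RtoC 1 -> - (3/2) <= fst s -> Cmod s <= 10 -> forall m k, Cmod (zM (k+m) s-zM m s) <= 10560*(wM m-wM (k+m)).
Proof.
 intros Hs Hre Hm.
 have St: forall m, Cmod (zM (S m) s-zM m s)<=10560*(wM m-wM (S m)).
 { intros m. replace (10560*(wM m-wM (S m))) with (2*(1320*(4*(wM m-wM (S m))))) by ring. apply zM_step; [exact Hs|].
  intros x Hx. have := N_ge_1 m. have Hl: 0<=ln x by (rewrite <- ln_1; destruct (Rle_lt_or_eq_dec 1 x ok) as [L|L]; [apply Rlt_le, ln_increasing; lra|rewrite L; lra]).
  have W := wM_step m x Hx.
  have E1: exp (- ((fst s+3)*ln x))<=exp (- (3/2*ln x)) by mono.
  have := exp_pos (- ((fst s+3)*ln x)). 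
  have C1: Cmod (s+1)<=11 by (le_trans Cmod_triangle; rewrite Cmod_1; lra).
  have C2: Cmod (s+2)<=12 by (le_trans Cmod_triangle; rewrite Cmod_R, Rabs_right by lra; lra).
  rewrite !Cmod_mult. apply Rmult_le_compat; [pos|lra| |lra].
  replace 1320 with (10*11*12) by ring. repeat apply Rmult_le_compat; try apply Cmod_ge_0; try lra. apply Rmult_le_pos; apply Cmod_ge_0. }
 intros m. induction k as [|k IH].
 - simpl. replace (zM m s-zM m s)%C with (RtoC 0) by ring. rewrite Cmod_0. lra.
 - change (S k+m)%nat with (S (k+m)). le_trans (Cmod_tri_minus _ (zM (k+m) s)). specialize (St (k+m)%nat). lra.
Qed.

Lemma zM_cauchy' s : s <> RtoC 1 -> - (3/2) <= fst s -> Cmod s <= 10 -> forall m n, (m <= n)%nat -> Cmod (zM n s-zM m s) <= 10560*wM m.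
Proof.
 intros H1 H2 H3 m n Hmn. have Q := zM_cauchy s H1 H2 H3 m (n-m). replace (n-m+m)%nat with n in Q by lia. have := wM_pos n. lra.
Qed.

Lemma zM_chol m s : s <> RtoC 1 -> chol (zM m) s.
Proof.
 intros Hs. have Hs1: (s-1)%C <> RtoC 0 by (now apply Cminus_neq0).
 have Cc: forall (g : C -> C) x, chol g s -> chol (fun s => cpw (g s) x) s.
 { intros g x Hg. unfold cpw. apply chol_exp, chol_opp, chol_mult; [exact Hg|apply chol_const]. }
 have Hid: chol (fun s => s) s by apply chol_id.
 unfold zM, PE. apply chol_plus.
 - induction m as [|m IH]; [apply chol_const|]. apply chol_plus; [exact IH|now apply Cc].
 - apply chol_plus; [apply chol_plus; [apply chol_mult|]|].
  + apply (Cc (fun s => s-1)%C). apply chol_minus; [exact Hid|apply chol_const].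
  + apply (chol_inv (fun s => s-1)%C); [apply chol_minus; [exact Hid|apply chol_const]|exact Hs1].
  + apply chol_scal. now apply Cc.
  + apply chol_mult; [apply chol_scal; exact Hid|]. apply (Cc (fun s => s+1)%C). apply chol_plus; [exact Hid|apply chol_const].
Qed.

Lemma exp_ln_small d eps : 0 < d -> 0 < eps -> exists n0, forall n, (n0 <= n)%nat -> exp (- (d*ln (INR (S n)))) <= eps.
Proof.
 intros Hd He. destruct (INR_unbounded (exp (/ (d*eps)))) as [n0 Hn0]. exists n0. intros n Hn. apply le_INR in Hn.
 have H1: exp (/ (d*eps))<=INR (S n) by (rewrite S_INR; lra).
 have H2: / (d*eps)<=ln (INR (S n)).
 { rewrite <- (ln_exp (/ (d*eps))). destruct (Rle_lt_or_eq_dec _ _ H1) as [L|L]; [apply Rlt_le, ln_increasing; [pos|exact L]|rewrite L; lra]. }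
 have H3: / eps<=d*ln (INR (S n)).
 { trans (d * / (d*eps)); [right; field; lra|mono]. }
 rewrite exp_Ropp, <- (Rinv_inv eps). apply Rinv_le_contravar; [pos|]. have := exp_ineq1_le (d*ln (INR (S n))). lra.
Qed.

Lemma dirichlet_csum s n : sum_n (dirichlet_term s) n = csum (S n) s.
Proof.
 have T: forall k, dirichlet_term s k=cpw s (INR (S k)).
 { intros k. unfold dirichlet_term, cpw, Cexp, Rpower, Re, Im. destruct s as [s1 s2]. cbn [fst snd RtoC Cmult Copp].
  have A: - (s1*ln (INR (S k))-s2*0) = - s1*ln (INR (S k)) by ring. have B: - (s1*0+s2*ln (INR (S k))) = - (s2*ln (INR (S k))) by ring.
  rewrite A, B, cos_neg, sin_neg. f_equal. ring. }
 induction n as [|n IH].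
 - rewrite sum_O, T. change (cpw s (INR 1)=(RtoC 0+cpw s (INR 1))%C). ring.
 - rewrite sum_Sn, IH, T. reflexivity.
Qed.

(** For Re s > 1 the correction [PE] tends to 0, so [zM] and the Dirichlet series have the same
    limit; the rate is the one of [zM_cauchy']. *)
Lemma zM_zeta (zeta : C -> C) s m : is_Riemann_zeta zeta -> 1 < fst s -> Cmod s <= 10 -> Cmod (zeta s-zM m s) <= 10560*wM m.
Proof.
 intros [Hz _] Hs Hm. have Hs1: s <> RtoC 1 by (intros Q; rewrite Q in Hs; simpl in Hs; lra).
 apply le_epsilon. intros eps He.
 set (K := Cmod (/ (s-1))+3). have HK: 3<=K by (unfold K; have := Cmod_ge_0 (/ (s-1)); lra).
 destruct (exp_ln_small (fst s-1) (eps/(2*K))) as [n1 Hn1]; [lra|pos|].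
 specialize (Hz s Hs). unfold is_series in Hz.
 have Hz': exists n2, forall n, (n2<=n)%nat -> Cmod (csum (S n) s-zeta s)<=eps/2.
 { have He4: 0<eps/4 by lra. destruct (Hz (ball (zeta s) (mkposreal _ He4)) (locally_ball _ _)) as [n2 Hn2]. exists n2. intros n Hn.
  specialize (Hn2 n Hn). rewrite dirichlet_csum in Hn2. apply C_NormedModule_mixin_compat2 in Hn2. 
  have: sqrt 2<=2 by (rewrite <- (sqrt_pow2 2) at 2 by lra; apply sqrt_le_1_alt; lra).
  trans (sqrt 2*(eps/4)); [apply Rlt_le; exact Hn2|]. trans (2*(eps/4)); [mono|lra]. }
 destruct Hz' as [n2 Hn2]. set (n := (n1+n2+m)%nat). specialize (Hn1 (S n) ltac:(unfold n; lia)). specialize (Hn2 n ltac:(unfold n; lia)).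
 have Q := zM_cauchy' s Hs1 ok Hm m (S n) ltac:(unfold n; lia).
 have HP: Cmod (PE (INR (S (S n))) s)<=eps/2.
 { set (X := INR (S (S n))) in *. have HX: 1<=X by apply N_ge_1. have HlX: 0<=ln X by (rewrite <- ln_1; destruct (Rle_lt_or_eq_dec 1 X HX) as [L|L]; [apply Rlt_le, ln_increasing; lra|rewrite L; lra]).
  set (e := exp (- ((fst s-1)*ln X))) in *. have He0: 0<e by apply exp_pos. unfold PE.
  have T1: Cmod (cpw (s-1) X)=e by (rewrite Cmod_cpw; unfold e; f_equal; destruct s; simpl; ring).
  have T2: Cmod (cpw s X)<=e by (rewrite Cmod_cpw; apply exp_le_mono; nra).
  have T3: Cmod (cpw (s+1) X)<=e by (rewrite Cmod_cpw; apply exp_le_mono; destruct s; simpl in *; nra).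
  le_trans Cmod_triangle. eapply Rle_trans; [apply Rplus_le_compat_r, Cmod_triangle|]. rewrite !Cmod_mult, T1, !Cmod_R. rewrite (Rabs_right (/ 2)), (Rabs_right (/ 12)) by lra.
  have: / 12*Cmod s*Cmod (cpw (s+1) X)<=1*e by (apply Rmult_le_compat; [have := Cmod_ge_0 s; lra|pos|lra|lra]).
  trans (e*K); [unfold K; lra|]. trans (eps/(2*K)*K); [mono|right; field; lra]. }
 le_trans (Cmod_tri_minus _ (zM (S n) s)).
 have: Cmod (zeta s-zM (S n) s)<=eps.
 { replace (zeta s-zM (S n) s)%C with (- (csum (S n) s-zeta s) + - PE (INR (S (S n))) s)%C by (unfold zM; ring). le_trans Cmod_triangle. rewrite !Cmod_opp. lra. }
 lra.
Qed.

Lemma seg_bounded_hor f a b c : a <= b -> (forall t, a <= t <= b -> ccont f (t, c)) -> exists M, forall t, a <= t <= b -> Cmod (f (t, c)) <= M.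
Proof.
 intros Hab H. destruct (continuity_ab_maj (fun t => Cmod (f (t, c))) a b Hab) as [t0 [Ht0 _]].
 - intros t Ht. apply continuity_pt_filterlim. apply real_continuous. intros eps He. destruct (H t Ht eps He) as [d [Hd Hz]]. exists d. split; [exact Hd|].
  intros s Hs. specialize (Hz (s, c)). rewrite Cmod_hor in Hz. specialize (Hz Hs).
  have T1 := Cmod_triangle (f (s, c)-f (t, c)) (f (t, c)). have T2 := Cmod_triangle (- (f (s, c)-f (t, c))) (f (s, c)).
  rewrite Cmod_opp in T2. replace (f (s, c)-f (t, c)+f (t, c))%C with (f (s, c)) in T1 by ring. replace (- (f (s, c)-f (t, c))+f (s, c))%C with (f (t, c)) in T2 by ring.
  alra. - exists (Cmod (f (t0, c))). exact Ht0.
Qed.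
Lemma seg_bounded_ver f a c d : c <= d -> (forall t, c <= t <= d -> ccont f (a, t)) -> exists M, forall t, c <= t <= d -> Cmod (f (a, t)) <= M.
Proof.
 intros Hab H. destruct (continuity_ab_maj (fun t => Cmod (f (a, t))) c d Hab) as [t0 [Ht0 _]].
 - intros t Ht. apply continuity_pt_filterlim. apply real_continuous. intros eps He. destruct (H t Ht eps He) as [dl [Hd Hz]]. exists dl. split; [exact Hd|].
  intros s Hs. specialize (Hz (a, s)). rewrite Cmod_ver in Hz. specialize (Hz Hs).
  have T1 := Cmod_triangle (f (a, s)-f (a, t)) (f (a, t)). have T2 := Cmod_triangle (- (f (a, s)-f (a, t))) (f (a, s)).
  rewrite Cmod_opp in T2. replace (f (a, s)-f (a, t)+f (a, t))%C with (f (a, s)) in T1 by ring. replace (- (f (a, s)-f (a, t))+f (a, s))%C with (f (a, t)) in T2 by ring.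
  alra. - exists (Cmod (f (a, t0))). exact Ht0.
Qed.

(* A slanted strip from -1 to the half-plane Re s > 1 that avoids the pole. *)
Definition slant (w : C) : C := (RtoC (-1)+(1, 1)%R*w)%C.
Lemma slant_xy x y : slant (x, y) = (-1+x-y, x+y).
Proof. unfold slant, RtoC, Cmult, Cplus. simpl. f_equal; ring. Qed.

(* On the horizontal sides of the strip the real part of the exponent vanishes. *)
Definition weight (N : R) (w : C) : C := Cexp (RtoC N*Cexp (RtoC (2*PI)*w)).
Lemma Cmod_weight N x y : Cmod (weight N (x, y)) = exp (N*(exp (2*PI*x)*cos (2*PI*y))).
Proof.
 unfold weight. rewrite Cmod_Cexp. f_equal. unfold Cexp, RtoC, Cmult. simpl.
 replace (2*PI*x-0*y) with (2*PI*x) by ring. replace (2*PI*y+0*x) with (2*PI*y) by ring. ring.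
Qed.

(** The weighted difference is at most Cb exp(2N/5) on the whole boundary: on the long sides the
    weight is 1, on the inner short side the exponent is at most N exp(-PI/2) <= 2N/5, and on the
    outer one Re s > 1, where m is taken so large that the difference defeats the weight. At the
    point itself the weight is at least exp(9N/10). N is fixed before m. *)
Lemma zM_limit (zeta : C -> C) (h eps : R) : is_Riemann_zeta zeta -> Rabs h <= / 50 -> 0 < eps ->
 exists m0, forall m, (m0 <= m)%nat -> Cmod (zeta (-1+h, 0)-zM m (-1+h, 0)) <= eps.
Proof.
 intros Hz Hh He. abs_in Hh.
 have Hreg: forall x y, -1/4<=x<=3 -> -1/4<=y<=1/4 -> slant (x, y) <> RtoC 1 /\ - (3/2)<=fst (slant (x, y)) /\ Cmod (slant (x, y))<=10.
 { intros x y Hx Hy. rewrite slant_xy. split; [intros Q; unfold RtoC in Q; injection Q; lra|]. split; [simpl; lra|].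
  le_trans Cmod_le_sum. simpl. have: Rabs (-1+x-y)<=5 by (apply Rabs_le; lra). have: Rabs (x+y)<=5 by (apply Rabs_le; lra). lra. }
 set (f := fun (m : nat) w => (zeta (slant w)-zM m (slant w))%C).
 have Hf: forall m x y, -1/4<=x<=3 -> -1/4<=y<=1/4 -> chol (f m) (x, y).
 { intros m x y Hx Hy. destruct (Hreg x y Hx Hy) as [N _]. have Cs: chol slant (x, y) by (apply chol_plus; [apply chol_const|apply chol_scal, chol_id]).
  apply chol_minus; [apply (chol_comp zeta slant)|apply (chol_comp (zM m) slant)]; auto; [apply chol_of_ex_derive; destruct Hz as [_ Hz]; now apply Hz|now apply zM_chol]. }
 destruct (seg_bounded_hor (f 0%nat) (-1/4) 3 (-1/4) ok) as [M1 HM1]; [intros t Ht; apply chol_ccont, Hf; lra|].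
 destruct (seg_bounded_hor (f 0%nat) (-1/4) 3 (1/4) ok) as [M2 HM2]; [intros t Ht; apply chol_ccont, Hf; lra|].
 destruct (seg_bounded_ver (f 0%nat) (-1/4) (-1/4) (1/4) ok) as [M3 HM3]; [intros t Ht; apply chol_ccont, Hf; lra|].
 set (Cb := Rmax 0 (Rmax M1 (Rmax M2 M3))+10561).
 have HCb: 1<=Cb /\ M1+10560<=Cb /\ M2+10560<=Cb /\ M3+10560<=Cb.
 { unfold Cb. minmax. lra. }
 have Hfm: forall m x y, -1/4<=x<=3 -> -1/4<=y<=1/4 -> Cmod (f m (x, y))<=Cmod (f 0%nat (x, y))+10560.
 { intros m x y Hx Hy. destruct (Hreg x y Hx Hy) as [N [R1 R2]]. have Q := zM_cauchy' _ N R1 R2 0%nat m okn.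
  have W0: wM 0=1 by (unfold wM; simpl; rewrite sqrt_1; field). rewrite W0 in Q.
  replace (f m (x, y)) with (f 0%nat (x, y) + - (zM m (slant (x, y))-zM 0 (slant (x, y))))%C by (unfold f; ring).
  le_trans Cmod_triangle. rewrite Cmod_opp. lra. }
 (* The constant of [Cauchy_estimate] for rho = 1/5; since |h/2| <= 1/100, the point keeps that
    distance from every side. *)
 set (K := ((3 - -1/4)^2+(1/4 - -1/4)^2)/(1/5)^2). 
 destruct (exp_m1_small (K*Cb) eps He) as [T HT]. set (n := Rmax T 1). have Hn: 1<=n by apply Rmax_r. specialize (HT n (Rmax_l _ _)).
 (* Chosen so that exp(N(2/5 - 9/10)) = exp(-n). *)
 set (N := 2*n). have P4 := PI_4. have P32 := PI2_3_2. 
 destruct (lim_seq_eps wM 0 (/ (10560*exp (N*exp (2*PI*3)))) wM_lim) as [m0 Hm0].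
 { apply Rinv_0_lt_compat. have := exp_pos (N*exp (2*PI*3)). lra. }
 exists m0. intros m Hm. specialize (Hm0 m Hm). rewrite Rminus_0_r, Rabs_right in Hm0 by (have := wM_pos m; lra).
 have Wc: forall p, chol (weight N) p by (intros p; unfold weight; apply chol_exp, chol_scal, chol_exp, chol_scal, chol_id).
 have CE := Cauchy_estimate (fun w => f m w*weight N w)%C (-1/4) 3 (-1/4) (1/4) (h/2) (-h/2) (1/5) (Cb*exp (N*(2/5))).
 have E25: 1<=exp (N*(2/5)) by (rewrite <- exp_0; apply exp_le_mono; unfold N; lra).
 have Hc1: cos (2*PI*(1/4))=0 by (replace (2*PI*(1/4)) with (PI/2) by field; apply cos_PI2).
 have Hc2: cos (2*PI*(-1/4))=0 by (replace (2*PI*(-1/4)) with (- (PI/2)) by field; rewrite cos_neg; apply cos_PI2).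
 have CE': Cmod (f m (h/2, -h/2)*weight N (h/2, -h/2))<=Cb*exp (N*(2/5))*K.
 { apply CE; try lra.
  - intros x y Hx Hy. apply chol_mult; [now apply Hf|apply Wc].
  - intros x Hx. rewrite !Cmod_mult, !Cmod_weight, Hc1, Hc2, Rmult_0_r, Rmult_0_r, exp_0, !Rmult_1_r.
   have := Hfm m x (-1/4) Hx ok. have := Hfm m x (1/4) Hx ok. specialize (HM1 x Hx). specialize (HM2 x Hx).
   have: Cb<=Cb*exp (N*(2/5)) by nra. split; lra.
  - intros y Hy. rewrite !Cmod_mult, !Cmod_weight. have CB := COS_bound (2*PI*y). split.
   + have := Hfm m (-1/4) y ok Hy. specialize (HM3 y Hy). apply Rmult_le_compat; [apply Cmod_ge_0|pos|lra|].
    apply exp_le_mono. apply Rmult_le_compat_l; [unfold N; lra|]. have := exp_pos (2*PI*(-1/4)).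
    trans (exp (2*PI*(-1/4))*1); [mono|]. rewrite Rmult_1_r.
    replace (2*PI*(-1/4)) with (- (PI/2)) by field. rewrite exp_Ropp. replace (2/5) with (/ (5/2)) by field. apply Rinv_le_contravar; [lra|].
    have := exp_ineq1_le (PI/2). lra.
   + have F1: Cmod (f m (3, y))<=10560*wM m.
    { unfold f. destruct (Hreg 3 y ok Hy) as [_ [_ R2]]. apply zM_zeta; [exact Hz|rewrite slant_xy; simpl; lra|exact R2]. }
    have Ep := exp_pos (N*exp (2*PI*3)). have Ep3 := exp_pos (2*PI*3).
    trans (10560 * / (10560*exp (N*exp (2*PI*3)))*exp (N*exp (2*PI*3))).
    * apply Rmult_le_compat; [pos|pos|lra|]. apply exp_le_mono. apply Rmult_le_compat_l; [unfold N; lra|].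
     trans (exp (2*PI*3)*1); [mono|lra].
    * replace (10560 * / (10560*exp (N*exp (2*PI*3)))*exp (N*exp (2*PI*3))) with 1 by fld. nra. }
 rewrite Cmod_mult, Cmod_weight in CE'. unfold f in CE'. rewrite slant_xy in CE'.
 replace (-1+h/2 - - h/2) with (-1+h) in CE' by field. replace (h/2 + - h/2) with 0 in CE' by field.
 replace (2*PI*(h/2)) with (PI*h) in CE' by field. replace (2*PI*(- h/2)) with (- (PI*h)) in CE' by field. rewrite cos_neg in CE'.
 have Hph: Rabs (PI*h)<=8/100 by (apply Rabs_le; nra).
 have Hw: 9/10<=exp (PI*h)*cos (PI*h).
 { have Q1: 92/100<=exp (PI*h) by (have := exp_ineq1_le (PI*h); abs_in Hph; lra).
  have Q2: 99/100<=cos (PI*h).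
  { replace (PI*h) with (2*(PI*h/2)) by field. rewrite cos_2a_sin. have S := abs_sin_le (PI*h/2).
   have: Rabs (PI*h/2)<=4/100 by (abs_in Hph; apply Rabs_le; lra). set (sn := sin (PI*h/2)) in *.
   have: Rabs sn<=4/100 by lra. abs_in H0. nra. }
  nra. }
 set (z := Cmod (zeta (-1+h, 0)-zM m (-1+h, 0))) in *. have Hz0: 0<=z by apply Cmod_ge_0.
 have F2: z*exp (N*(9/10))<=Cb*exp (N*(2/5))*K.
 { eapply Rle_trans; [|exact CE']. apply Rmult_le_compat_l; [exact Hz0|]. apply exp_le_mono. apply Rmult_le_compat_l; [unfold N; lra|exact Hw]. }
 have F3: z<=K*Cb*exp (- n).
 { apply Rmult_le_reg_r with (exp (N*(9/10))); [pos|]. apply Rle_trans with (1 := F2). right. rewrite (Rmult_assoc (K*Cb)), <- exp_plus.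
  replace (- n+N*(9/10)) with (N*(2/5)) by (unfold N; field). ring. }
 have := Rle_abs (K*Cb*exp (- n)). lra.
Qed.

(* x^(1-s)/(s-1) + x^(-s)/2 + s x^(-s-1)/12 and its s-derivative, with L = ln x. *)
Definition PR (L s : R) : R := exp (- ((s-1)*L))/(s-1) + / 2*exp (- (s*L)) + / 12*s*exp (- ((s+1)*L)).
Definition PR1 (L s : R) : R :=
 - (L/(s-1) + / (s-1)^2)*exp (- ((s-1)*L)) - / 2*L*exp (- (s*L)) + / 12*(1-s*L)*exp (- ((s+1)*L)).

(** * The derivative of zeta at -1 *)

Fixpoint rsum (m : nat) (s : R) : R := match m with O => 0 | S m => rsum m s+exp (- (s*ln (INR (S m)))) end.
Fixpoint rsum1 (m : nat) (s : R) : R := match m with O => 0 | S m => rsum1 m s + - ln (INR (S m))*exp (- (s*ln (INR (S m)))) end.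
Definition zr (m : nat) (s : R) : R := rsum m s+PR (ln (INR (S m))) s.
Definition zr1 (m : nat) (s : R) : R := rsum1 m s+PR1 (ln (INR (S m))) s.

Lemma exp_lin_derive c d s : is_derive (fun s => exp (- ((s+d)*c))) s (- c*exp (- ((s+d)*c))).
Proof. isd. ring. Qed.

Lemma zr_derive m s : s < 1 -> is_derive (zr m) s (zr1 m s).
Proof.
 intros Hs. have E0: forall c s, is_derive (fun s => exp (- (s*c))) s (- c*exp (- (s*c))).
 { intros c t. isd. ring. }
 apply isd_plus.
 - induction m as [|m IH]; [exact (isd_const 0 s)|]. apply isd_plus; [exact IH|apply E0].
 - set (L := ln (INR (S m))). unfold PR, PR1. eapply isd_eq.
  + apply isd_plus; [apply isd_plus; [apply isd_div; [apply (exp_lin_derive L (-(1)))|isd_|lra]|apply isd_mult; [isd_|apply E0]]|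
    apply isd_mult; [isd_|apply (exp_lin_derive L 1)]].
  + cbv beta. change (s + - (1)) with (s-1). field. lra.
Qed.

Lemma zM_real m s : s < 1 -> fst (zM m (s, 0)) = zr m s.
Proof.
 intros Hs. have Ec: forall s x, cpw (s, 0) x=RtoC (exp (- (s*ln x))).
 { intros t x. unfold cpw, Cexp, RtoC, Cmult, Copp. cbn [fst snd]. replace (- (t*0+0*ln x)) with 0 by ring. rewrite cos_0, sin_0.
  replace (- (t*ln x-0*0)) with (- (t*ln x)) by ring. f_equal; ring. }
 have Es: forall k, csum k (s, 0)=RtoC (rsum k s).
 { induction k as [|k IH]; [reflexivity|]. change (csum (S k) (s, 0)) with (csum k (s, 0)+cpw (s, 0) (INR (S k)))%C. rewrite IH, Ec. rewrite <- RtoC_plus. reflexivity. }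
 unfold zM, zr, PE. rewrite Es. change (s, 0) with (RtoC s) at 1 2 4 5 6 7 || idtac.
 replace ((s, 0)-1)%C with (s-1, 0) by (unfold RtoC, Cminus, Cplus, Copp; simpl; f_equal; ring).
 replace ((s, 0)+1)%C with (s+1, 0) by (unfold RtoC, Cplus; simpl; f_equal; ring).
 rewrite !Ec. unfold PR. 
 unfold RtoC, Cplus, Cmult, Cinv. simpl. field. lra.
Qed.

Lemma lexp_derive (A B c x : R) : 0 < x -> is_derive (fun x => (A+B*ln x)*exp (- (c*ln x))) x ((B-c*A+(- (c*B))*ln x)*exp (- ((c+1)*ln x))).
Proof.
 intros Hx. have Dl: is_derive ln x (/ x).
 { eapply isd_eq; [apply (isd_ln (fun x => x)); [isd_|exact Hx]|]. field. lra. }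
 eapply isd_eq; [apply isd_mult; [apply isd_plus; [isd_|apply isd_mult; [isd_|exact Dl]]|apply isd_exp, isd_opp, isd_mult; [isd_|exact Dl]]|].
 replace (- ((c+1)*ln x)) with (- (c*ln x) + - ln x) by ring. rewrite exp_plus, (exp_Ropp (ln x)), exp_ln by exact Hx. field. lra.
Qed.

Lemma ln_mono a b : 0 < a -> a <= b -> ln a <= ln b.
Proof. intros H [L| ->]; [apply Rlt_le, ln_increasing; lra|lra]. Qed.

(** Euler-Maclaurin for -log x x^(-s), the s-derivative of x^(-s). Near s = -1 its third derivative
    is at most (1 + L) exp(-(s+3)L) with L = log x; the estimate 1 + L <= 4 exp(4L/10) and s + 3 >=
    19/10 bring it to 4 x^(-3/2). *)
Lemma zr1_step m s : -11/10 <= s <= -9/10 -> Rabs (zr1 (S m) s-zr1 m s) <= 16*(wM m-wM (S m)).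
Proof.
 intros Hs. set (n := INR (S m)). have Hn: 1<=n by apply N_ge_1.
 set (f := fun x => (0 + -1*ln x)*exp (- (s*ln x))). set (Phi := fun x => (/ (s-1)^2 + / (s-1)*ln x)*exp (- ((s-1)*ln x))).
 set (f1 := fun x => (-1+s*ln x)*exp (- ((s+1)*ln x))). set (f2 := fun x => (2*s+1 + - (s*(s+1))*ln x)*exp (- ((s+1+1)*ln x))).
 set (f3 := fun x => (- (3*s^2+6*s+2)+s*(s+1)*(s+2)*ln x)*exp (- ((s+1+1+1)*ln x))).
 have E: zr1 (S m) s-zr1 m s=(f n+f (n+1))/2-(Phi (n+1)-Phi n)-(f1 (n+1)-f1 n)/12.
 { unfold zr1. change (rsum1 (S m) s) with (rsum1 m s + - ln (INR (S m))*exp (- (s*ln (INR (S m))))). rewrite (S_INR (S m)). fold n. unfold PR1, f, Phi, f1. field. lra. }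
 rewrite E. replace (16*(wM m-wM (S m))) with (4*(4*(wM m-wM (S m)))) by ring. apply (Euler_Maclaurin Phi f f1 f2 f3). intros x Hx. have Hx0: 0<x by lra.
 split; [|split; [|split; [|split]]].
 - eapply isd_eq; [apply lexp_derive, Hx0|]. unfold f. replace (s-1+1) with s by ring. f_equal. field. lra.
 - eapply isd_eq; [apply lexp_derive, Hx0|]. unfold f1. f_equal. ring.
 - eapply isd_eq; [apply lexp_derive, Hx0|]. unfold f2. f_equal. ring.
 - eapply isd_eq; [apply lexp_derive, Hx0|]. unfold f3. f_equal. ring.
 - have W := wM_step m x ltac:(fold n; lra). have Hl: 0<=ln x by (rewrite <- ln_1; apply ln_mono; lra). set (L := ln x) in *.
  unfold f3. rewrite Rabs_mult, (Rabs_right (exp _)) by pos. fold L.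
  have A: Rabs (- (3*s^2+6*s+2)+s*(s+1)*(s+2)*L)<=1+L.
  { pose (t := s+1). have Ht: -1/10<=t<=1/10 by (unfold t; lra).
   replace (- (3*s^2+6*s+2)+s*(s+1)*(s+2)*L) with ((1-3*t^2)+(t^2-1)*t*L) by (unfold t; ring).
   have T2: 0<=t^2<=1/100 by nra. have T0 := mul_le_between t (1-t^2) (1/10) 1 ok ok. have T3: -1<=(t^2-1)*t<=1 by lra. set (k := (t^2-1)*t) in *. clearbody k.
   have := mul_le_between k L 1 L ok ok. alra. }
  have B: 1+L<=4*exp (4/10*L) by (have := exp_ineq1_le (4/10*L); lra).
  trans (4*exp (4/10*L)*exp (- ((s+1+1+1)*L))).
  { apply Rmult_le_compat_r; [pos|lra]. }
  rewrite Rmult_assoc, <- exp_plus. apply Rmult_le_compat_l; [lra|]. eapply Rle_trans; [|exact W]. apply exp_le_mono. fold L. nra.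
Qed.

Lemma zr1_cauchy m n s : -11/10 <= s <= -9/10 -> (m <= n)%nat -> Rabs (zr1 n s-zr1 m s) <= 16*wM m.
Proof.
 intros Hs Hmn. have Q: forall k, Rabs (zr1 (k+m) s-zr1 m s)<=16*(wM m-wM (k+m)).
 { induction k as [|k IH]; [simpl; rewrite Rminus_diag, Rabs_R0; lra|]. change (S k+m)%nat with (S (k+m)).
  have := zr1_step (k+m) s Hs. replace (zr1 (S (k+m)) s-zr1 m s) with ((zr1 (S (k+m)) s-zr1 (k+m) s)+(zr1 (k+m) s-zr1 m s)) by ring.
  le_trans Rabs_triang. lra. }
 specialize (Q (n-m)%nat). replace (n-m+m)%nat with n in Q by lia. have := wM_pos n. lra.
Qed.

(** At s = -1 the derivative of the approximation is the hyperfactorial remainder up to sign and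
    1/12: here Glaisher's constant is tied to zeta'(-1). *)
Lemma zr1_at_m1 m : zr1 m (-1) = 1/12-hyp m.
Proof.
 have Es: forall k, rsum1 (S k) (-1) = - sum_n (fun j => INR (S j)*ln (INR (S j))) k.
 { induction k as [|k IH].
  - rewrite sum_O. simpl. rewrite ln_1. ring.
  - rewrite sum_Sn. change plus with Rplus. change (rsum1 (S (S k)) (-1)) with (rsum1 (S k) (-1) + - ln (INR (S (S k)))*exp (- (-1*ln (INR (S (S k)))))). rewrite IH.
   replace (- (-1*ln (INR (S (S k))))) with (ln (INR (S (S k)))) by ring. rewrite exp_ln by apply INR_S_pos. ring. }
 have HN := INR_S_pos m.
 have E1: rsum1 m (-1) = - sum_n (fun j => INR (S j)*ln (INR (S j))) m+INR (S m)*ln (INR (S m)).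
 { rewrite <- Es. change (rsum1 (S m) (-1)) with (rsum1 m (-1) + - ln (INR (S m))*exp (- (-1*ln (INR (S m))))).
  replace (- (-1*ln (INR (S m)))) with (ln (INR (S m))) by ring. rewrite exp_ln by exact HN. ring. }
 unfold zr1, hyp, PR1. rewrite E1. 
 replace (- ((-1-1)*ln (INR (S m)))) with (ln (INR (S m))+ln (INR (S m))) by ring. replace (- (-1*ln (INR (S m)))) with (ln (INR (S m))) by ring.
 replace (- ((-1+1)*ln (INR (S m)))) with 0 by ring. rewrite exp_plus, exp_0, exp_ln by exact HN. field.
Qed.

(** Limit and derivative are exchanged: the functions [zr m] converge pointwise, and the bound 16
    [wM m] on differences of their derivatives makes the difference quotients converge uniformly in
    h. *)
Lemma dzeta_value (zeta : C -> C) (a : R) : is_Riemann_zeta zeta -> is_lim_seq hyp a -> dzeta_m1 zeta = 1/12-a.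
Proof.
 intros Hz Ha. set (Z := fun h => fst (zeta (-1+h, 0))).
 have ZL: forall h eps, Rabs h <= / 50 -> 0<eps -> exists m0, forall m, (m0<=m)%nat -> Rabs (Z h-zr m (-1+h))<=eps.
 { intros h eps Hh He. destruct (zM_limit zeta h eps Hz Hh He) as [m0 H]. exists m0. intros m Hm. abs_in Hh.
  rewrite <- zM_real by lra. eapply Rle_trans; [|apply (H m Hm)]. set (p := (-1+h, 0) : C). exact (abs_fst_Cmod (zeta p-zM m p)%C). }
 have ZD: forall m h, Rabs h <= / 50 -> Rabs (Z h-Z 0-(zr m (-1+h)-zr m (-1)))<=16*wM m*Rabs h.
 { intros m h Hh. apply le_epsilon. intros eps He. destruct (ZL h (eps/2) Hh ok) as [m1 H1]. destruct (ZL 0 (eps/2)) as [m2 H2]; [rewrite Rabs_R0; lra|lra|].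
  set (n := (m+m1+m2)%nat). specialize (H1 n ltac:(unfold n; lia)). specialize (H2 n ltac:(unfold n; lia)). rewrite Rplus_0_r in H2. abs_in Hh.
  have B: Rabs ((zr n (-1+h)-zr m (-1+h))-(zr n (-1)-zr m (-1)))<=16*wM m*Rabs h.
  { have Bd: forall p r, p<=r -> -1 - / 50<=p -> r <= -1 + / 50 -> Rabs ((zr n r-zr m r)-(zr n p-zr m p))<=16*wM m*(r-p).
   { intros p r Hpr Hp Hr. apply (derive_bound (fun s => zr n s-zr m s) (fun s => zr1 n s-zr1 m s)); [exact Hpr| |].
    - intros x Hx. apply isd_minus; apply zr_derive; lra. - intros x Hx. apply zr1_cauchy; [lra|unfold n; lia]. }
   destruct (Rle_dec 0 h) as [P|P].
   - rewrite (Rabs_right h) by lra. specialize (Bd (-1) (-1+h) ok ok ok). replace (-1+h - -1) with h in Bd by ring. exact Bd.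
   - rewrite (Rabs_left h) by lra. specialize (Bd (-1+h) (-1) ok ok ok). replace (-1-(-1+h)) with (- h) in Bd by ring. rewrite Rabs_minus_sym. exact Bd. }
  alra. }
 (* [C_derive] unfolds to limits along the horizontal line through the point, so real increments
    suffice. *)
 unfold dzeta_m1, C_derive, C_lim, Re. cbn [fst snd RtoC].
 rewrite (is_lim_unique _ _ (Finite (1/12-a))); [reflexivity|].
 apply is_lim_spec. intros [eps He]. cbn [pos]. 
 destruct (lim_seq_eps hyp a (eps/4) Ha ok) as [n1 Hn1]. destruct (lim_seq_eps wM 0 (eps/64) wM_lim ok) as [n2 Hn2].
 set (m := (n1+n2)%nat). specialize (Hn1 m ltac:(unfold m; lia)). specialize (Hn2 m ltac:(unfold m; lia)). rewrite Rminus_0_r in Hn2. have := Rle_abs (wM m).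
 have D := zr_derive m (-1) ok. rewrite zr1_at_m1 in D. apply is_derive_Reals in D. destruct (D (eps/4) ok) as [dl Hdl].
 have Hd: 0<Rmin dl (/ 50) by (apply Rmin_glb_lt; [apply cond_pos|lra]). have X1: forall y : R, y+1=y + - -1 by (intros; ring). exists (mkposreal _ Hd). refine (fun (x : R) Hx Hx1 => _).
 unfold ball in Hx. unfold AbsRing_ball, abs, minus, plus, opp in Hx. set (h := x+1).
 have Hh: Rabs h<Rmin dl (/ 50) by (unfold h; rewrite (X1 x); exact Hx).
 minmax. have Hh0: h <> 0 by (unfold h; lra).
 specialize (Hdl h Hh0 ok). specialize (ZD m h ok).
 have Eq: fst ((zeta (x, 0)-zeta (RtoC (-1)))/((x, 0)-RtoC (-1)))%C=(Z h-Z 0)/h.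
 { replace ((x, 0)-RtoC (-1))%C with (RtoC h) by (unfold RtoC, Cminus, Cplus, Copp, h; simpl; f_equal; ring).
  unfold Z. replace (-1+h) with x by (unfold h; ring). rewrite Rplus_0_r. fold (RtoC (-1)).
  set (u := zeta (x, 0)). set (v := zeta (RtoC (-1))). destruct u, v. unfold Cdiv, Cinv, Cmult, Cminus, Cplus, Copp, RtoC. simpl. field. lra. }
 fold (RtoC (-1)). rewrite Eq.
 have Q: Rabs ((Z h-Z 0)/h-(zr m (-1+h)-zr m (-1))/h)<=16*wM m.
 { replace ((Z h-Z 0)/h-(zr m (-1+h)-zr m (-1))/h) with ((Z h-Z 0-(zr m (-1+h)-zr m (-1)))/h) by fld.
  unfold Rdiv. rewrite Rabs_mult, Rabs_inv. apply Rmult_le_reg_r with (Rabs h); [now apply Rabs_pos_lt|]. rewrite Rmult_assoc, Rinv_l by (now apply Rabs_no_R0). lra. }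
 abs_in Q. apply Rabs_lt_between in Hdl. apply Rabs_lt_between in Hn1. apply Rabs_lt_between. lra.
Qed.

(** * Full expansions of the two integrals *)

Lemma HM_left_ratio q : is_Hastings_McLeod q -> exists X0 C, 10 <= X0 /\ 0 < C /\ forall X, X0 <= X ->
 exists p, q (- X) = sqrt (X/2)*p /\ Rabs (p-(1 - / 8 * / X^3-73/128*(/ X^3)^2)) <= C*(/ X^3)^3.
Proof.
 intros Hq. destruct (HM_left_expansion q Hq) as [X0 [K [HX0 [HK [_ H]]]]]. exists X0, K. split; [exact HX0|]. split; [exact HK|]. intros X HX.
 specialize (H (- X) ok). unfold qbar in H. 
 have S0: 0<sqrt (X/2) by pos. exists (q (- X)/sqrt (X/2)). split; [field; lra|].
 replace (- - X/2) with (X/2) in H by field.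
 have Ez: forall k, pser k (- X)=1 - / 8 * / X^3-73/128*(/ X^3)^2+k*(/ X^3)^3 by (intros k; unfold pser; field; lra).
 rewrite !Ez in H. destruct H as [H1 H2]. set (s := sqrt (X/2)) in *.
 have Hi: 0 < / s by pos.
 have P1 := Rmult_le_compat_r (/ s) _ _ ok H1. have P2 := Rmult_le_compat_r (/ s) _ _ ok H2.
 rewrite (Rmult_comm s), Rmult_assoc, Rinv_r, Rmult_1_r in P1 by lra. rewrite (Rmult_comm s), Rmult_assoc, Rinv_r, Rmult_1_r in P2 by lra.
 unfold Rdiv. alra. Qed.

Lemma convex_van_right (h h1 h2 : R -> R) (x0 : R) : (forall x, x0 <= x -> is_derive h x (h1 x)) -> (forall x, x0 <= x -> is_derive h1 x (h2 x)) ->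
 (forall x, x0 <= x -> 0 <= h2 x) -> (forall eps, 0 < eps -> exists y, forall x, y <= x -> Rabs (h x) <= eps) -> forall x, x0 <= x -> 0 <= h x.
Proof.
 intros D D1 P L. apply (decreasing_to_0 h h1); auto. intros x Hx. destruct (L 1 ok) as [y Hy]. have := Rmax_l x y. have := Rmax_r x y.
 trans (h1 (Rmax x y)).
 - apply (derive_nonneg_le h1 h2); [lra|intros; apply D1; lra|intros; apply P; lra].
 - apply (convex_bdd_decr h h1 h2 (Rmax x y) 1); [intros; apply D; lra|intros; apply D1; lra|intros; apply P; lra| |lra].
  intros s Hs. specialize (Hy s ok). alra. Qed.

Lemma small_at_infty (h : R -> R) (T C : R) : (forall x, T <= x -> Rabs (h x) <= C/x) -> forall eps, 0 < eps -> exists y, forall x, y <= x -> Rabs (h x) <= eps.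
Proof.
 intros H eps He. exists (Rmax T (Rmax 1 (Rabs C/eps))). intros x Hx. minmax. eapply Rle_trans; [apply H; lra|]. have := Rle_abs C.
 apply Rmult_le_reg_r with x; [lra|]. unfold Rdiv. rewrite Rmult_assoc, Rinv_l, Rmult_1_r by lra.
 trans (Rabs C); [lra|]. trans (eps*(Rabs C/eps)); [right; field; lra|mono].
Qed.

Lemma neg_derive (f : R -> R) (X l : R) : is_derive f (- X) l -> is_derive (fun X => f (- X)) X (- l).
Proof. intros D. eapply isd_eq; [apply (isd_comp f (fun X => - X)); [exact D|isd_]|ring]. Qed.

Lemma ipow_derive n X : 0 < X -> is_derive (fun X => / X^n) X (- (INR n) * / X^(S n)).
Proof.
 intros HX. eapply isd_eq; [apply isd_inv; [isd_|apply pow_nonzero; lra]|]. destruct n as [|n]; [simpl; field; lra|].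
 replace (Init.Nat.pred (S n)) with n by reflexivity. change (X^S (S n)) with (X*(X*X^n)). change (X^S n) with (X*X^n). field. split; [apply pow_nonzero|]; lra.
Qed.

(** -(3/64) X^(-3) is the double primitive of the term -(9/16) X^(-5) in q(-X)^2; the constant is
    the one provided by [VV_const]. *)
Definition VVm (zz X : R) : R := X^3 * / 12+1/8*ln X+(- (ln 2/24)-zz)-3/64 * / X^3.

(** The difference D tends to 0 by hypothesis, and |D''| <= K X^(-8) is dominated by the second
    derivative of K X^(-6). Both K X^(-6) + D and K X^(-6) - D are therefore convex and vanish at
    infinity, hence nonnegative. *)
Lemma VV_expansion q zz X0 : is_Hastings_McLeod q -> 20 <= X0 -> (forall X, X0 <= X -> Rabs (VV q (- X)+lamL X zz) <= / (2*X)) ->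
 exists X1 C, 20 <= X1 /\ 0 < C /\ forall X, X1 <= X -> Rabs (VV q (- X)-VVm zz X) <= C * / X^6.
Proof.
 intros Hq HX0 HV. destruct (VV_facts q Hq) as [DV _]. destruct (HM_left_ratio q Hq) as [X2 [C [HX2 [HC HR]]]].
 set (X1 := Rmax X0 X2). have HX1: X0<=X1 /\ X2<=X1 by (split; [apply Rmax_l|apply Rmax_r]).
 set (K := 4+2*C+C^2). exists X1, K. split; [lra|]. have HK: 0<K by (unfold K; have := pow2_ge_0 C; lra). split; [exact HK|].
 set (D := fun X => VV q (- X)-VVm zz X).
 set (D1 := fun X => - - ham q (- X)-(X^2 * / 4+1/8 * / X+9/64 * / X^4)).
 set (D2 := fun X => q (- X)^2-(X/2-1/8 * / X^2-9/16 * / X^5)).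
 have DD: forall X, X1<=X -> is_derive D X (D1 X).
 { intros X HX. unfold D, VVm. eapply isd_eq.
  - apply isd_minus; [apply (neg_derive (VV q)), DV|].
   apply isd_minus; [apply isd_plus; [apply isd_plus; [isd_|apply isd_mult; [isd_|apply (isd_ln (fun x => x)); [isd_|lra]]]|isd_]|apply isd_mult; [isd_|apply (ipow_derive 3); lra]].
  - unfold D1. simpl. field. lra. }
 have DD1: forall X, X1<=X -> is_derive D1 X (D2 X).
 { intros X HX. unfold D1. eapply isd_eq.
  - apply isd_minus; [apply isd_opp, isd_opp, (neg_derive (ham q)), ham_derive, Hq|].
   apply isd_plus; [apply isd_plus; [isd_|apply isd_mult; [isd_|apply (isd_inv (fun x => x)); [isd_|lra]]]|apply isd_mult; [isd_|apply (ipow_derive 4); lra]].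
  - unfold D2. simpl. field. lra. }
 have B2: forall X, X1<=X -> Rabs (D2 X)<=K * / X^8.
 { intros X HX. destruct (HR X ok) as [p [Ep Hp]]. unfold D2. rewrite Ep, Rpow_mult_distr, pow2_sqrt by lra.
  have HX3: 8000<=X^3 by (replace 8000 with (20^3) by ring; apply pow_incr; lra).
  set (z := / X^3) in *. have Hz: 0<z<=1/8000 by (unfold z; split; [pos|replace (1/8000) with (/ 8000) by field; apply Rinv_le_contravar; lra]).
  replace (X/2*p^2-(X/2-1/8 * / X^2-9/16 * / X^5)) with (X/2*(p^2-(1-z/4-9/8*z^2))) by (unfold z; field; lra).
  replace (K * / X^8) with (X/2*(2*K*z^3)) by (unfold z; field; lra).
  rewrite Rabs_mult, Rabs_right by lra. apply Rmult_le_compat_l; [lra|].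
  set (m := 1 - / 8*z-73/128*z^2) in *. set (e := p-m) in *. replace p with (m+e) by (unfold e; ring).
  replace ((m+e)^2-(1-z/4-9/8*z^2)) with ((73/512*z^3+5329/16384*z^4)+2*m*e+e^2) by (unfold m; field).
  have Hz3: 0<z^3 by pos. have Hz1: z^3<=1 by (replace 1 with (1^3) by ring; apply pow_incr; lra).
  have Hm: Rabs m<=1 by (unfold m; apply Rabs_le; nra).
  have He2: e^2<=C^2*z^3.
  { rewrite <- pow2_abs. trans ((C*z^3)^2); [apply pow_incr; split; [pos|exact Hp]|]. rewrite Rpow_mult_distr. apply Rmult_le_compat_l; [pos|nra]. }
  have Hme: Rabs (2*m*e)<=2*C*z^3.
  { rewrite !Rabs_mult, (Rabs_right 2) by lra. have := Rabs_pos m. have := Rabs_pos e. have: Rabs m*Rabs e<=1*(C*z^3) by (apply Rmult_le_compat; lra). lra. }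
  have Hz4: z^4<=z^3 by (replace (z^4) with (z^3*z) by ring; nra). have: 0<z^4 by pos.
  abs_in Hme. have := pow2_ge_0 e. 
  replace (2*K*z^3) with (8*z^3+4*(C*z^3)+2*(C^2*z^3)) by (unfold K; ring). alra. }
 have L0: forall eps, 0<eps -> exists y, forall x, y<=x -> Rabs (D x)<=eps.
 { apply (small_at_infty D X1 1). intros X HX. specialize (HV X ok). unfold D, VVm. unfold lamL in HV.
  have Hi: 0 < / X^3 <= / X.
  { split; [pos|apply Rinv_le_contravar; [lra|]]. simpl. rewrite Rmult_1_r. nra. }
  replace (/ (2*X)) with (/ 2 * / X) in HV by fld. unfold Rdiv. alra. }
 set (B := fun X => K * / X^6). set (B1 := fun X => K*(-6 * / X^7)). set (B2' := fun X => K*(42 * / X^8)).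
 have DB: forall X, X1<=X -> is_derive B X (B1 X).
 { intros X HX. unfold B, B1. eapply isd_eq; [apply isd_mult; [isd_|apply (ipow_derive 6); lra]|]. replace (INR 6) with 6 by (simpl; ring). ring. }
 have DB1: forall X, X1<=X -> is_derive B1 X (B2' X).
 { intros X HX. unfold B1, B2'. eapply isd_eq; [apply isd_mult; [isd_|apply isd_mult; [isd_|apply (ipow_derive 7); lra]]|]. replace (INR 7) with 7 by (simpl; ring). ring. }
 have LB: forall eps, 0<eps -> exists y, forall x, y<=x -> Rabs (B x)<=eps.
 { apply (small_at_infty B 1 K). intros X HX. unfold B, Rdiv. have: 0<X^6 by pos. have: 0 < / X^6 by pos.
  rewrite Rabs_right by nra. apply Rmult_le_compat_l; [lra|]. apply Rinv_le_contravar; [lra|]. replace (X^6) with (X*X^5) by ring. have: 1<=X^5 by (apply pow_R1_Rle; lra). nra. }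
 intros X HX.
 have P: forall sg, sg=1 \/ sg = -1 -> 0<=B X+sg*D X.
 { intros sg Hsg. apply (convex_van_right (fun X => B X+sg*D X) (fun X => B1 X+sg*D1 X) (fun X => B2' X+sg*D2 X) X1); [| | | |exact HX].
  - intros s Hs. eapply isd_eq; [apply isd_plus; [apply DB, Hs|apply isd_mult; [isd_|apply DD, Hs]]|]. cbv beta. ring.
  - intros s Hs. eapply isd_eq; [apply isd_plus; [apply DB1, Hs|apply isd_mult; [isd_|apply DD1, Hs]]|]. cbv beta. ring.
  - intros s Hs. specialize (B2 s Hs). abs_in B2. unfold B2'. destruct Hsg; subst sg; lra.
  - intros eps He. destruct (LB (eps/2)) as [y1 Y1]; [lra|]. destruct (L0 (eps/2)) as [y2 Y2]; [lra|]. exists (Rmax y1 y2). intros x Hx.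
   minmax. specialize (Y1 x ok). specialize (Y2 x ok). le_trans Rabs_triang.
   rewrite Rabs_mult. replace (Rabs sg) with 1 by (destruct Hsg; subst sg; [rewrite Rabs_R1|rewrite Rabs_left]; lra). lra. }
 have := P 1 (or_introl eq_refl). have := P (-1) (or_intror eq_refl). change (Rabs (D X)<=B X). alra. Qed.

(** Expansion of -4 log E at -X; its constant log 2 becomes the factor 2^(-1/4) of E. *)
Definition SSm (X : R) : R := 4/3 * / sqrt 2*(X*sqrt X)+ln 2 + / (6*sqrt 2) * / (X*sqrt X).

Lemma SS_expansion q X0 : is_Hastings_McLeod q -> 20 <= X0 ->
 (forall X, X0 <= X -> Rabs (2*SS q (- X)-(4/3*sqrt (X^3 * / 2)+ln 2)) <= / (2*sqrt (X^3 * / 2))) ->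
 exists X1 C, 20 <= X1 /\ 0 < C /\ forall X, X1 <= X -> Rabs (2*SS q (- X)-SSm X) <= C * / X^4.
Proof.
 intros Hq HX0 HS. destruct (SS_facts q Hq) as [DS _]. destruct (HM_left_ratio q Hq) as [X2 [C [HX2 [HC HR]]]].
 set (X1 := Rmax X0 X2). have HX1: X0<=X1 /\ X2<=X1 by (split; [apply Rmax_l|apply Rmax_r]).
 set (K := 2+2*C). exists X1, K. split; [lra|]. have HK: 0<K by (unfold K; lra). split; [exact HK|].
 have S2 := sqrt_lt_R0 2 ok. have S22 := sqrt_sqrt 2 ok.
 set (D := fun X => 2*SS q (- X)-SSm X). set (D1 := fun X => 2*q (- X)-(2 * / sqrt 2*sqrt X - / (4*sqrt 2) * / (X^2*sqrt X))).
 have DD: forall X, X1<=X -> is_derive D X (D1 X).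
 { intros X HX. have SX := sqrt_lt_R0 X ok. have SX2 := sqrt_sqrt X ok. unfold D, SSm. 
  have Dq: is_derive (fun X => X*sqrt X) X (3/2*sqrt X).
  { eapply isd_eq; [apply isd_mult; [isd_|apply (isd_sqrt (fun x => x)); [isd_|lra]]|]. cbv beta. rewrite <- SX2 at 2. field. lra. }
  eapply isd_eq.
  - apply isd_minus; [apply isd_mult; [isd_|apply (neg_derive (SS q)), DS]|]. apply isd_plus; [apply isd_plus; [apply isd_mult; [isd_|exact Dq]|isd_]|apply isd_mult; [isd_|apply isd_inv; [exact Dq|]]]. nra.
  - unfold D1. cbv beta. set (Q := q (- X)). clearbody Q. set (r := sqrt X) in *. clearbody r. subst X. field. lra. }
 have B1: forall X, X1<=X -> Rabs (D1 X)<=K * / X^5.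
 { intros X HX. destruct (HR X ok) as [p [Ep Hp]]. unfold D1. rewrite Ep. have SX := sqrt_lt_R0 X ok. have SX2 := sqrt_sqrt X ok.
  rewrite sqrt_div_alt by lra.
  have HX3: 8000<=X^3 by (replace 8000 with (20^3) by ring; apply pow_incr; lra).
  set (z := / X^3) in *. have Hz: 0<z<=1/8000 by (unfold z; split; [pos|replace (1/8000) with (/ 8000) by field; apply Rinv_le_contravar; lra]).
  replace (2*(sqrt X/sqrt 2*p)-(2 * / sqrt 2*sqrt X - / (4*sqrt 2) * / (X^2*sqrt X))) with (2*(sqrt X/sqrt 2)*(p-(1 - / 8*z))).
  2:{ unfold z. replace (/ (X^2*sqrt X)) with (sqrt X * / X^3); [field; lra|]. rewrite <- SX2 at 2 3. field. lra. }
  have Hp': Rabs (p-(1 - / 8*z))<=(1+C)*z^2.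
  { have: z^3<=z^2 by (replace (z^3) with (z^2*z) by ring; have := pow2_ge_0 z; nra). have: C*z^3<=C*z^2 by mono. have := pow2_ge_0 z.
   alra. }
  have Hs2: 1<=sqrt 2 by mono. have HsX: sqrt X<=X by (rewrite <- (sqrt_pow2 X) at 2 by lra; apply sqrt_le_1_alt; nra).
  have HsX2: 0<sqrt X/sqrt 2<=X.
  { split; [pos|]. trans (sqrt X*1); [|lra]. unfold Rdiv. apply Rmult_le_compat_l; [lra|]. rewrite <- Rinv_1. apply Rinv_le_contravar; lra. }
  rewrite Rabs_mult, (Rabs_right (2*_)) by lra. replace (K * / X^5) with (2*X*((1+C)*z^2)) by (unfold K, z; field; lra).
  apply Rmult_le_compat; [lra|pos|lra|exact Hp']. }
 have SE: forall X, 0<X -> sqrt (X^3 * / 2)=X*sqrt X * / sqrt 2.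
 { intros X HX. have SX := sqrt_lt_R0 X HX. have SX2 := sqrt_sqrt X ok. apply sqrt_lem_1; [have: 0<X^3 by pos; lra| |].
  - apply Rmult_le_pos; [nra|pos].
  - replace (X*sqrt X * / sqrt 2*(X*sqrt X * / sqrt 2)) with (X*X*(sqrt X*sqrt X) * / (sqrt 2*sqrt 2)) by fld. rewrite SX2, S22. field. }
 have L0: forall eps, 0<eps -> exists y, forall x, y<=x -> Rabs (D x)<=eps.
 { apply (small_at_infty D X1 2). intros X HX. specialize (HS X ok). rewrite SE in HS by lra. unfold D, SSm.
  have SX := sqrt_lt_R0 X ok. have Hs1: 1<=sqrt X by mono.
  have Hs2: 1<=sqrt 2<=2 by (split; [mono|nra]).
  have Hi: 0 < / (X*sqrt X) <= / X by (split; [pos|mono]).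
  replace (/ (2*(X*sqrt X * / sqrt 2))) with (sqrt 2/2 * / (X*sqrt X)) in HS by fld.
  have: sqrt 2/2 * / (X*sqrt X)<=1 * / X by mono.
  have: 0 <= / (6*sqrt 2) * / (X*sqrt X)<=1 * / X.
  { have: 0 < / (6*sqrt 2)<=1 by (split; [pos|mono]). split; [pos|mono]. }
  abs_in HS. apply Rabs_le. replace (2/X) with (2 * / X) by reflexivity. lra. }
 set (B := fun X => K * / X^4). set (Bd := fun X => K*(-4 * / X^5)).
 have DB: forall X, X1<=X -> is_derive B X (Bd X).
 { intros X HX. unfold B, Bd. eapply isd_eq; [apply isd_mult; [isd_|apply (ipow_derive 4); lra]|]. replace (INR 4) with 4 by (simpl; ring). ring. }
 have LB: forall eps, 0<eps -> exists y, forall x, y<=x -> Rabs (B x)<=eps.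
 { apply (small_at_infty B 1 K). intros X HX. unfold B, Rdiv. have: 0<X^4 by pos. have: 0 < / X^4 by pos.
  rewrite Rabs_right by nra. apply Rmult_le_compat_l; [lra|]. apply Rinv_le_contravar; [lra|]. replace (X^4) with (X*X^3) by ring. have: 1<=X^3 by (apply pow_R1_Rle; lra). nra. }
 intros X HX.
 have P: forall sg, sg=1 \/ sg = -1 -> 0<=B X+sg*D X.
 { intros sg Hsg. apply (decreasing_to_0 (fun X => B X+sg*D X) (fun X => Bd X+sg*D1 X) X1); [| | |exact HX].
  - intros s Hs. eapply isd_eq; [apply isd_plus; [apply DB, Hs|apply isd_mult; [isd_|apply DD, Hs]]|]. cbv beta. ring.
  - intros s Hs. specialize (B1 s Hs). abs_in B1. unfold Bd. have: 0<K * / s^5 by pos. destruct Hsg; subst sg; lra.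
  - intros eps He. destruct (LB (eps/2)) as [y1 Y1]; [lra|]. destruct (L0 (eps/2)) as [y2 Y2]; [lra|]. exists (Rmax y1 y2). intros x Hx.
   minmax. specialize (Y1 x ok). specialize (Y2 x ok). le_trans Rabs_triang.
   rewrite Rabs_mult. replace (Rabs sg) with 1 by (destruct Hsg; subst sg; [rewrite Rabs_R1|rewrite Rabs_left]; lra). lra. }
 have := P 1 (or_introl eq_refl). have := P (-1) (or_intror eq_refl). change (Rabs (D X)<=B X). alra. Qed.

(** * From logarithms to relative expansions, and uniqueness of the leading constants *)

Lemma minfty_intro (P : R -> Prop) (X0 : R) : 0 < X0 -> (forall X, X0 <= X -> P (- X)) -> Rbar_locally m_infty P.
Proof. intros H0 H. exists (- X0). intros x Hx. replace x with (- - x) by ring. apply H. lra. Qed.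

Lemma expansion_intro (f a m g : R -> R) (X0 M : R) : 0 < X0 ->
 (forall X, X0 <= X -> exists w, f (- X) = a (- X)*w /\ Rabs (w-m (- X)) <= M*Rabs (g (- X)) /\ a (- X) <> 0) -> expansion_minfty f a m g.
Proof.
 intros H0 H. exists (fun x => f x/a x-m x). split.
 - exists M. apply (minfty_intro _ X0 H0). intros X HX. destruct (H X HX) as [w [E [B N]]]. rewrite E. replace (a (- X)*w/a (- X)) with w by (field; exact N). exact B.
 - apply (minfty_intro _ X0 H0). intros X HX. destruct (H X HX) as [w [E [B N]]]. field. exact N.
Qed.

(** Two expansions of the same shape give (tau - tau0) m = tau0 r0 - tau r, whose right side tends
    to 0 while m tends to 1. This turns an expansion into a characterisation of its constant. *)
Lemma expansion_unique (f b m g : R -> R) (tau0 : R) : (forall x, x < 0 -> b x <> 0) ->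
 (forall eps, 0 < eps -> exists T, forall x, x < T -> Rabs (m x-1) <= eps) -> (forall eps, 0 < eps -> exists T, forall x, x < T -> Rabs (g x) <= eps) ->
 expansion_minfty f (fun x => tau0*b x) m g -> forall tau, expansion_minfty f (fun x => tau*b x) m g <-> tau = tau0.
Proof.
 intros Hb Hm Hg H0 tau. split; [|intros ->; exact H0]. intros [r [[M [T1 HM]] [T2 E]]]. destruct H0 as [r0 [[M0 [T3 HM0]] [T4 E0]]].
 destruct (Req_dec tau tau0) as [Q|Q]; [exact Q|exfalso]. set (d := Rabs (tau-tau0)). have Hd: 0<d by (apply Rabs_pos_lt; lra).
 set (A := Rabs tau+Rabs tau0+1). have HA: 1<=A by (unfold A; have := Rabs_pos tau; have := Rabs_pos tau0; lra).
 set (e := d/(8*A)). have He: 0<e by (apply Rdiv_lt_0_compat; lra). have HeA: e*A=d/8 by (unfold e; field; lra).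
 destruct (Hm (1/2)) as [T5 Hm5]; [lra|].
 set (B := Rabs M+Rabs M0+1). have HB: 1<=B by (unfold B; have := Rabs_pos M; have := Rabs_pos M0; lra).
 destruct (Hg (e/B)) as [T6 Hg6]; [pos|].
 set (x := Rmin (Rmin (Rmin T1 T2) (Rmin T3 T4)) (Rmin (Rmin T5 T6) 0)-1).
 have Hx: x<T1 /\ x<T2 /\ x<T3 /\ x<T4 /\ x<T5 /\ x<T6 /\ x<0.
 { unfold x. minmax. repeat split; lra. }
 destruct Hx as [X1 [X2 [X3 [X4 [X5 [X6 X7]]]]]]. specialize (HM x X1). specialize (E x X2). specialize (HM0 x X3). specialize (E0 x X4). specialize (Hm5 x X5). specialize (Hg6 x X6). specialize (Hb x X7).
 have Eq: tau*(m x+r x)=tau0*(m x+r0 x) by (apply Rmult_eq_reg_r with (b x); [|exact Hb]; lra).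
 have Rb: forall r M', Rabs M'<=B -> Rabs r<=M'*Rabs (g x) -> Rabs r<=e.
 { intros r1 M' HM' H1. have := Rle_abs M'. have := Rabs_pos (g x). eapply Rle_trans; [exact H1|]. trans (B*(e/B)); [trans (B*Rabs (g x)); [mono|mono]|right; field; lra]. }
 have R1: Rabs (r x)<=e by (apply (Rb _ M); [unfold B; have := Rabs_pos M0; lra|exact HM]).
 have R2: Rabs (r0 x)<=e by (apply (Rb _ M0); [unfold B; have := Rabs_pos M; lra|exact HM0]).
 have Ed: (tau-tau0)*m x=tau0*r0 x-tau*r x by lra.
 have L: d*(1/2)<=Rabs ((tau-tau0)*m x).
 { rewrite Rabs_mult. fold d. apply Rmult_le_compat_l; [lra|]. abs_in Hm5. rewrite Rabs_right; lra. }
 have U: Rabs (tau0*r0 x-tau*r x)<=A*e.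
 { unfold Rminus. le_trans Rabs_triang. rewrite Rabs_Ropp, !Rabs_mult. have := Rabs_pos tau. have := Rabs_pos tau0.
  have: Rabs tau0*Rabs (r0 x)<=Rabs tau0*e by mono. have: Rabs tau*Rabs (r x)<=Rabs tau*e by mono. unfold A. lra. }
 rewrite Ed in L. lra.
Qed.

Lemma exp_expand w y e : Rabs (w-y) <= e -> Rabs y+e <= 1 -> Rabs (exp w-(1+y)) <= e+(Rabs y+e)^2.
Proof.
 intros H1 H2. have Hw: Rabs w<=Rabs y+e by (replace w with (y+(w-y)) by ring; le_trans Rabs_triang; lra).
 have Q := exp_quad (- w). rewrite Rabs_Ropp in Q. specialize (Q ok). rewrite Ropp_involutive in Q.
 have W2: (- w)^2<=(Rabs y+e)^2 by (replace ((- w)^2) with (Rabs w^2) by (rewrite pow2_abs; ring); apply pow_incr; split; [pos|exact Hw]).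
 alra. Qed.

Lemma TW_log_expansions q zeta : is_Hastings_McLeod q -> is_Riemann_zeta zeta ->
 exists X0 C, 20 <= X0 /\ 1 <= C /\ forall X, X0 <= X -> exists wF wE,
  TW_F q (- X) = exp (ln 2/48+dzeta_m1 zeta/2-X^3/24-ln X/16)*exp wF /\ Rabs (wF-3/128 * / X^3) <= C * / X^6 /\
  TW_E q (- X) = exp (- (ln 2/4) - / (3*sqrt 2)*(X*sqrt X))*exp wE /\ Rabs (wE - - / (24*sqrt 2) * / (X*sqrt X)) <= C * / X^4.
Proof.
 intros Hq Hz. destruct mbes0_asymptotic as [k Hk]. destruct stir_lim as [kap [Ls Hs]]. destruct hyp_lim as [a Ha].
 destruct (VV_const q k kap a Hq Hk Hs Ha) as [K0 [X1 [HX1 HV]]]. rewrite <- (dzeta_value zeta a Hz Ha) in HV.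
 destruct (SS_const q k kap Hq Hk Ls K0) as [X2 [HX2 HS]].
 destruct (VV_expansion q _ X1 Hq HX1 HV) as [X3 [C3 [HX3 [HC3 EV]]]]. destruct (SS_expansion q X2 Hq HX2 HS) as [X4 [C4 [HX4 [HC4 ES]]]].
 exists (Rmax X3 X4), (1+C3+C4). minmax. split; [lra|]. split; [lra|]. intros X HX.
 specialize (EV X ok). specialize (ES X ok). have S2 := sqrt_lt_R0 2 ok. 
 set (lF := ln 2/48+dzeta_m1 zeta/2-X^3/24-ln X/16). set (lE := - (ln 2/4) - / (3*sqrt 2)*(X*sqrt X)).
 exists (- (1/2)*VV q (- X)-lF), (- (1/2)*SS q (- X)-lE).
 have P6: 0 < / X^6 by pos. have P4: 0 < / X^4 by pos.
 split; [|split; [|split]].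
 - rewrite <- exp_plus. unfold TW_F. f_equal. unfold VV. ring.
 - trans (C3 * / X^6); [|mono]. unfold VVm, lF in *. alra. - rewrite <- exp_plus. unfold TW_E. f_equal. unfold SS. ring.
 - trans (C4 * / X^4); [|mono]. unfold SSm, lE in *.
  replace (/ (6*sqrt 2)) with (/ 6 * / sqrt 2) in ES by fld.
  replace (/ (3*sqrt 2)) with (/ 3 * / sqrt 2) by fld. replace (/ (24*sqrt 2)) with (/ 24 * / sqrt 2) by fld.
  alra. Qed.

Lemma Rpower_3_2 X : 0 < X -> Rpower X (3/2) = X*sqrt X.
Proof.
 intros HX. replace (3/2) with (1 + / 2) by field. rewrite Rpower_plus, Rpower_1, Rpower_sqrt by exact HX. reflexivity.
Qed.

Lemma inv_pow_le X n m : 1 <= X -> (n <= m)%nat -> 0 < / X^m <= / X^n.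
Proof. intros HX Hnm. split; [pos|]. apply Rinv_le_contravar; [pos|]. now apply Rle_pow. Qed.

Lemma small_minfty (g : R -> R) (C : R) : (forall X, 1 <= X -> Rabs (g (- X)) <= C/X) -> forall eps, 0 < eps -> exists T, forall x, x < T -> Rabs (g x) <= eps.
Proof.
 intros H eps He. destruct (small_at_infty (fun X => g (- X)) 1 C H eps He) as [y Hy]. exists (- y). intros x Hx. specialize (Hy (- x) ok). now rewrite Ropp_involutive in Hy.
Qed.

Lemma xsqrtx_bounds X : 1 <= X -> 0 < / (X*sqrt X) <= / X /\ (/ (X*sqrt X))^2 = / X^3.
Proof.
 intros HX. have SX := sqrt_lt_R0 X ok. have S2 := sqrt_sqrt X ok. 
 split; [split; [pos|mono]|]. replace (X^3) with ((X*sqrt X)^2) by (replace ((X*sqrt X)^2) with (X*X*(sqrt X*sqrt X)) by ring; rewrite S2; ring). now rewrite pow_inv.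
Qed.

(** In F_4 the term 1/E dominates: the ratio of E to it contains exp(-2t) with t = X^(3/2)/(3 sqrt
    2), for which the crude bound 1/(2t^2) = 9 X^(-3) is enough. The exponent -35/48 is -1 + 1/4 +
    1/48, from the factor 1/2, from 1/E and from F. *)
Lemma TW_relative q zeta : is_Hastings_McLeod q -> is_Riemann_zeta zeta ->
 exists X0 M, 20 <= X0 /\ 0 < M /\ forall X, X0 <= X -> exists f e f1 f2 f4,
  TW_F q (- X) = exp (ln 2/48+dzeta_m1 zeta/2-X^3/24-ln X/16)*f /\ Rabs (f-(1+3/128 * / X^3)) <= M * / X^6 /\
  TW_E q (- X) = exp (- (ln 2/4) - / (3*sqrt 2)*(X*sqrt X))*e /\ Rabs (e-(1 - / (24*sqrt 2) * / (X*sqrt X))) <= M * / X^3 /\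
  F1 q (- X) = exp (- (11/48)*ln 2+dzeta_m1 zeta/2-X^3/24-ln X/16 - / (3*sqrt 2)*(X*sqrt X))*f1 /\ Rabs (f1-(1 - / (24*sqrt 2) * / (X*sqrt X))) <= M * / X^3 /\
  F2 q (- X) = exp (ln 2/24+dzeta_m1 zeta-X^3/12-ln X/8)*f2 /\ Rabs (f2-(1+3/64 * / X^3)) <= M * / X^6 /\
  F4 q (- X) = exp (- (35/48)*ln 2+dzeta_m1 zeta/2-X^3/24-ln X/16 + / (3*sqrt 2)*(X*sqrt X))*f4 /\ Rabs (f4-(1 + / (24*sqrt 2) * / (X*sqrt X))) <= M * / X^3.
Proof.
 intros Hq Hz. destruct (TW_log_expansions q zeta Hq Hz) as [X0 [C [HX0 [HC H]]]]. exists (X0+8*C), (32+2*C). split; [lra|]. split; [lra|]. intros X HX.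
 destruct (H X ok) as [wF [wE [EF [BF [EE BE]]]]]. exists (exp wF), (exp wE), (exp (wF+wE)), (exp (2*wF)).
 set (t := / (3*sqrt 2)*(X*sqrt X)) in *. exists (exp (wF-wE)+exp (wF+wE)*exp (- (ln 2/2)-2*t)).
 have HX1: 1<=X by lra. destruct (xsqrtx_bounds X HX1) as [Yb Y2]. have S2 := sqrt_lt_R0 2 ok. have S22 := sqrt_sqrt 2 ok.
 have S2': 1<=sqrt 2<=2 by (split; [mono|nra]).
 set (y := / (24*sqrt 2) * / (X*sqrt X)) in *. set (z := / X^3) in *.
 have Hi24: 0 < / (24*sqrt 2) <= / 24 by (split; [pos|mono]).
 have Hz3: 0<z <= / X by (have Q := inv_pow_le X 1 3 HX1 okn; rewrite pow_1 in Q; exact Q).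
 have HCX: C * / X<=1/8. { apply Rmult_le_reg_r with X; [lra|]. rewrite Rmult_assoc, Rinv_l by lra. lra. }
 have HX20: / X<=1/20 by (replace (1/20) with (/ 20) by field; apply Rinv_le_contravar; lra).
 have E6: / X^6=z^2 by (unfold z; field; lra). have E4: / X^4 = / X*z by (unfold z; field; lra). rewrite E6 in *. rewrite E4 in BE.
 have HCz: C*z<=1/8 by (trans (C * / X); [mono|lra]).
 have HCz2: 0<=C*z^2<=z/8 by (split; [pos|nra]).
 have HC4: 0<=C*(/ X*z)<=z/8 by (split; [pos|nra]).
 have Hy: 0<y <= / 24 * / X by (unfold y; split; [pos|mono]).
 have Hy2: y^2<=z.
 { unfold y. rewrite Rpow_mult_distr, Y2. fold z. have: (/ (24*sqrt 2))^2<=1 by nra. nra. }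
 have Ay := Rabs_right y ok. have Any: Rabs (- y)=y by (rewrite Rabs_Ropp; exact Ay).
 apply Rabs_le_between in BF as BF'. replace (- / (24*sqrt 2) * / (X*sqrt X)) with (- y) in BE by (unfold y; ring). apply Rabs_le_between in BE as BE'.
 have B12: Rabs (wF+wE - - y)<=z by (apply Rabs_le; lra). have B13: Rabs (wF-wE-y)<=z by (apply Rabs_le; lra).
 have Q5: z+(y+z)^2<=5*z by nra.
 split; [exact EF|]. split; [|split; [exact EE|split; [|split; [|split; [|split; [|split; [|split]]]]]]].
 - le_trans (exp_expand wF (3/128*z) (C*z^2) BF); rewrite Rabs_right by lra; [lra|].
  have: (3/128*z+C*z^2)^2<=z^2 by mono. have := pow2_ge_0 z. lra.
 - replace (1-y) with (1 + - y) by ring. have BE3: Rabs (wE - - y)<=z by lra.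
  le_trans (exp_expand wE (- y) z BE3); rewrite Any; [lra|]. have: 0<=C*z by nra. lra.
 - unfold F1. rewrite EF, EE. rewrite (exp_plus wF). transitivity (exp (ln 2/48+dzeta_m1 zeta/2-X^3/24-ln X/16)*exp (- (ln 2/4)-t)*(exp wF*exp wE)); [ring|].
  rewrite <- (exp_plus (ln 2/48+dzeta_m1 zeta/2-X^3/24-ln X/16)). f_equal. f_equal. field.
 - replace (1-y) with (1 + - y) by ring. le_trans (exp_expand _ (- y) z B12); rewrite Any; [lra|]. have: 0<=C*z by nra. lra.
 - unfold F2. rewrite EF, Rpow_mult_distr. replace (2*wF) with (wF+wF) by ring. rewrite exp_plus. simpl. rewrite !Rmult_1_r, <- exp_plus. f_equal. f_equal. field.
 - have B2: Rabs (2*wF-3/64*z)<=2*(C*z^2) by (apply Rabs_le; lra).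
  le_trans (exp_expand _ (3/64*z) _ B2); rewrite Rabs_right by lra; [lra|].
  have: (3/64*z+2*(C*z^2))^2<=z^2 by mono. have := pow2_ge_0 z. lra.
 - unfold F4. rewrite EF, EE. 
  have Hi: forall u v, 1/(exp u*exp v)=exp (- u)*exp (- v) by (intros; unfold Rdiv; rewrite Rmult_1_l, Rinv_mult, !exp_Ropp; reflexivity). rewrite Hi.
  have L2: ln (1/2) = - ln 2 by (replace (1/2) with (/ 2) by field; apply ln_Rinv; lra).
  replace (1/2) with (exp (- ln 2)) by (rewrite <- L2; apply exp_ln; lra).
  rewrite Rmult_plus_distr_l, Rmult_plus_distr_r, Rmult_plus_distr_l, <- !exp_plus. rewrite Rplus_comm. f_equal; f_equal; field.
 - have A1: Rabs (exp (wF-wE)-(1+y))<=5*z by (le_trans (exp_expand _ y z B13); rewrite Ay; lra).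
  have A2: exp (wF+wE)<=3 by (trans (exp 1); [apply exp_le_mono; abs_in B12; lra|apply exp_le_3]).
  have A3: exp (- (ln 2/2)-2*t)<=9*z.
  { have Ht: 0<t by (unfold t; apply Rmult_lt_0_compat; [pos|]; rewrite <- (Rinv_inv (X*sqrt X)); apply Rinv_0_lt_compat; lra).
   have: ln 2 > 0 by (rewrite <- ln_1; apply ln_increasing; lra).
   trans (exp (- (2*t))); [mono|]. trans (/ t^2 * / 2*1); [|].
   - replace (2*t) with (t+t) by ring. rewrite exp_Ropp, exp_plus, Rmult_1_r, <- Rinv_mult. apply Rinv_le_contravar; [have: 0<t^2 by (apply pow_lt; lra); lra|].
    have E1: 2*t<=exp t.
    { replace (exp t) with (exp (t/2)*exp (t/2)) by (rewrite <- exp_plus; f_equal; field). have := exp_ineq1_le (t/2).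
     have: (t/2+1)*(t/2+1)<=exp (t/2)*exp (t/2) by mono. have := pow2_ge_0 (t/2-1). lra. }
    have: 2*t*(2*t)<=exp t*exp t by mono. have := pow2_ge_0 t. lra.
   - right. have E2: / t^2=18*z.
    { unfold t, z. rewrite Rpow_mult_distr, Rinv_mult, !pow_inv, Rinv_inv. rewrite <- Y2 || idtac. rewrite <- pow_inv, Y2. replace ((3*sqrt 2)^2) with (9*(sqrt 2*sqrt 2)) by ring. rewrite S22. unfold z. ring. }
    rewrite E2. field. }
  have := exp_pos (wF+wE). have := exp_pos (- (ln 2/2)-2*t).
  have A4: 0<=exp (wF+wE)*exp (- (ln 2/2)-2*t)<=3*(9*z) by (split; [pos|mono]).
  have: 0<=C*z by nra. alra. Qed.

Theorem corollary1p3 (q : R -> R) (zeta : C -> C)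
  (Hq : is_Hastings_McLeod q) (Hzeta : is_Riemann_zeta zeta) :
  expansion_minfty (TW_F q)
    (fun x => Rpower 2 (1 / 48) * exp (1 / 2 * dzeta_m1 zeta) *
              (exp (- (1 / 24) * Rabs x ^ 3) / Rpower (Rabs x) (1 / 16)))
    (fun x => 1 + 3 / (2 ^ 7 * Rabs x ^ 3))
    (fun x => / Rabs x ^ 6) /\
  expansion_minfty (TW_E q)
    (fun x => 1 / Rpower 2 (1 / 4) *
              exp (- (1 / (3 * sqrt 2)) * Rpower (Rabs x) (3 / 2)))
    (fun x => 1 - 1 / (24 * sqrt 2 * Rpower (Rabs x) (3 / 2)))
    (fun x => / Rabs x ^ 3) /\
  (forall tau1 : R,
    expansion_minfty (F1 q)
      (fun x => tau1 *
                (exp (- (1 / 24) * Rabs x ^ 3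
                      - 1 / (3 * sqrt 2) * Rpower (Rabs x) (3 / 2)) /
                 Rpower (Rabs x) (1 / 16)))
      (fun x => 1 - 1 / (24 * sqrt 2 * Rpower (Rabs x) (3 / 2)))
      (fun x => / Rabs x ^ 3) <->
    tau1 = Rpower 2 (- (11 / 48)) * exp (1 / 2 * dzeta_m1 zeta)) /\
  (forall tau2 : R,
    expansion_minfty (F2 q)
      (fun x => tau2 *
                (exp (- (1 / 12) * Rabs x ^ 3) / Rpower (Rabs x) (1 / 8)))
      (fun x => 1 + 3 / (2 ^ 6 * Rabs x ^ 3))
      (fun x => / Rabs x ^ 6) <->
    tau2 = Rpower 2 (1 / 24) * exp (dzeta_m1 zeta)) /\
  (forall tau4 : R,
    expansion_minfty (F4 q)
      (fun x => tau4 *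
                (exp (- (1 / 24) * Rabs x ^ 3
                      + 1 / (3 * sqrt 2) * Rpower (Rabs x) (3 / 2)) /
                 Rpower (Rabs x) (1 / 16)))
      (fun x => 1 + 1 / (24 * sqrt 2 * Rpower (Rabs x) (3 / 2)))
      (fun x => / Rabs x ^ 3) <->
    tau4 = Rpower 2 (- (35 / 48)) * exp (1 / 2 * dzeta_m1 zeta)).
Proof.
 destruct (TW_relative q zeta Hq Hzeta) as [X0 [M [HX0 [HM H]]]].
 have S2 := sqrt_lt_R0 2 ok.
 have RX: forall X, X0<=X -> Rabs (- X)=X by (intros; rewrite Rabs_Ropp, Rabs_right; lra).
 (* All prefactors are rewritten as single exponentials, so that each equality reduces to one
    between exponents. *)
 have Rinv_Rpower: forall x y, / Rpower x y=exp (- (y*ln x)) by (intros; unfold Rpower; now rewrite exp_Ropp).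
 have Dv: forall u v c, exp u/Rpower v c=exp (u-c*ln v) by (intros; unfold Rdiv; rewrite Rinv_Rpower, <- exp_plus; f_equal; ring).
 have D1: forall c, 1/Rpower 2 c=exp (- (c*ln 2)) by (intros; unfold Rdiv; rewrite Rmult_1_l; apply Rinv_Rpower).
 have G: forall n X, X0<=X -> Rabs (/ X^n) = / X^n by (intros n X HX; apply Rabs_right, Rle_ge, Rlt_le, Rinv_0_lt_compat, pow_lt; lra).
 have Nz: forall u v, exp u/Rpower v (1/16) <> 0 by (intros u v; rewrite Dv; apply Rgt_not_eq, exp_pos).
 have Nz8: forall u v, exp u/Rpower v (1/8) <> 0 by (intros u v; rewrite Dv; apply Rgt_not_eq, exp_pos).
 have Gs: forall n C, (1<=n)%nat -> 0<=C<=1 -> forall X, 1<=X -> Rabs (C * / Rabs (- X)^n)<=1/X.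
 { intros n C Hn HC X HX. rewrite Rabs_Ropp, (Rabs_right X) by lra. have Q := inv_pow_le X 1 n HX Hn. rewrite pow_1 in Q. rewrite Rabs_right by pos.
  unfold Rdiv. apply Rmult_le_compat; lra. }
 have Gn: forall n, (1<=n)%nat -> forall eps, 0<eps -> exists T, forall x, x<T -> Rabs (/ Rabs x^n)<=eps.
 { intros n Hn. apply (small_minfty _ 1). intros X HX. rewrite <- (Rmult_1_l (/ _^n)). apply Gs; [exact Hn|lra|exact HX]. }
 have Y: forall X, 0<X -> 1/(24*sqrt 2*Rpower X (3/2)) = / (24*sqrt 2) * / (X*sqrt X).
 { intros X HX. rewrite Rpower_3_2 by exact HX. have := sqrt_lt_R0 X HX. field. lra. }
 have Gy: forall X, 1<=X -> Rabs (1/(24*sqrt 2*Rpower (Rabs (- X)) (3/2)))<=1/X.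
 { intros X HX. rewrite Rabs_Ropp, (Rabs_right X), Y by lra. destruct (xsqrtx_bounds X HX) as [Q _].
  have: 1<=sqrt 2 by mono.
  have: 0 < / (24*sqrt 2)<=1 by (split; [pos|mono]).
  rewrite Rabs_right by pos. unfold Rdiv. apply Rmult_le_compat; lra. }
 have T1: forall X, 0<X -> 1/(3*sqrt 2)*Rpower X (3/2) = / (3*sqrt 2)*(X*sqrt X) by (intros X HX; rewrite Rpower_3_2 by exact HX; field; lra).
 split; [|split; [|split; [|split]]].
 - apply (expansion_intro _ _ _ _ X0 M); [lra|]. intros X HX. destruct (H X HX) as [f [e [f1 [f2 [f4 [E [B _]]]]]]]. exists f. rewrite RX, G by exact HX.
  split; [|split].
  + rewrite E. f_equal. rewrite Dv. unfold Rpower. rewrite <- !exp_plus. f_equal. field.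
  + replace (3/(2^7*X^3)) with (3/128 * / X^3) by fld. exact B.
  + apply Rmult_neq_0; [|apply Nz]. unfold Rpower. rewrite <- exp_plus. apply Rgt_not_eq, exp_pos.
 - apply (expansion_intro _ _ _ _ X0 M); [lra|]. intros X HX. destruct (H X HX) as [f [e [f1 [f2 [f4 [_ [_ [E [B _]]]]]]]]]. exists e. rewrite RX, G by exact HX.
  split; [|split].
  + rewrite E. f_equal. rewrite D1, <- exp_plus. f_equal. rewrite Ropp_mult_distr_l_reverse, T1 by lra. field. lra.
  + rewrite Y by lra. exact B.
  + rewrite D1, <- exp_plus. apply Rgt_not_eq, exp_pos.
 - apply expansion_unique; [intros; apply Nz| |apply Gn; lia|].
  { apply (small_minfty _ 1). intros X HX. replace (1-1/(24*sqrt 2*Rpower (Rabs (- X)) (3/2))-1) with (- (1/(24*sqrt 2*Rpower (Rabs (- X)) (3/2)))) by ring. rewrite Rabs_Ropp. now apply Gy. }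
  apply (expansion_intro _ _ _ _ X0 M); [lra|]. intros X HX. destruct (H X HX) as [f [e [f1 [f2 [f4 [_ [_ [_ [_ [E [B _]]]]]]]]]]]. exists f1. rewrite RX, G by exact HX.
  split; [|split].
  + rewrite E. f_equal. rewrite T1 by lra. rewrite Dv. unfold Rpower. rewrite <- !exp_plus. f_equal. field. lra.
  + rewrite Y by lra. exact B.
  + apply Rmult_neq_0; [|apply Nz]. unfold Rpower. rewrite <- exp_plus. apply Rgt_not_eq, exp_pos.
 - apply expansion_unique; [intros; apply Nz8| |apply Gn; lia|].
  { apply (small_minfty _ 1). intros X HX. replace (1+3/(2^6*Rabs (- X)^3)-1) with (3/64 * / Rabs (- X)^3).
   - apply Gs; [lia|lra|exact HX]. - rewrite Rabs_Ropp, Rabs_right by lra. field. lra. }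
  apply (expansion_intro _ _ _ _ X0 M); [lra|]. intros X HX. destruct (H X HX) as [f [e [f1 [f2 [f4 [_ [_ [_ [_ [_ [_ [E [B _]]]]]]]]]]]]]. exists f2. rewrite RX, G by exact HX.
  split; [|split].
  + rewrite E. f_equal. rewrite Dv. unfold Rpower. rewrite <- !exp_plus. f_equal. field.
  + replace (3/(2^6*X^3)) with (3/64 * / X^3) by fld. exact B.
  + apply Rmult_neq_0; [|apply Nz8]. unfold Rpower. rewrite <- exp_plus. apply Rgt_not_eq, exp_pos.
 - apply expansion_unique; [intros; apply Nz| |apply Gn; lia|].
  { apply (small_minfty _ 1). intros X HX. replace (1+1/(24*sqrt 2*Rpower (Rabs (- X)) (3/2))-1) with (1/(24*sqrt 2*Rpower (Rabs (- X)) (3/2))) by ring. now apply Gy. }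
  apply (expansion_intro _ _ _ _ X0 M); [lra|]. intros X HX. destruct (H X HX) as [f [e [f1 [f2 [f4 [_ [_ [_ [_ [_ [_ [_ [_ [E B]]]]]]]]]]]]]]. exists f4. rewrite RX, G by exact HX.
  split; [|split].
  + rewrite E. f_equal. rewrite T1 by lra. rewrite Dv. unfold Rpower. rewrite <- !exp_plus. f_equal. field. lra.
  + rewrite Y by lra. exact B.
  + apply Rmult_neq_0; [|apply Nz]. unfold Rpower. rewrite <- exp_plus. apply Rgt_not_eq, exp_pos.
Qed.
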